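(* Let $N,d\ge1$ be integers and let $B^{\overline H,\overline K}$ be an $(N,d)$-bifractional Brownian sheet with indices $\overline H=(H_{i,j})$, $\overline K=(K_{i,j})$, $H_{i,j}\in(0,1)$, $K_{i,j}\in(0,1]$ ($1\le i\le d$, $1\le j\le N$). For any $x\in\mathbb{R}^d$ and $t\in(0,\infty)^N$, the local time $L(x,t)$ admits the following chaotic expansion: $$L(x,t)=\sum_{n_1,\ldots,n_d\ge0}\int_{[0,t]}\prod_{i=1}^d\frac{p_{\underline{s}^{2\overline H_i\overline K_i}}(x_i)}{\underline{s}^{n_i\overline H_i\overline K_i}}\,\mathbf{H}_{n_i}\Big(\frac{x_i}{\underline{s}^{\overline H_i\overline K_i}}\Big)\,I^i_{n_i}\big(\mathbf{1}_{[0,s]}(\cdot)^{\otimes n_i}\big)\,ds.$$ Moreover, if $\sum_{j=1}^N\frac{1}{H_j^*K_j^*}>d$, where $H_j^*=\max\{H_{i,j}:\ i=1,\dots,d\}$ and $K_j^*=\max\{K_{i,j}:\ i=1,\dots,d\}$, then $L(x,t)$ is a random variable in $L^2(\Omega)$.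
   Context: For $H\in(0,1)$, $K\in(0,1]$ let $R^{H,K}(s,t)=\frac1{2^K}\big[(t^{2H}+s^{2H})^K-|t-s|^{2HK}\big]$, $s,t\ge 0$. Given $\overline H_i=(H_{i,1},\dots,H_{i,N})\in(0,1)^N$ and $\overline K_i=(K_{i,1},\dots,K_{i,N})\in(0,1]^N$, $i=1,\dots,d$, the $(N,d)$-bifractional Brownian sheet $B^{\overline H,\overline K}(t)=(B^{\overline H_1,\overline K_1}(t),\dots,B^{\overline H_d,\overline K_d}(t))$, $t\in[0,\infty)^N$, has independent components, the $i$-th being a centered real Gaussian field with covariance $\mathbb{E}[B^{\overline H_i,\overline K_i}(t)B^{\overline H_i,\overline K_i}(s)]=R^{\overline H_i,\overline K_i}(s,t)=\prod_{j=1}^N R^{H_{i,j},K_{i,j}}(s_j,t_j)$. Local time: for $t\in\mathbb{R}_+^N$, $[0,t]=\prod_j[0,t_j]$, $L(x,t)$ is the density of the occupation measure $\mu_t(A)=\int_{[0,t]}\mathbf{1}_A(B^{\overline H,\overline K}(s))\,ds$, $A\in\mathcal{B}(\mathbb{R}^d)$. Formally $L(x,t)=\int_{[0,t]}\delta_x(B^{\overline H,\overline K}(s))\,ds$, where $\delta_x$ is the Dirac function and $\delta_x(B^{\overline H,\overline K}(s))$ is a distribution in the sense of Watanabe (obtained by approximating $\delta_x$ by Gaussian kernels with variance tending to $0$). Notation: $p_\sigma$ is the centered Gaussian density on $\mathbb{R}$ with variance $\sigma>0$; for real $m\ge0$, $\underline s^{m\overline H_i\overline K_i}=\prod_{j=1}^N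 s_j^{mH_{i,j}K_{i,j}}$. The Hermite polynomials are $\mathbf{H}_0=1$ and $\mathbf{H}_n(x)=\frac{(-1)^n}{n!}e^{x^2/2}\frac{d^n}{dx^n}e^{-x^2/2}$ for $n\ge1$. $I^i_n$ denotes the multiple Wiener–Itô integral of order $n$ with respect to the Gaussian field $B^{\overline H_i,\overline K_i}$ (on its associated Gaussian space, where $\mathbf{1}_{[0,s]}$ corresponds to $B^{\overline H_i,\overline K_i}(s)$); explicitly $I^i_n(\mathbf{1}_{[0,s]}^{\otimes n})=n!\,\sigma^n\,\mathbf{H}_n\big(B^{\overline H_i,\overline K_i}(s)/\sigma\big)$ with $\sigma=\underline s^{\overline H_i\overline K_i}$, the standard deviation of $B^{\overline H_i,\overline K_i}(s)$.
   Formalization: At x=0 existence of L(0,t) is claimed only if the zero-order term ∫_{[0,t]}∏p(0)ds is finite; the expansion and L² claims are for L when it exists. Otherwise that term is +∞ and the claim fails (e.g. Brownian sheet, N=2, d=3, despite 4>3). *)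

(* Defs.v *)
From HB Require Import structures.
From mathcomp Require Import all_boot all_order all_algebra finmap.
From mathcomp Require Import all_classical all_reals all_analysis.
From mathcomp Require summability.

Set Implicit Arguments.
Unset Strict Implicit.
Unset Printing Implicit Defensive.

Import Order.TTheory GRing.Theory Num.Theory.
Import numFieldNormedType.Exports.

Local Open Scope classical_set_scope.
Local Open Scope ring_scope.

Section cons_measure.
Context {R : realType} (n : nat).

Definition tcons (p : measurableTypeR R * n.-tuple R) : n.+1.-tuple R := [tuple of p.1 :: p.2].

Lemma measurable_tcons : measurable_fun [set: measurableTypeR R * n.-tuple R] tcons.
Proof. exact: measurable_cons. Qed.

Variable mu : {sigma_finite_measure set (n.-tuple R) -> \bar R}.

Local Notation prod := (@lebesgue_measure R \x mu)%E.

Definition cons_measure : set (n.+1.-tuple R) -> \bar R :=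
  pushforward prod tcons.

Let mtcons A : measurable A -> measurable (tcons @^-1` A).
Proof. by move=> mA; rewrite -[X in measurable X]setTI; exact: measurable_tcons. Qed.

Let cons_measure0 : cons_measure set0 = 0%E.
Proof. by rewrite /cons_measure /pushforward preimage_set0 measure0. Qed.

Let cons_measure_ge0 A : (0 <= cons_measure A)%E.
Proof. by rewrite /cons_measure /pushforward; apply: measure_ge0. Qed.

Let cons_measure_sigma_additive : semi_sigma_additive cons_measure.
Proof.
move=> F mF tF mUF; rewrite /cons_measure /pushforward preimage_bigcup.
apply: measure_semi_sigma_additive.
- by move=> k; exact: mtcons.
- apply/trivIsetP => /= i j _ _ ij; rewrite -preimage_setI.
  by move/trivIsetP : tF => /(_ _ _ _ _ ij) ->//; rewrite preimage_set0.
- by rewrite -preimage_bigcup; exact: mtcons.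
Qed.

HB.instance Definition _ := isMeasure.Build _ _ _ cons_measure
  cons_measure0 cons_measure_ge0 cons_measure_sigma_additive.

Let cons_measure_sigma_finite : sigma_finite setT cons_measure.
Proof.
have [G GT Gfin] : sigma_finite setT prod.
  have /sigma_finiteP[F [TF ndF Foo]] := sigma_finiteT (@lebesgue_measure R).
  have /sigma_finiteP[G [TG ndG Goo]] := sigma_finiteT mu.
  exists (fun k => F k `*` G k).
    rewrite -setXTT TF TG predeqE => -[x y]; split.
      move=> [/= [k _ Fkx] [m _ Gmy]]; exists (maxn k m) => //; split.
        by move: x Fkx; exact/subsetPset/ndF/leq_maxl.
      by move: y Gmy; exact/subsetPset/ndG/leq_maxr.
    by move=> [k _ []/= ? ?]; split; exists k.
  move=> k; have [? ?] := Foo k; have [? ?] := Goo k.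
  split; first exact: measurableX.
  by rewrite product_measure1E// lte_mul_pinfty// ge0_fin_numE.
pose uncons (u : n.+1.-tuple R) : measurableTypeR R * n.-tuple R :=
  (thead u, [tuple of behead u]).
have munc : measurable_fun setT uncons.
  apply/measurable_fun_pair; last exact: measurable_behead.
  exact: (@measurable_tnth _ _ n.+1 ord0).
exists (fun k => uncons @^-1` G k); first by rewrite -preimage_bigcup -GT.
move=> k; have [mG Gk] := Gfin k; split.
  by rewrite -[X in measurable X]setTI; exact: munc.
rewrite /cons_measure /pushforward -comp_preimage.
rewrite (_ : uncons \o tcons = id)//; apply/funext => -[a u] /=.
by rewrite /uncons /tcons; congr pair; apply/val_inj.
Qed.

HB.instance Definition _ := Measure_isSigmaFinite.Build _ _ _ cons_measure
  cons_measure_sigma_finite.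

End cons_measure.

(** Lebesgue measure on [R^n]; on [R^0] it is the unit mass. *)
Fixpoint lebesgue_tuple {R : realType} (n : nat) :
    {sigma_finite_measure set (n.-tuple R) -> \bar R} :=
  match n with
  | 0 => @dirac _ _ [tuple] R
  | m.+1 => cons_measure (lebesgue_tuple m)
  end.

Lemma lebesgue_tuple_box {R : realType} (n : nat) (a b : n.-tuple R) :
  (forall j, tnth a j <= tnth b j) ->
  lebesgue_tuple n [set s | forall j, tnth a j <= tnth s j <= tnth b j]
  = (\prod_(j < n) (tnth b j - tnth a j))%:E.
Proof.
elim: n a b => [|n IHn] a b ab.
  rewrite big_ord0 /= diracE mem_set//= => -[]//.
have msub (m : nat) (u v : m.-tuple R) : measurable
    [set s : m.-tuple R | forall j, tnth u j <= tnth s j <= tnth v j].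
  rewrite (_ : [set s | _] = \bigcap_(j in [set: 'I_m])
      ((fun s : m.-tuple R => tnth s j) @^-1` `[tnth u j, tnth v j])).
    apply: fin_bigcap_measurable; first exact: finite_finset.
    move=> j _; rewrite -[X in measurable X]setTI.
    exact: (@measurable_tnth _ _ m j).
  apply/seteqP; split => s /= h j; first by move=> _; rewrite /= in_itv/= h.
  by have := h j I; rewrite /= ?in_itv.
rewrite /= /cons_measure /pushforward.
pose a' : n.-tuple R := [tuple of behead a]; pose b' : n.-tuple R := [tuple of behead b].
have beE (u : n.+1.-tuple R) j : tnth [tuple of behead u] j = tnth u (lift ord0 j).
  by rewrite tnth_behead; congr tnth; apply/val_inj; rewrite /= inordK ?ltnS.
rewrite (_ : _ @^-1` _ = `[tnth a ord0, tnth b ord0]%classic `*`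
    [set s | forall j, tnth a' j <= tnth s j <= tnth b' j]); last first.
  apply/seteqP; split => -[x s] /=.
    move=> h; split; first by rewrite in_itv/=; exact: (h ord0).
    by move=> j; rewrite !beE; have := h (lift ord0 j); rewrite tnthS.
  rewrite in_itv/= => -[hx hs] j; have [k ->|->//] := unliftP ord0 j.
  by rewrite tnthS -!beE.
rewrite product_measure1E//=; last exact: msub.
rewrite IHn; last by move=> j; rewrite !beE.
rewrite lebesgue_measure_itv/= lte_fin big_ord_recl EFinM; congr (_ * _)%E.
  by have [//|ba] := ltP; rewrite (@le_anti _ _ (tnth a ord0) (tnth b ord0)) ?ab// subrr.
by congr EFin; apply: eq_bigr => j _; rewrite !beE.
Qed.
Definition orthant {R : realType} (N : nat) : set (N.-tuple R) :=
  [set s | forall j, 0 <= tnth s j].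

Definition bifractional_cov {R : realType} (H K s t : R) : R :=
  (2 `^ K)^-1 *
  ((t `^ (2 * H) + s `^ (2 * H)) `^ K - `|t - s| `^ (2 * H * K)).

Definition bifractional_sheet_cov {R : realType} (N : nat) (H K : 'I_N -> R)
    (s t : N.-tuple R) : R :=
  \prod_(j < N) bifractional_cov (H j) (K j) (tnth s j) (tnth t j).

(** [normal_prob] takes the standard deviation, and is not the Dirac mass when
    the latter is zero. *)
Definition centered_gaussian_law {R : realType} (v : R) (A : set R) : \bar R :=
  if v == 0 then \d_(0 : R) A else normal_prob 0 (Num.sqrt v) A.

Section sheet.
Context {R : realType} (N d : nat) {disp : measure_display}
  {Omega : measurableType disp} (P : probability Omega R).

Definition centered_gaussian_field (X : N.-tuple R -> Omega -> R) : Prop :=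
  forall (n : nat) (s : 'I_n -> N.-tuple R) (c : 'I_n -> R),
    (forall k, orthant (s k)) ->
  exists2 v : R, 0 <= v & forall A : set R, measurable A ->
    P ((fun w => \sum_(k < n) c k * X (s k) w) @^-1` A)
    = centered_gaussian_law v A.

Definition field_sigma_algebra (X : N.-tuple R -> Omega -> R) :
    set (set Omega) :=
  <<s [set E | exists s (A : set R),
         [/\ orthant s, measurable A & E = X s @^-1` A]] >>.

Definition independent_fields (X : 'I_d -> N.-tuple R -> Omega -> R) : Prop :=
  forall E : 'I_d -> set Omega,
    (forall i, field_sigma_algebra (X i) (E i)) ->
  P (\bigcap_i E i) = (\prod_(i < d) P (E i))%E.

(** Joint measurability, which holds for the continuous version of the sheet,
    is what makes the occupation measure and the pathwise time integrals
    below meaningful. *)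
Record bifractional_sheet (H K : 'I_d -> 'I_N -> R)
    (B : 'I_d -> N.-tuple R -> Omega -> R) : Prop := {
  sheet_measurable : forall i,
    measurable_fun (@orthant R N `*` [set: Omega]) (fun p => B i p.1 p.2) ;
  sheet_gaussian : forall i, centered_gaussian_field (B i) ;
  sheet_cov : forall i s t, orthant s -> orthant t ->
    ('E_P[fun w => (B i t w * B i s w)%R]
    = (bifractional_sheet_cov (H i) (K i) s t)%:E)%E ;
  sheet_independent : independent_fields B
}.

End sheet.

Section hermite.
Context {R : realType}.

Definition hermite (n : nat) (x : R) : R :=
  (-1) ^+ n / n`!%:R * expR (x ^+ 2 / 2) *
  derive1n n (fun y : R => expR (- (y ^+ 2 / 2))) x.

(** Centered Gaussian density with variance [v > 0]. *)
Definition gaussian_density (v x : R) : R := normal_pdf 0 (Num.sqrt v) x.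

(** [underline s ^ (m H K)] *)
Definition sheet_pow (N : nat) (H K : 'I_N -> R) (m : R) (s : N.-tuple R) : R :=
  \prod_(j < N) tnth s j `^ (m * H j * K j).

Definition box (N : nat) (t : N.-tuple R) : set (N.-tuple R) :=
  [set s | forall j, 0 <= tnth s j <= tnth t j].

End hermite.

Section chaos.
Context {R : realType} (N d : nat) {disp : measure_display}
  {Omega : measurableType disp} (P : probability Omega R).
Variable B : 'I_d -> N.-tuple R -> Omega -> R.

Definition L2_closed_span (S : set (Omega -> R)) : set (Omega -> R) :=
  [set X | X \in Lfun P 2%:E /\
    forall e : R, 0 < e -> exists n (c : 'I_n -> R) (Y : 'I_n -> Omega -> R),
      (forall k, S (Y k)) /\
      ('E_P[fun w => ((X w - \sum_(k < n) c k * Y k w) ^+ 2)%R] < e%:E)%E].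

Definition gaussian_space : set (Omega -> R) :=
  L2_closed_span [set X | exists i s, orthant s /\ X = B i s].

Definition chaos (n : nat) : set (Omega -> R) :=
  L2_closed_span [set X | exists Y, [/\ gaussian_space Y,
    ('E_P[fun w => (Y w ^+ 2)%R] = 1)%E & X = hermite n \o Y]].

(** [F] is the sequence of the chaos components of the random variable [X]. *)
Definition chaos_decomposition (X : Omega -> R) (F : nat -> Omega -> R) :
    Prop :=
  [/\ X \in Lfun P 2%:E, forall m, chaos m (F m) &
      ('E_P[fun w => ((X w - \sum_(m < n) F m w) ^+ 2)%R])%E
      @[n --> \oo] --> 0%E].

(** The square of the norm of the Sobolev-Watanabe space [D^{alpha,2}], for any
    real [alpha], on formal series of chaos components. *)
Definition sobolev_sqnorm (alpha : R) (F : nat -> Omega -> R) : \bar R :=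
  (\sum_(0 <= m <oo) ((1 + m%:R) `^ alpha)%:E * 'E_P[fun w => (F m w ^+ 2)%R])%E.

(** An element of [D^{alpha,2}] for some real, possibly negative, [alpha],
    given by its chaos components. *)
Definition watanabe_distribution (F : nat -> Omega -> R) : Prop :=
  (forall m, chaos m (F m)) /\
  exists alpha : R, (sobolev_sqnorm alpha F < +oo)%E.

Definition square_integrable_distribution (F : nat -> Omega -> R) : Prop :=
  exists X : Omega -> R, chaos_decomposition X F.

(** The series [\sum_n T n] converges to [F] in some [D^{alpha,2}],
    unconditionally, [T n] lying in the chaos of order [n_1 + ... + n_d]. *)
Definition chaos_expansion (F : nat -> Omega -> R)
    (T : d.-tuple nat -> Omega -> R) : Prop :=
  (forall n : d.-tuple nat, chaos (\sum_(i < d) tnth n i)%N (T n)) /\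
  exists alpha : R,
    sobolev_sqnorm alpha (fun m w =>
      F m w - \sum_(n <- enum_fset J | (\sum_(i < d) tnth n i)%N == m) T n w)
    @[J --> @summability.totally (d.-tuple nat)] --> 0%E.

Definition approx_local_time (x : 'I_d -> R) (t : N.-tuple R) (eps : R)
    (w : Omega) : R :=
  \int[lebesgue_tuple N]_(s in box t)
    \prod_(i < d) gaussian_density eps (B i s w - x i).

(** [L] is [\int_[0,t] delta_x(B(s)) ds]: the limit, in some [D^{alpha,2}], of
    the random variables in which the Dirac function is replaced by the
    centered Gaussian kernel of variance [eps]. *)
Definition local_time (x : 'I_d -> R) (t : N.-tuple R)
    (L : nat -> Omega -> R) : Prop :=
  watanabe_distribution L /\
  exists (alpha : R) (F : R -> nat -> Omega -> R),
    (forall eps, 0 < eps ->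
       chaos_decomposition (approx_local_time x t eps) (F eps)) /\
    sobolev_sqnorm alpha (fun m w => F eps m w - L m w)
    @[eps --> 0^'+] --> 0%E.

Variables H K : 'I_d -> 'I_N -> R.

(** [I^i_n (1_[0,s]^{\otimes n})] *)
Definition multiple_integral (i : 'I_d) (n : nat) (s : N.-tuple R)
    (w : Omega) : R :=
  let sigma := sheet_pow (H i) (K i) 1 s in
  n`!%:R * sigma ^+ n * hermite n (B i s w / sigma).

Definition local_time_term (x : 'I_d -> R) (t : N.-tuple R)
    (n : d.-tuple nat) (w : Omega) : R :=
  \int[lebesgue_tuple N]_(s in box t) \prod_(i < d)
    (gaussian_density (sheet_pow (H i) (K i) 2 s) (x i)
       / sheet_pow (H i) (K i) (tnth n i)%:R s
     * hermite (tnth n i) (x i / sheet_pow (H i) (K i) 1 s)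
     * multiple_integral i (tnth n i) s w).

(** The term of order zero, with values in [[0, +oo]]: it is finite when
    [x <> 0], but may diverge near the axes when [x = 0], in which case
    [local_time x t] is empty. *)
Definition local_time_mean (x : 'I_d -> R) (t : N.-tuple R) : \bar R :=
  (\int[lebesgue_tuple N]_(s in box t)
    (\prod_(i < d) gaussian_density (sheet_pow (H i) (K i) 2 s) (x i))%:E)%E.

End chaos.

(* Main.v *)
Require Import Defs.
From HB Require Import structures.
From mathcomp Require Import all_boot all_order all_algebra finmap.
From mathcomp Require Import all_classical all_reals all_analysis measurable_realfun.
From mathcomp Require Import zify ring lra.
From mathcomp Require summability.

Set Implicit Arguments.
Unset Strict Implicit.
Unset Printing Implicit Defensive.

Import Order.TTheory GRing.Theory Num.Theory.
Import numFieldNormedType.Exports.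

Local Open Scope classical_set_scope.
Local Open Scope ring_scope.

(** Write [u_n(x, v)] for the heat polynomials, [sigma^n H_n(x / sigma) =
    u_n(x, sigma^2)]; their addition formula yields the moments, the covariances
    and the chaos membership of the products [prod_i u_(n_i)(B_i(s), sigma_i^2)].
    The kernel of variance [eps] has the expansion
    [p_eps(B_i(s) - x_i) = sum_n A_n(x_i, sigma_i^2 + eps) u_n(B_i(s), sigma_i^2)]
    with [A_n(x, V) = n! p_V(x) V^-n u_n(x, V)], and integrating in [s] gives the
    chaos components of the approximate local time.  Mehler's formula on the
    diagonal provides both Parseval's identity for this expansion and Cramer's
    bound on [u_n], hence a bound on the components uniform in [eps], under which
    they converge, in a space [D^{alpha,2}] of negative order, as [eps] tends to
    [0].  For square integrability, the sum of the second moments of the terms is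
    bounded, through Mehler's formula again, by a double integral of
    [prod_i (1 - r_i^2)^(-1/2)], where [r_i] is the correlation of [B_i(s)] and
    [B_i(s')]; since [1 - r_i >= c D_j^(2 H_ij K_ij)] for each [j], with
    [D_j = |s_j - s'_j| / max(s_j, s'_j)], a weighted geometric mean over [j]
    bounds the integrand by a product of powers of the [D_j] with exponent
    [- d / sum_j 1 / (H*_j K*_j) > - 1]. *)

(** * Heat polynomials *)

(** Heat polynomials replace normalized Hermite polynomials because they are polynomial in the
    variance too: the null variances on the axes need no division, and negative variances invert the
    passage from powers to [heat]. Since the chaos of order [m] is generated by polynomials in one
    variable, the products over the components are reached by polarization. A chaos component is
    determined only up to a null set, so equality means null norm, and integrals in [s] are handled
    weakly, by inner products with a test variable. The obstacle to the limit is domination near the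
    axes. If some [x i] is not zero, [exp(- x_i ^ 2 / (4 V))] beats every power of the variances. If
    [x = 0] nothing compensates them, and integrability must come from the finiteness of the mean,
    which an existing local time entails: its component of order zero bounds the means of the
    approximations, and Fatou's lemma applies. Finiteness of the mean then forces
    [sum_i H_ij K_ij < 1] on each axis. Cramer's bound is used in a crude form, whose polynomial
    factor in the order is absorbed by the negative Sobolev exponent. *)

Section heat.
Context {R : realType}.
Implicit Types (v w x y c : R) (f g : nat -> R).

(** Multiplication of a generating series by its variable; [conv] below is the product of two
    series. *)
Definition shift f n := if n is k.+1 then f k else 0.

(** Coefficients in [z] of [exp(x z - v z ^ 2 / 2)]; the inner match only makes the two-step
    recursion structural. *)
Fixpoint heat v x (n : nat) : R :=
  if n is m.+1 then
    (x * heat v x m - v * (if m is k.+1 then heat v x k else 0)) / m.+1%:R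
  else 1.

Lemma heat_rec v x n :
  n.+1%:R * heat v x n.+1 = x * heat v x n - v * shift (heat v x) n.
Proof. by rewrite /= mulrC divfK ?pnatr_eq0//; case: n. Qed.

Lemma heat_n0 v x : heat v x 0 = 1. Proof. by []. Qed.

Lemma heat_n1 v x : heat v x 1 = x.
Proof. by rewrite /= mulr1 mulr0 subr0 divr1. Qed.

Arguments heat : simpl never.

(** The two-step induction is done once here; the addition formula, homogeneity and the Gaussian
    integrals below only have to check the recurrence. *)
Lemma heat_unique v x f : f 0%N = 1 ->
  (forall n, n.+1%:R * f n.+1 = x * f n - v * shift f n) -> f =1 heat v x.
Proof.
move=> f0 fS n; suff: f n = heat v x n /\ f n.+1 = heat v x n.+1 by case.
have step k : f k = heat v x k -> shift f k = shift (heat v x) k ->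
    f k.+1 = heat v x k.+1.
  move=> e1 e2; apply: (@mulfI _ k.+1%:R); first by rewrite pnatr_eq0.
  by rewrite fS heat_rec e1 e2.
elim: n => [|n [IH1 IH2]]; first by split=> //; exact: step.
by split=> //; exact: step.
Qed.

Lemma heat_shift v x n : n%:R * heat v x n =
  x * shift (heat v x) n - v * shift (shift (heat v x)) n.
Proof. by case: n => [|n]; rewrite ?heat_rec /= ?mulr0 ?mul0r ?subr0. Qed.

Definition conv f g n := \sum_(k < n.+1) f k * g (n - k)%N.

Lemma conv_shiftl f g n : conv (shift f) g n = shift (conv f g) n.
Proof.
rewrite /conv big_ord_recl/= mul0r add0r; case: n => [|n]; first by rewrite big_ord0.
by apply: eq_bigr => k _; rewrite /= /bump/= add1n subSS.
Qed.

Lemma convC f g n : conv f g n = conv g f n.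
Proof.
rewrite /conv (reindex_inj rev_ord_inj)/=; apply: eq_bigr => k _.
by rewrite mulrC !subSS subKn // -ltnS.
Qed.

(** Leibniz rule for the derivative of a product of power series. *)
Lemma conv_natmul f g n : n.+1%:R * conv f g n.+1 =
  conv (fun k => k.+1%:R * f k.+1) g n + conv f (fun k => k.+1%:R * g k.+1) n.
Proof.
have e : n.+1%:R * conv f g n.+1 =
    conv (fun k => k%:R * f k) g n.+1 + conv f (fun k => k%:R * g k) n.+1.
  rewrite /conv mulr_sumr -big_split/=; apply: eq_bigr => -[k /= kn] _.
  move: kn; rewrite ltnS => kn.
  by rewrite -[X in X%:R * _](subnKC kn) natrD; ring.
rewrite e; congr (_ + _).
  by rewrite /conv big_ord_recl/= !mul0r add0r.
rewrite /conv [LHS]big_ord_recr/= subnn mul0r mulr0 addr0.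
by apply: eq_bigr => -[k /= kn] _; rewrite subSn.
Qed.

Lemma convDl f1 f2 g n :
  conv (fun k => f1 k + f2 k) g n = conv f1 g n + conv f2 g n.
Proof. by rewrite /conv -big_split; apply: eq_bigr => k _; rewrite mulrDl. Qed.

Lemma convZl c f g n : conv (fun k => c * f k) g n = c * conv f g n.
Proof. by rewrite /conv mulr_sumr; apply: eq_bigr => k _; rewrite mulrA. Qed.

Lemma eq_conv f1 f2 g1 g2 n : f1 =1 f2 -> g1 =1 g2 ->
  conv f1 g1 n = conv f2 g2 n.
Proof. by move=> ef eg; apply: eq_bigr => k _; rewrite ef eg. Qed.

Lemma conv_heat_rec v x g n :
  conv (fun k => k.+1%:R * heat v x k.+1) g n =
  x * conv (heat v x) g n - v * shift (conv (heat v x) g) n.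
Proof.
rewrite (eq_conv (f2 := fun k => x * heat v x k + - v * shift (heat v x) k)
  (g2 := g) n)//; last by move=> k; rewrite heat_rec mulNr.
by rewrite convDl !convZl conv_shiftl mulNr.
Qed.

(* In terms of the generating function exp(x t - v t^2 / 2), which solves
   F' = (x - v t) F, this is multiplicativity of the exponential. *)
Lemma heatD v w x y n :
  heat (v + w) (x + y) n = conv (heat v x) (heat w y) n.
Proof.
apply/esym; move: n; apply: heat_unique => [|n].
  by rewrite /conv big_ord_recl big_ord0 /= !heat_n0 mulr1 addr0.
rewrite conv_natmul [X in _ + X]convC !conv_heat_rec.
have -> : shift (conv (heat w y) (heat v x)) n = shift (conv (heat v x) (heat w y)) n.
  by case: n => //= n; rewrite convC.
by rewrite [conv (heat w y) _ _]convC; ring.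
Qed.

Lemma heatZ c v x n : heat (c ^+ 2 * v) (c * x) n = c ^+ n * heat v x n.
Proof.
apply/esym; move: n; apply: heat_unique => [|n]; first by rewrite heat_n0 mulr1.
rewrite mulrCA heat_rec; case: n => [|n] /=.
  by rewrite !mulr0 !subr0 !mulr1 expr1.
by rewrite !exprS; ring.
Qed.

Lemma heat0 x n : heat 0 x n = x ^+ n / n`!%:R.
Proof.
apply/esym; move: n; apply: heat_unique => [|n]; first by rewrite expr0 fact0 divr1.
rewrite mul0r subr0 factS natrM exprS.
have n0 : n.+1%:R != 0 :> R by rewrite pnatr_eq0.
have f0 : n`!%:R != 0 :> R by rewrite pnatr_eq0 -lt0n fact_gt0.
by field; rewrite f0 nat1r n0.
Qed.

(** At [x = 0] and variance [- 2 v] the generating function is [exp(v z ^ 2)]. *)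
Lemma heat_even v n : heat (- v *+ 2) 0 n.*2 = v ^+ n / n`!%:R.
Proof.
elim: n => [|n IH]; first by rewrite expr0 fact0 divr1.
apply: (@mulfI _ n.+1.*2%:R); first by rewrite pnatr_eq0.
rewrite doubleS heat_rec mul0r sub0r /= IH -muln2 factS !natrM exprS.
have n0 : n.+1%:R != 0 :> R by rewrite pnatr_eq0.
have f0 : n`!%:R != 0 :> R by rewrite pnatr_eq0 -lt0n fact_gt0.
by field; rewrite f0 nat1r n0.
Qed.

Lemma heat_odd v n : heat v 0 n.*2.+1 = 0.
Proof.
elim: n => [|n IH]; first by rewrite heat_n1.
apply: (@mulfI _ n.+1.*2.+1%:R); first by rewrite pnatr_eq0.
by rewrite heat_rec mul0r sub0r doubleS /= IH !mulr0 oppr0.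
Qed.

(* This is the inversion of [heat] in terms of powers. *)
Lemma exp_heat v x n : x ^+ n / n`!%:R = conv (heat v x) (heat (- v) 0) n.
Proof. by rewrite -heatD subrr addr0 heat0. Qed.

(** Differentiation in [x] multiplies the generating function by [z]. As an instance, this lets
    inference differentiate the products in Rodrigues' formula and in the integration by parts. *)
Global Instance is_derive_heat v x n :
  is_derive x 1 (fun y => heat v y n) (shift (heat v x) n).
Proof.
suff: is_derive x 1 (fun y => heat v y n) (shift (heat v x) n) /\
  is_derive x 1 (fun y => heat v y n.+1) (heat v x n) by case.
elim: n => [|n [IH1 IH2]]; split=> //.
- exact: is_derive_cst.
- rewrite (_ : (fun y => _) = id); last first.
    by apply/funext => y; rewrite heat_n1.
  exact: is_derive_id.
rewrite (_ : (fun y => _) = (fun y => n.+2%:R^-1 *: (y * heat v y n.+1 - v *: heat v y n))); last first.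
  by apply/funext => y; apply: (@mulfI _ n.+2%:R); rewrite ?pnatr_eq0// heat_rec /GRing.scale/= mulVKf ?pnatr_eq0.
apply: is_derive_eq.
rewrite /GRing.scale/= !mulr1.
apply: (@mulfI _ n.+2%:R); first by rewrite pnatr_eq0.
rewrite mulVKf ?pnatr_eq0//.
have := heat_shift v x n.+1; rewrite /= => e.
rewrite -[n.+2%:R]natr1 mulrDl mul1r e.
by case: (n) => [|k] /=; ring.
Qed.

Lemma continuous_heat v n : continuous (fun x => heat v x n).
Proof.
move=> x; apply: differentiable_continuous; apply/derivable1_diffP.
exact: ex_derive.
Qed.

End heat.

Arguments heat {R} v x n : simpl never.

Section hermite_heat.
Context {R : realType}.

Let gauss (y : R) := expR (- (y ^+ 2 / 2)).

Lemma hermiteE n (x : R) : hermite n x = heat 1 x n.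
Proof.
rewrite /hermite.
(* Rodrigues' formula, by induction on the order. *)
have -> : derive1n n gauss x = (-1) ^+ n * n`!%:R * heat 1 x n * gauss x.
  elim: n x => [|n IH] x; first by rewrite heat_n0 expr0 fact0 !mul1r.
  rewrite derive1nS (_ : derive1n n gauss =
      (fun x => (-1) ^+ n * n`!%:R * heat 1 x n * gauss x)); last exact/funext.
  rewrite derive1E.
  have -> : (fun x => (-1) ^+ n * n`!%:R * heat 1 x n * gauss x) =
      ((-1) ^+ n * n`!%:R) *: ((fun x => heat 1 x n) * gauss).
    by apply/funext => y; rewrite /= -mulrA.
  have dg : is_derive x 1 gauss (- x * gauss x).
    rewrite /gauss; apply: is_derive_eq.
    by rewrite /GRing.scale/= !mulr1; field.
  rewrite derive_val /GRing.scale/=.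
  have := heat_rec 1 x n; rewrite mul1r => e.
  rewrite factS natrM exprS (_ : -1 * (-1) ^+ n * (n.+1%:R * n`!%:R) * _ * _ =
     - ((-1) ^+ n * n`!%:R) * gauss x * (n.+1%:R * heat 1 x n.+1)); last by ring.
  by rewrite e; ring.
rewrite (_ : (-1) ^+ n / n`!%:R * expR (x ^+ 2 / 2) * _ =
  ((-1) ^+ n * (-1) ^+ n) * (n`!%:R / n`!%:R) * (expR (x ^+ 2 / 2) * gauss x) * heat 1 x n); last by ring.
rewrite -expRD subrr expR0 divff ?pnatr_eq0 -?lt0n ?fact_gt0//.
by rewrite -exprD addnn -mul2n exprM sqrrN !expr1n !mul1r.
Qed.

End hermite_heat.

(** * Multi-indices of given total degree *)

Section compositions.

(** An explicit list, because the type of multi-indices is infinite: sums over a total degree become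
    finite sums over a sequence without duplicates. *)
Fixpoint compositions (d m : nat) : seq (d.-tuple nat) :=
  match d with
  | 0 => if m is 0 then [:: [tuple]] else [::]
  | d'.+1 => [seq cons_tuple k n | k <- iota 0 m.+1, n <- compositions d' (m - k)]
  end.

Lemma mem_compositions d m (n : d.-tuple nat) :
  (n \in compositions d m) = (\sum_(i < d) tnth n i == m)%N.
Proof.
elim: d m n => [|d IH] m n.
  by rewrite big_ord0 (tuple0 n); case: m => //=; rewrite inE eqxx.
rewrite big_ord_recl; apply/allpairsPdep/eqP => [[k [p [kin pin ->]]]|e].
  move: kin pin; rewrite mem_iota add0n ltnS /= => km; rewrite IH => /eqP e.
  under eq_bigr do rewrite tnthS.
  by rewrite e tnth0 subnKC.
exists (tnth n ord0), [tuple of behead n]; split.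
- by rewrite mem_iota add0n ltnS /= -e leq_addr.
- rewrite IH -e addKn; apply/eqP; apply: eq_bigr => i _.
  by rewrite tnth_behead; congr tnth; apply/val_inj; rewrite /= inordK ?ltnS.
- by rewrite [LHS]tuple_eta.
Qed.

Lemma compositions_uniq d m : uniq (compositions d m).
Proof.
elim: d m => [|d IH] m; first by case: m.
apply: allpairs_uniq_dep; [exact: iota_uniq | by move=> k _; exact: IH|].
move=> [k1 n1] [k2 n2] _ _ /= /(congr1 val)/= [-> e].
by congr existT; apply/val_inj.
Qed.

Lemma size_compositions d m : (size (compositions d m) <= m.+1 ^ d)%N.
Proof.
elim: d m => [|d IH] m; first by case: m.
rewrite size_allpairs_dep sumnE big_map expnS.
have -> : (m.+1 * m.+1 ^ d = \sum_(k <- iota 0 m.+1) m.+1 ^ d)%N.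
  by rewrite big_const_seq iter_addn_0 count_predT size_iota mulnC.
apply: leq_sum => k _; apply: leq_trans (IH _) _.
by case: (d) => [//|d']; rewrite leq_exp2r// ltnS leq_subr.
Qed.

Lemma heat_sum {R : realType} d (v x : 'I_d -> R) m :
  heat (\sum_i v i) (\sum_i x i) m =
  \sum_(n <- compositions d m) \prod_i heat (v i) (x i) (tnth n i).
Proof.
elim: d v x m => [|d IH] v x m.
  rewrite !big_ord0 heat0 /=; case: m => [|m].
    by rewrite big_seq1 big_ord0 expr0 fact0 divr1.
  by rewrite big_nil exprS !mul0r.
rewrite !big_ord_recl heatD big_allpairs_dep /conv.
rewrite -[iota 0 m.+1]/(index_iota 0 m.+1) big_mkord; apply: eq_bigr => k _.
rewrite IH mulr_sumr; apply: eq_bigr => n _.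
rewrite big_ord_recl tnth0; congr (_ * _); apply: eq_bigr => i _.
by rewrite tnthS.
Qed.

End compositions.

(** * Square integrable random variables *)

Section inner_product.
Context {R : realType} {disp : measure_display} {T : measurableType disp}
  (P : probability T R).
Implicit Types (X Y Z : T -> R) (a b : R).

Local Notation L2 := (Lfun P 2%:E).

(** Real-valued, hence informative only between square integrable variables. Variables equal almost
    everywhere are not identified: their equality is stated as a null [L2nrm] of the difference. *)
Definition L2inner X Y : R := \int[P]_w (X w * Y w).
Local Notation dotp := L2inner.

Lemma L2P X : X \in L2 <->
  measurable_fun setT X /\ (\int[P]_w (X w ^+ 2)%:E < +oo)%E.
Proof.
split=> [X2|[mX X2]].
  split; first by move: X2; rewrite inE => /andP[/[!inE]].
  exact: integrable_lty (Lfun2_integrable_sqr X2).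
rewrite inE; apply/andP; split; rewrite inE//= /finite_norm.
rewrite unlock/= poweR_lty//.
by under eq_integral do rewrite powR_mulrn// -normrX ger0_norm ?sqr_ge0//.
Qed.

Lemma L2_measurable X : X \in L2 -> measurable_fun setT X.
Proof. by move=> /L2P[]. Qed.

Lemma L2D X Y : X \in L2 -> Y \in L2 -> X + Y \in L2.
Proof.
move=> hX hY; have [_ /(_ 1 X Y hX hY)] := Lfun_submod_closed P (lee1n 2 : (1 <= 2%:E :> \bar R)%E).
by rewrite scale1r.
Qed.

Lemma L2Z a X : X \in L2 -> a *: X \in L2.
Proof.
move=> hX; have [h0 /(_ a X 0 hX h0)] := Lfun_submod_closed P (lee1n 2 : (1 <= 2%:E :> \bar R)%E).
by rewrite addr0.
Qed.

Lemma L20 : (0 : T -> R) \in L2.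
Proof. by have [] := Lfun_submod_closed P (lee1n 2 : (1 <= 2%:E :> \bar R)%E). Qed.

Lemma L2N X : X \in L2 -> - X \in L2.
Proof. by rewrite -scaleN1r; exact: L2Z. Qed.

Lemma L2B X Y : X \in L2 -> Y \in L2 -> X - Y \in L2.
Proof. by move=> hX hY; apply: L2D => //; exact: L2N. Qed.

Lemma L2_sum I (r : seq I) (Q : pred I) (F : I -> T -> R) :
  (forall i, Q i -> F i \in L2) -> \sum_(i <- r | Q i) F i \in L2.
Proof. by move=> h; apply: (big_ind (fun X => X \in L2)); [exact: L20|exact: L2D|]. Qed.

Lemma L2_cst a : cst a \in L2. Proof. exact: Lfun_cst. Qed.

Lemma L2_bounded X M : measurable_fun setT X -> (forall w, `|X w| <= M) ->
  X \in L2.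
Proof.
move=> mX XM; apply/L2P; split=> //.
apply: (@le_lt_trans _ _ (\int[P]_w (M ^+ 2)%:E)%E).
  apply: ge0_le_integral => //.
  - by move=> w _; rewrite lee_fin sqr_ge0.
  - by apply/measurable_EFinP; exact: measurable_funX.
  - by move=> w _; rewrite lee_fin -real_normK ?num_real// lerXn2r// ?nnegrE// (le_trans _ (XM w)).
by rewrite integral_cst//= probability_setT mule1 ltry.
Qed.

Lemma L2_integrable_mul X Y : X \in L2 -> Y \in L2 ->
  P.-integrable setT (EFin \o (fun w => X w * Y w)).
Proof. by move=> hX hY; apply/Lfun1_integrable; exact: Lfun2_mul_Lfun1. Qed.

Lemma L2_integrable X : X \in L2 -> P.-integrable setT (EFin \o X).
Proof.
move=> hX; have := L2_integrable_mul hX (L2_cst 1).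
by under [X in _ -> _.-integrable _ X]eq_fun do rewrite /= -[X _]mulr1.
Qed.

Lemma dotpC X Y : dotp X Y = dotp Y X.
Proof. by apply: eq_Rintegral => w _; rewrite mulrC. Qed.

Lemma dotpDl X Y Z : X \in L2 -> Y \in L2 -> Z \in L2 ->
  dotp (X + Y) Z = dotp X Z + dotp Y Z.
Proof.
move=> hX hY hZ; rewrite /L2inner -RintegralD//; try exact: L2_integrable_mul.
by apply: eq_Rintegral => w _; rewrite mulrDl.
Qed.

Lemma dotpZl a X Y : X \in L2 -> Y \in L2 -> dotp (a *: X) Y = a * dotp X Y.
Proof.
move=> hX hY; rewrite /L2inner -RintegralZl//; last exact: L2_integrable_mul.
by apply: eq_Rintegral => w _; rewrite mulrA.
Qed.

Lemma dotpDr X Y Z : X \in L2 -> Y \in L2 -> Z \in L2 ->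
  dotp Z (X + Y) = dotp Z X + dotp Z Y.
Proof. by move=> hX hY hZ; rewrite dotpC dotpDl// ![dotp Z _]dotpC. Qed.

Lemma dotpZr a X Y : X \in L2 -> Y \in L2 -> dotp Y (a *: X) = a * dotp Y X.
Proof. by move=> hX hY; rewrite dotpC dotpZl// [dotp Y _]dotpC. Qed.

Lemma dotp0l X : dotp 0 X = 0.
Proof.
by rewrite /L2inner; under eq_Rintegral do rewrite mul0r; rewrite Rintegral_cst// mul0r.
Qed.

Lemma dotpNl X Y : X \in L2 -> Y \in L2 -> dotp (- X) Y = - dotp X Y.
Proof. by move=> hX hY; rewrite -scaleN1r dotpZl// mulN1r. Qed.

Lemma dotpBl X Y Z : X \in L2 -> Y \in L2 -> Z \in L2 ->
  dotp (X - Y) Z = dotp X Z - dotp Y Z.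
Proof. by move=> hX hY hZ; rewrite dotpDl ?dotpNl// L2N. Qed.

Lemma dotpBr X Y Z : X \in L2 -> Y \in L2 -> Z \in L2 ->
  dotp Z (X - Y) = dotp Z X - dotp Z Y.
Proof. by move=> hX hY hZ; rewrite dotpC dotpBl// ![dotp Z _]dotpC. Qed.

Lemma dotp_suml I (r : seq I) (Q : pred I) (F : I -> T -> R) Y :
  (forall i, Q i -> F i \in L2) -> Y \in L2 ->
  dotp (\sum_(i <- r | Q i) F i) Y = \sum_(i <- r | Q i) dotp (F i) Y.
Proof.
move=> hF hY; elim: r => [|i r IH]; first by rewrite !big_nil dotp0l.
by rewrite !big_cons; case: ifPn => // Qi; rewrite dotpDl ?IH//; [exact: hF|exact: L2_sum].
Qed.

Lemma dotp_sumr I (r : seq I) (Q : pred I) (F : I -> T -> R) Y :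
  (forall i, Q i -> F i \in L2) -> Y \in L2 ->
  dotp Y (\sum_(i <- r | Q i) F i) = \sum_(i <- r | Q i) dotp Y (F i).
Proof.
by move=> hF hY; rewrite dotpC dotp_suml//; under eq_bigr do rewrite dotpC.
Qed.

Lemma dotp_ge0 X : 0 <= dotp X X.
Proof. by apply: Rintegral_ge0 => w _; rewrite -expr2 sqr_ge0. Qed.

Lemma expectation_sqr X : X \in L2 ->
  ('E_P[fun w => (X w ^+ 2)%R] = (dotp X X)%:E)%E.
Proof.
move=> hX; rewrite unlock /L2inner /Rintegral fineK; first exact: eq_integral.
exact: (integrable_fin_num measurableT (L2_integrable_mul hX hX)).
Qed.

(** Discriminant of a nonnegative quadratic. It stands apart from Cauchy-Schwarz because
    [closed_span_weak] applies it to a quadratic whose constant term is not a squared norm. *)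
Lemma quadratic_ge0 (q b g : R) : 0 <= g -> 0 <= q ->
  (forall l, 0 <= q - 2 * l * b + l ^+ 2 * g) -> b ^+ 2 <= q * g.
Proof.
move=> g0 q0 h; have [g_0|gn0] := eqVneq g 0.
  have [->|b0] := eqVneq b 0; first by rewrite expr0n/= mulr_ge0.
  (* This [l] makes the affine function [q - 2 l b] equal to [- 1]. *)
  have := h ((q + 1) / (2 * b)); rewrite g_0 mulr0 addr0.
  by rewrite (_ : q - _ = -1); [rewrite lerNr oppr0 ler10|field].
have {}g0 : 0 < g by rewrite lt_def gn0.
have := h (b / g); rewrite (_ : _ + _ = q - b ^+ 2 / g); last by field.
by rewrite subr_ge0 ler_pdivrMr.
Qed.

Lemma dotp_lin l X Y : X \in L2 -> Y \in L2 ->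
  dotp (X - l *: Y) (X - l *: Y) =
  dotp X X - 2 * l * dotp X Y + l ^+ 2 * dotp Y Y.
Proof.
move=> hX hY; have hl := L2Z l hY.
by rewrite dotpBl ?dotpBr ?L2B// !dotpZl ?dotpZr ?(dotpC Y X)//; ring.
Qed.

Lemma dotp_CS X Y : X \in L2 -> Y \in L2 ->
  dotp X Y ^+ 2 <= dotp X X * dotp Y Y.
Proof.
move=> hX hY; apply: quadratic_ge0; [exact: dotp_ge0..|] => l.
by rewrite -dotp_lin//; exact: dotp_ge0.
Qed.

Definition L2nrm X := Num.sqrt (dotp X X).
Local Notation nrm := L2nrm.

Lemma nrm_ge0 X : 0 <= nrm X. Proof. exact: sqrtr_ge0. Qed.

Lemma nrm_sqr X : nrm X ^+ 2 = dotp X X.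
Proof. by rewrite sqr_sqrtr// dotp_ge0. Qed.

Lemma nrm_CS X Y : X \in L2 -> Y \in L2 -> `|dotp X Y| <= nrm X * nrm Y.
Proof.
move=> hX hY; rewrite /L2nrm -sqrtrM ?dotp_ge0// -sqrtr_sqr ler_sqrt ?dotp_CS//.
by rewrite mulr_ge0 ?dotp_ge0.
Qed.

Lemma nrmD X Y : X \in L2 -> Y \in L2 -> nrm (X + Y) <= nrm X + nrm Y.
Proof.
move=> hX hY.
rewrite -(@ler_pXn2r _ 2)// ?nnegrE ?addr_ge0 ?nrm_ge0//.
rewrite nrm_sqr sqrrD !nrm_sqr dotpDl ?dotpDr ?L2D// (dotpC Y X).
have := le_trans (ler_norm _) (nrm_CS hX hY); lra.
Qed.

Lemma nrmZ a X : X \in L2 -> nrm (a *: X) = `|a| * nrm X.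
Proof.
move=> hX; rewrite /L2nrm dotpZl ?dotpZr ?L2Z// mulrA -expr2 sqrtrM ?sqr_ge0//.
by rewrite sqrtr_sqr.
Qed.

Lemma nrmN X : X \in L2 -> nrm (- X) = nrm X.
Proof. by move=> hX; rewrite -scaleN1r nrmZ// normrN1 mul1r. Qed.

Lemma nrm0 : nrm 0 = 0. Proof. by rewrite /L2nrm dotp0l sqrtr0. Qed.

Lemma nrmB X Y : X \in L2 -> Y \in L2 -> nrm (X - Y) = nrm (Y - X).
Proof. by move=> hX hY; rewrite -opprB nrmN ?L2B. Qed.

Lemma nrm_sum I (r : seq I) (Q : pred I) (F : I -> T -> R) :
  (forall i, Q i -> F i \in L2) ->
  nrm (\sum_(i <- r | Q i) F i) <= \sum_(i <- r | Q i) nrm (F i).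
Proof.
move=> hF; elim: r => [|i r IH]; first by rewrite !big_nil nrm0.
rewrite !big_cons; case: ifPn => // Qi.
by rewrite (le_trans (nrmD _ _)) ?lerD2l//; [exact: hF|exact: L2_sum].
Qed.

Lemma nrm_triangle X Y Z : X \in L2 -> Y \in L2 -> Z \in L2 ->
  nrm (X - Z) <= nrm (X - Y) + nrm (Y - Z).
Proof.
move=> hX hY hZ; rewrite (_ : X - Z = (X - Y) + (Y - Z)) ?nrmD ?L2B//.
by rewrite addrA subrK.
Qed.

Lemma nrm_le X Y : Y \in L2 -> measurable_fun setT X ->
  (forall w, `|X w| <= `|Y w|) -> X \in L2 /\ nrm X <= nrm Y.
Proof.
move=> hY mX XY.
have le2 : (\int[P]_w (X w ^+ 2)%:E <= \int[P]_w (Y w ^+ 2)%:E)%E.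
  apply: ge0_le_integral => //.
  - by move=> w _; rewrite lee_fin sqr_ge0.
  - by apply/measurable_EFinP; exact: measurable_funX.
  - by apply/measurable_EFinP; apply: measurable_funX; exact: L2_measurable.
  - by move=> w _; rewrite lee_fin -[leLHS]real_normK ?num_real// -[leRHS]real_normK ?num_real// lerXn2r// ?nnegrE.
have hX : X \in L2 by apply/L2P; split=> //; apply: le_lt_trans le2 _; have /L2P[] := hY.
split=> //; rewrite /L2nrm ler_sqrt ?dotp_ge0// -lee_fin -!expectation_sqr//.
by rewrite unlock.
Qed.

Lemma nrm_cst a : nrm (cst a) = `|a|.
Proof.
rewrite /L2nrm /L2inner (_ : (fun w => _) = cst (a ^+ 2))//.
by rewrite Rintegral_cst//= probability_setT /= mulr1 sqrtr_sqr.
Qed.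

End inner_product.

(** * Closed linear spans of square integrable variables *)

Section closed_span.
Context {R : realType} {disp : measure_display} {T : measurableType disp}
  (P : probability T R).
Implicit Types (X Y Z : T -> R) (a b : R) (S : set (T -> R)).

Local Notation L2 := (Lfun P 2%:E).
Local Notation dotp := (L2inner P).
Local Notation nrm := (L2nrm P).

Definition lin_span S : set (T -> R) :=
  [set X | exists n (c : 'I_n -> R) (Y : 'I_n -> T -> R),
    (forall k, S (Y k)) /\ X = \sum_k c k *: Y k].

Lemma lin_span_gen S X : S X -> lin_span S X.
Proof.
by move=> SX; exists 1%N, (fun=> 1), (fun=> X); rewrite big_ord1 scale1r.
Qed.

Lemma lin_span0 S : lin_span S 0.
Proof. by exists 0%N, (fun=> 0), (fun=> 0); split; [case|rewrite big_ord0]. Qed.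

Lemma lin_spanZ S a X : lin_span S X -> lin_span S (a *: X).
Proof.
move=> [n [c [Y [SY ->]]]]; exists n, (fun k => a * c k), Y; split=> //.
by rewrite scaler_sumr; apply: eq_bigr => k _; rewrite scalerA.
Qed.

Lemma lin_spanD S X Y : lin_span S X -> lin_span S Y -> lin_span S (X + Y).
Proof.
move=> [n [c [F [SF ->]]]] [m [e [G [SG ->]]]].
exists (n + m)%N, (fun k : 'I_(n + m) => match fintype.split k with inl i => c i | inr j => e j end),
  (fun k : 'I_(n + m) => match fintype.split k with inl i => F i | inr j => G j end); split.
  by move=> k; case: (fintype.split k).
rewrite big_split_ord/=; congr (_ + _); apply: eq_bigr => k _.
  by rewrite (unsplitK (inl k)).
by rewrite (unsplitK (inr k)).
Qed.

Section square_integrable.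
Variable S : set (T -> R).
Hypothesis SL2 : S `<=` [set X | X \in L2].

Lemma lin_span_L2 X : lin_span S X -> X \in L2.
Proof.
by move=> [n [c [Y [SY ->]]]]; apply: L2_sum => k _; apply: L2Z; exact: SL2.
Qed.

Lemma closed_spanP X : L2_closed_span P S X <->
  X \in L2 /\ forall e : R, 0 < e -> exists2 Y, lin_span S Y & nrm (X - Y) < e.
Proof.
have eE (n : nat) (c : 'I_n -> R) (Y : 'I_n -> T -> R) :
    X \in L2 -> (forall k, S (Y k)) ->
    ('E_P[fun w => ((X w - \sum_(k < n) c k * Y k w) ^+ 2)%R] =
    (nrm (X - \sum_k c k *: Y k) ^+ 2)%:E)%E.
  move=> hX SY; have hY : \sum_k c k *: Y k \in L2 by apply: lin_span_L2; exists n, c, Y.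
  rewrite nrm_sqr -expectation_sqr ?L2B//; congr expectation.
  by apply/funext => w; rewrite /= fct_sumE.
split=> -[hX h]; split=> // e e0.
  have [n [c [Y [SY lt]]]] := h _ (exprn_gt0 2 e0).
  exists (\sum_k c k *: Y k); first by exists n, c, Y.
  by move: lt; rewrite eE// lte_fin ltr_pXn2r// ?nnegrE ?nrm_ge0 ?ltW.
have se0 : 0 < Num.sqrt e by rewrite sqrtr_gt0.
have [_ [n [c [Y [SY ->]]]] lt] := h _ se0; exists n, c, Y; split=> //.
by rewrite eE// lte_fin -[ltRHS]sqr_sqrtr ?ltW// ltr_pXn2r// ?nnegrE ?nrm_ge0 ?ltW.
Qed.

Lemma lin_span_closed X : lin_span S X -> L2_closed_span P S X.
Proof.
move=> hX; apply/closed_spanP; split; first exact: lin_span_L2.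
by move=> e e0; exists X => //; rewrite subrr nrm0.
Qed.

Lemma closed_span_lim X : X \in L2 ->
  (forall e : R, 0 < e -> exists2 Y, L2_closed_span P S Y & nrm (X - Y) < e) ->
  L2_closed_span P S X.
Proof.
move=> hX h; apply/closed_spanP; split=> // e e0.
have [Y hY lt] := h _ (divr_gt0 e0 (@ltr0Sn R 1)).
have /closed_spanP[Y2 /(_ _ (divr_gt0 e0 (@ltr0Sn R 1)))[Z hZ lt2]] := hY.
exists Z => //; have Z2 := lin_span_L2 hZ.
by rewrite (le_lt_trans (nrm_triangle hX Y2 Z2))// [e]splitr ltrD.
Qed.

Lemma closed_spanD X Y : L2_closed_span P S X -> L2_closed_span P S Y ->
  L2_closed_span P S (X + Y).
Proof.
move=> /closed_spanP[hX aX] /closed_spanP[hY aY]; apply/closed_spanP.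
split=> [|e e0]; first exact: L2D.
have [X' sX ltX] := aX _ (divr_gt0 e0 (@ltr0Sn R 1)).
have [Y' sY ltY] := aY _ (divr_gt0 e0 (@ltr0Sn R 1)).
exists (X' + Y'); first exact: lin_spanD.
have X'2 := lin_span_L2 sX; have Y'2 := lin_span_L2 sY.
rewrite opprD addrACA (le_lt_trans (nrmD _ _)) ?L2B//.
by rewrite [e]splitr ltrD.
Qed.

Lemma closed_spanZ a X : L2_closed_span P S X -> L2_closed_span P S (a *: X).
Proof.
move=> /closed_spanP[hX aX]; apply/closed_spanP; split=> [|e e0]; first exact: L2Z.
have a0 : 0 < `|a| + 1 by rewrite ltr_wpDl.
have [X' sX ltX] := aX _ (divr_gt0 e0 a0).
exists (a *: X'); first exact: lin_spanZ.
have X'2 := lin_span_L2 sX.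
rewrite -scalerBr nrmZ ?L2B//.
rewrite ltr_pdivlMr// in ltX; apply: le_lt_trans ltX.
by rewrite mulrC ler_wpM2l ?nrm_ge0// lerDl.
Qed.

Lemma closed_span0 : L2_closed_span P S 0.
Proof. by apply: lin_span_closed; exact: lin_span0. Qed.

Lemma closed_span_sum I (r : seq I) (Q : pred I) (F : I -> T -> R) :
  (forall i, Q i -> L2_closed_span P S (F i)) ->
  L2_closed_span P S (\sum_(i <- r | Q i) F i).
Proof.
move=> h; apply: (big_ind (L2_closed_span P S)) => //; first exact: closed_span0.
exact: closed_spanD.
Qed.

Lemma closed_span_orthogonal X Z : Z \in L2 ->
  (forall Y, S Y -> dotp Y Z = 0) -> L2_closed_span P S X -> dotp X Z = 0.
Proof.
move=> hZ h /closed_spanP[hX aX]; apply/eqP; rewrite -normr_eq0 eq_le normr_ge0 andbT.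
apply/ler_addgt0Pl => e e0; rewrite addr0.
have Z0 : 0 < nrm Z + 1 by rewrite ltr_wpDl ?nrm_ge0.
have [Y sY ltY] := aX _ (divr_gt0 e0 Z0).
have Y2 := lin_span_L2 sY.
have Y0 : dotp Y Z = 0.
  case: sY => n [c [F [SF ->]]]; rewrite dotp_suml//; last first.
    by move=> k _; apply: L2Z; exact: SL2.
  by rewrite big1// => k _; rewrite dotpZl ?h ?mulr0//; exact: SL2.
rewrite -[dotp X Z]subr0 -Y0 -dotpBl// (le_trans (nrm_CS _ _))// ?L2B//.
rewrite ltr_pdivlMr// in ltY; apply: le_trans (ltW ltY).
by rewrite ler_wpM2l ?nrm_ge0// lerDl.
Qed.

(* Near-minimality of the distance makes [X - Y] almost orthogonal to [S], which
   replaces the orthogonal projection: the hypothesis expresses that [X] is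
   a weak average of elements of [S]. *)
Lemma closed_span_weak (C : R) X : X \in L2 -> 0 <= C ->
  (forall Z (eta : R), Z \in L2 -> 0 <= eta ->
    (forall Y, S Y -> `|dotp Y Z| <= eta * nrm Y) -> `|dotp X Z| <= eta * C) ->
  L2_closed_span P S X.
Proof.
move=> hX C0 h; apply/closed_spanP; split=> //.
pose A := [set dotp (X - Y) (X - Y) | Y in lin_span S].
have A0 : A !=set0 by exists (dotp (X - 0) (X - 0)); exists 0 => //; exact: lin_span0.
have lbA : lbound A 0 by move=> _ [Y _ <-]; exact: dotp_ge0.
have infA : has_inf A by split=> //; exists 0.
(* [D] is the squared distance from [X] to the span; it has to vanish. *)
set D := inf A; have D0 : 0 <= D by apply: lb_le_inf.
suff D_0 : D = 0.
  move=> e e0; have /(_ (e ^+ 2))[] := inf_adherent _ infA; first exact: exprn_gt0.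
  move=> _ [Y sY <-]; rewrite -/D D_0 add0r -nrm_sqr => lt; exists Y => //.
  by rewrite -(@ltr_pXn2r _ 2)// nnegrE ?nrm_ge0// ltW.
apply/eqP; rewrite eq_le D0 andbT.
set K := C + nrm X + Num.sqrt (D + 1).
have K0 : 0 <= K by rewrite !addr_ge0 ?nrm_ge0 ?sqrtr_ge0.
have key (eta : R) : 0 < eta <= 1 -> D <= eta * K.
  move=> /andP[eta0 eta1].
  have /(_ (eta ^+ 2))[] := inf_adherent _ infA; first exact: exprn_gt0.
  move=> _ [Y sY <-]; rewrite -/D => ltY.
  have Y2 := lin_span_L2 sY; have XY2 := L2B hX Y2.
  (* First-order condition at a near minimizer: displacing [Y] along [G] cannot lower the squared
     distance by more than [eta ^ 2], and the discriminant turns this into a bound on the inner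
     product. *)
  have orth G : lin_span S G -> `|dotp G (X - Y)| <= eta * nrm G.
    move=> sG; have G2 := lin_span_L2 sG.
    rewrite -(@ler_pXn2r _ 2)// ?nnegrE ?mulr_ge0 ?nrm_ge0 ?(ltW eta0)//.
    rewrite real_normK ?num_real// exprMn nrm_sqr dotpC.
    apply: quadratic_ge0; rewrite ?dotp_ge0 ?sqr_ge0// => l.
    have : D <= dotp (X - Y - l *: G) (X - Y - l *: G).
      apply: ge_inf; first by exists 0.
      exists (Y + l *: G); first by apply: lin_spanD => //; exact: lin_spanZ.
      by rewrite opprD addrA.
    by rewrite dotp_lin//; lra.
  have D1 : D <= dotp (X - Y) (X - Y).
    by apply: ge_inf; [exists 0|exists Y].
  have nXY : nrm (X - Y) <= Num.sqrt (D + 1).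
    rewrite ler_sqrt ?addr_ge0//; apply: le_trans (ltW ltY) _.
    by rewrite lerD2l -[leRHS](expr1n _ 2) lerXn2r// nnegrE ltW.
  have nY : nrm Y <= nrm X + Num.sqrt (D + 1).
    rewrite -[Y](subKr X) opprB addrC (le_trans (nrmD _ _)) ?L2B// addrC lerD2l.
    by rewrite nrmB.
  (* The hypothesis on weak averages, applied to the test variable [X - Y]. *)
  have e1 : `|dotp X (X - Y)| <= eta * C.
    by apply: h => //; [exact: ltW|move=> G SG; exact/orth/lin_span_gen].
  have e2 := orth _ sY.
  apply: (le_trans D1); rewrite dotpBl//.
  have := ler_wpM2l (ltW eta0) nY; move: e1 e2; rewrite !ler_norml /K !mulrDr.
  by move=> /andP[_ ?] /andP[? _] ?; lra.
rewrite leNgt; apply/negP => Dp.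
have K1 : 0 < K + D by rewrite ltr_wpDl.
(* This [eta] is at most one and makes [eta * K] smaller than [D]. *)
have := key (D / (2 * (K + D))); rewrite divr_gt0 ?mulr_gt0//=.
rewrite ler_pdivrMr ?mulr_gt0// mul1r.
have le : D <= 2 * (K + D) by lra.
move=> /(_ le); rewrite mulrAC ler_pdivlMr ?mulr_gt0// ler_pM2l//; lra.
Qed.

End square_integrable.

Lemma closed_span_sub S S' X : S `<=` [set X | X \in L2] ->
  S' `<=` L2_closed_span P S -> L2_closed_span P S' X -> L2_closed_span P S X.
Proof.
move=> SL2 S'S hX.
have S'L2 : S' `<=` [set X | X \in L2] by move=> Y /S'S[].
have /(closed_spanP S'L2)[X2 aX] := hX.
apply: closed_span_lim => // e e0; have [Y [n [c [F [SF ->]]]] lt] := aX _ e0.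
exists (\sum_k c k *: F k) => //; apply: closed_span_sum => // k _.
by apply: closed_spanZ => //; exact: S'S.
Qed.

End closed_span.

(** * Almost everywhere limits and completeness *)

Section L2_convergence.
Context {R : realType} {disp : measure_display} {T : measurableType disp}
  (P : probability T R).
Implicit Types (X Y : T -> R).

Local Notation L2 := (Lfun P 2%:E).
Local Notation nrm := (L2nrm P).

Lemma expectation_norm_le X : X \in L2 ->
  (\int[P]_w (`|X w|)%:E <= (nrm X)%:E)%E.
Proof.
move=> hX; have mX := L2_measurable hX.
have [aX naX] : Num.norm \o X \in L2 /\ nrm (Num.norm \o X) <= nrm X.
  by apply: nrm_le => //= [|w]; [exact: measurableT_comp|rewrite normr_id].
have := nrm_CS aX (L2_cst P 1); rewrite nrm_cst normr1 mulr1 => h.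
have := le_trans (ler_norm _) (le_trans h naX).
rewrite -lee_fin; apply: le_trans; rewrite /L2inner /Rintegral fineK.
  by under [leRHS]eq_integral do rewrite mulr1.
by apply: (integrable_fin_num measurableT); exact: L2_integrable_mul (L2_cst _ _).
Qed.

(** On a probability space the [L1] norm is below the [L2] norm, so the sum of the [|Z k|] is
    integrable, hence finite almost everywhere. *)
Lemma summable_ae (Z : nat -> T -> R) (C : R) : (forall k, Z k \in L2) ->
  (forall n, \sum_(k < n) nrm (Z k) <= C) ->
  {ae P, forall w, cvgn (series (fun k => `|Z k w|))}.
Proof.
move=> hZ hC.
pose g w : \bar R := (\sum_(0 <= k <oo) (`|Z k w|)%:E)%E.
have mZ k : measurable_fun setT (fun w => (`|Z k w|)%:E : \bar R).
  by apply/measurable_EFinP; apply: measurableT_comp => //; exact: L2_measurable.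
have mg : measurable_fun setT g by apply: ge0_emeasurable_sum.
have ig : P.-integrable setT g.
  apply/integrableP; split=> //.
  under eq_integral do rewrite gee0_abs ?nneseries_ge0//.
  rewrite integral_nneseries//.
  apply: (@le_lt_trans _ _ C%:E); last exact: ltry.
  apply: lime_le; first by apply: is_cvg_nneseries => k _ _; exact: integral_ge0.
  apply: nearW => n; rewrite big_mkord.
  apply: le_trans (_ : (\sum_(k < n) (nrm (Z k))%:E <= _)%E); last first.
    by rewrite sumEFin lee_fin.
  by apply: lee_sum => k _; exact: expectation_norm_le.
have := integrable_ae measurableT ig; apply: filterS => w /(_ I) gfin.
apply: nondecreasing_is_cvgn.
  by apply/nondecreasing_seqP => n; rewrite /series/= big_nat_recr//= lerDl.
exists (fine (g w)) => _ [n _ <-].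
rewrite -lee_fin fineK// /series/= -sumEFin.
by apply: nneseries_lim_ge => k _ _; rewrite lee_fin.
Qed.

(** Fatou's lemma on the squares. The square integrability of the limit is part of the conclusion,
    which is how limits below are shown to be square integrable. *)
Lemma fatou_nrm (X : nat -> T -> R) Y (C : R) : (forall k, X k \in L2) ->
  measurable_fun setT Y -> (forall k, nrm (X k) <= C) ->
  {ae P, forall w, X k w @[k --> \oo] --> Y w} -> Y \in L2 /\ nrm Y <= C.
Proof.
move=> hX mY hC cv.
have C0 : 0 <= C by apply: le_trans (hC 0%N); exact: nrm_ge0.
have mX k : measurable_fun setT (fun w => (X k w ^+ 2)%:E : \bar R).
  by apply/measurable_EFinP; apply: measurable_funX; exact: L2_measurable.
have le : (\int[P]_w (Y w ^+ 2)%:E <= (C ^+ 2)%:E)%E.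
  have -> : (\int[P]_w (Y w ^+ 2)%:E =
      \int[P]_w limn_einf (fun k => (X k w ^+ 2)%:E))%E.
    apply: ge0_ae_eq_integral => //.
    - by apply/measurable_EFinP; exact: measurable_funX.
    - apply: measurableT_comp => //; apply: measurable_fun_limn_esup => k.
      exact: measurableT_comp.
    - by move=> w _; rewrite lee_fin sqr_ge0.
    - move=> w _; rewrite limn_einf_lim; apply: lime_ge; first exact: is_cvg_einfs.
      by apply: nearW => n; apply/ereal_infP => _ [k _ <-]; rewrite lee_fin sqr_ge0.
    apply: filterS cv => w Xw _; apply/esym.
    by apply: (cvg_limn_einf_sup _).1; apply: cvg_EFin; [exact: nearW|exact: (cvgM Xw Xw)].
  apply: le_trans; first by apply: fatou => // k w _; rewrite lee_fin sqr_ge0.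
  apply: le_trans (limn_einf_sup _) _.
  rewrite limn_esup_lim; apply: lime_le; first exact: is_cvg_esups.
  apply: nearW => n; apply/ereal_supP => _ [k _ <-].
  have := expectation_sqr (hX k); rewrite unlock => ->.
  by rewrite lee_fin -nrm_sqr lerXn2r// nnegrE nrm_ge0.
have hY : Y \in L2 by apply/L2P; split=> //; exact: le_lt_trans le (ltry _).
split=> //; rewrite -(@ler_pXn2r _ 2)// ?nnegrE ?nrm_ge0// nrm_sqr -lee_fin.
by rewrite -expectation_sqr// unlock.
Qed.

Lemma geo_half_sum n : \sum_(k < n) (2^-1 : R) ^+ k <= 2.
Proof.
suff -> : \sum_(k < n) (2^-1 : R) ^+ k = 2 - 2 * 2^-1 ^+ n.
  by rewrite gerBl mulr_ge0.
elim: n => [|n IH]; first by rewrite big_ord0 expr0 mulr1 subrr.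
by rewrite big_ord_recr/= IH exprS; field.
Qed.

Lemma fast_ae_cvg (X : nat -> T -> R) Y : (forall k, X k \in L2) -> Y \in L2 ->
  (forall k, nrm (X k - Y) <= 2^-1 ^+ k) ->
  {ae P, forall w, X k w @[k --> \oo] --> Y w}.
Proof.
move=> hX hY h.
have := @summable_ae (fun k => X k - Y) 2 (fun k => L2B (hX k) hY).
move=> /(_ (fun n => le_trans (ler_sum _ (fun (k : 'I_n) _ => h k)) (geo_half_sum n))).
apply: filterS => w /cvg_series_cvg_0 cv.
by apply/subr_cvg0; apply/norm_cvg0P.
Qed.

(** A fast subsequence converges almost everywhere, and Fatou's lemma bounds the distance between
    its limit and the tail of the whole sequence. *)
Lemma L2_complete (X : nat -> T -> R) : (forall k, X k \in L2) ->
  (forall e : R, 0 < e -> exists N, forall n m, (N <= n)%N -> (N <= m)%N ->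
     nrm (X n - X m) <= e) ->
  exists2 Y, Y \in L2 & nrm (X n - Y) @[n --> \oo] --> 0.
Proof.
move=> hX cauchy.
have /choice[N hN] (k : nat) : exists N, forall n m, (N <= n)%N -> (N <= m)%N ->
    nrm (X n - X m) <= 2^-1 ^+ k.
  by apply: cauchy; rewrite exprn_gt0 ?invr_gt0.
(* A running maximum, so that [phi k] lies beyond every [N j] with [j <= k], and two consecutive
   values are both beyond [N k]. *)
pose phi k := (\max_(j < k.+1) N j)%N.
have phiN j k : (j <= k)%N -> (N j <= phi k)%N.
  rewrite -ltnS => jk; rewrite /phi (bigD1 (Ordinal jk))//=; exact: leq_maxl.
pose Z k := X (phi k.+1) - X (phi k).
have hZ k : Z k \in L2 by apply: L2B.
have nZ k : nrm (Z k) <= 2^-1 ^+ k by apply: hN; apply: phiN.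
have aecv := summable_ae hZ (fun n => le_trans (ler_sum _ (fun (k : 'I_n) _ => nZ k)) (geo_half_sum n)).
(* The upper limit is measurable everywhere and agrees with the limit where the subsequence
   converges. *)
pose Y w := fine (limn_esup (fun k => (X (phi k) w)%:E)).
have mY : measurable_fun setT Y.
  apply: measurableT_comp => //; apply: measurable_fun_limn_esup => k.
  by apply/measurable_EFinP; exact: L2_measurable.
have XY : {ae P, forall w, X (phi k) w @[k --> \oo] --> Y w}.
  apply: filterS aecv => w /normed_cvg cvZ.
  have sumE n : X (phi n) w = X (phi 0%N) w + series (Z ^~ w) n.
    by rewrite /series/= telescope_sumr//= subrKC.
  have [l cvl] : exists l : R, X (phi k) w @[k --> \oo] --> l.
    exists (X (phi 0%N) w + limn (series (Z ^~ w))).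
    by under eq_fun do rewrite sumE; apply: cvgD; [exact: cvg_cst|].
  rewrite /Y (_ : limn_esup _ = l%:E)//.
  by apply: (cvg_limn_einf_sup _).2; apply: cvg_EFin => //; exact: nearW.
have bound k n : (N k <= n)%N -> Y - X n \in L2 /\ nrm (Y - X n) <= 2^-1 ^+ k.
  move=> kn; apply: (@fatou_nrm (fun j => X (phi (j + k)%N) - X n)).
  - by move=> j; exact: L2B.
  - by apply: measurable_funB => //; exact: L2_measurable.
  - by move=> j; apply: hN => //; apply: phiN; exact: leq_addl.
  - apply: filterS XY => w cvw; apply: cvgB; last exact: cvg_cst.
    by rewrite (cvg_shiftn k (fun j => X (phi j) w)).
have hY : Y \in L2.
  have [h _] := bound 0%N _ (leqnn _).
  by rewrite -[Y](subrK (X (N 0%N))); apply: L2D.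
exists Y => //; apply/cvgr0Pnorm_le => e e0.
have [k ke] : exists k, 2^-1 ^+ k <= e.
  have : (2^-1 : R) ^+ n @[n --> \oo] --> 0.
    by apply: cvg_expr; rewrite ger0_norm// invf_lt1// ltr1n.
  move=> /cvgr0Pnorm_le/(_ _ e0)[k _ /(_ k (leqnn _))/= h]; exists k.
  exact: le_trans (ler_norm _) h.
exists (N k) => // n /= kn; rewrite ger0_norm ?nrm_ge0// nrmB//.
by apply: le_trans ke; have [] := bound k n kn.
Qed.

End L2_convergence.

(** * Integrals of random variables *)

Section integral_of_random_variables.
Context {R : realType} {disp disp' : measure_display}
  {T : measurableType disp} {U : measurableType disp'}
  (P : probability T R) (mu : {sigma_finite_measure set U -> \bar R}).

Local Notation L2 := (Lfun P 2%:E).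
Local Notation dotp := (L2inner P).
Local Notation nrm := (L2nrm P).

Variables (G : U -> T -> R) (b : U -> R).
Hypothesis mG : measurable_fun setT (fun p : U * T => G p.1 p.2).
Hypothesis G2 : forall s, G s \in L2.
Hypothesis ib : mu.-integrable setT (EFin \o b).
Hypothesis Gb : forall s, nrm (G s) <= b s.

(** The pathwise integral, which represents the Bochner integral of [s |-> G s] in [L2]. It is zero
    by convention where the section is not integrable, which happens on a negligible set where it
    matters. *)
Definition Gint w : R := \int[mu]_s G s w.

Let b0 s : 0 <= b s. Proof. exact: le_trans (nrm_ge0 _ _) (Gb s). Qed.

Let beta : R := \int[mu]_s b s.

Let beta0 : 0 <= beta. Proof. exact: Rintegral_ge0. Qed.

Let betaE : (\int[mu]_s (b s)%:E = beta%:E)%E.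
Proof. by rewrite /beta /Rintegral fineK//; exact: integrable_fin_num ib. Qed.

Let mGw w : measurable_fun setT (G ^~ w).
Proof. exact: (measurableT_comp mG (measurable_pair2 _)). Qed.

Lemma measurable_Gint : measurable_fun setT Gint.
Proof.
apply: measurableT_comp => //.
have mE : measurable_fun setT (fun p : U * T => (G p.1 p.2)%:E).
  exact/measurable_EFinP.
under eq_fun do rewrite integralE.
apply: emeasurable_funB.
  rewrite [X in measurable_fun _ X](_ : _ =
    fubini_G mu (fun p : U * T => (G p.1 p.2)%:E)^\+%E); last first.
    by apply/funext => w; apply: eq_integral => s _; rewrite !funeposE.
  apply: measurable_fun_fubini_tonelli_G => //.
  exact: measurable_funepos.
rewrite [X in measurable_fun _ X](_ : _ =
    fubini_G mu (fun p : U * T => (G p.1 p.2)%:E)^\-%E); last first.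
    by apply/funext => w; apply: eq_integral => s _; rewrite !funenegE.
  apply: measurable_fun_fubini_tonelli_G => //.
exact: measurable_funeneg.
Qed.

Section against.
Variable Z : T -> R.
Hypothesis hZ : Z \in L2.

Let mGZ : measurable_fun setT (fun p : U * T => (G p.1 p.2 * Z p.2)%:E).
Proof.
apply/measurable_EFinP; apply: measurable_funM => //.
exact: (measurableT_comp (L2_measurable hZ) measurable_snd).
Qed.

Let mnGZ : measurable_fun setT (fun p : U * T => (`|G p.1 p.2 * Z p.2|)%:E).
Proof. by apply/measurable_EFinP/measurableT_comp => //; exact/measurable_EFinP. Qed.

(** Absolute integrability on the product space, from Cauchy-Schwarz in [w] at each [s]; it licenses
    the uses of Fubini's theorem below. *)
Lemma tonelli_Gint :
  (\int[P]_w \int[mu]_s (`|G s w * Z w|%R)%:E <= (nrm Z * beta)%:E)%E.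
Proof.
rewrite -(fubini_tonelli (fun p => (`|G p.1 p.2 * Z p.2|)%:E))//=.
apply: (@le_trans _ _ (\int[mu]_s ((nrm Z)%:E * (b s)%:E))%E); last first.
  by rewrite integralZl// betaE EFinM.
apply: ge0_le_integral => //.
- by move=> s _; exact: integral_ge0.
- exact: (measurable_fun_fubini_tonelli_F (fun p => (`|G p.1 p.2 * Z p.2|)%:E)).
- by apply: emeasurable_funM => //; have /integrableP[] := ib.
move=> s _.
have [aG naG] : Num.norm \o G s \in L2 /\ nrm (Num.norm \o G s) <= nrm (G s).
  by apply: nrm_le => //= [|w]; [exact/measurableT_comp/L2_measurable|rewrite normr_id].
have [aZ naZ] : Num.norm \o Z \in L2 /\ nrm (Num.norm \o Z) <= nrm Z.
  apply: nrm_le => //= [|w]; last by rewrite normr_id.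
  by apply: measurableT_comp => //; exact: L2_measurable hZ.
rewrite -EFinM; apply: (@le_trans _ _ (dotp (Num.norm \o G s) (Num.norm \o Z))%:E).
  rewrite /L2inner /Rintegral fineK; last first.
    by apply: (integrable_fin_num measurableT); exact: L2_integrable_mul.
  by under [leLHS]eq_integral do rewrite normrM.
rewrite lee_fin (le_trans (ler_norm _))// (le_trans (nrm_CS aG aZ))// mulrC.
by apply: ler_pM; rewrite ?nrm_ge0//; exact: le_trans naG _.
Qed.

Let iGZ : (mu \x P)%E.-integrable setT (fun p => (G p.1 p.2 * Z p.2)%:E).
Proof. by apply/integrable21ltyP => //; exact: le_lt_trans tonelli_Gint (ltry _). Qed.

Let dotpGE s : ((dotp (G s) Z)%:E = \int[P]_w (G s w * Z w)%:E)%E.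
Proof.
rewrite /L2inner /Rintegral fineK//.
by apply: (integrable_fin_num measurableT); exact: L2_integrable_mul.
Qed.

Lemma integrable_dotpG : mu.-integrable setT (fun s => (dotp (G s) Z)%:E).
Proof.
have := integrable_fubini_F iGZ; rewrite /fubini_F.
by under [X in _.-integrable _ X -> _]eq_fun do rewrite -dotpGE.
Qed.

Let GintZ : {ae P, forall w, (Gint w * Z w)%:E = (\int[mu]_s (G s w * Z w)%:E)%E}.
Proof.
have := ae_integrable2 iGZ; apply: filterS => w /= iw.
(* Integrability of the section of [G] is recovered by dividing by [Z w]; where [Z w = 0], both
   sides vanish. *)
have [Z0|Z0] := eqVneq (Z w) 0.
  by rewrite Z0 mulr0 integral0_eq// => s _; rewrite mulr0.
have iG : mu.-integrable setT (fun s => (G s w)%:E).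
  have := integrableZl measurableT (Z w)^-1 iw.
  by under [X in _.-integrable _ X -> _]eq_fun do rewrite -EFinM mulrC mulfK//.
rewrite EFinM /Gint /Rintegral fineK ?(integrable_fin_num measurableT)//.
by rewrite -integralZr.
Qed.

Let mGintZ : measurable_fun setT (fun w => (Gint w * Z w)%:E).
Proof.
apply/measurable_EFinP; apply: measurable_funM; first exact: measurable_Gint.
exact: L2_measurable hZ.
Qed.

Lemma integrable_Gint_mul : P.-integrable setT (fun w => (Gint w * Z w)%:E).
Proof.
apply/integrableP; split=> //; apply: le_lt_trans (le_lt_trans tonelli_Gint (ltry _)).
have mt : measurable_fun setT (fun w => \int[mu]_s (`|G s w * Z w|%R)%:E)%E.
  exact: (measurable_fun_fubini_tonelli_G (fun p => (`|G p.1 p.2 * Z p.2|)%:E)).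
apply: ae_ge0_le_integral => //.
- exact: measurableT_comp.
- by move=> w _; exact: integral_ge0.
apply: filterS GintZ => w h _; rewrite h; apply: le_abse_integral => //.
by apply: (measurableT_comp mGZ (measurable_pair2 _)).
Qed.

Lemma dotp_Gint_ae : (\int[P]_w (Gint w * Z w)%:E = (\int[mu]_s dotp (G s) Z)%:E)%E.
Proof.
rewrite (@ae_eq_integral _ _ _ _ _ (fun w => \int[mu]_s (G s w * Z w)%:E)%E)//.
- have := integral21_prod_meas1 iGZ; rewrite /fubini_G => ->.
  rewrite -integral12_prod_meas1//= /fubini_F.
  rewrite /Rintegral fineK ?(integrable_fin_num measurableT) ?integrable_dotpG//.
  by apply: eq_integral => s _; rewrite dotpGE.
- exact: (measurable_fubini_G iGZ).
- by apply: filterS GintZ => w h _.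
Qed.

Lemma dotp_Gint : dotp Gint Z = \int[mu]_s dotp (G s) Z.
Proof. by rewrite {1}/L2inner /Rintegral dotp_Gint_ae. Qed.

Lemma dotp_Gint_le : `|dotp Gint Z| <= nrm Z * beta.
Proof.
rewrite dotp_Gint (le_trans (le_normr_Rintegral _ _))//; last first.
  rewrite /beta -RintegralZl// le_Rintegral//.
  - by apply/Lfun1_integrable; apply: Lfun_norm; apply/Lfun1_integrable; exact: integrable_dotpG.
  - exact: (integrableZl measurableT _ ib).
  - move=> s _; rewrite (le_trans (nrm_CS _ _))// mulrC ler_wpM2l ?nrm_ge0//.
exact: integrable_dotpG.
Qed.

End against.

(** Minkowski's integral inequality. [Gint] cannot be tested against itself before it is known to be
    square integrable, so it is tested against its truncations [X n], for which [nrm (X n) ^ 2 <=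
    dotp Gint (X n) <= nrm (X n) * beta]; Fatou's lemma removes the truncation. *)
Lemma Gint_L2_nrm : Gint \in L2 /\ nrm Gint <= beta.
Proof.
pose X (n : nat) w := Num.max (- n%:R) (Num.min (Gint w) n%:R).
have mX n : measurable_fun setT (X n).
  apply: measurable_maxr => //; apply: measurable_minr => //.
  exact: measurable_Gint.
have X2 n : X n \in L2.
  apply: (@L2_bounded _ _ _ _ _ n%:R) => // w; rewrite ler_norml /X.
  by rewrite le_max lexx/= ge_max ge_min lexx orbT andbT lerNl (le_trans _ (ler0n _ _))// oppr_le0.
apply: (@fatou_nrm _ _ _ _ X) => //.
- exact: measurable_Gint.
- move=> n; have : dotp (X n) (X n) <= dotp Gint (X n).
    apply: le_Rintegral => //.
    + exact: L2_integrable_mul.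
    + exact: integrable_Gint_mul.
    + move=> w _; rewrite /X.
      have n0 := ler0n R n.
      case: (leP (Gint w) n%:R) => h1; case: (leP (- n%:R) _) => h2 //; nra.
  move=> h; have [->//|n0] := eqVneq (nrm (X n)) 0.
  have {}n0 : 0 < nrm (X n) by rewrite lt_def n0 nrm_ge0.
  rewrite -(ler_pM2l n0) -expr2 nrm_sqr (le_trans h)// (le_trans (ler_norm _))//.
  exact: dotp_Gint_le.
- apply: aeW => w; apply/cvgrPdist_lt => e e0.
  have [N hN] : exists N : nat, `|Gint w| < N%:R.
    by exists (Num.trunc `|Gint w|).+1; exact: truncnS_gt.
  exists N => // n /= Nn; rewrite /X.
  have {hN} : `|Gint w| < n%:R by rewrite (lt_le_trans hN)// ler_nat.
  rewrite ltr_norml => /andP[h1 h2].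
  by rewrite (min_idPl (ltW h2)) (max_idPr (ltW h1)) subrr normr0.
Qed.

(** A test variable almost orthogonal to every [G s] is almost orthogonal to their integral, which
    is what [closed_span_weak] asks for. *)
Lemma Gint_closed_span (S : set (T -> R)) : S `<=` [set X | X \in L2] ->
  (forall s, L2_closed_span P S (G s)) -> L2_closed_span P S Gint.
Proof.
move=> SL2 SG.
apply: (@closed_span_sub _ _ _ P S [set G s | s in setT]) => //.
  by move=> _ [s _ <-].
apply: (@closed_span_weak _ _ _ _ _ _ beta) => //.
- by move=> _ [s _ <-] /=.
- by have [] := Gint_L2_nrm.
move=> Z eta hZ eta0 h.
rewrite dotp_Gint// (le_trans (le_normr_Rintegral _ (integrable_dotpG hZ)))//.
rewrite /beta -RintegralZl// le_Rintegral//.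
- by apply/Lfun1_integrable; apply: Lfun_norm; apply/Lfun1_integrable; exact: integrable_dotpG.
- exact: (integrableZl measurableT _ ib).
- by move=> s _; rewrite (le_trans (h _ _)) ?ler_wpM2l//; exists s.
Qed.

End integral_of_random_variables.

(** * Independence and normal laws *)

Section transfer.
Context {R : realType} {d1 d2 d3 : measure_display}
  {Y1 : measurableType d1} {Y2 : measurableType d2} {V : measurableType d3}
  (mu1 : {measure set Y1 -> \bar R}) (mu2 : {measure set Y2 -> \bar R})
  (X1 : Y1 -> V) (X2 : Y2 -> V) (W1 : Y1 -> R) (W2 : Y2 -> R).
Hypotheses (mX1 : measurable_fun setT X1) (mX2 : measurable_fun setT X2)
  (mW1 : measurable_fun setT W1) (mW2 : measurable_fun setT W2)
  (W1_ge0 : forall y, 0 <= W1 y) (W2_ge0 : forall y, 0 <= W2 y).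
Hypothesis indic12 : forall A : set V, measurable A ->
  (\int[mu1]_y (\1_A (X1 y) * W1 y)%:E = \int[mu2]_y (\1_A (X2 y) * W2 y)%:E)%E.

Import HBNNSimple.

Let nnsfun_integral {d} {Y : measurableType d} (mu : {measure set Y -> \bar R})
    (X : Y -> V) (W : Y -> R) (g : {nnsfun V >-> R}) :
    measurable_fun setT X -> measurable_fun setT W -> (forall y, 0 <= W y) ->
  (\int[mu]_y (g (X y) * W y)%:E = \sum_(r \in range g)
    (r%:E * \int[mu]_y (\1_(g @^-1` [set r]) (X y) * W y)%:E))%E.
Proof.
move=> mX mW W0.
have mI r : measurable_fun setT (fun y => (\1_(g @^-1` [set r]) (X y) * W y)%:E : \bar R).
  apply/measurable_EFinP; apply: measurable_funM => //.
  by apply: measurableT_comp.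
under eq_integral => y _.
  rewrite fimfunE mulrC EFinM -fsumEFin// ge0_mule_fsumr; last first.
    by move=> r; rewrite EFinM nnfun_muleindic_ge0.
  under eq_fsbigr do rewrite -EFinM mulrC -mulrA EFinM.
  over.
rewrite ge0_integral_fsum//=; last 2 first.
- by move=> r; apply: emeasurable_funM.
- move=> r y _; rewrite -EFinM mulrA EFinM mule_ge0 ?lee_fin// -lee_fin EFinM.
  exact: nnfun_muleindic_ge0.
apply: eq_fsbigr => r; rewrite inE => -[v _ <-].
by rewrite ge0_integralZl ?lee_fin// => y _; rewrite lee_fin mulr_ge0.
Qed.

Let approx_integral {d} {Y : measurableType d} (mu : {measure set Y -> \bar R})
    (X : Y -> V) (W : Y -> R) (f : V -> \bar R) (mf : measurable_fun setT f) :
    measurable_fun setT X -> measurable_fun setT W -> (forall y, 0 <= W y) ->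
    (forall v, 0 <= f v)%E ->
  (\int[mu]_y (f (X y) * (W y)%:E) =
   limn (fun n => \int[mu]_y (nnsfun_approx measurableT mf n (X y) * W y)%:E))%E.
Proof.
move=> mX mW W0 f0; rewrite -monotone_convergence//=; last 3 first.
- move=> n; apply/measurable_EFinP; apply: measurable_funM => //.
  by apply: measurableT_comp.
- by move=> n y _; rewrite lee_fin mulr_ge0.
- move=> y _ m n mn; rewrite lee_fin ler_wpM2r//.
  exact/lefP/nd_nnsfun_approx.
apply: eq_integral => y _; apply/esym/cvg_lim => //.
under eq_fun do rewrite EFinM.
apply: cvgeZr => //; exact: cvg_nnsfun_approx.
Qed.

(** Approximation by simple functions. The weights serve twice: as a density with respect to
    Lebesgue measure, and as the product of the remaining factors in the multiplicativity of
    expectations. *)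
Lemma ge0_integral_transfer (f : V -> \bar R) : measurable_fun setT f ->
  (forall v, 0 <= f v)%E ->
  (\int[mu1]_y (f (X1 y) * (W1 y)%:E) = \int[mu2]_y (f (X2 y) * (W2 y)%:E))%E.
Proof.
move=> mf f0; rewrite !(approx_integral _ mf)//.
congr (limn _); apply/funext => n; rewrite !nnsfun_integral//.
by apply: eq_fsbigr => r _; rewrite indic12.
Qed.

Lemma integrable_transfer (f : V -> R) : measurable_fun setT f ->
  mu1.-integrable setT (fun y => (f (X1 y) * W1 y)%:E) ->
  mu2.-integrable setT (fun y => (f (X2 y) * W2 y)%:E).
Proof.
move=> mf /integrableP[m1 i1]; apply/integrableP; split.
  apply/measurable_EFinP; apply: measurable_funM => //.
  by apply: measurableT_comp.
have := @ge0_integral_transfer (fun v => (`|f v|)%:E).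
have mnf : measurable_fun setT (fun v => (`|f v|)%:E : \bar R).
  by apply/measurable_EFinP; apply: measurableT_comp.
move=> /(_ mnf (fun v => normr_ge0 (f v))) e.
under eq_integral do rewrite /= normrM (ger0_norm (W2_ge0 _)) EFinM.
rewrite -e; apply: le_lt_trans i1.
by under [leRHS]eq_integral do rewrite /= normrM (ger0_norm (W1_ge0 _)) EFinM.
Qed.

Lemma integral_transfer (f : V -> R) : measurable_fun setT f ->
  (\int[mu1]_y (f (X1 y) * W1 y)%:E = \int[mu2]_y (f (X2 y) * W2 y)%:E)%E.
Proof.
move=> mf; rewrite integralE [RHS]integralE.
have mE : measurable_fun setT (EFin \o f) by exact/measurable_EFinP.
have posE d (Y : measurableType d) (X : Y -> V) (W : Y -> R) :
    (forall y, 0 <= W y) ->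
    (fun y => (f (X y) * W y)%:E)^\+%E = fun y => ((EFin \o f)^\+ (X y) * (W y)%:E)%E.
  move=> W0; apply/funext => y; rewrite !funeposE /= [RHS]muleC maxeMr ?lee_fin//.
  by rewrite mule0 EFinM muleC.
have negE d (Y : measurableType d) (X : Y -> V) (W : Y -> R) :
    (forall y, 0 <= W y) ->
    (fun y => (f (X y) * W y)%:E)^\-%E = fun y => ((EFin \o f)^\- (X y) * (W y)%:E)%E.
  move=> W0; apply/funext => y; rewrite !funenegE /= [RHS]muleC maxeMr ?lee_fin//.
  by rewrite mule0 -EFinM mulrN mulrC.
rewrite !posE ?negE//; congr (_ - _)%E; apply: ge0_integral_transfer => //.
  exact: measurable_funepos.
exact: measurable_funeneg.
Qed.

End transfer.

Section density.
Context {R : realType} {d : measure_display} {T : measurableType d}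
  (P : probability T R).

Lemma integral_normal_law (X : T -> R) (m s : R) : measurable_fun setT X ->
  (forall A, measurable A -> P (X @^-1` A) = normal_prob m s A) ->
  forall f : R -> R, measurable_fun setT f ->
  (\int[P]_w (f (X w))%:E =
   \int[lebesgue_measure]_x (f x * normal_pdf m s x)%:E)%E /\
  (lebesgue_measure.-integrable setT (fun x => (f x * normal_pdf m s x)%:E) ->
   P.-integrable setT (fun w => (f (X w))%:E)).
Proof.
move=> mX lawX f mf.
have key A : measurable A -> (\int[P]_w (\1_A (X w) * cst 1 w)%:E =
    \int[lebesgue_measure]_x (\1_A (idfun x) * normal_pdf m s x)%:E)%E.
  move=> mA; under eq_integral do rewrite mulr1.
  rewrite (_ : (fun w => _) = EFin \o \1_(X @^-1` A)); last by apply/funext.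
  rewrite integral_indic ?setIT//; last first.
    by rewrite -[X in measurable X]setTI; exact: mX.
  rewrite /= lawX// /normal_prob [LHS]integral_mkcond.
  apply: eq_integral => x _; rewrite patchE indicE.
  by case: ifPn; rewrite ?mul1r ?mul0r.
have mid : measurable_fun setT (idfun : measurableTypeR R -> R).
  by move=> _ A mA; rewrite setTI.
have mp := measurable_normal_pdf m s; have p0 := normal_pdf_ge0 m s.
split.
  have := @integral_transfer _ _ _ _ _ _ _ P lebesgue_measure X idfun (cst 1)
    (normal_pdf m s) mX mid (measurable_cst _) mp (fun=> ler01) p0 key f mf.
  by under eq_integral do rewrite mulr1.
move=> i; have := @integrable_transfer _ _ _ _ _ _ _ lebesgue_measure P idfun X
   (normal_pdf m s) (cst 1) mid mX mp (measurable_cst _) p0 (fun=> ler01)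
   (fun A mA => esym (key A mA)) f mf i.
by under [X in _.-integrable _ X -> _]eq_fun do rewrite mulr1.
Qed.

End density.

Section independence.
Context {R : realType} {d d' : measure_display} {T : measurableType d}
  {V : measurableType d'} (P : probability T R) {n : nat} (X : 'I_n -> T -> V).
Hypothesis mX : forall i, measurable_fun setT (X i).
Hypothesis indep : forall A : 'I_n -> set V, (forall i, measurable (A i)) ->
  P (\bigcap_i (X i @^-1` A i)) = (\prod_(i < n) P (X i @^-1` A i))%E.

(** Interpolates between indicators, to which the independence hypothesis applies, and the functions
    [f i]: the induction on [k] turns one indicator into a function at a time. *)
Let mixed (f : 'I_n -> V -> R) (A : 'I_n -> set V) (k : nat) (i : 'I_n) : V -> R :=
  if (i < k)%N then f i else \1_(A i).

Let ge0_indep_mixed (f : 'I_n -> V -> R) (A : 'I_n -> set V) k :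
  (forall i, measurable_fun setT (f i)) -> (forall i y, 0 <= f i y) ->
  (forall i, P.-integrable setT (fun w => (f i (X i w))%:E)) ->
  (forall i, measurable (A i)) -> (k <= n)%N ->
  P.-integrable setT (fun w => (\prod_i mixed f A k i (X i w))%:E) /\
  \int[P]_w (\prod_i mixed f A k i (X i w)) =
  \prod_i \int[P]_w mixed f A k i (X i w).
Proof.
move=> mf f0 fi; elim: k A => [|k IH] A mA kn.
  have e w : \prod_i mixed f A 0 i (X i w) = \1_(\bigcap_i (X i @^-1` A i)) w.
    rewrite /mixed/= indicE.
    have [h|h] := pselect ((\bigcap_i (X i @^-1` A i)) w).
      by rewrite mem_set// big1// => i _; rewrite indicE mem_set//; exact: h.
    rewrite memNset//.
    have [i Ai] : exists i, ~ A i (X i w).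
      by apply/not_existsP => h'; apply: h => i _; have := h' i; move/contrapT.
    by rewrite (bigD1 i)//= indicE memNset// mul0r.
  have mI : measurable (\bigcap_i (X i @^-1` A i)).
    apply: fin_bigcap_measurable => // i _.
    by rewrite -[X in measurable X]setTI; exact: mX.
  split.
    by rewrite (_ : (fun w => _) = (fun w => (\1_(\bigcap_i (X i @^-1` A i)) w)%:E));
      [exact: integrable_indic|apply/funext => w; rewrite e].
  under eq_Rintegral do rewrite e.
  rewrite /Rintegral integral_indic// setIT/= indep//.
  have pE i : P (X i @^-1` A i) = (fine (P (X i @^-1` A i)))%:E.
    by rewrite fineK// fin_num_measure// -[X in measurable X]setTI; exact: mX.
  rewrite (eq_bigr _ (fun i _ => pE i)) prodEFin/=; apply: eq_bigr => i _; congr fine.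
  rewrite /mixed/= (_ : (fun w => _) = EFin \o \1_(X i @^-1` A i))//.
  by rewrite integral_indic ?setIT// -[X in measurable X]setTI; exact: mX.
pose i0 := Ordinal kn.
have mixedS i : i != i0 -> mixed f A k.+1 i = mixed f A k i.
  by move=> ii0; rewrite /mixed ltnS leq_eqVlt (negbTE (ii0 : (i : nat) != k)).
have mmixed i : measurable_fun setT (mixed f A k i).
  by rewrite /mixed; case: ifP => // _; exact: measurable_indic.
have mixed0 i y : 0 <= mixed f A k i y by rewrite /mixed; case: ifP.
pose W w := \prod_(i | i != i0) mixed f A k i (X i w).
pose c := \prod_(i | i != i0) \int[P]_w mixed f A k i (X i w).
have mW : measurable_fun setT W.
  rewrite /W; under eq_fun do rewrite big_mkcond.
  apply: measurable_prod => i _.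
  by case: (i != i0) => //; apply: measurableT_comp.
have W0 w : 0 <= W w by apply: prodr_ge0 => i _.
have c0 : 0 <= c by apply: prodr_ge0 => i _; apply: Rintegral_ge0.
(* The induction hypothesis with an arbitrary set at index [k] says that the law of [X i0] weighted
   by [W] is a constant multiple of its law; this extends from sets to [f i0]. *)
have key (C : set V) : measurable C ->
    (\int[P]_w (\1_C (X i0 w) * W w)%:E = \int[P]_w (\1_C (X i0 w) * cst c w)%:E)%E.
  move=> mC; pose A' i := if i == i0 then C else A i.
  have [] := IH A' _ (ltnW kn); first by move=> i; rewrite /A'; case: ifP.
  have mA' i : i != i0 -> mixed f A' k i = mixed f A k i.
    by move=> /negbTE ii0; rewrite /mixed /A' ii0.
  have mA'0 : mixed f A' k i0 = \1_C by rewrite /mixed /A' ltnn eqxx.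
  have prodE w : \prod_i mixed f A' k i (X i w) = \1_C (X i0 w) * W w.
    rewrite (bigD1 i0)//= mA'0; congr (_ * _); apply: eq_bigr => i ii0.
    by rewrite mA'.
  under eq_fun do rewrite prodE; move=> iW.
  under eq_Rintegral do rewrite prodE.
  rewrite (bigD1 i0)//= mA'0 (eq_bigr _ (fun i ii0 => congr1 (fun g => \int[P]_w g (X i w)) (mA' i ii0))) -/c => e.
  have iC : P.-integrable setT (fun w => (\1_C (X i0 w))%:E).
    rewrite (_ : (fun w => _) = EFin \o \1_(X i0 @^-1` C))//.
    by apply: integrable_indic => //; rewrite -[X in measurable X]setTI; exact: mX.
  have -> : (\int[P]_w (\1_C (X i0 w) * W w)%:E = (\int[P]_w (\1_C (X i0 w) * W w))%:E)%E.
    by rewrite /Rintegral fineK//; exact: integrable_fin_num.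
  rewrite e; under [RHS]eq_integral do rewrite EFinM.
  by rewrite integralZr// EFinM /Rintegral fineK//; exact: integrable_fin_num.
have prodE w : \prod_i mixed f A k.+1 i (X i w) = f i0 (X i0 w) * W w.
  rewrite (bigD1 i0)//= {1}/mixed ltnS leqnn; congr (_ * _).
  by apply: eq_bigr => i ii0; rewrite mixedS.
have e := integral_transfer (mX i0) (mX i0) mW (measurable_cst c) W0 (fun=> c0) key (mf i0).
have ifc : P.-integrable setT (fun w => (f i0 (X i0 w) * cst c w)%:E).
  by under eq_fun do rewrite EFinM; apply: integrableZr.
split.
  under eq_fun do rewrite prodE.
  exact: (integrable_transfer (mX i0) (mX i0) (measurable_cst c) mW (fun=> c0) W0
    (fun A mA => esym (key A mA)) (mf i0) ifc).
under eq_Rintegral do rewrite prodE.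
rewrite {1}/Rintegral e.
rewrite (bigD1 i0)//= {1}/mixed ltnS leqnn.
rewrite (eq_bigr _ (fun i ii0 => congr1 (fun g => \int[P]_w g (X i w)) (mixedS i ii0))) -/c.
by rewrite -RintegralZr//; exact: fi.
Qed.

Let ge0_indep (f : 'I_n -> V -> R) :
  (forall i, measurable_fun setT (f i)) -> (forall i y, 0 <= f i y) ->
  (forall i, P.-integrable setT (fun w => (f i (X i w))%:E)) ->
  P.-integrable setT (fun w => (\prod_i f i (X i w))%:E) /\
  \int[P]_w (\prod_i f i (X i w)) = \prod_i \int[P]_w f i (X i w).
Proof.
move=> mf f0 fi.
have [] := ge0_indep_mixed mf f0 fi (fun=> measurableT) (leqnn n).
have e i : mixed f (fun=> setT) n i = f i by rewrite /mixed ltn_ord.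
under eq_fun do under eq_bigr do rewrite e.
move=> h; under eq_Rintegral do under eq_bigr do rewrite e.
by under [in RHS]eq_bigr do rewrite e.
Qed.

Lemma integral_prod_independent (f : 'I_n -> V -> R) :
  (forall i, measurable_fun setT (f i)) ->
  (forall i, P.-integrable setT (fun w => (f i (X i w))%:E)) ->
  P.-integrable setT (fun w => (\prod_i f i (X i w))%:E) /\
  \int[P]_w (\prod_i f i (X i w)) = \prod_i \int[P]_w f i (X i w).
Proof.
move=> mf fi.
(* Signed factors are reduced to nonnegative ones by expanding the product of the differences
   [f^+ - f^-] over all choices of signs. *)
pose g (e : bool) (i : 'I_n) : V -> R := if e then (f i)^\+ else (f i)^\-.
have mg e i : measurable_fun setT (g e i).
  by case: e; [exact: measurable_funrpos|exact: measurable_funrneg].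
have g0 e i y : 0 <= g e i y by case: e; [exact: funrpos_ge0|exact: funrneg_ge0].
have gi e i : P.-integrable setT (fun w => (g e i (X i w))%:E).
  apply: le_integrable (fi i) => //.
    by apply/measurable_EFinP; apply: measurableT_comp.
  move=> w _; rewrite lee_fin ger0_norm//.
  have := congr1 (fun h => h (X i w)) (funrposDneg (f i)) => /= <-.
  by case: e => /=; rewrite ?lerDl ?lerDr ?funrpos_ge0 ?funrneg_ge0.
have fE i y : f i y = \sum_(e : bool) (-1) ^+ (~~ e) * g e i y.
  rewrite big_bool/= expr0 mul1r expr1 mulN1r.
  exact: (esym (congr1 (fun h => h y) (funrposBneg (f i)))).
pose G (e : {ffun 'I_n -> bool}) w := \prod_i g (e i) i (X i w).
have GE (e : {ffun 'I_n -> bool}) := ge0_indep (fun i => mg (e i) i) (fun i => g0 (e i) i) (fun i => gi (e i) i).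
pose sg (e : {ffun 'I_n -> bool}) : R := \prod_i (-1) ^+ (~~ e i).
have prodE w : \prod_i f i (X i w) = \sum_e sg e * G e w.
  under eq_bigr do rewrite fE.
  rewrite bigA_distr_bigA; apply: eq_bigr => e _.
  by rewrite -big_split.
have iG e : P.-integrable setT (fun w => (sg e * G e w)%:E).
  by have [h _] := GE e; under eq_fun do rewrite EFinM; exact: integrableZl.
split.
  under eq_fun do rewrite prodE -sumEFin.
  by apply: integrable_sum.
under eq_Rintegral do rewrite prodE.
rewrite /Rintegral; under eq_integral do rewrite -sumEFin.
rewrite integral_sum// -sum_fine; last by move=> e _; exact: integrable_fin_num.
have -> : \prod_i \int[P]_x f i (X i x) =
    \prod_i \sum_(e : bool) (-1) ^+ (~~ e) * \int[P]_w g e i (X i w).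
  apply: eq_bigr => i _; rewrite big_bool/= expr0 mul1r expr1 mulN1r.
  rewrite -RintegralB//; [|exact: (gi true i)|exact: (gi false i)].
  apply: eq_Rintegral => w _.
  by rewrite fE big_bool/= expr0 mul1r expr1 mulN1r.
rewrite bigA_distr_bigA; apply: eq_bigr => e _.
rewrite -[LHS]/(\int[P]_w (sg e * G e w)) RintegralZl//; last by have [] := GE e.
by rewrite big_split/=; congr (_ * _); have [_ ->] := GE e.
Qed.

End independence.

(** * Normal integrals of functions of exponential growth *)

Section subexponential.
Context {R : realType}.
Implicit Types f g : R -> R.

(** Exponential growth is stable under sums and products and, by completing the square, reduces
    integrability against a normal density to that of shifted densities. *)
Definition subexp f := exists C a : R,
  [/\ 0 <= C, 0 <= a & forall x, `|f x| <= C * expR (a * `|x|)].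

Lemma subexp_cst (c : R) : subexp (cst c).
Proof.
exists `|c|, 0; split=> // x; rewrite ler_peMr//.
by rewrite mul0r expR0.
Qed.

Lemma subexp_id : subexp id.
Proof.
exists 1, 1; split=> // x; rewrite !mul1r.
by apply: le_trans (expR_ge1Dx _); rewrite lerDr.
Qed.

Lemma subexpM f g : subexp f -> subexp g -> subexp (fun x => f x * g x).
Proof.
move=> [C [a [C0 a0 hf]]] [D [b [D0 b0 hg]]]; exists (C * D), (a + b).
split=> [||x]; rewrite ?mulr_ge0 ?addr_ge0// mulrDl expRD normrM.
by rewrite mulrACA; apply: ler_pM.
Qed.

Lemma subexpD f g : subexp f -> subexp g -> subexp (fun x => f x + g x).
Proof.
move=> [C [a [C0 a0 hf]]] [D [b [D0 b0 hg]]]; exists (C + D), (a + b).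
split=> [||x]; rewrite ?addr_ge0// mulrDl (le_trans (ler_normD _ _))//.
apply: lerD; [apply: le_trans (hf x) _|apply: le_trans (hg x) _].
  by rewrite ler_wpM2l// ler_expR mulrDl lerDl mulr_ge0.
by rewrite ler_wpM2l// ler_expR mulrDl lerDr mulr_ge0.
Qed.

Lemma subexpX f n : subexp f -> subexp (fun x => f x ^+ n).
Proof.
move=> hf; elim: n => [|n IH]; first exact: subexp_cst.
under [X in subexp X]eq_fun do rewrite exprS.
exact: subexpM.
Qed.

Lemma subexp_heat v n : subexp (fun x => heat v x n).
Proof.
suff: subexp (fun x => heat v x n) /\ subexp (fun x => heat v x n.+1) by case.
elim: n => [|n [IH1 IH2]]; split=> //; first exact: subexp_cst.
  by under [X in subexp X]eq_fun do rewrite heat_n1; exact: subexp_id.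
have -> : (fun x => heat v x n.+2) =
    (fun x => cst n.+2%:R^-1 x * (x * heat v x n.+1 + cst (- v) x * heat v x n)).
  apply/funext => x; apply: (@mulfI _ n.+2%:R); first by rewrite pnatr_eq0.
  by rewrite heat_rec /= mulVKf ?pnatr_eq0// mulNr.
apply: subexpM; first exact: subexp_cst.
apply: subexpD; apply: subexpM => //; [exact: subexp_id|exact: subexp_cst].
Qed.

Lemma measurable_heat v n : measurable_fun setT (fun x : R => heat v x n).
Proof. by apply: continuous_measurable_fun; exact: continuous_heat. Qed.

End subexponential.

Section normal_integrals.
Context {R : realType}.
Variables (m s : R).
Hypothesis s0 : s != 0.

Local Notation mu := (@lebesgue_measure R).
Local Notation p := (normal_pdf m s).

(** Completing the square: an exponential factor only shifts the mean. *)
Lemma expR_normal_pdf a x : expR (a * x) * normal_pdf m s x =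
  expR (a * m + a ^+ 2 * s ^+ 2 / 2) * normal_pdf (m + a * s ^+ 2) s x.
Proof.
rewrite !normal_pdfE// /normal_fun !(mulrCA (expR _)) -!expRD.
by congr (_ * expR _); field.
Qed.

Lemma subexp_normal_pdf f : subexp f -> exists C a : R,
  forall x, `|f x * p x| <=
    C * (normal_pdf (m + a) s x + normal_pdf (m - a) s x).
Proof.
move=> [C [a [C0 a0 hf]]].
exists (C * expR (a * `|m| + a ^+ 2 * s ^+ 2 / 2)), (a * s ^+ 2) => x.
have p0 := normal_pdf_ge0 m s x.
rewrite normrM (ger0_norm p0).
apply: (@le_trans _ _ (C * (expR (a * x) * p x + expR (- a * x) * p x))).
  apply: le_trans (ler_wpM2r p0 (hf x)) _.
  rewrite -mulrA ler_wpM2l// -mulrDl ler_wpM2r//.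
  have [x0|x0] := leP 0 x.
    by rewrite ger0_norm// lerDl expR_ge0.
  by rewrite ltr0_norm// mulrN mulNr lerDr expR_ge0.
rewrite -mulrA; apply: ler_wpM2l => //; rewrite mulrDr 2!expR_normal_pdf !mulNr sqrrN.
apply: lerD; rewrite ler_wpM2r ?normal_pdf_ge0// ler_expR lerD2r.
  by rewrite ler_wpM2l// ler_norm.
by rewrite -mulrN ler_wpM2l// ler_normr lexx orbT.
Qed.

Lemma subexp_normal_integrable f : measurable_fun setT f -> subexp f ->
  mu.-integrable setT (fun x => (f x * p x)%:E).
Proof.
move=> mf /subexp_normal_pdf[C [a h]].
have ip m' := integrable_normal_pdf m' s.
have i := integrableZl measurableT C (integrableD measurableT (ip (m + a)) (ip (m - a))).
apply: le_integrable i => //.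
  by apply/measurable_EFinP; apply: measurable_funM => //; exact: measurable_normal_pdf.
move=> x _; rewrite -EFinD -EFinM lee_fin; apply: le_trans (h x) _.
exact: ler_norm.
Qed.

(** Decay at the rate [1 / |x|] is all that the boundary terms of an integration by parts
    require. *)
Lemma subexp_normal_vanish f : subexp f ->
  exists C : R, forall x, `|x| * `|f x * p x| <= C.
Proof.
move=> hf.
have [C [a h]] := subexp_normal_pdf (subexpM subexp_id hf).
have C0 : 0 <= C.
  have := le_trans (normr_ge0 _) (h (m + a)); rewrite pmulr_lge0//.
  rewrite ltr_pwDl ?normal_pdf_ge0// normal_pdfE// mulr_gt0//.
    exact: normal_peak_gt0.
  exact: expR_gt0.
exists (C * (normal_peak s + normal_peak s)) => x.
rewrite -normrM mulrA (le_trans (h x))// ler_wpM2l//.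
by apply: lerD; exact: normal_pdf_ub.
Qed.

Lemma is_derive_normal_pdf (x : R) :
  is_derive x 1 p (- ((x - m) / s ^+ 2) * p x).
Proof.
rewrite normal_pdfE// /normal_fun.
apply: is_derive_eq.
rewrite /GRing.scale/=; field; exact: s0.
Qed.

End normal_integrals.

Section integral_of_derivative.
Context {R : realType}.
Local Notation mu := (@lebesgue_measure R).

Lemma integral_derivative_eq0 (F f : R -> R) (C : R) :
  (forall x : R, is_derive x 1 F (f x)) -> continuous f ->
  mu.-integrable setT (EFin \o f) -> (forall x, `|x| * `|F x| <= C) ->
  (\int[mu]_x (f x)%:E = 0)%E.
Proof.
move=> dF cf fi hC.
(* [n.+1] keeps the interval nondegenerate at [n = 0]. *)
pose J (n : nat) : set R := `[- n.+1%:R, n.+1%:R]%classic.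
pose g (n : nat) : R -> \bar R := (EFin \o f) \_ (J n).
have mf : measurable_fun setT (EFin \o f) by have /integrableP[] := fi.
have gE n : (\int[mu]_x g n x = (F n.+1%:R - F (- n.+1%:R))%:E)%E.
  have n0 : - n.+1%:R < n.+1%:R :> R by rewrite gtrN.
  rewrite /g -integral_mkcond (@continuous_FTC2 _ f F _ _ n0)//.
  - exact: continuous_subspaceT.
  - have cF : continuous F.
      move=> x; apply: differentiable_continuous; apply/derivable1_diffP.
      exact: ex_derive.
    split; first by move=> x _; exact: ex_derive.
      by apply: cvg_at_right_filter; exact: cF.
    by apply: cvg_at_left_filter; exact: cF.
  - by move=> x _; rewrite derive1E; exact: derive_val.
have mJ n : measurable (J n) by exact: measurable_itv.
have mg n : measurable_fun setT (g n).
  by apply/(measurable_restrictT _ (mJ n)); exact: measurable_funTS.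
have [_ _ cv] : [/\ mu.-integrable setT (EFin \o f),
    (\int[mu]_x `|g n x - (EFin \o f) x|)%E @[n --> \oo] --> 0%E &
    (\int[mu]_x g n x)%E @[n --> \oo] --> (\int[mu]_x (EFin \o f) x)%E].
  apply: (@dominated_convergence _ _ _ mu setT measurableT g _ (abse \o (EFin \o f))) => //.
  - apply: aeW => x _; apply: cvg_near_cst.
    exists (Num.trunc `|x|) => // n /= xn; rewrite /g patchE mem_set//.
    rewrite /J/= in_itv/= -ler_norml (le_trans (ltW (truncnS_gt _)))//.
    by rewrite ler_nat.
  - exact: integrable_abse.
  - by apply: aeW => x n _; rewrite /g patchE; case: ifP => [//|_]; rewrite abse0; exact: abse_ge0.
move: cv; under eq_fun do rewrite gE.
move=> cv.
have : (F n.+1%:R - F (- n.+1%:R))%:E @[n --> \oo] --> (0%:E : \bar R).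
  apply: cvg_EFin; first exact: nearW.
  apply/cvgr0Pnorm_le => e e0.
  exists (Num.trunc (2 * C / e)) => // n /= xn.
  have n0 : 0 < n.+1%:R :> R by rewrite ltr0n.
  have le_n : 2 * C / e <= n.+1%:R.
    by rewrite (le_trans (ltW (truncnS_gt _)))// ler_nat.
  rewrite ler_pdivrMr// in le_n.
  have h1 := hC n.+1%:R; have h2 := hC (- n.+1%:R).
  rewrite normrN in h2; rewrite ger0_norm ?(ltW n0)// in h1 h2.
  rewrite -(ler_pM2l n0); have := ler_normB (F n.+1%:R) (F (- n.+1%:R)).
  by move=> /(ler_wpM2l (ltW n0)); lra.
by move=> h0; rewrite -(cvg_lim _ cv)// (cvg_lim _ h0).
Qed.

End integral_of_derivative.

Section normal_heat.
Context {R : realType}.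
Variables (m s : R).
Hypothesis s0 : s != 0.

Local Notation mu := (@lebesgue_measure R).
Local Notation p := (normal_pdf m s).

Lemma heat_normal_integrable v n :
  mu.-integrable setT (fun x => (heat v x n * p x)%:E).
Proof.
apply: subexp_normal_integrable => //; [exact: measurable_heat|exact: subexp_heat].
Qed.

(* Integration by parts turns the recurrence of [heat v] into the one
   of [heat (v - s ^+ 2)]. *)
Lemma integral_heat_normal v n :
  \int[mu]_x (heat v x n * p x) = heat (v - s ^+ 2) m n.
Proof.
move: n; apply: heat_unique => [|n].
  rewrite /Rintegral; under eq_integral do rewrite heat_n0 mul1r.
  by rewrite integral_normal_pdf.
have i k := heat_normal_integrable v k.
have ish : mu.-integrable setT (fun x => (shift (heat v x) n * p x)%:E).
  case: (n) => [|k]; last exact: i.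
  by under eq_fun do rewrite mul0r; exact: integrable0.
have shE : \int[mu]_x (shift (heat v x) n * p x) =
    shift (fun k => \int[mu]_x (heat v x k * p x)) n.
  by case: (n) => [|k]//=; under eq_Rintegral do rewrite mul0r; rewrite Rintegral_cst// mul0r.
(* Stein's identity: the derivative [f] of [F] integrates to zero. *)
pose F x := s ^+ 2 * (heat v x n * p x).
pose f x := s ^+ 2 * (shift (heat v x) n * p x) - (x - m) * (heat v x n * p x).
have dF (x : R) : is_derive x 1 F (f x).
  have dp := is_derive_normal_pdf m s0 x.
  rewrite /F; apply: is_derive_eq.
  rewrite /GRing.scale/= /f; field; exact: s0.
have sxp : subexp (fun x => (x - m) * heat v x n).
  apply: subexpM; last exact: subexp_heat.
  by apply: subexpD; [exact: subexp_id|exact: subexp_cst].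
have ix : mu.-integrable setT (fun x => ((x - m) * (heat v x n * p x))%:E).
  rewrite (_ : (fun x => _) = (fun x => ((x - m) * heat v x n * p x)%:E)); last first.
    by apply/funext => x; rewrite mulrA.
  apply: subexp_normal_integrable => //.
  apply: measurable_funM; first exact: measurable_funB.
  exact: measurable_heat.
have ifT : mu.-integrable setT (EFin \o f).
  exact: (integrableB measurableT (integrableZl measurableT (s ^+ 2) ish) ix).
have [C hC] := subexp_normal_vanish m s0 (subexp_heat v n).
have cf : continuous f.
  have cp : continuous p by exact: continuous_normal_pdf.
  have csh : continuous (fun x : R => shift (heat v x) n).
    by case: (n) => [|k]; [exact: cst_continuous|exact: continuous_heat].
  move=> x; apply: cvgB; apply: cvgM; [exact: cvg_cst| | |].
  - by apply: cvgM; [exact: csh|exact: cp].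
  - by apply: cvgB; [exact: cvg_id|exact: cvg_cst].
  - by apply: cvgM; [exact: continuous_heat|exact: cp].
have := @integral_derivative_eq0 _ F f (s ^+ 2 * C) dF cf ifT.
have hF x : `|x| * `|F x| <= s ^+ 2 * C.
  by rewrite /F normrM (ger0_norm (sqr_ge0 s)) mulrCA ler_wpM2l ?sqr_ge0.
move=> /(_ hF)/(congr1 fine).
rewrite -[fine (\int[mu]_x (f x)%:E)%E]/(\int[mu]_x f x) /f RintegralB//; last first.
  exact: (integrableZl measurableT (s ^+ 2) ish).
rewrite RintegralZl//= shE => e.
have -> : n.+1%:R * \int[mu]_x (heat v x n.+1 * p x) =
   \int[mu]_x ((x - m) * (heat v x n * p x)) + m * \int[mu]_x (heat v x n * p x)
   - v * \int[mu]_x (shift (heat v x) n * p x).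
  have im := integrableZl measurableT m (i n).
  have iv := integrableZl measurableT v ish.
  rewrite -(@RintegralZl _ _ _ mu _ _ m measurableT (i n)) -(@RintegralZl _ _ _ mu _ _ v measurableT ish).
  rewrite -(@RintegralZl _ _ _ mu _ _ n.+1%:R measurableT (i n.+1)) -(RintegralD measurableT ix im).
  rewrite -(RintegralB measurableT (integrableD measurableT ix im) iv).
  by apply: eq_Rintegral => x _; rewrite mulrA heat_rec; ring.
by rewrite shE -(subr0_eq e); ring.
Qed.

End normal_heat.

(** * Gaussian random variables *)

Lemma cvg_exprn {R : realType} {U : Type} {F : set_system U} {FF : Filter F}
  (f : U -> R) (l : R) n :
  f x @[x --> F] --> l -> f x ^+ n @[x --> F] --> l ^+ n.
Proof.
move=> fl; elim: n => [|n IH].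
  by under eq_fun do rewrite expr0; exact: cvg_cst.
by under eq_fun do rewrite exprS; rewrite exprS; exact: cvgM.
Qed.

Section all_moments.
Context {R : realType} {disp : measure_display} {T : measurableType disp}
  (P : probability T R).
Implicit Types (X Y : T -> R) (a b v : R).
Local Notation L2 := (Lfun P 2%:E).
Local Notation dotp := (L2inner P).
Local Notation nrm := (L2nrm P).

(** Products of square integrable variables need not be square integrable; the variables all of
    whose powers are so form an algebra. *)
Definition all_moments X := measurable_fun setT X /\ forall n, X ^+ n \in L2.

Lemma expfE X n w : (X ^+ n) w = X w ^+ n.
Proof. by elim: n => [|n IH]; rewrite ?expr0// !exprS -IH. Qed.

Lemma all_moments_L2 X : all_moments X -> X \in L2.
Proof. by case=> _ /(_ 1%N); rewrite expr1. Qed.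

Lemma all_moments_cst a : all_moments (cst a).
Proof.
split=> // n; rewrite (_ : cst a ^+ n = cst (a ^+ n)); first exact: L2_cst.
by apply/funext => w; rewrite expfE.
Qed.

Lemma expr_mul_le (x y : R) k l :
  `|x ^+ k * y ^+ l| <= x ^+ (2 * k) + y ^+ (2 * l).
Proof.
rewrite !(mulnC 2) !exprM normrM.
by rewrite -[x ^+ k ^+ 2]real_normK ?num_real// -[y ^+ l ^+ 2]real_normK ?num_real//; nra.
Qed.

Lemma all_momentsM X Y : all_moments X -> all_moments Y -> all_moments (X * Y).
Proof.
move=> [mX hX] [mY hY]; have mXY : measurable_fun setT (X * Y) by exact: measurable_funM.
split=> // n; have h := L2D (hX (2 * n)%N) (hY (2 * n)%N).
have [//|w|//] := nrm_le h (X := (X * Y) ^+ n).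
  rewrite (_ : _ ^+ n = fun w => (X * Y) w ^+ n); first exact: measurable_funX.
  by apply/funext => w; rewrite expfE.
rewrite -[X in _ <= `|X|]/((X ^+ (2 * n)%N) w + (Y ^+ (2 * n)%N) w) !expfE.
rewrite -[(X * Y) w]/(X w * Y w) exprMn.
by apply: le_trans (expr_mul_le _ _ _ _) _; exact: ler_norm.
Qed.

Lemma all_momentsD X Y : all_moments X -> all_moments Y -> all_moments (X + Y).
Proof.
move=> [mX hX] [mY hY]; have mXY : measurable_fun setT (X + Y) by exact: measurable_funD.
split=> // n; rewrite exprDn; apply: L2_sum => k _.
rewrite -scaler_nat; apply: L2Z; have [] := @all_momentsM (X ^+ (n - k)) (Y ^+ k).
- split; first by have /L2_measurable := hX (n - k)%N.
  by move=> j; rewrite -exprM.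
- split; first by have /L2_measurable := hY k.
  by move=> j; rewrite -exprM.
by move=> _ /(_ 1%N); rewrite expr1.
Qed.

Lemma all_momentsZ a X : all_moments X -> all_moments (a *: X).
Proof. by move=> hX; have := all_momentsM (all_moments_cst a) hX. Qed.

Lemma all_moments_sum I (r : seq I) (F : I -> T -> R) :
  (forall i, all_moments (F i)) -> all_moments (\sum_(i <- r) F i).
Proof.
move=> h; elim: r => [|i r IH]; first by rewrite big_nil; exact: all_moments_cst.
by rewrite big_cons; exact: all_momentsD.
Qed.

Lemma all_moments_prod I (r : seq I) (F : I -> T -> R) :
  (forall i, all_moments (F i)) ->
  all_moments (fun w => \prod_(i <- r) F i w).
Proof.
move=> h; elim: r => [|i r IH].
  by under [X in all_moments X]eq_fun do rewrite big_nil; exact: all_moments_cst.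
by under [X in all_moments X]eq_fun do rewrite big_cons; exact: (all_momentsM (h i) IH).
Qed.

Lemma all_moments_heat v X n : all_moments X -> all_moments (fun w => heat v (X w) n).
Proof.
move=> hX; suff: all_moments (fun w => heat v (X w) n) /\
  all_moments (fun w => heat v (X w) n.+1) by case.
elim: n => [|n [IH1 IH2]]; split=> //; first exact: all_moments_cst.
  by under [X in all_moments X]eq_fun do rewrite heat_n1.
have -> : (fun w => heat v (X w) n.+2) =
    n.+2%:R^-1 *: (X * (fun w => heat v (X w) n.+1) + (- v) *: (fun w => heat v (X w) n)).
  apply/funext => w; apply: (@mulfI _ n.+2%:R); first by rewrite pnatr_eq0.
  change (n.+2%:R * heat v (X w) n.+2 =
    n.+2%:R * (n.+2%:R^-1 * (X w * heat v (X w) n.+1 + - v * heat v (X w) n))).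
  by rewrite heat_rec mulVKf ?pnatr_eq0// mulNr.
by apply: all_momentsZ; apply: all_momentsD; [exact: all_momentsM|exact: all_momentsZ].
Qed.

Lemma heat_L2 v X n : all_moments X -> (fun w => heat v (X w) n) \in L2.
Proof. by move=> /(all_moments_heat v n)/all_moments_L2. Qed.

Definition expect X : R := \int[P]_w X w.

Lemma expectZ a X : X \in L2 -> expect (a *: X) = a * expect X.
Proof. by move=> hX; rewrite /expect -RintegralZl//; exact: L2_integrable. Qed.

Lemma expect_dotp X : expect X = dotp X (cst 1).
Proof. by apply: eq_Rintegral => w _; rewrite mulr1. Qed.

Lemma expect_sum I (r : seq I) (F : I -> T -> R) : (forall i, F i \in L2) ->
  expect (\sum_(i <- r) F i) = \sum_(i <- r) expect (F i).
Proof.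
move=> h; rewrite expect_dotp dotp_suml ?L2_cst//.
by apply: eq_bigr => i _; rewrite expect_dotp.
Qed.

(** In the Gaussian space only this property of the normal law is used: the heat polynomials of
    positive order have mean zero. It survives independent sums and limits in [L2] without any
    identification of laws. *)
Definition gaussian_moments X v := all_moments X /\
  forall n, expect (fun w => heat v (X w) n) = (n == 0%N)%:R.

(** Powers and heat polynomials are triangular combinations of each other, with coefficients taken
    at the variances [- v] and [v]. *)
Lemma gaussian_momentsP X v : all_moments X ->
  (forall n, expect (fun w => heat v (X w) n) = (n == 0%N)%:R) <->
  (forall n, expect (X ^+ n) = n`!%:R * heat (- v) 0 n).
Proof.
move=> hX.
have n0 n : n`!%:R != 0 :> R by rewrite pnatr_eq0 -lt0n fact_gt0.
split=> h n.
  have -> : X ^+ n = n`!%:R *: \sum_(k < n.+1) heat (- v) 0 (n - k) *: (fun w => heat v (X w) k).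
    apply/funext => w; rewrite expfE /GRing.scale/= fct_sumE.
    rewrite -[LHS](divfK (n0 n)) (exp_heat v) /conv mulrC; congr (_ * _).
    by apply: eq_bigr => k _; rewrite mulrC.
  rewrite expectZ; last by apply: L2_sum => k _; apply: L2Z; exact: heat_L2.
  rewrite expect_sum; last by move=> k; apply: L2Z; exact: heat_L2.
  congr (_ * _); rewrite big_ord_recl big1 ?addr0.
    by rewrite expectZ ?heat_L2// h mulr1 subn0.
  by move=> k _; rewrite expectZ ?heat_L2// h mulr0.
have -> : (fun w => heat v (X w) n) =
    \sum_(k < n.+1) (heat v 0 (n - k) / k`!%:R) *: X ^+ k.
  apply/funext => w; rewrite fct_sumE -[v in LHS]add0r -[X w]addr0 heatD.
  apply: eq_bigr => k _; rewrite heat0 -[RHS]/(_ * (X ^+ k) w) expfE.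
  by rewrite mulrC mulrA mulrAC.
rewrite expect_sum; last by move=> k; apply: L2Z; case: hX.
have -> : (n == 0%N)%:R = heat (- v + v) (0 + 0) n :> R.
  by rewrite addNr addr0 heat0 expr0n; case: (n) => [|k]; rewrite ?fact0 ?divr1 ?mul0r.
rewrite heatD; apply: eq_bigr => k _; rewrite expectZ; last by case: hX.
by rewrite h mulrA divfK// mulrC.
Qed.

Lemma gaussian_moments_even X v n : gaussian_moments X v ->
  expect (X ^+ n.*2) = n.*2`!%:R * ((v / 2) ^+ n / n`!%:R).
Proof.
move=> [hX /(gaussian_momentsP v hX) ->]; rewrite -heat_even.
by congr (_ * heat _ _ _); rewrite -mulr_natr; field.
Qed.

Lemma gaussian_moments_sqr X v : gaussian_moments X v -> dotp X X = v.
Proof.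
move=> /(gaussian_moments_even 1) e.
transitivity (expect (X ^+ 1.*2)); last first.
  by rewrite e expr1 (_ : 1`! = 1%N)// (_ : 1.*2`! = 2%N)//; field.
by apply: eq_Rintegral => w _; rewrite expfE expr2.
Qed.

Lemma gaussian_moments_sum n (X : 'I_n -> T -> R) (v : 'I_n -> R) :
  (forall i, gaussian_moments (X i) (v i)) ->
  (forall A : 'I_n -> set R, (forall i, measurable (A i)) ->
    P (\bigcap_i (X i @^-1` A i)) = (\prod_(i < n) P (X i @^-1` A i))%E) ->
  gaussian_moments (\sum_i X i) (\sum_i v i).
Proof.
move=> hX indep; have aX i : all_moments (X i) by case: (hX i).
split; first exact: all_moments_sum.
move=> m.
have -> : (fun w => heat (\sum_i v i) ((\sum_i X i) w) m) =
    \sum_(k <- compositions n m) (fun w => \prod_i heat (v i) (X i w) (tnth k i)).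
  by apply/funext => w; rewrite !fct_sumE heat_sum.
rewrite expect_sum; last first.
  by move=> k; apply/all_moments_L2/all_moments_prod => i; exact: all_moments_heat.
have pE k : expect (fun w => \prod_i heat (v i) (X i w) (tnth k i)) =
    \prod_i (tnth k i == 0%N)%:R.
  have [|||_ e] := @integral_prod_independent _ _ _ _ _ P n X _ indep
     (fun i x => heat (v i) x (tnth k i)).
  - by move=> i; case: (aX i).
  - by move=> i; exact: measurable_heat.
  - by move=> i; apply/L2_integrable/heat_L2.
  by rewrite /expect e; apply: eq_bigr => i _; have [_ h] := hX i; exact: h.
under eq_bigr do rewrite pE.
have k0E (k : n.-tuple nat) : \prod_i (tnth k i == 0%N)%:R = (k == [tuple of nseq n 0%N])%:R :> R.
  have [->|k0] := eqVneq k; first by rewrite big1// => i _; rewrite tnth_nseq eqxx.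
  have [i ki] : exists i, tnth k i != 0%N.
    apply/not_existsP => h; move/eqP: k0; apply; apply: eq_from_tnth => i.
    by rewrite tnth_nseq; apply/eqP/negPn/negP; exact: h.
  by rewrite (bigD1 i)//= (negbTE ki) mul0r.
under eq_bigr do rewrite k0E.
have [m0|m0] := eqVneq m 0%N.
  rewrite m0 (bigD1_seq [tuple of nseq n 0%N]) ?compositions_uniq//=; last first.
    by rewrite mem_compositions big1// => i _; rewrite tnth_nseq.
  by rewrite eqxx big1 ?addr0// => k /negbTE ->.
rewrite big_seq big1// => k; rewrite mem_compositions => /eqP km.
case: eqP => // ke; move: m0; rewrite -km ke big1 ?eqxx// => i _.
by rewrite tnth_nseq.
Qed.

Lemma heat_var0_continuous (v : nat -> R) l n : v k @[k --> \oo] --> l ->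
  heat (- v k) 0 n @[k --> \oo] --> heat (- l) 0 n.
Proof.
move=> vl; rewrite -[n]odd_double_half; case: (odd n).
  by rewrite add1n; under eq_fun do rewrite heat_odd; rewrite heat_odd; exact: cvg_cst.
have e (u : R) : heat (- u) 0 n./2.*2 = (u / 2) ^+ n./2 / n./2`!%:R.
  by rewrite -heat_even; congr (heat _ _ _); rewrite -mulr_natr; field.
rewrite add0n; under eq_fun do rewrite e; rewrite e.
apply: cvgMl; apply: cvg_exprn; exact: cvgMl.
Qed.

(** Convergence in [L2] alone does not carry powers along. The explicit even moments bound the
    powers of the [X k] uniformly, Fatou's lemma passes the bound to [Y], and Cauchy-Schwarz on the
    factorization of [Y ^ n - X k ^ n] gives the convergence of all moments. *)
Lemma gaussian_moments_lim (X : nat -> T -> R) (v : nat -> R) Y :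
  (forall k, gaussian_moments (X k) (v k)) -> Y \in L2 ->
  (forall k, nrm (X k - Y) <= 2^-1 ^+ k) ->
  gaussian_moments Y (dotp Y Y).
Proof.
move=> hX Y2 XY; have aX k : all_moments (X k) by case: (hX k).
have X2 k : X k \in L2 by exact: all_moments_L2.
have aeXY := fast_ae_cvg X2 Y2 XY.
have vE k : v k = nrm (X k) ^+ 2 by rewrite nrm_sqr (gaussian_moments_sqr (hX k)).
have nX k : nrm (X k) <= nrm Y + 1.
  rewrite -[X k](subrK Y) (le_trans (nrmD _ _)) ?L2B// addrC lerD2l.
  by rewrite (le_trans (XY k))// exprn_ile1// invf_le1// ler1n.
have v_le k : v k <= (nrm Y + 1) ^+ 2.
  by rewrite vE lerXn2r// nnegrE ?addr_ge0 ?nrm_ge0.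
have v0 k : 0 <= v k by rewrite vE sqr_ge0.
(* Bound on the norm of the [n]-th powers: the square root of a Gaussian moment of order [2 n], at a
   variance above all the [v k]. *)
pose M n : R := Num.sqrt (n.*2`!%:R * (((nrm Y + 1) ^+ 2 / 2) ^+ n / n`!%:R)).
have M0 n : 0 <= M n by exact: sqrtr_ge0.
have XM n k : nrm (X k ^+ n) <= M n.
  rewrite /L2nrm ler_sqrt; last by rewrite mulr_ge0// divr_ge0// exprn_ge0// divr_ge0// sqr_ge0.
  have -> : dotp (X k ^+ n) (X k ^+ n) = expect (X k ^+ n.*2).
    by apply: eq_Rintegral => w _; rewrite !expfE -exprD addnn.
  rewrite (gaussian_moments_even _ (hX k)) ler_wpM2l// ler_wpM2r ?invr_ge0//.
  apply: lerXn2r; rewrite ?nnegrE ?divr_ge0 ?sqr_ge0//.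
  by rewrite ler_wpM2r ?invr_ge0.
have Ypow n : Y ^+ n \in L2 /\ nrm (Y ^+ n) <= M n.
  apply: (@fatou_nrm _ _ _ P (fun k => X k ^+ n)).
  - by move=> k; case: (aX k).
  - rewrite (_ : Y ^+ n = fun w => Y w ^+ n); last by apply/funext => w; rewrite expfE.
    by apply: measurable_funX; exact: L2_measurable Y2.
  - exact: XM.
  - apply: filterS aeXY => w h; under eq_fun do rewrite expfE; rewrite expfE.
    exact: cvg_exprn.
have aY : all_moments Y.
  by split=> [|n]; [exact: L2_measurable Y2|case: (Ypow n)].
split=> //; apply/(gaussian_momentsP _ aY) => n.
have half0 : (2^-1 : R) ^+ k @[k --> \oo] --> 0.
  by apply: cvg_expr; rewrite ger0_norm// invf_lt1// ltr1n.
have cvM (u : nat -> R) (l C : R) : (forall k, `|l - u k| <= C * 2^-1 ^+ k) ->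
    u k @[k --> \oo] --> l.
  move=> h; apply/subr_cvg0; apply/norm_cvg0P.
  apply: (@squeeze_cvgr _ _ _ _ (cst 0) (fun k => C * 2^-1 ^+ k)).
  - by apply: nearW => k; rewrite normr_ge0/= distrC.
  - exact: cvg_cst.
  - by rewrite -(mulr0 C); exact: cvgMr.
have cvE : expect (X k ^+ n) @[k --> \oo] --> expect (Y ^+ n).
  case: n => [|n].
    by rewrite expr0; under eq_fun do rewrite expr0; exact: cvg_cst.
  apply: (cvM _ _ (\sum_(i < n.+1) (M (2 * (n - i))%N + M (2 * i)%N))) => k.
  have F2 i : Y ^+ (n - i) * X k ^+ i \in L2 /\
      nrm (Y ^+ (n - i) * X k ^+ i) <= M (2 * (n - i))%N + M (2 * i)%N.
    have Z2 := L2D (Ypow (2 * (n - i))%N).1 ((aX k).2 (2 * i)%N).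
    have [||W2 nW] := nrm_le Z2 (X := Y ^+ (n - i) * X k ^+ i).
    - apply: measurable_funM; first by have := L2_measurable (Ypow (n - i)%N).1.
      by have := L2_measurable ((aX k).2 i).
    - move=> w; rewrite -[X in _ <= `|X|]/((Y ^+ _) w + (X k ^+ _) w).
      rewrite -[X in `|X|]/((Y ^+ _) w * (X k ^+ _) w) !expfE.
      by apply: le_trans (expr_mul_le _ _ _ _) _; exact: ler_norm.
    split=> //; apply: le_trans nW _; apply: le_trans (nrmD _ _) _ => //.
    - by case: (Ypow (2 * (n - i))%N).
    - by case: (aX k).
    - by apply: lerD; [case: (Ypow (2 * (n - i))%N)|exact: XM].
  have Yn2 := (Ypow n.+1).1; have Xn2 := (aX k).2 n.+1.
  have -> : expect (Y ^+ n.+1) - expect (X k ^+ n.+1) =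
      dotp (Y - X k) (\sum_(i < n.+1) Y ^+ (n - i) * X k ^+ i).
    rewrite /expect -RintegralB ?L2_integrable//.
    apply: eq_Rintegral => w _.
    by rewrite -[LHS]/((Y ^+ n.+1 - X k ^+ n.+1) w) subrXX.
  apply: le_trans (nrm_CS _ _) _.
  - exact: L2B.
  - by apply: L2_sum => i _; case: (F2 i).
  rewrite mulrC; apply: ler_pM; rewrite ?nrm_ge0//.
    have h2 := @nrm_sum _ _ _ P _ (index_enum _) predT
      (fun i : 'I_n.+1 => Y ^+ (n - i) * X k ^+ i) (fun i _ => (F2 i).1).
    apply: le_trans h2 _.
    by apply: ler_sum => i _; case: (F2 i).
  by rewrite nrmB.
have cvv : v k @[k --> \oo] --> dotp Y Y.
  rewrite -nrm_sqr; under eq_fun do rewrite vE.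
  apply: cvg_exprn; apply: (cvM _ _ 1) => k; rewrite mul1r.
  apply: le_trans (XY k).
  have := nrmD (L2B (X2 k) Y2) Y2; rewrite subrK => h1.
  have := nrmD (L2B Y2 (X2 k)) (X2 k); rewrite subrK (nrmB Y2 (X2 k)) => h2.
  by rewrite ler_norml; apply/andP; split; lra.
rewrite -(cvg_lim _ cvE)//; apply: cvg_lim => //.
under eq_fun => k do rewrite ((gaussian_momentsP _ (aX k)).1 (hX k).2 n).
by apply: cvgMr; exact: heat_var0_continuous.
Qed.

End all_moments.

Section gaussian_law.
Context {R : realType} {disp : measure_display} {T : measurableType disp}
  (P : probability T R).

Lemma gaussian_law_moments (X : T -> R) (v : R) : 0 <= v ->
  measurable_fun setT X ->
  (forall A, measurable A -> P (X @^-1` A) = centered_gaussian_law v A) ->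
  gaussian_moments P X v.
Proof.
move=> v0 mX lawX.
have [v_0|vn0] := eqVneq v 0.
  have X0 : {ae P, forall w, X w = 0}.
    exists (X @^-1` [set~ 0]); split.
    - rewrite -[X in measurable X]setTI; apply: mX => //.
      by apply: measurableC; exact: measurable_set1.
    - rewrite lawX; last by apply: measurableC; exact: measurable_set1.
      by rewrite /centered_gaussian_law v_0 eqxx diracE memNset//=; apply.
    - by move=> w /= h; apply: h.
  have aeE (f : R -> R) : measurable_fun setT f ->
      (\int[P]_w (f (X w))%:E = (f 0)%:E)%E.
    move=> mf; rewrite (@ae_eq_integral _ _ _ _ _ (cst (f 0)%:E))//.
    - by rewrite integral_cst//= probability_setT mule1.
    - by apply/measurable_EFinP; apply: measurableT_comp.
    - by apply: filterS X0 => w -> _.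
  split=> [|n].
    split=> // n; apply/L2P; split.
      rewrite (_ : _ ^+ n = fun w => X w ^+ n); first exact: measurable_funX.
      by apply/funext => w; rewrite expfE.
    under eq_integral do rewrite expfE -exprM.
    by rewrite (aeE (fun x => x ^+ (n * 2))) ?ltry//; exact: measurable_funX.
  rewrite /expect /Rintegral (aeE (fun x => heat v x n)); last exact: measurable_heat.
  by rewrite /= v_0 heat0 expr0n; case: n => [|n]; rewrite ?fact0 ?divr1 ?mul0r.
have vp : 0 < v by rewrite lt_def vn0.
have s0 : Num.sqrt v != 0 by rewrite gt_eqF// sqrtr_gt0.
have lawX' A : measurable A -> P (X @^-1` A) = normal_prob 0 (Num.sqrt v) A.
  by move=> mA; rewrite lawX// /centered_gaussian_law (negbTE vn0).
have law := integral_normal_law mX lawX'.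
split=> [|n].
  split=> // n; apply/L2P; split.
    rewrite (_ : _ ^+ n = fun w => X w ^+ n); first exact: measurable_funX.
    by apply/funext => w; rewrite expfE.
  under eq_integral do rewrite expfE -exprM.
  have mpow : measurable_fun setT (fun x : R => x ^+ (n * 2)) by exact: measurable_funX.
  have [_ h] := law _ mpow; apply: integrable_lty => //; apply: h.
  by apply: subexp_normal_integrable => //; apply: subexpX; exact: subexp_id.
rewrite /expect /Rintegral (law (fun x => heat v x n) (measurable_heat _ _)).1.
have := integral_heat_normal 0 s0 v n; rewrite /Rintegral => ->.
rewrite sqr_sqrtr// subrr heat0 expr0n.
by case: n => [|n]; rewrite ?fact0 ?divr1 ?mul0r.
Qed.

End gaussian_law.

Section poly_identity.

Lemma horner_inj {R : numDomainType} (p q : {poly R}) :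
  (forall x, p.[x] = q.[x]) -> p = q.
Proof.
move=> pq; apply/eqP; rewrite -subr_eq0; apply/negPn/negP => pq0.
have := @max_poly_roots _ (p - q) [seq k%:R | k <- iota 0 (size (p - q))] pq0.
rewrite size_map size_iota ltnn => h.
suff : false by []; apply: h.
  by apply/allP => x _; rewrite rootE hornerD hornerN pq subrr.
by rewrite map_inj_uniq ?iota_uniq// => x y /eqP; rewrite eqr_nat => /eqP.
Qed.

End poly_identity.

(** * The Gaussian space of the sheet *)

Section gaussian_space_theory.
Context {R : realType} (N d : nat) {disp : measure_display}
  {T : measurableType disp} (P : probability T R)
  (B : 'I_d -> N.-tuple R -> T -> R).
Hypothesis mB : forall i s, orthant s -> measurable_fun setT (B i s).
Hypothesis gaussB : forall i, centered_gaussian_field P (B i).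
Hypothesis indepB : independent_fields P B.

Local Notation L2 := (Lfun P 2%:E).
Local Notation dotp := (L2inner P).
Local Notation nrm := (L2nrm P).
Local Notation expect := (expect P).

(** Measurability for the sigma-algebra generated by the field [i], the form in which independence
    of the fields passes to functions of them. *)
Definition field_measurable d' (V : measurableType d') i (f : T -> V) :=
  forall A, measurable A -> field_sigma_algebra (B i) (f @^-1` A).

Lemma field_measurableP d' (V : measurableType d') i (f : T -> V) :
  field_measurable i f <->
  measurable_fun setT (f : g_sigma_algebraType [set E | exists s (A : set R),
    [/\ orthant s, measurable A & E = B i s @^-1` A]] -> V).
Proof.
split=> [h _ A mA|h A mA]; first by rewrite setTI; exact: h.
by have := h measurableT A mA; rewrite setTI.
Qed.

Lemma field_measurableB i s : orthant s -> field_measurable i (B i s).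
Proof. by move=> os A mA; apply: sub_sigma_algebra; exists s, A. Qed.

Lemma field_measurable_pair d1 d2 (V1 : measurableType d1) (V2 : measurableType d2)
    i (f : T -> V1) (g : T -> V2) :
  field_measurable i f -> field_measurable i g ->
  field_measurable i (fun w => (f w, g w)).
Proof.
move=> /field_measurableP hf /field_measurableP hg; apply/field_measurableP.
exact: measurable_fun_pair.
Qed.

Lemma field_measurable_comb i n (c : 'I_n -> R) (s : 'I_n -> N.-tuple R) :
  (forall k, orthant (s k)) ->
  field_measurable i (fun w => \sum_k c k * B i (s k) w).
Proof.
move=> os; apply/field_measurableP; apply: measurable_sum => k.
apply: measurable_funM => //; apply/field_measurableP; exact: field_measurableB.
Qed.

Lemma independentB d' (V : measurableType d') (X : 'I_d -> T -> V) :
  (forall i, field_measurable i (X i)) ->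
  forall A : 'I_d -> set V, (forall i, measurable (A i)) ->
  P (\bigcap_i (X i @^-1` A i)) = (\prod_(i < d) P (X i @^-1` A i))%E.
Proof. by move=> hX A mA; apply: indepB => i; apply: hX. Qed.

Definition sheet_values : set (T -> R) :=
  [set X | exists i s, orthant s /\ X = B i s].

Lemma comb_gaussian i n (c : 'I_n -> R) (s : 'I_n -> N.-tuple R) :
  (forall k, orthant (s k)) ->
  exists v, gaussian_moments P (fun w => \sum_k c k * B i (s k) w) v.
Proof.
move=> os; have [v v0 h] := gaussB i c os; exists v.
apply: gaussian_law_moments => //.
by apply: measurable_sum => k; apply: measurable_funM => //; exact: mB.
Qed.

(** Joint normality is given within each field only; across the fields it results from
    independence. *)
Lemma lin_span_gaussian X : lin_span sheet_values X ->
  exists v, gaussian_moments P X v.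
Proof.
move=> [n [c [Y [SY ->]]]].
have /choice[f hf] k : exists p : 'I_d * N.-tuple R, orthant p.2 /\ Y k = B p.1 p.2.
  by have [i [s [os e]]] := SY k; exists (i, s).
pose Z i w := \sum_k (c k * (f k).1%:R) * B i (f k).2 w.
(* The part of the combination that comes from the field [i], with null coefficients on the other
   terms. *)
pose Z' i w := \sum_k (c k * ((f k).1 == i)%:R) * B i (f k).2 w.
have e : \sum_k c k *: Y k = \sum_i Z' i.
  apply/funext => w; rewrite !fct_sumE exchange_big/=; apply: eq_bigr => k _.
  rewrite (bigD1 (f k).1)//= big1 ?addr0.
    by rewrite eqxx mulr1 (hf k).2.
  by move=> i /negbTE; rewrite eq_sym => ->; rewrite mulr0 mul0r.
have /choice[v hv] i : exists v, gaussian_moments P (Z' i) v.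
  by apply: comb_gaussian => k; case: (hf k).
exists (\sum_i v i); rewrite e; apply: gaussian_moments_sum => //.
apply: independentB => i; apply: field_measurable_comb => k.
by case: (hf k).
Qed.

Lemma sheet_values_L2 : sheet_values `<=` [set X | X \in L2].
Proof.
move=> X SX; have [v [h _]] := lin_span_gaussian (lin_span_gen SX).
exact: all_moments_L2 h.
Qed.

Lemma gaussian_space_moments Y : gaussian_space P B Y ->
  gaussian_moments P Y (dotp Y Y).
Proof.
move=> /(closed_spanP sheet_values_L2)[Y2 aY].
have /choice[X hX] (k : nat) : exists X, lin_span sheet_values X /\ nrm (Y - X) < 2^-1 ^+ k.
  have [|X] := aY (2^-1 ^+ k); first by rewrite exprn_gt0 ?invr_gt0.
  by exists X.
have /choice[v hv] k := lin_span_gaussian (hX k).1.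
apply: (gaussian_moments_lim hv) => // k.
rewrite nrmB//; first exact: ltW (hX k).2.
by case: (hv k) => /all_moments_L2.
Qed.

Lemma gaussian_space_L2 Y : gaussian_space P B Y -> Y \in L2.
Proof. by move=> []. Qed.

Lemma gaussian_space_all_moments Y : gaussian_space P B Y -> all_moments P Y.
Proof. by move=> /gaussian_space_moments[]. Qed.

Lemma gaussian_spaceD X Y : gaussian_space P B X -> gaussian_space P B Y ->
  gaussian_space P B (X + Y).
Proof. exact: (closed_spanD sheet_values_L2). Qed.

Lemma gaussian_spaceZ a X : gaussian_space P B X -> gaussian_space P B (a *: X).
Proof. exact: (closed_spanZ sheet_values_L2). Qed.

Lemma gaussian_space_sum I (r : seq I) (F : I -> T -> R) :
  (forall i, gaussian_space P B (F i)) -> gaussian_space P B (\sum_(i <- r) F i).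
Proof. by move=> h; exact: (closed_span_sum sheet_values_L2 r (Q := predT) (fun i _ => h i)). Qed.

Lemma gaussian_spaceB i s : orthant s -> gaussian_space P B (B i s).
Proof.
move=> os; apply: (lin_span_closed sheet_values_L2).
by apply: lin_span_gen; exists i, s.
Qed.

(* The coefficients of the powers of [a] in the moments of [a X + Y]. *)
Lemma heat_covariance X Y n m : gaussian_space P B X -> gaussian_space P B Y ->
  expect (fun w => heat (dotp X X) (X w) n * heat (dotp Y Y) (Y w) m) =
  if n == m then dotp X Y ^+ n / n`!%:R else 0.
Proof.
move=> gX gY.
have X2 := gaussian_space_L2 gX; have Y2 := gaussian_space_L2 gY.
have aX := gaussian_space_all_moments gX; have aY := gaussian_space_all_moments gY.
set v := dotp X X; set v' := dotp Y Y; set c := dotp X Y.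
pose e p q := expect (fun w => heat v (X w) p * heat v' (Y w) q).
have hh p q : (fun w => heat v (X w) p * heat v' (Y w) q) \in L2.
  by apply/all_moments_L2; apply: (@all_momentsM _ _ _ _ (fun w => heat v (X w) p) (fun w => heat v' (Y w) q)); exact: all_moments_heat.
pose K := (n + m)%N.
(* The mean of one polynomial of order [K] in [a X + Y] is computed in two ways: at the variance
   [a ^ 2 v + v'] the addition formula separates [X] from [Y], and relative to the true variance
   [vZ] only the term of order zero has a nonzero mean. *)
have key a : \sum_(p < K.+1) a ^+ p * e p (K - p)%N = heat (- (a * c) *+ 2) 0 K.
  have gZ : gaussian_space P B (a *: X + Y) by apply: gaussian_spaceD => //; exact: gaussian_spaceZ.
  have [aZ hZ] := gaussian_space_moments gZ.
  set vZ := dotp _ _ in hZ.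
  have vZE : vZ = a ^+ 2 * v + v' + (a * c) *+ 2.
    rewrite /vZ dotpDl ?dotpDr ?L2D ?L2Z// !dotpZl ?dotpZr ?L2Z// (dotpC _ Y X).
    by rewrite -/v -/v' -/c -mulr_natr; ring.
  transitivity (expect (fun w => heat (a ^+ 2 * v + v') (a * X w + Y w) K)).
    rewrite (_ : (fun w => _) = \sum_(p < K.+1) a ^+ p *: (fun w => heat v (X w) p * heat v' (Y w) (K - p))).
      rewrite expect_sum; last by move=> p; exact: L2Z.
      by apply: eq_bigr => p _; rewrite expectZ.
    apply/funext => w; rewrite fct_sumE heatD; apply: eq_bigr => p _.
    by rewrite heatZ -mulrA.
  rewrite (_ : (fun w => _) = \sum_(p < K.+1) heat (- (a * c) *+ 2) 0 (K - p) *: (fun w => heat vZ ((a *: X + Y) w) p)).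
    rewrite expect_sum; last by move=> p; apply: L2Z; exact: heat_L2.
    rewrite big_ord_recl big1 ?addr0 => [|p _]; last first.
      by rewrite expectZ ?heat_L2// hZ mulr0.
    by rewrite expectZ ?heat_L2// hZ mulr1 subn0.
  apply/funext => w; rewrite fct_sumE.
  have -> : a ^+ 2 * v + v' = vZ + - (a * c) *+ 2 by rewrite vZE mulNrn addrK.
  rewrite -[a * X w + Y w]addr0 heatD; apply: eq_bigr => p _.
  by rewrite mulrC.
pose p1 := \poly_(p < K.+1) e p (K - p)%N.
pose p2 : {poly R} := if odd K then 0 else (c ^+ K./2 / K./2`!%:R) *: 'X^(K./2).
have p12 : p1 = p2.
  apply: horner_inj => a; rewrite horner_poly.
  under eq_bigr do rewrite mulrC.
  rewrite key /p2 -{1}[K]odd_double_half; case: (odd K).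
    by rewrite add1n heat_odd horner0.
  by rewrite add0n heat_even hornerZ hornerXn exprMn; ring.
have : p1`_n = p2`_n by rewrite p12.
rewrite coef_poly ltnS leq_addr /K addKn => E; rewrite -[LHS]/(e n m) E.
rewrite /p2 /K; have [->|nm] := eqVneq n m.
  by rewrite addnn odd_double doubleK coefZ coefXn eqxx mulr1.
case: ifPn => [_|ev]; first by rewrite coef0.
rewrite coefZ coefXn; case: eqP => [nE|]; last by rewrite mulr0.
move/negP: nm; case; rewrite -(eqn_add2l n) addnn.
rewrite -[X in _ == X]odd_double_half (negbTE ev) add0n.
by rewrite {1}nE.
Qed.

End gaussian_space_theory.

(** * Chaos spaces *)

Section vandermonde.
Context {R : numFieldType} {V : lmodType R} (W : V -> Prop).
Hypothesis WD : forall x y, W x -> W y -> W (x + y).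
Hypothesis WZ : forall a x, W x -> W (a *: x).

(** Combining the values at [2 b] and at [b] removes the last coefficient and multiplies the one of
    index [j] by [2 ^ j - 2 ^ K], which is not zero. Only positive [b] are available later, where
    [b] scales Gaussian variables that must stay nondegenerate. *)
Lemma span_power_coefficients K (X : nat -> V) :
  (forall b : R, 0 < b -> W (\sum_(j < K) b ^+ j *: X j)) ->
  forall j, (j < K)%N -> W (X j).
Proof.
elim: K X => [//|K IH] X h.
have low j : (j < K)%N -> W (X j).
  move=> jK; pose c (i : nat) : R := 2 ^+ i - 2 ^+ K.
  have c0 : c j != 0.
    by rewrite subr_eq0 lt_eqF// ltr_eXn2l// ltr1n.
  rewrite -[X j](scalerK c0); apply: WZ; apply: (IH (fun i => c i *: X i)) => // b b0.
  have := WD (h (2 * b) (mulr_gt0 (ltr0Sn R 1) b0)) (WZ (- 2 ^+ K) (h b b0)).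
  rewrite scaler_sumr -big_split/= big_ord_recr/= exprMn scalerA mulNr scaleNr subrr addr0.
  rewrite (eq_bigr (fun i : 'I_K => b ^+ i *: (c i *: X i)))// => i _.
  by rewrite exprMn !scalerA -scalerDl /c; congr (_ *: _); ring.
move=> j; rewrite ltnS leq_eqVlt => /predU1P[->|]; last exact: low.
have := h 1 ltr01; rewrite big_ord_recr/= expr1n scale1r => hK.
have -> : X K = (\sum_(i < K) 1 ^+ i *: X i + X K) + (-1) *: \sum_(i < K) X i.
  by under eq_bigr do rewrite expr1n scale1r; rewrite scaleN1r addrAC subrr add0r.
have [K0|K0] := posnP K.
  by rewrite [X in _ + _ *: X]big1 ?scaler0 ?addr0// => -[i /= iK]; move: iK; rewrite K0.
apply: WD => //; apply: WZ.
apply: (big_ind (fun x => W x)) => //.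
  by rewrite -(scale0r (X 0%N)); apply: WZ; exact: low.
by move=> i _; exact: low.
Qed.

End vandermonde.

Section digits.

Lemma digits_lt M d (n : d.-tuple nat) : (forall i, tnth n i < M)%N ->
  (\sum_(i < d) tnth n i * M ^ i < M ^ d)%N.
Proof.
elim: d n => [|d IH] n h; first by rewrite big_ord0.
rewrite big_ord_recl expn0 muln1.
have M0 : (0 < M)%N by exact: leq_ltn_trans (leq0n _) (h ord0).
have := IH [tuple of behead n] (fun i => _).
have bE i : tnth [tuple of behead n] i = tnth n (lift ord0 i).
  by rewrite tnth_behead; congr tnth; apply/val_inj; rewrite /= inordK ?ltnS.
move=> /(_ (fun i => eq_ind_r (fun k => k < M)%N (h _) (bE i))) lt.
under eq_bigr do rewrite lift0 expnSr mulnA -bE.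
rewrite -big_distrl/= expnSr.
apply: leq_trans (_ : (M + (\sum_(i < d) tnth [tuple of behead n] i * M ^ i) * M <= _)%N).
  by rewrite ltn_add2r h.
by rewrite -mulSn leq_mul2r lt orbT.
Qed.

(** Uniqueness of digits in base [M]: it gives distinct multi-indices distinct exponents in the
    polarization below. *)
Lemma digits_inj M d (n n' : d.-tuple nat) :
  (forall i, tnth n i < M)%N -> (forall i, tnth n' i < M)%N ->
  (\sum_(i < d) tnth n i * M ^ i = \sum_(i < d) tnth n' i * M ^ i)%N -> n = n'.
Proof.
elim: d n n' => [|d IH] n n' h h' e; first by rewrite (tuple0 n) (tuple0 n').
have bE (k : d.+1.-tuple nat) i : tnth [tuple of behead k] i = tnth k (lift ord0 i).
  by rewrite tnth_behead; congr tnth; apply/val_inj; rewrite /= inordK ?ltnS.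
have eE (k : d.+1.-tuple nat) : (\sum_(i < d.+1) tnth k i * M ^ i =
    (\sum_(i < d) tnth [tuple of behead k] i * M ^ i) * M + tnth k ord0)%N.
  rewrite big_ord_recl expn0 muln1 addnC big_distrl; congr addn.
  by apply: eq_bigr => i _; rewrite lift0 expnSr mulnA bE.
rewrite !eE in e.
have e0 : tnth n ord0 = tnth n' ord0.
  by have := congr1 (modn^~ M) e; rewrite !modnMDl !modn_small.
move: e; rewrite e0 => /addIn/eqP; rewrite eqn_pmul2r ?(leq_ltn_trans _ (h ord0))// => /eqP e.
have {}IH := IH _ _ (fun i => eq_ind_r (fun k => k < M)%N (h _) (bE n i))
  (fun i => eq_ind_r (fun k => k < M)%N (h' _) (bE n' i)) e.
apply: eq_from_tnth => i; have [j ->|->//] := unliftP ord0 i.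
by rewrite -!bE IH.
Qed.

End digits.

Section chaos_theory.
Context {R : realType} (N d : nat) {disp : measure_display}
  {T : measurableType disp} (P : probability T R)
  (B : 'I_d -> N.-tuple R -> T -> R).
Hypothesis mB : forall i s, orthant s -> measurable_fun setT (B i s).
Hypothesis gaussB : forall i, centered_gaussian_field P (B i).
Hypothesis indepB : independent_fields P B.

Local Notation L2 := (Lfun P 2%:E).
Local Notation dotp := (L2inner P).
Local Notation nrm := (L2nrm P).
Local Notation expect := (expect P).
Local Notation gaussian_space := (gaussian_space P B).
Local Notation chaos := (chaos P B).

(** The generators of [chaos n], named so that the lemmas on closed spans apply. *)
Definition chaos_gen n : set (T -> R) := [set X | exists Y,
  [/\ gaussian_space Y, ('E_P[fun w => (Y w ^+ 2)%R] = 1)%E & X = hermite n \o Y]].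

Let gspace_all Y := @gaussian_space_all_moments _ _ _ _ _ P B mB gaussB indepB Y.

Lemma unit_dotp Y : gaussian_space Y ->
  ('E_P[fun w => (Y w ^+ 2)%R] = 1)%E <-> dotp Y Y = 1.
Proof.
move=> gY; rewrite expectation_sqr; last exact: gaussian_space_L2 gY.
by split=> [[]|->].
Qed.

Lemma hermite_comp n (Y : T -> R) : hermite n \o Y = (fun w => heat 1 (Y w) n).
Proof. by apply/funext => w /=; rewrite hermiteE. Qed.

Lemma chaos_gen_L2 n : chaos_gen n `<=` [set X | X \in L2].
Proof.
by move=> _ [Y [gY _ ->]] /=; rewrite hermite_comp; apply/heat_L2/gspace_all.
Qed.

Lemma chaos_L2 n X : chaos n X -> X \in L2. Proof. by case. Qed.

Lemma chaosD n X Y : chaos n X -> chaos n Y -> chaos n (X + Y).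
Proof. exact: (closed_spanD (@chaos_gen_L2 n)). Qed.

Lemma chaosZ n a X : chaos n X -> chaos n (a *: X).
Proof. exact: (closed_spanZ (@chaos_gen_L2 n)). Qed.

Lemma chaosB n X Y : chaos n X -> chaos n Y -> chaos n (X - Y).
Proof. by move=> hX hY; rewrite -scaleN1r; apply: chaosD => //; exact: chaosZ. Qed.

Lemma chaos_sum n I (r : seq I) (Q : pred I) (F : I -> T -> R) :
  (forall i, Q i -> chaos n (F i)) -> chaos n (\sum_(i <- r | Q i) F i).
Proof. by move=> h; exact: (closed_span_sum (@chaos_gen_L2 n) r h). Qed.

Lemma chaos_orthogonal n m X Y : n != m -> chaos n X -> chaos m Y -> dotp X Y = 0.
Proof.
move=> nm cX cY; have Y2 := chaos_L2 cY.
apply: (closed_span_orthogonal (@chaos_gen_L2 n) Y2 _ cX) => X' gX'.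
have X'2 := chaos_gen_L2 gX'.
rewrite dotpC; apply: (closed_span_orthogonal (@chaos_gen_L2 m) X'2 _ cY) => Y'.
case: gX' => Z [gZ /(unit_dotp gZ) Z1 ->] [Z' [gZ' /(unit_dotp gZ') Z'1 ->]].
have := heat_covariance mB gaussB indepB m n gZ' gZ.
by rewrite Z1 Z'1 eq_sym (negbTE nm) !hermite_comp.
Qed.

Lemma heat_chaos n Y : gaussian_space Y -> 0 < dotp Y Y ->
  chaos n (fun w => heat (dotp Y Y) (Y w) n).
Proof.
move=> gY Y0; have Y2 := gaussian_space_L2 gY.
set l := nrm Y; have l2 : l ^+ 2 = dotp Y Y by rewrite nrm_sqr.
have l0 : l != 0 by rewrite gt_eqF// /l /L2nrm sqrtr_gt0.
have -> : (fun w => heat (dotp Y Y) (Y w) n) = l ^+ n *: (hermite n \o (l^-1 *: Y)).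
  rewrite hermite_comp; apply/funext => w.
  change (heat (dotp Y Y) (Y w) n = l ^+ n * heat 1 (l^-1 * Y w) n).
  by rewrite -heatZ mulr1 l2 mulVKf.
apply: chaosZ; apply: (lin_span_closed (@chaos_gen_L2 n)); apply: lin_span_gen.
have glY : gaussian_space (l^-1 *: Y) by exact: gaussian_spaceZ.
exists (l^-1 *: Y); split=> //; apply/unit_dotp => //.
by rewrite dotpZl ?dotpZr ?L2Z// -l2 mulrA -expr2 -exprMn mulVf// expr1n.
Qed.

Lemma sheet_orthogonal i j s s' : i != j -> orthant s -> orthant s' ->
  dotp (B i s) (B j s') = 0.
Proof.
move=> ij os os'.
have aB k u : orthant u -> all_moments P (B k u).
  by move=> ou; apply: gspace_all; exact: gaussian_spaceB.
pose u k := if k == i then s else s'.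
have ou k : orthant (u k) by rewrite /u; case: ifP.
have fB k : field_measurable B k (B k (u k)) by exact: field_measurableB.
pose f (k : 'I_d) (x : R) := if (k == i) || (k == j) then x else 1.
have [|||_ e] := @integral_prod_independent _ _ _ _ _ P d (fun k => B k (u k)) _
   (independentB indepB fB) f.
- by move=> k; exact: mB.
- by move=> k; rewrite /f; case: ((k == i) || (k == j)).
- move=> k; rewrite /f; case: ((k == i) || (k == j)); last exact: (L2_integrable (L2_cst P 1)).
  by apply/L2_integrable/all_moments_L2/aB.
have fE w : \prod_k f k (B k (u k) w) = B i s w * B j s' w.
  rewrite (bigD1 i)//= (bigD1 j) 1?eq_sym//= big1 ?mulr1 => [|k /andP[ki kj]].
    by rewrite /f /u !eqxx orbT (eq_sym j) (negbTE ij).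
  by rewrite /f (negbTE ki) (negbTE kj).
rewrite /L2inner; under eq_Rintegral do rewrite -fE.
rewrite e (bigD1 i)//=.
have -> : \int[P]_w f i (B i (u i) w) = 0; last by rewrite mul0r.
have [_ /(_ 1%N)] := gaussian_space_moments mB gaussB indepB (gaussian_spaceB mB gaussB indepB i os).
under [in X in X -> _]eq_fun do rewrite heat_n1.
move=> e1; transitivity ((1%N == 0%N)%:R : R) => //; rewrite -e1.
by apply: eq_Rintegral => w _; rewrite /f /u eqxx.
Qed.

(** Polarization. For [Y = sum_i b ^ ((m + 1) ^ i) Z i], the polynomial of order [m] in [Y] is a
    polynomial in [b] where each product of heat polynomials carries its own power of [b];
    [span_power_coefficients] then extracts the product wanted. *)
Lemma prod_heat_chaos (Z : 'I_d -> T -> R) (n : d.-tuple nat) (d0 : (0 < d)%N) :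
  (forall i, gaussian_space (Z i)) -> (forall i j, i != j -> dotp (Z i) (Z j) = 0) ->
  (forall i, 0 < dotp (Z i) (Z i)) ->
  chaos (\sum_(i < d) tnth n i) (fun w => \prod_i heat (dotp (Z i) (Z i)) (Z i w) (tnth n i)).
Proof.
move=> gZ oZ pZ; set m := (\sum_(i < d) tnth n i)%N.
have Z2 i := gaussian_space_L2 (gZ i).
pose H (k : d.-tuple nat) w := \prod_i heat (dotp (Z i) (Z i)) (Z i w) (tnth k i).
pose e (k : d.-tuple nat) := (\sum_(i < d) tnth k i * m.+1 ^ i)%N.
have comp_lt k : k \in compositions d m -> forall i, (tnth k i < m.+1)%N.
  rewrite mem_compositions => /eqP km i; rewrite ltnS -km (bigD1 i)//=.
  exact: leq_addr.
have nm : n \in compositions d m by rewrite mem_compositions.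
pose X j := \sum_(k <- compositions d m | e k == j) H k.
have Xn : X (e n) = H n.
  rewrite /X big_mkcond (bigD1_seq n) ?compositions_uniq//= eqxx.
  rewrite big_seq_cond big1 ?addr0// => k /andP[km kn].
  case: eqP => // ek; move/eqP: kn; case.
  by apply: (digits_inj (comp_lt k km) (comp_lt n nm)); exact: ek.
rewrite -/(H n) -Xn.
apply: (@span_power_coefficients _ _ (chaos m) _ _ (m.+1 ^ d)); last 2 first.
- move=> b b0; pose a (i : 'I_d) := b ^+ (m.+1 ^ i).
  pose Y := \sum_i a i *: Z i.
  have gY : gaussian_space Y.
    by apply: gaussian_space_sum => // i; exact: gaussian_spaceZ.
  have YE : dotp Y Y = \sum_i a i ^+ 2 * dotp (Z i) (Z i).
    rewrite /Y dotp_suml; [|by move=> i _; exact: L2Z|exact: gaussian_space_L2 gY].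
    apply: eq_bigr => i _; rewrite dotp_sumr; [|by move=> j _; exact: L2Z|exact: L2Z].
    rewrite (bigD1 i)//= big1 ?addr0 => [|j ji].
      by rewrite dotpZl ?dotpZr ?L2Z// mulrA.
    by rewrite dotpZl ?dotpZr ?L2Z// oZ ?mulr0// eq_sym.
  have Y0 : 0 < dotp Y Y.
    rewrite YE (bigD1 (Ordinal d0))//= ltr_pwDl// ?mulr_gt0 ?exprn_gt0//.
    by apply: sumr_ge0 => i _; rewrite mulr_ge0 ?sqr_ge0// ltW.
  have := heat_chaos m gY Y0.
  rewrite (_ : (fun w => _) = \sum_(j < m.+1 ^ d) b ^+ j *: X j)//.
  apply/funext => w; rewrite YE /Y !fct_sumE heat_sum.
  transitivity (\sum_(k <- compositions d m) b ^+ e k * H k w).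
    apply: eq_bigr => k _; rewrite /e /H.
    rewrite -prodrXr -big_split/=; apply: eq_bigr => i _.
    by rewrite heatZ /a -exprM mulnC.
  rewrite [RHS](eq_bigr (fun j : 'I_(m.+1 ^ d) =>
      \sum_(k <- compositions d m) if e k == j then b ^+ j * H k w else 0)); last first.
    move=> j _; transitivity (b ^+ j * X j w) => //.
    by rewrite /X fct_sumE mulr_sumr big_mkcond.
  rewrite exchange_big/= big_seq [RHS]big_seq; apply: eq_bigr => k km.
  have ek : (e k < m.+1 ^ d)%N by apply: digits_lt; exact: comp_lt.
  rewrite (bigD1 (Ordinal ek))//= eqxx big1 ?addr0// => j /negbTE jk.
  by case: eqP => // ekj; move/eqP: jk; case; apply/val_inj.
- by apply: digits_lt; exact: comp_lt.
- by move=> x y; exact: chaosD.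
- by move=> a x; exact: chaosZ.
Qed.

Lemma dotp_prod_heat s s' (n n' : d.-tuple nat) : orthant s -> orthant s' ->
  dotp (fun w => \prod_i heat (dotp (B i s) (B i s)) (B i s w) (tnth n i))
       (fun w => \prod_i heat (dotp (B i s') (B i s')) (B i s' w) (tnth n' i)) =
  if n == n' then \prod_i (dotp (B i s) (B i s') ^+ tnth n i / (tnth n i)`!%:R) else 0.
Proof.
move=> os os'.
have gB k u : orthant u -> gaussian_space (B k u) by exact: gaussian_spaceB.
pose X (i : 'I_d) w := (B i s w, B i s' w).
pose f (i : 'I_d) (p : R * R) := heat (dotp (B i s) (B i s)) p.1 (tnth n i) *
  heat (dotp (B i s') (B i s')) p.2 (tnth n' i).
have fX i : field_measurable B i (X i).
  by apply: field_measurable_pair; exact: field_measurableB.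
have [|||_ e] := @integral_prod_independent _ _ _ _ _ P d X _ (independentB indepB fX) f.
- by move=> i; apply: measurable_fun_pair; exact: mB.
- move=> i; apply: measurable_funM.
    exact: (measurableT_comp (measurable_heat _ _) measurable_fst).
  exact: (measurableT_comp (measurable_heat _ _) measurable_snd).
- by move=> i; apply: L2_integrable_mul; apply: heat_L2; apply: gspace_all; exact: gB.
transitivity (\int[P]_w \prod_i f i (X i w)).
  by apply: eq_Rintegral => w _; rewrite -big_split.
rewrite e.
have hE i : \int[P]_w f i (X i w) = if tnth n i == tnth n' i
    then dotp (B i s) (B i s') ^+ tnth n i / (tnth n i)`!%:R else 0.
  by have := heat_covariance mB gaussB indepB (tnth n i) (tnth n' i) (gB i _ os) (gB i _ os').
under eq_bigr do rewrite hE.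
have [->|nn] := eqVneq n n'; first by apply: eq_bigr => i _; rewrite eqxx.
have [i ni] : exists i, tnth n i != tnth n' i.
  apply/not_existsP => h; move/eqP: nn; apply; apply: eq_from_tnth => i.
  by apply/eqP/negPn/negP; exact: h.
by rewrite (bigD1 i)//= (negbTE ni) mul0r.
Qed.

End chaos_theory.

(** * Mehler's formula on the diagonal *)

Section power_series_disc.
Context {R : realType}.
Implicit Types (c : R^nat) (z q : R).

(** The radius of convergence is at least one. *)
Definition subgeometric c := forall q, 0 < q < 1 ->
  exists C : R, forall n, `|c n| * q ^+ n <= C.

Lemma subgeometric_normed_cvg c z : subgeometric c -> `|z| < 1 ->
  cvgn (series (fun k => `|c k * z ^+ k|)).
Proof.
move=> hc z1; pose q := (1 + `|z|) / 2.
have q01 : 0 < q < 1.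
  by rewrite /q; have := normr_ge0 z; move=> ?; apply/andP; split; lra.
have zq : `|z| < q by rewrite /q; lra.
have q0 : 0 < q by case/andP: q01.
have [C hC] := hc _ q01.
have zq0 : 0 <= `|z| / q by rewrite divr_ge0 ?(ltW q0).
apply: (@series_le_cvg _ _ (geometric C (`|z| / q))) => //=.
- by move=> n; rewrite /geometric/= mulr_ge0 ?exprn_ge0// (le_trans _ (hC 0%N))// mulr_ge0// exprn_ge0// ltW.
- move=> n; rewrite /geometric/= normrM normrX expr_div_n.
  rewrite [leRHS]mulrCA [leLHS]mulrC; apply: ler_wpM2l; first exact: exprn_ge0.
  by rewrite ler_pdivlMr ?exprn_gt0.
- apply: is_cvg_geometric_series.
  by rewrite ger0_norm// ltr_pdivrMr// mul1r.
Qed.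

Lemma subgeometric_cvg c z : subgeometric c -> `|z| < 1 -> cvgn (pseries c z).
Proof. by move=> hc z1; apply: normed_cvg; exact: subgeometric_normed_cvg. Qed.

Lemma natmul_expr_le (r : R) n : 0 <= r < 1 -> n%:R * r ^+ n <= (1 - r)^-1.
Proof.
move=> /andP[r0 r1]; have r1' : 0 < 1 - r by rewrite subr_gt0.
rewrite -[leRHS]mul1r ler_pdivlMr//.
have : (1 - r) * \sum_(k < n) r ^+ k = 1 - r ^+ n.
  elim: n => [|n IH]; first by rewrite big_ord0 mulr0 expr0 subrr.
  by rewrite big_ord_recr/= mulrDr IH exprS; ring.
have : n%:R * r ^+ n <= \sum_(k < n) r ^+ k.
  rewrite mulr_natl -[X in _ *+ X]card_ord -sumr_const; apply: ler_sum => k _.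
  by apply: ler_wiXn2l; rewrite ?(ltW r1)// ltnW.
have := exprn_ge0 n r0; nra.
Qed.

Lemma subgeometric_diffs c : subgeometric c -> subgeometric (pseries_diffs c).
Proof.
move=> hc q /andP[q0 q1]; pose p := (1 + q) / 2.
have p0 : 0 < p by rewrite /p; lra.
have p1 : p < 1 by rewrite /p; lra.
have qp : q < p by rewrite /p; lra.
have [C hC] := hc p (introT andP (conj p0 p1)).
have C0 : 0 <= C by apply: le_trans (hC 0%N); rewrite mulr_ge0// exprn_ge0// ltW.
have r01 : 0 <= q / p < 1 by rewrite divr_ge0 ?(ltW p0) ?(ltW q0)//= ltr_pdivrMr// mul1r.
exists (C * (1 - q / p)^-1 / q) => n; rewrite /pseries_diffs normrM ger0_norm//.
rewrite ler_pdivlMr// -!mulrA -exprSr.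
have -> : n.+1%:R * (`|c n.+1| * q ^+ n.+1) =
    (`|c n.+1| * p ^+ n.+1) * (n.+1%:R * (q / p) ^+ n.+1).
  have pn0 : p ^+ n.+1 != 0 by rewrite expf_neq0// gt_eqF.
  rewrite [(q / p) ^+ _]expr_div_n; move: (p ^+ n.+1) pn0 => P pn0; move: (q ^+ n.+1) => Q.
  by field.
apply: ler_pM => //.
- by rewrite mulr_ge0// exprn_ge0// ltW.
- by rewrite mulr_ge0// exprn_ge0//; case/andP: r01.
- exact: natmul_expr_le.
Qed.

Definition psum c z := limn (pseries c z).

Lemma is_derive_psum c z : subgeometric c -> `|z| < 1 ->
  is_derive z 1 (psum c) (psum (pseries_diffs c) z).
Proof.
move=> hc z1; pose K := (1 + `|z|) / 2.
have K1 : `|K| < 1.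
  by rewrite /K ger0_norm ?divr_ge0 ?addr_ge0// ltr_pdivrMr// mul1r; lra.
have zK : `|z| < `|K|.
  by rewrite /K (@ger0_norm _ ((1 + `|z|) / 2)) ?divr_ge0 ?addr_ge0// ltr_pdivlMr//; lra.
have hd := subgeometric_diffs hc; have hdd := subgeometric_diffs hd.
exact: (pseries_snd_diffs (subgeometric_cvg hc K1) (subgeometric_cvg hd K1)
  (subgeometric_cvg hdd K1) zK).
Qed.

Lemma psumD c1 c2 z : subgeometric c1 -> subgeometric c2 -> `|z| < 1 ->
  psum (fun n => c1 n + c2 n) z = psum c1 z + psum c2 z.
Proof.
move=> h1 h2 z1; rewrite /psum -limD; [|exact: subgeometric_cvg..].
congr (limn _); apply/funext => n; rewrite /pseries /series/= -[RHS]big_split/=.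
by apply: eq_bigr => k _; rewrite mulrDl.
Qed.

Lemma psumZ a c z : subgeometric c -> `|z| < 1 ->
  psum (fun n => a * c n) z = a * psum c z.
Proof.
move=> h1 z1; rewrite /psum; apply: cvg_lim => //.
rewrite [X in X @ \oo --> _](_ : _ = (fun n => a * pseries c z n)); last first.
  apply/funext => n; rewrite /pseries /series/= mulr_sumr.
  by apply: eq_bigr => k _; rewrite mulrA.
by apply: cvgMr; exact: subgeometric_cvg.
Qed.

Lemma psum_shift c z : subgeometric c -> `|z| < 1 ->
  psum (shift c) z = z * psum c z.
Proof.
move=> h1 z1; rewrite /psum; apply: cvg_lim => //.
rewrite -(cvg_shiftS (pseries (shift c) z)).
rewrite [X in X @ \oo --> _](_ : _ = (fun n => z * pseries c z n)); last first.
  apply/funext => n; rewrite /pseries /series/= big_nat_recl//= mul0r add0r mulr_sumr.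
  by apply: eq_bigr => k _; rewrite exprS mulrCA.
by apply: cvgMr; exact: subgeometric_cvg.
Qed.

Lemma subgeometricD c1 c2 : subgeometric c1 -> subgeometric c2 ->
  subgeometric (fun n => c1 n + c2 n).
Proof.
move=> h1 h2 q q01; have [C1 hC1] := h1 q q01; have [C2 hC2] := h2 q q01.
exists (C1 + C2) => n; apply: le_trans (lerD (hC1 n) (hC2 n)).
rewrite -mulrDl ler_wpM2r ?ler_normD// exprn_ge0//.
by case/andP: q01 => /ltW.
Qed.

Lemma subgeometricZ a c : subgeometric c -> subgeometric (fun n => a * c n).
Proof.
move=> h q q01; have [C hC] := h q q01; exists (`|a| * C) => n.
by rewrite normrM -mulrA ler_wpM2l.
Qed.

Lemma subgeometric_shift c : subgeometric c -> subgeometric (shift c).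
Proof.
move=> h q q01; have [C hC] := h q q01; have /andP[q0 q1] := q01.
have C0 : 0 <= C by apply: le_trans (hC 0%N); rewrite mulr_ge0// exprn_ge0// ltW.
exists C => -[|n] /=; first by rewrite normr0 mul0r.
apply: le_trans (hC n); rewrite ler_wpM2l// exprS ler_piMl ?(ltW q1)//.
by rewrite exprn_ge0// ltW.
Qed.

End power_series_disc.

Section mehler.
Context {R : realType} (y : R).

(** Squared values at [y] of the orthonormal Hermite polynomials, that is, the Taylor coefficients
    of Mehler's kernel at the pair [(y, y)]. *)
Definition mehler_coef n : R := n`!%:R * heat 1 y n ^+ 2.

Local Notation b := mehler_coef.

Lemma mehler_coef_ge0 n : 0 <= b n.
Proof. by rewrite mulr_ge0 ?sqr_ge0. Qed.

(** The square of the recurrence, the cross term being split with weight [dl]. *)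
Lemma mehler_coef_step (dl : R) n : 0 < dl ->
  n.+2%:R * b n.+2 <= (y ^+ 2 + y ^+ 2 / dl) * b n.+1 + (1 + dl) * n.+1%:R * b n.
Proof.
move=> dl0; rewrite /mehler_coef.
have := heat_rec 1 y n.+1; rewrite mul1r /=.
set u2 := heat 1 y n.+2; set u1 := heat 1 y n.+1; set u0 := heat 1 y n => e.
have f0 : 0 < n`!%:R :> R by rewrite ltr0n fact_gt0.
rewrite !factS !natrM.
have -> : n.+2%:R * (n.+2%:R * (n.+1%:R * n`!%:R) * u2 ^+ 2) =
  n.+1%:R * n`!%:R * (n.+2%:R * u2) ^+ 2 by ring.
have -> : (y ^+ 2 + y ^+ 2 / dl) * (n.+1%:R * n`!%:R * u1 ^+ 2) +
  (1 + dl) * n.+1%:R * (n`!%:R * u0 ^+ 2) = n.+1%:R * n`!%:R *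
  ((y ^+ 2 + y ^+ 2 / dl) * u1 ^+ 2 + (1 + dl) * u0 ^+ 2) by ring.
rewrite e ler_wpM2l ?mulr_ge0//.
rewrite -subr_ge0 (_ : _ - _ = (y * u1 + dl * u0) ^+ 2 / dl).
  by rewrite divr_ge0 ?sqr_ge0// ltW.
by field; rewrite gt_eqF.
Qed.

Lemma subgeometric_mehler : subgeometric b.
Proof.
(* With this [dl], [dl * q + (1 + dl) * q = 1], so that beyond [n0] each [x n.+2] is at most the
   larger of the two preceding terms. *)
move=> q /andP[q0 q1]; pose dl := (q^-1 - 1) / 2.
have dl0 : 0 < dl by rewrite /dl divr_gt0// subr_gt0 invf_gt1.
have dlq : (2 * dl + 1) * q = 1.
  by rewrite /dl; field; rewrite gt_eqF.
pose A := y ^+ 2 + y ^+ 2 / dl.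
have A0 : 0 <= A by rewrite addr_ge0 ?sqr_ge0// divr_ge0 ?sqr_ge0// ltW.
pose n0 := (Num.trunc (A / dl)).+1.
have An n : (n0 <= n)%N -> A <= dl * n.+2%:R.
  move=> n0n; rewrite -ler_pdivrMl// mulrC (le_trans (ltW (truncnS_gt _)))//.
  by rewrite ler_nat (leq_trans n0n)// -addn2 leq_addr.
pose x n := b n * q ^+ n.
have x0 n : 0 <= x n by rewrite mulr_ge0 ?mehler_coef_ge0// exprn_ge0// ltW.
have step n : (n0 <= n)%N -> x n.+2 <= Num.max (x n.+1) (x n).
  move=> n0n; set M := Num.max _ _.
  have M1 : x n.+1 <= M by rewrite /M le_max lexx.
  have M2 : x n <= M by rewrite /M le_max lexx orbT.
  have h : b n.+2 <= dl * b n.+1 + (1 + dl) * b n.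
    have n2 : 0 < n.+2%:R :> R by rewrite ltr0n.
    rewrite -(ler_pM2l n2); apply: le_trans (mehler_coef_step n dl0) _.
    rewrite mulrDr; apply: lerD.
      by rewrite [leRHS]mulrA ler_wpM2r ?mehler_coef_ge0// [leRHS]mulrC An.
    rewrite [leRHS]mulrA [n.+2%:R * _]mulrC ler_wpM2r ?mehler_coef_ge0//.
    by rewrite ler_wpM2l ?addr_ge0 ?(ltW dl0)// ler_nat.
  have : x n.+2 <= dl * q * x n.+1 + (1 + dl) * q * x n.
    rewrite {1}/x; apply: (@le_trans _ _ ((dl * b n.+1 + (1 + dl) * b n) * q ^+ n.+2)).
      by rewrite ler_wpM2r// exprn_ge0// ltW.
    rewrite mulrDl; apply: lerD; first by rewrite /x !exprS le_eqVlt; apply/orP; left; apply/eqP; ring.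
    rewrite /x !exprS.
    have -> : (1 + dl) * b n * (q * (q * q ^+ n)) = q * ((1 + dl) * q * (b n * q ^+ n)) by ring.
    apply: ler_piMl; last exact: ltW.
    apply: mulr_ge0; last exact: x0.
    by rewrite mulr_ge0 ?addr_ge0 ?(ltW q0) ?(ltW dl0).
  have qd : 0 <= dl * q by rewrite mulr_ge0// ltW.
  have qd' : 0 <= (1 + dl) * q by rewrite mulr_ge0 ?addr_ge0// ltW.
  have := ler_wpM2l qd M1; have := ler_wpM2l qd' M2.
  have eM : M = dl * q * M + (1 + dl) * q * M.
    by transitivity (((2 * dl + 1) * q) * M); [rewrite dlq mul1r|ring].
  by move: eM; move: (x n.+2) (x n.+1) (x n) M M1 M2 => *; lra.
pose C := \sum_(k < n0.+2) x k.
have C_ge k : (k < n0.+2)%N -> x k <= C.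
  by move=> kn; rewrite /C (bigD1 (Ordinal kn))//= lerDl sumr_ge0.
have hC n : x (n0 + n)%N <= C /\ x (n0 + n).+1 <= C.
  elim: n => [|n [IH1 IH2]]; first by rewrite addn0; split; apply: C_ge.
  rewrite addnS; split=> //; apply: le_trans (step _ (leq_addr _ _)) _.
  by rewrite ge_max IH1 IH2.
exists C => n; rewrite ger0_norm ?mehler_coef_ge0//.
have [n0n|nn0] := leqP n0 n; first by rewrite -(subnKC n0n); case: (hC (n - n0)%N).
by apply: C_ge; rewrite ltnS (leq_trans (ltnW nn0)).
Qed.

Lemma mehler_ode z : `|z| < 1 ->
  (1 - z) * (1 + z) ^+ 2 * psum (pseries_diffs b) z =
  (z * (1 + z) + y ^+ 2 * (1 - z)) * psum b z.
Proof.
move=> z1; have hb := subgeometric_mehler; have hD := subgeometric_diffs hb.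
set D := pseries_diffs b in hD *.
have hS := subgeometric_shift hb; have hSS := subgeometric_shift hS.
have hD1 := subgeometric_shift hD; have hD2 := subgeometric_shift hD1.
have hD3 := subgeometric_shift hD2.
(* Coefficients of the difference of the two sides, with [(1 - z) (1 + z) ^ 2 = 1 + z - z ^ 2 - z ^
   3]. *)
pose e n := (D n + shift D n + (-1) * shift (shift D) n + (-1) * shift (shift (shift D)) n)
  + ((-1) * shift b n + (-1) * shift (shift b) n + (- y ^+ 2) * b n + y ^+ 2 * shift b n).
have e0 n : e n = 0.
  rewrite /e /D /pseries_diffs.
  have bE k : k.+2%:R * b k.+2 = k.+1`!%:R * (y * heat 1 y k.+1 - heat 1 y k) ^+ 2.
    have := heat_rec 1 y k.+1; rewrite mul1r /= => <-.
    by rewrite /mehler_coef factS natrM; ring.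
  have b0E : b 0%N = 1 by rewrite /mehler_coef fact0 heat_n0 expr1n mulr1.
  have b1E : b 1%N = y ^+ 2 by rewrite /mehler_coef heat_n1 mul1r.
  case: n => [|[|n]].
  - by rewrite /= b0E b1E; ring.
  - by rewrite /= bE b0E b1E heat_n1 heat_n0 (_ : 1`! = 1%N)//; ring.
  have h := heat_rec 1 y n.+1; rewrite mul1r /= in h.
  have -> : shift (shift (shift (fun i => i.+1%:R * b i.+1))) n.+2 = n%:R * b n.
    by case: (n) => [|k] //=; rewrite mul0r.
  (* The order [n] is eliminated by the recurrence, which leaves a polynomial identity in the two
     following orders. *)
  have uE : heat 1 y n = y * heat 1 y n.+1 - n.+2%:R * heat 1 y n.+2 by rewrite h; ring.
  rewrite /= bE /mehler_coef !factS !natrM uE.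
  by move: (heat 1 y n.+2) (heat 1 y n.+1) => u2 u1; ring.
have : psum e z = 0.
  rewrite (_ : e = (fun n => 0 * b n)); last by apply/funext => n; rewrite e0 mul0r.
  by rewrite psumZ// mul0r.
have hZ a c := @subgeometricZ _ a c.
rewrite /e !psumD ?psumZ ?psum_shift//; do ?[by apply: hZ | by do !apply: subgeometricD => //; apply: hZ].
lra.
Qed.

Lemma psum_mehler_ge0 z : 0 <= z < 1 -> 0 <= psum b z.
Proof.
move=> /andP[z0 z1]; apply: limr_ge.
  by apply: subgeometric_cvg; [exact: subgeometric_mehler|rewrite ger0_norm].
by apply: nearW => n; apply: sumr_ge0 => k _; rewrite mulr_ge0 ?mehler_coef_ge0 ?exprn_ge0.
Qed.

Lemma psum_mehler0 : psum b 0 = 1.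
Proof.
rewrite /psum; apply: cvg_lim => //; rewrite -cvg_shiftS.
rewrite [X in X @ \oo --> _](_ : _ = cst 1); first exact: cvg_cst.
apply/funext => n; rewrite /pseries /series/= big_nat_recl//= big1 ?addr0.
  by rewrite /mehler_coef fact0 heat_n0 expr0 expr1n !mulr1.
by move=> i _; rewrite exprS mul0r mulr0.
Qed.

(** The differential equation says that this product is constant; the square keeps
    [sqrt (1 - q ^ 2)] out of the differentiation. *)
Lemma psum_mehler q : 0 <= q < 1 ->
  psum b q ^+ 2 * (1 - q ^+ 2) * expR (- (2 * q * y ^+ 2 / (1 + q))) = 1.
Proof.
move=> /andP[q0 q1]; pose S := psum b.
pose g (z : R) := - (2 * z * y ^+ 2 / (1 + z)).
pose F (z : R) := S z ^+ 2 * (1 - z ^+ 2) * expR (g z).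
have F0 : F 0 = 1.
  by rewrite /F /S psum_mehler0 /g mulr0 !mul0r oppr0 expR0 expr1n expr0n subr0 !mulr1.
have dF (z : R) : 0 <= z < 1 -> is_derive z 1 F 0.
  move=> /andP[z0 z1]; have z1' : `|z| < 1 by rewrite ger0_norm.
  have dS := is_derive_psum subgeometric_mehler z1'.
  have ode := mehler_ode z1'.
  have zn0 : 1 + z != 0 by rewrite gt_eqF// ltr_pwDl.
  have dg : is_derive z 1 g (- (2 * y ^+ 2 / (1 + z) ^+ 2)).
    rewrite /g; apply: is_derive_eq.
    by rewrite /GRing.scale/= ?mulr1 ?mulr0; field.
  rewrite /F /S; apply: is_derive_eq.
  move: ode; rewrite /GRing.scale/= -/S.
  move: (psum (pseries_diffs b) z) (S z) (expR (g z)) => D s E ode.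
  have {}ode : D = (z * (1 + z) + y ^+ 2 * (1 - z)) * s / ((1 - z) * (1 + z) ^+ 2).
    rewrite -ode mulrC mulKf// mulf_neq0 ?expf_neq0//.
    by rewrite subr_eq0 gt_eqF.
  rewrite ode; field.
  by rewrite zn0 subr_eq0 gt_eqF.
have [q_0|qn0] := eqVneq q 0; first by rewrite q_0.
have {}q0 : 0 < q by rewrite lt_def qn0.
have [||c _] := @MVT _ F (fun=> 0) 0 q q0.
- by move=> z /[!in_itv]/= /andP[? ?]; apply: dF; apply/andP; split; [exact: ltW|exact: lt_trans q1].
- apply: derivable_within_continuous => z /[!in_itv]/= /andP[? ?].
  have : is_derive z 1 F 0 by apply: dF; apply/andP; split=> //; exact: le_lt_trans q1.
  by move=> h; exact: ex_derive.
by rewrite mul0r F0 => /subr0_eq.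
Qed.

Lemma psum_mehlerE q : 0 <= q < 1 ->
  psum b q = (Num.sqrt (1 - q ^+ 2))^-1 * expR (q * y ^+ 2 / (1 + q)).
Proof.
move=> q01; have /andP[q0 q1] := q01.
have q2 : 0 < 1 - q ^+ 2 by rewrite subr_gt0 expr_lt1.
have S0 := psum_mehler_ge0 q01.
set r := RHS; have r0 : 0 <= r by rewrite /r mulr_ge0 ?expR_ge0// invr_ge0.
apply/eqP; rewrite -(eqrXn2 (isT : (0 < 2)%N) S0 r0) /r.
rewrite exprMn exprVn sqr_sqrtr ?(ltW q2)// -expRM_natl.
apply/eqP; have := psum_mehler q01.
rewrite expRN (_ : 2 * q * y ^+ 2 / (1 + q) = 2%:R * (q * y ^+ 2 / (1 + q))); last by rewrite !mulrA.
move=> h; apply: (@mulIf _ (1 - q ^+ 2)); first by rewrite gt_eqF.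
apply: (@mulIf _ (expR (2%:R * (q * y ^+ 2 / (1 + q))))^-1); first by rewrite invr_neq0// gt_eqF// expR_gt0.
by rewrite h; field; rewrite !gt_eqF ?expR_gt0.
Qed.

Lemma mehler_coef_le n q : 0 <= q < 1 ->
  b n * q ^+ n <= (Num.sqrt (1 - q ^+ 2))^-1 * expR (q * y ^+ 2 / (1 + q)).
Proof.
move=> q01; have /andP[q0 q1] := q01; rewrite -psum_mehlerE//.
have cv : cvgn (pseries b q).
  by apply: subgeometric_cvg; [exact: subgeometric_mehler|rewrite ger0_norm].
apply: le_trans (_ : pseries b q n.+1 <= _).
  rewrite /pseries /series/= big_nat_recr//= lerDr.
  by apply: sumr_ge0 => k _; rewrite mulr_ge0 ?mehler_coef_ge0 ?exprn_ge0.
apply: nondecreasing_cvgn_le => //; apply/nondecreasing_seqP => k.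
rewrite /pseries /series/= big_nat_recr//= lerDl.
by rewrite mulr_ge0 ?mehler_coef_ge0 ?exprn_ge0.
Qed.

(* This is Cramer's inequality up to the polynomial factor, obtained
   with [q = n / (n + 1)]. *)
Lemma mehler_coef_bound n : b n <= expR 1 * n.+1%:R * expR (y ^+ 2 / 2).
Proof.
have [->|n0] := posnP n.
  rewrite /mehler_coef fact0 heat_n0 expr1n !mulr1.
  by rewrite -expRD -[leLHS]expR0 ler_expR addr_ge0// divr_ge0 ?sqr_ge0.
pose q : R := n%:R / n.+1%:R.
have nn : 0 < n.+1%:R :> R by rewrite ltr0n.
have q0 : 0 < q by rewrite divr_gt0// ltr0n.
have q1 : q < 1 by rewrite ltr_pdivrMr// mul1r ltr_nat.
have := @mehler_coef_le n q; rewrite (ltW q0) q1 => /(_ isT) h.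
have n0' : n%:R != 0 :> R by rewrite pnatr_eq0 -lt0n.
(* From [q^-1 = 1 + 1 / n <= exp(1 / n)]. *)
have e1 : 1 <= expR 1 * q ^+ n.
  have le_q : q^-1 <= expR n%:R^-1.
    apply: le_trans (expR_ge1Dx _); rewrite /q invf_div -natr1 mulrDl divff//.
    by rewrite mul1r addrC.
  rewrite -[leLHS](mulVf (_ : q ^+ n != 0)); last by rewrite expf_neq0// gt_eqF.
  rewrite ler_wpM2r ?exprn_ge0 ?(ltW q0)//.
  have -> : expR 1 = expR (n%:R^-1) ^+ n :> R by rewrite -expRM_natl divff.
  by rewrite -exprVn lerXn2r// nnegrE ?expR_ge0// invr_ge0 ltW.
(* [1 - q ^ 2 >= 1 - q = 1 / (n + 1) >= 1 / (n + 1) ^ 2]. *)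
have sq : (Num.sqrt (1 - q ^+ 2))^-1 <= n.+1%:R.
  have q2 : 0 < 1 - q ^+ 2 by rewrite subr_gt0 expr_lt1// ltW.
  rewrite -[leRHS]invrK lef_pV2 ?posrE ?invr_gt0 ?sqrtr_gt0//.
  have -> : n.+1%:R^-1 = Num.sqrt (n.+1%:R^-1 ^+ 2) :> R by rewrite sqrtr_sqr ger0_norm ?invr_ge0.
  rewrite ler_sqrt ?(ltW q2)//.
  apply: (@le_trans _ _ n.+1%:R^-1).
    by rewrite expr2 ler_piMl ?invr_ge0// invf_le1// ler1n.
  have -> : n.+1%:R^-1 = 1 - q :> R.
    by rewrite /q -natr1; field; rewrite natr1.
  by rewrite lerD2l lerN2 expr2 ler_piMl ?(ltW q1)// ltW.
have ex : expR (q * y ^+ 2 / (1 + q)) <= expR (y ^+ 2 / 2).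
  rewrite ler_expR ler_pdivrMr ?addr_gt0//.
  by have := sqr_ge0 y; move: (y ^+ 2) q0 q1 => Y; clearbody q => *; nra.
apply: (@le_trans _ _ (expR 1 * (b n * q ^+ n))).
  by rewrite mulrCA ler_peMr ?mehler_coef_ge0.
rewrite -mulrA ler_wpM2l ?expR_ge0// (le_trans h)//.
by apply: ler_pM; rewrite ?invr_ge0 ?sqrtr_ge0 ?expR_ge0.
Qed.

End mehler.

Section cauchy_product.
Context {R : realType}.
Implicit Types f g : nat -> R.

Lemma conv_partial_sum f g M : \sum_(m < M) conv f g m =
  \sum_(k < M) f k * \sum_(l < M - k) g l.
Proof.
elim: M => [|M IH]; first by rewrite !big_ord0.
rewrite big_ord_recr/= IH /conv [in RHS]big_ord_recr/= subSnn big_ord1.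
rewrite [X in _ + X]big_ord_recr/= subnn addrA; congr (_ + _).
rewrite -big_split/=; apply: eq_bigr => -[k /= kM] _.
by rewrite subSn ?(ltnW kM)// big_ord_recr/= mulrDr.
Qed.

(** The partial sums of the product run over a triangle, which lies between the squares of sides
    [M / 2] and [M]. *)
Lemma ge0_cvg_conv f g (F G : R) : (forall n, 0 <= f n) -> (forall n, 0 <= g n) ->
  series f @ \oo --> F -> series g @ \oo --> G ->
  series (conv f g) @ \oo --> F * G.
Proof.
move=> f0 g0 fF gG.
have mono (h : nat -> R) n m : (forall k, 0 <= h k) -> (n <= m)%N -> \sum_(l < n) h l <= \sum_(l < m) h l.
  by move=> h0 /subnKC <-; rewrite big_split_ord/= lerDl sumr_ge0.
have sE (h : nat -> R) n : series h n = \sum_(k < n) h k :> R by rewrite /series/= big_mkord.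
apply: (@squeeze_cvgr _ _ _ _ (fun M => series f M./2 * series g M./2)
  (fun M => series f M * series g M)).
- apply: nearW => M; rewrite !sE conv_partial_sum; apply/andP; split.
    have M2 : (M./2 <= M)%N by lia.
    rewrite mulr_suml (le_trans (_ : _ <= \sum_(k < M./2) f k * \sum_(l < M - k) g l))//.
      apply: ler_sum => -[k /= kM] _; rewrite ler_wpM2l// mono//.
      by lia.
    apply: (mono (fun k => f k * \sum_(l < M - k) g l)) => // k.
    by rewrite mulr_ge0// sumr_ge0.
  rewrite mulr_suml; apply: ler_sum => k _; rewrite ler_wpM2l// mono//.
  exact: leq_subr.
- have half_oo : half @ \oo --> \oo.
    by move=> A [n _ nA]; exists n.*2 => // m /= nm; apply: nA => /=; rewrite -[n]doubleK half_leq.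
  by apply: cvgM; [exact: (cvg_comp half _ half_oo fF)|exact: (cvg_comp half _ half_oo gG)].
- exact: cvgM.
Qed.

Lemma cvg_compositions d (f : 'I_d -> nat -> R) (F : 'I_d -> R) :
  (forall i n, 0 <= f i n) -> (forall i, series (f i) @ \oo --> F i) ->
  series (fun m => \sum_(n <- compositions d m) \prod_i f i (tnth n i)) @ \oo
    --> \prod_i F i.
Proof.
elim: d f F => [|d IH] f F f0 fF.
  rewrite big_ord0 -cvg_shiftS; apply: cvg_near_cst; apply: nearW => n.
  rewrite /series/= big_nat_recl//= big_seq1 big_ord0 big1 ?addr0// => i _.
  by rewrite big_nil.
rewrite big_ord_recl.
have := ge0_cvg_conv (f0 ord0) _ (fF ord0) (IH (fun i => f (lift ord0 i)) _ (fun i => f0 _) (fun i => fF _)).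
move=> /(_ (fun n => sumr_ge0 _ (fun k _ => prodr_ge0 _ (fun i _ => f0 _ _)))).
rewrite (_ : conv _ _ = (fun m => \sum_(n <- compositions d.+1 m) \prod_i f i (tnth n i)))//.
apply/funext => m.
rewrite big_allpairs_dep /conv -[iota 0 m.+1]/(index_iota 0 m.+1) big_mkord.
apply: eq_bigr => k _; rewrite mulr_sumr; apply: eq_bigr => n _.
by rewrite big_ord_recl tnth0; congr (_ * _); apply: eq_bigr => i _; rewrite tnthS.
Qed.

End cauchy_product.

(** * Chaos expansion of the Gaussian kernel *)

Section gaussian_kernel.
Context {R : realType}.
Implicit Types (v eps x y V : R).

Lemma gaussian_densityE V x : 0 < V ->
  gaussian_density V x = (Num.sqrt (V * pi *+ 2))^-1 * expR (- (x ^+ 2 / (V *+ 2))).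
Proof.
move=> V0; have s0 : Num.sqrt V != 0 by rewrite gt_eqF// sqrtr_gt0.
rewrite /gaussian_density normal_pdfE// /normal_peak /normal_fun subr0.
by rewrite sqr_sqrtr ?(ltW V0)// mulNr.
Qed.

Lemma gaussian_density_ge0 V x : 0 <= gaussian_density V x.
Proof. exact: normal_pdf_ge0. Qed.

Lemma gaussian_density_sqr V x : 0 < V ->
  gaussian_density V x ^+ 2 = (V * pi *+ 2)^-1 * expR (- (x ^+ 2 / V)).
Proof.
move=> V0; rewrite gaussian_densityE// exprMn exprVn sqr_sqrtr; last first.
  by rewrite mulrn_wge0// mulr_ge0 ?pi_ge0// ltW.
rewrite -expRM_natl; congr (_ * expR _); field.
by rewrite gt_eqF.
Qed.

(** Completing the square in [y]: for an observation [x] of [y] with Gaussian noise of variance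
    [eps], the joint density is the marginal density of [x] times the conditional density of [y]. *)
Lemma gaussian_product v eps x y : 0 < v -> 0 < eps ->
  gaussian_density eps (y - x) * gaussian_density v y =
  gaussian_density (v + eps) x *
    normal_pdf (x * v / (v + eps)) (Num.sqrt (v * eps / (v + eps))) y.
Proof.
move=> v0 e0; have V0 : 0 < v + eps by rewrite addr_gt0.
have w0 : 0 < v * eps / (v + eps) by rewrite divr_gt0// mulr_gt0.
have sw0 : Num.sqrt (v * eps / (v + eps)) != 0 by rewrite gt_eqF// sqrtr_gt0.
have p0 := @pi_gt0 R.
rewrite !gaussian_densityE// normal_pdfE// /normal_peak /normal_fun.
rewrite sqr_sqrtr ?(ltW w0)//.
have a0 V : 0 < V -> 0 <= V * pi *+ 2 by move=> ?; rewrite mulrn_wge0// mulr_ge0// ltW.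
rewrite !mulrA [X in X * _ = _]mulrAC [in RHS](mulrAC _ (expR _)) -!invfM -!sqrtrM ?a0//.
rewrite -!mulrA -!expRD; congr ((Num.sqrt _)^-1 * expR _).
  by move: (@pi R) => p; field; rewrite gt_eqF.
by field; rewrite !gt_eqF.
Qed.

(** Coefficient of [heat v X n] in the chaos expansion of the kernel of variance
    [V - v] at [X - x], for [X] Gaussian of variance [v]. *)
Definition hcoef n V x : R :=
  n`!%:R * gaussian_density V x / V ^+ n * heat V x n.

Lemma heat_sqr_scale V x n : 0 < V ->
  heat V x n ^+ 2 = V ^+ n * heat 1 (x / Num.sqrt V) n ^+ 2.
Proof.
move=> V0; have s0 : Num.sqrt V != 0 by rewrite gt_eqF// sqrtr_gt0.
have e : heat V x n = Num.sqrt V ^+ n * heat 1 (x / Num.sqrt V) n.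
  by rewrite -heatZ mulr1 sqr_sqrtr ?(ltW V0)// mulrCA divff// mulr1.
by rewrite e exprMn -exprM mulnC exprM sqr_sqrtr ?(ltW V0).
Qed.

(** Second moment of the term of order [n] of that expansion. *)
Definition alpha n v V x : R := hcoef n V x ^+ 2 * (v ^+ n / n`!%:R).

Lemma alphaE n v V x : 0 < V ->
  alpha n v V x = gaussian_density V x ^+ 2 * (mehler_coef (x / Num.sqrt V) n * (v / V) ^+ n).
Proof.
move=> V0; rewrite /alpha /hcoef /mehler_coef expr_div_n.
have f0 : n`!%:R != 0 :> R by rewrite pnatr_eq0 -lt0n fact_gt0.
have Vn0 : V ^+ n != 0 by rewrite expf_neq0// gt_eqF.
have := heat_sqr_scale x n V0.
move: f0 Vn0 (heat 1 _ n) (heat V x n) (gaussian_density V x).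
move: (n`!%:R) (V ^+ n) (v ^+ n) => F A C F0 A0 h1 h g e.
rewrite (_ : (F * g / A * h) ^+ 2 = F ^+ 2 * g ^+ 2 / A ^+ 2 * h ^+ 2); last by field.
by rewrite e; field; rewrite F0 A0.
Qed.

Lemma alpha_ge0 n v V x : 0 <= v -> 0 <= alpha n v V x.
Proof. by move=> v0; rewrite mulr_ge0 ?sqr_ge0// divr_ge0// exprn_ge0. Qed.

(** The squared density contributes [exp(- y ^ 2)] and Cramer's bound [exp(y ^ 2 / 2)], so half of
    the decay is left. The case [v = V] is included, which makes the bound uniform down to
    [eps = 0]. *)
Lemma alpha_le n v V x : 0 < V -> 0 <= v <= V ->
  alpha n v V x <= expR 1 * n.+1%:R * (V^-1 * expR (- (x ^+ 2 / V) / 2)).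
Proof.
move=> V0 /andP[v0 vV]; rewrite alphaE//.
set y := x / _; have y2 : y ^+ 2 = x ^+ 2 / V.
  by rewrite /y expr_div_n sqr_sqrtr// ltW.
have q1 : (v / V) ^+ n <= 1.
  by rewrite exprn_ile1 ?divr_ge0 ?(ltW V0)// ler_pdivrMr// mul1r.
have q0 : 0 <= (v / V) ^+ n by rewrite exprn_ge0// divr_ge0// ltW.
apply: (@le_trans _ _ (gaussian_density V x ^+ 2 * (expR 1 * n.+1%:R * expR (y ^+ 2 / 2)))).
  rewrite ler_wpM2l ?sqr_ge0//; apply: le_trans (mehler_coef_bound y n).
  by rewrite ler_piMr ?mehler_coef_ge0.
rewrite gaussian_density_sqr// -y2 mulrCA ler_wpM2l ?mulr_ge0 ?expR_ge0//.
rewrite -mulrA -expRD (_ : - y ^+ 2 + y ^+ 2 / 2 = - y ^+ 2 / 2); last by field.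
rewrite ler_wpM2r ?expR_ge0// lef_pV2 ?posrE ?mulrn_wgt0 ?mulr_gt0 ?pi_gt0//.
by rewrite -mulrnAr ler_peMr ?(ltW V0)//; have := @pi_ge2 R; rewrite -mulr_natr; lra.
Qed.

(** The limit is the second moment of the kernel found independently in [expect_kernel_sqr], so the
    expansion loses no mass. *)
Lemma cvg_alpha v eps x : 0 < v -> 0 < eps ->
  series (fun n => alpha n v (v + eps) x) @ \oo -->
    (Num.sqrt (eps * pi *+ 4))^-1 * gaussian_density (v + eps / 2) x.
Proof.
move=> v0 e0; have V0 : 0 < v + eps by rewrite addr_gt0.
set V := v + eps in V0 *; pose q := v / V.
have q0 : 0 < q by rewrite divr_gt0.
have q1 : q < 1 by rewrite ltr_pdivrMr// mul1r ltrDl.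
have q01 : 0 <= q < 1 by rewrite (ltW q0).
set y := x / Num.sqrt V.
have y2 : y ^+ 2 = x ^+ 2 / V by rewrite /y expr_div_n sqr_sqrtr// ltW.
have -> : (Num.sqrt (eps * pi *+ 4))^-1 * gaussian_density (v + eps / 2) x =
    gaussian_density V x ^+ 2 * psum (mehler_coef y) q.
  rewrite psum_mehlerE// gaussian_density_sqr// gaussian_densityE; last first.
    by rewrite addr_gt0// divr_gt0.
  have p0 := @pi_gt0 R.
  rewrite mulrA -invfM -sqrtrM; last by rewrite mulrn_wge0// mulr_ge0// ltW.
  rewrite [RHS]mulrACA -invfM -expRD.
  have -> : (V * pi *+ 2) = Num.sqrt ((V * pi *+ 2) ^+ 2).
    by rewrite sqrtr_sqr ger0_norm// mulrn_wge0// mulr_ge0 ?pi_ge0// ltW.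
  rewrite -sqrtrM ?sqr_ge0//; congr ((Num.sqrt _)^-1 * expR _).
    by move: (@pi R) => p; rewrite /q /V; field; rewrite (gt_eqF V0).
  rewrite y2 /q /V; field.
  by rewrite !gt_eqF// ?addr_gt0// mulr_gt0.
rewrite [X in X @ \oo --> _](_ : _ =
  (fun n => gaussian_density V x ^+ 2 * pseries (mehler_coef y) q n)).
  apply: cvgMr; apply: subgeometric_cvg; first exact: subgeometric_mehler.
  by rewrite ger0_norm// ltW.
apply/funext => n; rewrite /series/= mulr_sumr; apply: eq_bigr => k _.
by rewrite alphaE.
Qed.

End gaussian_kernel.

Section gaussian_kernel_expectation.
Context {R : realType} {disp : measure_display} {T : measurableType disp}
  (P : probability T R).
Variables (X : T -> R) (v : R).
Hypotheses (v0 : 0 < v) (mX : measurable_fun setT X).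
Hypothesis lawX : forall A, measurable A ->
  P (X @^-1` A) = normal_prob 0 (Num.sqrt v) A.

Lemma measurable_gaussian_density (eps x : R) :
  measurable_fun setT (fun y : R => gaussian_density eps (y - x)).
Proof.
apply: (measurableT_comp (measurable_normal_pdf _ _)).
exact: measurable_funB.
Qed.

(** By [gaussian_product] the expectation is an integral of the heat polynomial against the
    conditional normal law, which lowers the variance to [(v / (v + eps)) ^ 2 * (v + eps)];
    homogeneity takes the ratio out. *)
Lemma expect_kernel_heat (eps x : R) n : 0 < eps ->
  expect P (fun w => gaussian_density eps (X w - x) * heat v (X w) n) =
  hcoef n (v + eps) x * (v ^+ n / n`!%:R).
Proof.
move=> e0; have V0 : 0 < v + eps by rewrite addr_gt0.
have w0 : 0 < v * eps / (v + eps) by rewrite divr_gt0// mulr_gt0.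
have sw0 : Num.sqrt (v * eps / (v + eps)) != 0 by rewrite gt_eqF// sqrtr_gt0.
have mf : measurable_fun setT (fun y : R => gaussian_density eps (y - x) * heat v y n).
  by apply: measurable_funM; [exact: measurable_gaussian_density|exact: measurable_heat].
rewrite /expect /Rintegral (integral_normal_law mX lawX mf).1.
transitivity (\int[lebesgue_measure]_y (gaussian_density (v + eps) x *
    (heat v y n * normal_pdf (x * v / (v + eps)) (Num.sqrt (v * eps / (v + eps))) y))).
  apply: eq_Rintegral => y _; have := gaussian_product x y v0 e0.
  rewrite [gaussian_density v y]/gaussian_density => h.
  by rewrite mulrAC h; ring.
rewrite RintegralZl//; last exact: heat_normal_integrable.
rewrite integral_heat_normal// sqr_sqrtr ?(ltW w0)//.
have -> : v - v * eps / (v + eps) = (v / (v + eps)) ^+ 2 * (v + eps).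
  by field; rewrite gt_eqF.
rewrite (_ : x * v / (v + eps) = v / (v + eps) * x); last by ring.
rewrite heatZ /hcoef expr_div_n.
have f0 : n`!%:R != 0 :> R by rewrite pnatr_eq0 -lt0n fact_gt0.
have Vn0 : (v + eps) ^+ n != 0 by rewrite expf_neq0// gt_eqF.
by move: Vn0 f0; move: ((v + eps) ^+ n) (n`!%:R) => A F A0 F0; field; rewrite A0 F0.
Qed.

Lemma expect_kernel (eps x : R) : 0 < eps ->
  expect P (fun w => gaussian_density eps (X w - x)) = gaussian_density (v + eps) x.
Proof.
move=> e0; have := expect_kernel_heat x 0 e0.
rewrite /hcoef !expr0 fact0 !heat_n0 !divr1 mul1r !mulr1 => <-.
by apply: eq_Rintegral => w _; rewrite heat_n0 mulr1.
Qed.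

(** The square of the kernel of variance [eps] is a multiple of the kernel of variance [eps / 2]. *)
Lemma expect_kernel_sqr (eps x : R) : 0 < eps ->
  expect P (fun w => gaussian_density eps (X w - x) ^+ 2) =
  (Num.sqrt (eps * pi *+ 4))^-1 * gaussian_density (v + eps / 2) x.
Proof.
move=> e0; have e20 : 0 < eps / 2 by rewrite divr_gt0.
rewrite -(expect_kernel x e20) -expectZ; last first.
  apply: (@L2_bounded _ _ _ _ _ (normal_peak (Num.sqrt (eps / 2)))) => [|w].
    exact: (measurableT_comp (measurable_gaussian_density _ _) mX).
  by rewrite ger0_norm ?gaussian_density_ge0// normal_pdf_ub// gt_eqF// sqrtr_gt0.
apply: eq_Rintegral => w _; rewrite -[RHS]/(_ * gaussian_density _ _).
have p0 := @pi_gt0 R.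
rewrite gaussian_density_sqr// gaussian_densityE// mulrA -invfM -sqrtrM; last first.
  by rewrite mulrn_wge0// mulr_ge0// ltW.
have -> : (eps * pi *+ 2) = Num.sqrt ((eps * pi *+ 2) ^+ 2).
  by rewrite sqrtr_sqr ger0_norm// mulrn_wge0// mulr_ge0 ?pi_ge0// ltW.
congr ((Num.sqrt _)^-1 * expR _).
  by move: (@pi R) => p; field.
by field; rewrite gt_eqF.
Qed.

End gaussian_kernel_expectation.

(** * Lebesgue measure on tuples *)

Section measurability.
Context {R : realType}.

Lemma measurable_inv : measurable_fun setT (fun x : R => x^-1).
Proof.
rewrite (_ : (fun x => _) = fun x : R => if 0 <= x then `|x| `^ (-1) else - `|x| `^ (-1)); last first.
  apply/funext => x; have [x0|x0] := leP 0 x.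
    by rewrite ger0_norm// powR_inv1.
  by rewrite ltr0_norm// powR_inv1 ?oppr_ge0 ?(ltW x0)// invrN opprK.
have mp : measurable_fun setT (fun x : R => `|x| `^ (-1)).
  by apply: (measurableT_comp (measurable_powR _)).
apply: measurable_fun_ifT => //; first exact: measurable_fun_ler.
exact: measurableT_comp.
Qed.

Context {d : measure_display} {T : measurableType d}.
Implicit Types f V X : T -> R.

Lemma measurable_fun_inv f : measurable_fun setT f ->
  measurable_fun setT (fun t => (f t)^-1).
Proof. exact: (measurableT_comp measurable_inv). Qed.

Lemma measurable_sqrt f : measurable_fun setT f ->
  measurable_fun setT (fun t => Num.sqrt (f t)).
Proof.
apply: measurableT_comp; apply: continuous_measurable_fun; exact: sqrt_continuous.
Qed.

Lemma measurable_gaussian_density2 V X : measurable_fun setT V ->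
  measurable_fun setT X -> measurable_fun setT (fun t => gaussian_density (V t) (X t)).
Proof.
move=> mV mX; rewrite /gaussian_density /normal_pdf.
have ms := measurable_sqrt mV.
apply: measurable_fun_ifT.
- exact: measurable_fun_eqr.
- have mi : measurable_fun setT (\1_`[0, 1]%classic : R -> R) by exact: measurable_indic.
  exact: (measurableT_comp mi mX).
apply: measurable_funM.
  apply: measurable_fun_inv; apply: measurable_sqrt.
  under eq_fun do rewrite -mulr_natr.
  by do 2 apply: measurable_funM => //; exact: measurable_funX.
apply: measurableT_comp => //; apply: measurable_funM.
  apply: measurableT_comp => //; apply: measurable_funX; exact: measurable_funB.
apply: measurable_fun_inv; under eq_fun do rewrite -mulr_natr.
by apply: measurable_funM => //; exact: measurable_funX.
Qed.

Lemma measurable_heat2 V X n : measurable_fun setT V -> measurable_fun setT X ->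
  measurable_fun setT (fun t => heat (V t) (X t) n).
Proof.
move=> mV mX; suff: measurable_fun setT (fun t => heat (V t) (X t) n) /\
  measurable_fun setT (fun t => heat (V t) (X t) n.+1) by case.
elim: n => [|n [IH1 IH2]]; split=> //.
  by under eq_fun do rewrite heat_n1.
rewrite (_ : (fun t => _) = (fun t => n.+2%:R^-1 *
    (X t * heat (V t) (X t) n.+1 - V t * heat (V t) (X t) n))); last first.
  apply/funext => t; apply: (@mulfI _ n.+2%:R); first by rewrite pnatr_eq0.
  by rewrite heat_rec mulVKf ?pnatr_eq0.
by apply: measurable_funM => //; apply: measurable_funB; exact: measurable_funM.
Qed.

Lemma measurable_hcoef V (x : R) n : measurable_fun setT V ->
  measurable_fun setT (fun t => hcoef n (V t) x).
Proof.
move=> mV; rewrite /hcoef; apply: measurable_funM; last exact: measurable_heat2.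
apply: measurable_funM.
  by apply: measurable_funM => //; exact: measurable_gaussian_density2.
by apply: measurable_fun_inv; exact: measurable_funX.
Qed.

Lemma emeasurable_prod_ord k (F : 'I_k -> T -> \bar R) :
  (forall j, measurable_fun setT (F j)) ->
  measurable_fun setT (fun t => \prod_(j < k) F j t)%E.
Proof.
elim: k F => [|k IH] F mF; first by under eq_fun do rewrite big_ord0; exact: measurable_cst.
under eq_fun do rewrite big_ord_recr/=.
by apply: emeasurable_funM => //; exact: IH.
Qed.

Lemma measurable_prod_all (I : finType) (h : I -> T -> R) :
  (forall i, measurable_fun setT (h i)) -> measurable_fun setT (fun t => \prod_i h i t).
Proof. by move=> hm; apply: measurable_prod => i _. Qed.

End measurability.

Section tuple_measure.
Context {R : realType}.

Lemma measurable_sheet_pow N (H K : 'I_N -> R) m :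
  measurable_fun setT (sheet_pow H K m : N.-tuple R -> R).
Proof.
apply: measurable_prod_all => j.
exact: (measurableT_comp (measurable_powR _) (@measurable_tnth _ _ N j)).
Qed.

Lemma integral_tuple_prod n (g : 'I_n -> R -> \bar R) :
  (forall j, measurable_fun setT (g j)) -> (forall j x, 0 <= g j x)%E ->
  (\int[lebesgue_tuple n]_s (\prod_(j < n) g j (tnth s j)) =
   \prod_(j < n) \int[lebesgue_measure]_x g j x)%E.
Proof.
elim: n g => [|n IH] g mg g0.
  rewrite big_ord0 integral_dirac//.
    by rewrite diracT mul1e big_ord0.
  by under eq_fun do rewrite big_ord0; exact: measurable_cst.
have mprod k (h : 'I_k -> R -> \bar R) : (forall j, measurable_fun setT (h j)) ->
    measurable_fun setT (fun s : k.-tuple R => \prod_(j < k) h j (tnth s j))%E.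
  move=> mh; apply: emeasurable_prod_ord => j.
  exact: (measurableT_comp (mh j) (@measurable_tnth _ _ k j)).
rewrite /=.
rewrite ge0_integral_pushforward//; last 3 first.
- exact: measurable_tcons.
- exact: mprod.
- by move=> s _; apply: prode_ge0.
rewrite preimage_setT.
transitivity (\int[lebesgue_measure]_x \int[lebesgue_tuple n]_s
   (g ord0 x * \prod_(j < n) g (lift ord0 j) (tnth s j)))%E.
  have mc := measurableT_comp (mprod _ _ mg) (@measurable_tcons R n).
  rewrite (fubini_tonelli1 _ mc); last by move=> p /=; apply: prode_ge0.
  - apply: eq_integral => x _; apply: eq_integral => s _ /=.
    rewrite big_ord_recl; congr (_ * _)%E; apply: eq_bigr => j _.
    by rewrite tnthS.
transitivity (\int[lebesgue_measure]_x (g ord0 x *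
    \prod_(j < n) \int[lebesgue_measure]_y g (lift ord0 j) y))%E.
  apply: eq_integral => x _; rewrite -IH// ge0_integralZl//; last by move=> s _; apply: prode_ge0 => j _.
  exact: (mprod n (fun j => g (lift ord0 j)) (fun j => mg _)).
under eq_integral do rewrite muleC.
rewrite ge0_integralZl; first by rewrite muleC big_ord_recl.
- by [].
- exact: (mg ord0).
- by move=> x _; exact: g0.
- by apply: prode_ge0 => j _; apply: integral_ge0 => x _; exact: g0.
Qed.

(** The box without the coordinate hyperplanes, on which all variances are positive; what is removed
    is negligible. *)
Definition pos_box N (t : N.-tuple R) : set (N.-tuple R) :=
  [set s | forall j, 0 < tnth s j <= tnth t j].

Lemma measurable_tuple_cond N (A : 'I_N -> set R) : (forall j, measurable (A j)) ->
  measurable [set s : N.-tuple R | forall j, A j (tnth s j)].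
Proof.
move=> mA; rewrite (_ : [set s | _] =
    \bigcap_(j in [set: 'I_N]) ((fun s : N.-tuple R => tnth s j) @^-1` A j)).
  apply: fin_bigcap_measurable; first exact: finite_finset.
  move=> j _; rewrite -[X in measurable X]setTI.
  exact: (@measurable_tnth _ _ N j).
by apply/seteqP; split => s /= h j; [move=> _; exact: h|exact: h].
Qed.

Lemma measurable_box N (t : N.-tuple R) : measurable (box t).
Proof.
rewrite (_ : box t = [set s | forall j, `[0, tnth t j]%classic (tnth s j)]).
  by apply: (@measurable_tuple_cond _ (fun j => `[0, tnth t j]%classic)).
by apply/seteqP; split => s /= h j; have := h j; rewrite in_itv.
Qed.

Lemma measurable_pos_box N (t : N.-tuple R) : measurable (pos_box t).
Proof.
rewrite (_ : pos_box t = [set s | forall j, `]0, tnth t j]%classic (tnth s j)]).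
  by apply: (@measurable_tuple_cond _ (fun j => `]0, tnth t j]%classic)).
by apply/seteqP; split => s /= h j; have := h j; rewrite in_itv.
Qed.

Lemma measurable_orthant N : measurable (@orthant R N).
Proof.
rewrite (_ : @orthant R N = [set s | forall j, `[0, +oo[%classic (tnth s j)]).
  by apply: (@measurable_tuple_cond _ (fun j => `[0, +oo[%classic)).
by apply/seteqP; split => s /= h j; have := h j; rewrite in_itv/= andbT.
Qed.

(** The removed set is covered by boxes with one side reduced to zero. *)
Lemma axes_negligible N (t : N.-tuple R) : (forall j, 0 < tnth t j) ->
  lebesgue_tuple N (box t `\` pos_box t) = 0%E.
Proof.
move=> t0.
pose F (j : 'I_N) := [set s : N.-tuple R | forall k, 0 <= tnth s k <= (if k == j then 0 else tnth t k)].
have mF j : measurable (F j).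
  rewrite (_ : F j = box [tuple (if k == j then 0 else tnth t k) | k < N]).
    exact: measurable_box.
  by apply/seteqP; split => s /= h k; have := h k; rewrite tnth_mktuple.
have F0 j : lebesgue_tuple N (F j) = 0%E.
  have := @lebesgue_tuple_box R N [tuple 0 | k < N] [tuple (if k == j then 0 else tnth t k) | k < N].
  rewrite (_ : [set s | _] = F j); last first.
    by apply/seteqP; split => s /= h k; have := h k; rewrite !tnth_mktuple.
  move=> ->; last by move=> k; rewrite !tnth_mktuple; case: ifP => // _; exact: ltW.
  by rewrite (bigD1 j)//= !tnth_mktuple eqxx subrr mul0r.
apply/eqP; rewrite eq_le measure_ge0 andbT.
apply: (@le_trans _ _ (lebesgue_tuple N (\big[setU/set0]_(j < N) F j))).
  apply: le_measure; rewrite ?inE//.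
  - by apply: measurableD; [exact: measurable_box|exact: measurable_pos_box].
  - exact: bigsetU_measurable.
  move=> s [bs /= nps].
  have [j sj] : exists j, tnth s j <= 0.
    apply/not_existsP => h; apply: nps => j; have := bs j => /andP[_ ->].
    by rewrite andbT ltNge; apply/negP; exact: h.
  rewrite (bigD1 j)//=; left => k; have := bs k => /andP[k0 kt]; rewrite k0/=.
  by case: eqP => [->|].
have [_ ->] // : measurable (\big[setU/set0]_(j < N) F j) /\
    lebesgue_tuple N (\big[setU/set0]_(j < N) F j) = 0%E.
apply: (big_ind (fun A => measurable A /\ lebesgue_tuple N A = 0%E)).
- by split; [exact: measurable0|exact: measure0].
- by move=> A C [mA A0] [mC C0]; split; [exact: measurableU|rewrite measureU0].
- by move=> j _; split.
Qed.

Lemma pos_box_sub N (t : N.-tuple R) : pos_box t `<=` box t.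
Proof. by move=> s h j; have /andP[/ltW -> ->] := h j. Qed.

Lemma integral_box N (t : N.-tuple R) (f : N.-tuple R -> \bar R) :
  (forall j, 0 < tnth t j) -> measurable_fun setT f ->
  (\int[lebesgue_tuple N]_(s in box t) f s = \int[lebesgue_tuple N]_s (f \_ (pos_box t)) s)%E.
Proof.
move=> t0 mf; rewrite integral_mkcond; apply: ae_eq_integral => //.
- by apply/(measurable_restrictT _ (measurable_box t)); exact: measurable_funTS.
- by apply/(measurable_restrictT _ (measurable_pos_box t)); exact: measurable_funTS.
exists (box t `\` pos_box t); split.
- by apply: measurableD; [exact: measurable_box|exact: measurable_pos_box].
- exact: axes_negligible.
move=> s /= h; apply: contrapT => ns; apply: h => _.
rewrite !patchE; have [ps|ps] := pselect (pos_box t s).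
  by rewrite !mem_set//; exact: pos_box_sub.
by rewrite [s \in pos_box t]memNset// memNset// => bs; apply: ns; split.
Qed.

End tuple_measure.

(** * Integrals of power singularities *)

Section power_integrals.
Context {R : realType}.
Local Notation mu := (@lebesgue_measure R).

(** [D `^ (- b)], infinite on the diagonal even when [b = 0]. *)
Definition sing (b D : R) : \bar R := if D == 0 then +oo%E else (D `^ (- b))%:E.

Lemma sing_ge0 b D : (0 <= sing b D)%E.
Proof. by rewrite /sing; case: ifP => // _; rewrite ?leey ?lee_fin ?powR_ge0. Qed.

Lemma le_sing b D D' : 0 <= b -> 0 <= D' -> D' <= D -> (sing b D <= sing b D')%E.
Proof.
move=> b0 D'0 DD; rewrite /sing; case: (eqVneq D' 0) => [|D'n]; first by rewrite leey.
have D'p : 0 < D' by rewrite lt_neqAle eq_sym D'n.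
have Dp := lt_le_trans D'p DD.
rewrite gt_eqF// lee_fin !powRN lef_pV2 ?posrE ?powR_gt0//.
by apply: ge0_ler_powR; rewrite // nnegrE ltW.
Qed.

Lemma measurable_sing b d (T : measurableType d) (f : T -> R) :
  measurable_fun setT f -> measurable_fun setT (fun x => sing b (f x)).
Proof.
move=> mf; rewrite /sing; apply: measurable_fun_ifT.
- by apply: measurable_fun_eqr.
- exact: measurable_cst.
by apply/measurable_EFinP; exact: (measurableT_comp (measurable_powR _)).
Qed.

Lemma dyadic_scale (r y : R) : 0 < y -> y <= r ->
  exists k, r / 2 ^+ k.+1 < y <= r / 2 ^+ k.
Proof.
move=> y0 yr; have [k] : exists k, r / 2 ^+ k < y.
  have [n hn] : exists n, r / y < 2 ^+ n.
    exists (Num.trunc (r / y)).+1; apply: (lt_le_trans (truncnS_gt _)).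
    by rewrite -natrX ler_nat ltnW// ltn_expl.
  by exists n; rewrite ltr_pdivrMr ?exprn_gt0// mulrC -ltr_pdivrMr.
elim: k => [|k IH] h; first by move: h; rewrite expr0 divr1 ltNge yr.
have [/IH //|h2] := ltP (r / 2 ^+ k) y.
by exists k; rewrite h.
Qed.

Definition ball_sing (b c r u : R) : \bar R :=
  if `|u - c| <= r then sing b `|u - c| else 0%E.

Lemma ball_sing_ge0 b c r u : (0 <= ball_sing b c r u)%E.
Proof. by rewrite /ball_sing; case: ifP => // _; exact: sing_ge0. Qed.

Lemma measurable_ball_sing b c r : measurable_fun setT (ball_sing b c r).
Proof.
apply: measurable_fun_ifT; last exact: measurable_cst.
  by apply: measurable_fun_ler; [apply: measurableT_comp => //; exact: measurable_funB|].
by apply: measurable_sing; apply: measurableT_comp => //; exact: measurable_funB.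
Qed.

(** On the dyadic shell of outer radius [r / 2 ^ k] the singularity is at most
    [(r / 2 ^ k.+1) ^ (- b)]; integrating this value over the whole ball of that radius gives a
    geometric series of ratio [2 ^ b / 2 < 1]. *)
Lemma ball_power_integral (b : R) : 0 <= b < 1 -> exists2 C : R, 0 <= C & forall c r : R, 0 < r ->
  (\int[mu]_u ball_sing b c r u <= (C * r `^ (1 - b))%:E)%E.
Proof.
move=> /andP[b0 b1]; pose y := 2 `^ b : R.
have y1 : 1 <= y by rewrite -(powRr0 2) ler_powR// ler1n.
have y2 : y < 2.
  by rewrite -[ltRHS](@powRr1 _ 2)// /y /powR pnatr_eq0/= ltr_expR ltr_pM2r// ln_gt0// ltr1n.
exists (2 * y * (1 - y / 2)^-1); first by rewrite !mulr_ge0 ?invr_ge0//; lra.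
move=> c r r0.
have scaleE n : (r / 2 ^+ n) `^ (- b) = r `^ (- b) * y ^+ n.
  rewrite powRM ?invr_ge0 ?exprn_ge0 ?ltW//; congr (_ * _).
  by rewrite -(@powR_mulrn _ 2)// -powRN -powRrM mulrNN mulrC powRrM powR_mulrn ?powR_ge0.
have rb : r `^ (- b) * r = r `^ (1 - b).
  by rewrite -[X in _ * X](@powRr1 _ r) ?ltW// -powRD ?(gt_eqF r0) ?implybT// addrC.
pose A k : set R := `[c - r / 2 ^+ k, c + r / 2 ^+ k]%classic.
have mA k : measurable (A k) by exact: measurable_itv.
pose g k (u : R) := (((r / 2 ^+ k.+1)%R `^ (- b))%:E * (\1_(A k) u)%:E)%E.
have mg k : measurable_fun setT (g k).
  by apply: emeasurable_funM => //; apply/measurable_EFinP; exact: measurable_indic.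
have g0 k u : (0 <= g k u)%E by rewrite mule_ge0 ?lee_fin ?powR_ge0 ?indicE.
have gE k u : `|u - c| <= r / 2 ^+ k -> g k u = ((r / 2 ^+ k.+1) `^ (- b))%:E.
  move=> h; rewrite /g indicE mem_set ?mule1// /A/= in_itv/=.
  by move: h; rewrite ler_norml; lra.
apply: (@le_trans _ _ (\int[mu]_u (\sum_(0 <= k <oo) g k u))%E).
  apply: ge0_le_integral => //.
  - by move=> u _; exact: ball_sing_ge0.
  - exact: measurable_ball_sing.
  - by apply: (@ge0_emeasurable_sum _ _ _ _ _ predT) => *; [exact: g0|exact: mg].
  move=> u _; rewrite /ball_sing; case: ifP => [ur|_]; last by apply: nneseries_ge0.
  (* At the centre [sing] is infinite, and so is the series, all of whose terms are bounded
     below. *)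
  rewrite /sing; case: eqP => [u0|/eqP u0].
    have w k : (((r / 2)%R `^ (- b))%:E <= g k u)%E.
      rewrite gE; last by rewrite u0 divr_ge0 ?exprn_ge0 ?(ltW r0).
      have /= s1 := scaleE 1; rewrite expr1 in s1; rewrite lee_fin scaleE s1.
      rewrite ler_pM2l ?powR_gt0//; exact: ler_weXn2l.
    rewrite leye_eq; apply/eqP; apply/eqyP => M M0.
    have w0 : 0 < (r / 2) `^ (- b) by rewrite powR_gt0 ?divr_gt0.
    pose n := (Num.trunc (M / (r / 2) `^ (- b))).+1.
    apply: le_trans (nneseries_lim_ge n _); last by move=> *; exact: g0.
    apply: (@le_trans _ _ (\sum_(0 <= i < n) ((r / 2) `^ (- b))%:E)%E); last by apply: lee_sum.
    rewrite sumEFin lee_fin sumr_const_nat subn0 -[_ *+ n]mulr_natl -ler_pdivrMr//.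
    exact/ltW/truncnS_gt.
  have up : 0 < `|u - c| by rewrite lt_neqAle eq_sym u0 normr_ge0.
  have [k /andP[k1 k2]] := dyadic_scale up ur.
  apply: le_trans (nneseries_lim_ge k.+1 _); last by move=> *; exact: g0.
  rewrite big_nat_recr//=; apply: lee_paddl; first exact: sume_ge0.
  rewrite gE// lee_fin !powRN lef_pV2 ?posrE ?powR_gt0 ?divr_gt0 ?exprn_gt0//.
  by apply: ge0_ler_powR => //; rewrite ?nnegrE ?divr_ge0 ?exprn_ge0 ?(ltW r0)//; exact: ltW.
rewrite integral_nneseries//.
have iE k : (\int[mu]_u g k u = (2 * y * r `^ (1 - b) * (y / 2) ^+ k)%:E)%E.
  rewrite /g ge0_integralZl//; last 2 first.
  - by apply/measurable_EFinP; apply: measurable_indic; exact: measurable_itv.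
  - by rewrite lee_fin powR_ge0.
  rewrite (integral_indic mu measurableT (measurable_itv _)) setIT /= lebesgue_measure_itv/= lte_fin.
  rewrite ifT; last by have : 0 < r / 2 ^+ k by [rewrite divr_gt0 ?exprn_gt0]; lra.
  rewrite -EFinD -EFinM scaleE -rb; congr EFin; rewrite expr_div_n exprS.
  by field; rewrite expf_neq0.
under eq_eseriesr do rewrite iE.
apply: lime_le; first by apply: is_cvg_nneseries => k _ _; rewrite lee_fin !mulr_ge0 ?powR_ge0 ?exprn_ge0 ?divr_ge0//; lra.
apply: nearW => n; rewrite sumEFin lee_fin -mulr_sumr.
have /= := @geometric_le_lim R n 1 (y / 2); rewrite /series/= => gl.
rewrite [leRHS](_ : _ = 2 * y * r `^ (1 - b) * (1 - y / 2)^-1); last by ring.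
apply: ler_wpM2l; first by rewrite !mulr_ge0 ?powR_ge0//; lra.
rewrite -[leRHS]div1r; apply: le_trans (gl _ _ _); try lra; last by rewrite ger0_norm; lra.
by apply: ler_sum => i _; rewrite mul1r.
Qed.

Lemma power_integral (a T : R) : 0 <= a < 1 -> 0 < T ->
  (\int[mu]_(u in `]0%R, T]) ((u : R) `^ (- a))%:E < +oo)%E.
Proof.
move=> ha T0; have [C C0 h] := ball_power_integral ha.
apply: le_lt_trans (le_trans _ (h 0 T T0)) (ltry _).
rewrite integral_mkcond; apply: ge0_le_integral => //.
- by move=> u _; rewrite patchE; case: ifP => // _; rewrite lee_fin powR_ge0.
- apply/(measurable_restrictT _ (measurable_itv _)); apply: measurable_funTS; apply/measurable_EFinP; exact: measurable_powR.
- exact: measurable_ball_sing.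
move=> u _; rewrite patchE; case: ifPn => [|_]; last exact: ball_sing_ge0.
rewrite /ball_sing subr0.
rewrite inE/= in_itv/= => /andP[u0 uT]; rewrite gtr0_norm// uT.
by rewrite /sing gt_eqF.
Qed.

(** Each dyadic shell contributes at least the same amount [c]. *)
Lemma power_integral_infinite (a T : R) : 1 <= a -> 0 < T ->
  (\int[mu]_(u in `]0%R, T]) ((u : R) `^ (- a))%:E = +oo)%E.
Proof.
move=> a1 T0.
pose J n := (\int[mu]_(u in `]0%R, (T / 2 ^+ n)%R]) ((u : R) `^ (- a))%:E)%E.
pose c := T `^ (1 - a) / 2.
have c0 : 0 < c by rewrite divr_gt0 ?powR_gt0.
have mf (A : set R) : measurable_fun A (fun u : R => (u `^ (- a))%:E).
  by apply: measurable_funTS; apply/measurable_EFinP; exact: measurable_powR.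
have Jge0 n : (0 <= J n)%E by apply: integral_ge0 => u _; rewrite lee_fin powR_ge0.
have step n : (c%:E + J n.+1 <= J n)%E.
  have rn : 0 < T / 2 ^+ n.+1 by rewrite divr_gt0 ?exprn_gt0.
  have rS : T / 2 ^+ n = T / 2 ^+ n.+1 * 2 by rewrite exprS invfM; field; rewrite expf_neq0.
  rewrite /J (_ : `]0, T / 2 ^+ n]%classic = `]0, T / 2 ^+ n.+1] `|` `]T / 2 ^+ n.+1, T / 2 ^+ n])%classic; last first.
    by rewrite -itv_bndbnd_setU// ?bnd_simp ?ltW// rS; lra.
  rewrite ge0_integral_setU//; last 3 first.
  - exact: mf.
  - by move=> u _; rewrite lee_fin powR_ge0.
  - apply/disj_setPS => u [] /=; rewrite !in_itv/= => /andP[_ h1] /andP[h2 _].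
    by move: h2; rewrite ltNge h1.
  rewrite [leRHS]addeC leeD2r//.
  apply: (@le_trans _ _ (\int[mu]_(u in `](T / 2 ^+ n.+1)%R, (T / 2 ^+ n)%R]) cst ((c / (T / 2 ^+ n.+1))%R%:E) u)%E).
    rewrite (integral_cst mu (measurable_itv _))/= lebesgue_measure_itv/= lte_fin ifT; last by rewrite rS; lra.
    rewrite -EFinD -EFinM lee_fin rS [X in _ <= _ * X](_ : _ = T / 2 ^+ n.+1); last by ring.
    by rewrite divfK ?gt_eqF.
  apply: ge0_le_integral => //.
  - by move=> u _; rewrite lee_fin divr_ge0 ?ltW.
  - exact: mf.
  move=> u /=; rewrite in_itv/= => /andP[u1 u2].
  have u0 := lt_trans rn u1.
  have uT : u <= T.
    apply: (le_trans u2); rewrite ler_pdivrMr ?exprn_gt0// ler_peMr ?(ltW T0)//.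
    by rewrite exprn_ege1// ler1n.
  rewrite lee_fin [leRHS](_ : _ = u `^ (1 - a) * u^-1); last first.
    by rewrite -[u^-1]powR_inv1 ?(ltW u0)// -powRD ?(gt_eqF u0) ?implybT//; congr (_ `^ _); ring.
  rewrite /c -mulrA ler_pM ?powR_ge0 ?mulr_ge0 ?invr_ge0//.
  - exact: ltW.
  - rewrite -[1 - a]opprB !powRN lef_pV2 ?posrE ?powR_gt0//.
    by apply: ge0_ler_powR; rewrite ?nnegrE ?subr_ge0 ?(ltW u0) ?(ltW T0).
  rewrite -invfM lef_pV2 ?posrE ?mulr_gt0// mulrC -rS//.
have all_n n : ((c *+ n)%:E <= J 0%N)%E.
  suff : ((c *+ n)%:E + J n <= J 0%N)%E by apply: le_trans; rewrite leeDl.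
  elim: n => [|n IH]; first by rewrite mulr0n add0e.
  by apply: le_trans IH; rewrite mulrS addrC EFinD -addeA leeD2l.
have -> : (\int[mu]_(u in `]0%R, T]) (u `^ (- a))%:E = J 0%N)%E by rewrite /J expr0 divr1.
apply/eqyP => A A0; apply: le_trans (all_n (Num.trunc (A / c)).+1).
rewrite lee_fin -mulr_natl -ler_pdivrMr//; exact/ltW/truncnS_gt.
Qed.

(** Either [u] is at distance at least [s / 2] from [s], and then [max u s] is
    at most [3 |u - s|], or [u] is comparable to [s]. *)
Lemma schur_power_bound (a b T : R) : 0 <= a < 1 -> 0 <= b < 1 -> 0 < T ->
  exists2 C : R, 0 <= C & forall s, 0 < s <= T ->
  (\int[mu]_(u in `]0%R, T]) ((u `^ (- a))%:E * sing b (`|u - s| / Num.max u s)%R) <= C%:E)%E.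
Proof.
move=> ha hb T0; have [C C0 h] := ball_power_integral hb.
have : (\int[mu]_(u in `]0%R, T]) ((u : R) `^ (- a))%:E)%E \is a fin_num.
  by rewrite ge0_fin_numE ?power_integral//; apply: integral_ge0 => u _; rewrite lee_fin powR_ge0.
case/fineK => I0E; set I0 := fine _ in I0E.
have I0ge : 0 <= I0 by rewrite fine_ge0//; apply: integral_ge0 => u _; rewrite lee_fin powR_ge0.
have [/andP[a0 a1] /andP[b0 b1]] := (ha, hb).
have mp : measurable_fun setT (fun u : R => u `^ (- a))by exact: measurable_powR.
exists (3 `^ b * I0 + C * (2 `^ a * 3 `^ b * T `^ (1 - a))).
  by rewrite addr_ge0 ?mulr_ge0 ?powR_ge0.
move=> s /andP[s0 sT].
pose g := ball_sing b s (s / 2).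
have mg : measurable_fun setT g := @measurable_ball_sing b s (s / 2).
have g0 u : (0 <= g u)%E by exact: ball_sing_ge0.
have k0 : 0 <= (s / 2) `^ (- a) * (3 * s / 2) `^ b by rewrite mulr_ge0 ?powR_ge0.
apply: (@le_trans _ _ (\int[mu]_(u in `]0%R, T]) ((3 `^ b)%:E * (u `^ (- a))%:E +
    ((s / 2) `^ (- a) * (3 * s / 2) `^ b)%R%:E * g u))%E).
  apply: ge0_le_integral => //.
  - by move=> u _; rewrite mule_ge0 ?sing_ge0 ?lee_fin ?powR_ge0.
  - apply: measurable_funTS; apply: emeasurable_funM; first exact/measurable_EFinP.
    apply: measurable_sing; apply: measurable_funM.
      by apply: measurableT_comp => //; exact: measurable_funB.
    by apply: measurable_fun_inv; exact: measurable_maxr.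
  - apply: measurable_funTS; apply: emeasurable_funD; apply: emeasurable_funM => //.
    exact/measurable_EFinP.
  move=> u /=; rewrite in_itv/= => /andP[u0 uT].
  have m0 : 0 < Num.max u s by rewrite lt_max u0.
  have [us|us] := leP `|u - s| (s / 2); last first.
    apply: lee_paddr; first by rewrite mule_ge0.
    rewrite muleC; apply: lee_pmul; rewrite ?sing_ge0 ?lee_fin ?powR_ge0//.
    have D0 : 3^-1 <= `|u - s| / Num.max u s.
      rewrite ler_pdivlMr// mulrC ler_pdivrMr//; move: us.
      by rewrite ge_max; case: (ger0P (u - s)) => ? ?; apply/andP; split; lra.
    apply: (le_trans (le_sing b0 _ D0)) => //.
    by rewrite /sing invr_eq0 pnatr_eq0/= lee_fin -[3^-1]powR_inv1// -powRrM mulN1r opprK.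
  apply: lee_paddl; first by rewrite mule_ge0 ?lee_fin ?powR_ge0.
  have u2 : s / 2 <= u by move: us; rewrite ler_norml; lra.
  have gE : g u = sing b `|u - s| by rewrite /g /ball_sing us.
  rewrite gE EFinM -muleA; apply: lee_pmul; rewrite ?sing_ge0 ?lee_fin ?powR_ge0//.
    rewrite !powRN lef_pV2 ?posrE ?powR_gt0 ?divr_gt0//.
    by apply: ge0_ler_powR; rewrite ?nnegrE ?divr_ge0 ?(ltW s0) ?(ltW u0).
  rewrite /sing mulf_eq0 invr_eq0 (gt_eqF m0) orbF; case: eqP => [_|/eqP nz].
    by rewrite gt0_muley// lte_fin powR_gt0// divr_gt0 ?mulr_gt0.
  rewrite lee_fin powRM ?invr_ge0 ?(ltW m0)// mulrC ler_wpM2r ?powR_ge0//.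
  rewrite -powR_inv1 ?(ltW m0)// -powRrM mulN1r opprK.
  apply: ge0_ler_powR; rewrite ?nnegrE ?divr_ge0 ?mulr_ge0 ?(ltW m0) ?(ltW s0)//.
  by move: us; rewrite ler_norml ge_max; lra.
rewrite ge0_integralD//; last 4 first.
- by move=> u _; rewrite mule_ge0 ?lee_fin ?powR_ge0.
- by apply: measurable_funTS; apply: emeasurable_funM => //; exact/measurable_EFinP.
- by move=> u _; rewrite mule_ge0.
- by apply: measurable_funTS; apply: emeasurable_funM.
rewrite ge0_integralZl//; last 2 first.
- by apply: measurable_funTS; exact/measurable_EFinP.
- by move=> u _; rewrite lee_fin powR_ge0.
rewrite -I0E -EFinM EFinD leeD2l// ge0_integralZl//; last exact: measurable_funTS.
apply: (@le_trans _ _ (((s / 2) `^ (- a) * (3 * s / 2) `^ b)%R%:E * (C * (s / 2) `^ (1 - b))%R%:E)%E).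
  apply: lee_wpmul2l; first by rewrite lee_fin.
  apply: le_trans (h s (s / 2) _); last by rewrite divr_gt0.
  rewrite integral_mkcond; apply: ge0_le_integral => //.
  - by move=> u _; rewrite patchE; case: ifP.
  - by apply/(measurable_restrictT _ (measurable_itv _)); exact: measurable_funTS.
  - by move=> u _; rewrite patchE; case: ifP.
rewrite -EFinM lee_fin; have sh : 0 < s / 2 by rewrite divr_gt0.
rewrite (_ : 3 * s / 2 = 3 * (s / 2)); last by rewrite mulrA.
rewrite (@powRM _ 3 (s / 2)) ?(ltW sh)//.
(* The powers of [s / 2] combine to the positive exponent [1 - a], hence a bound uniform in [s]. *)
rewrite [leLHS](_ : _ = C * (3 `^ b * (s / 2) `^ (1 - a))); last first.
  have -> : 1 - a = - a + b + (1 - b) by ring.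
  by rewrite !powRD ?(gt_eqF sh) ?implybT//; ring.
rewrite ler_wpM2l// mulrAC mulrC ler_wpM2r ?powR_ge0//.
apply: (@le_trans _ _ (T `^ (1 - a))).
  by apply: ge0_ler_powR; rewrite ?nnegrE ?subr_ge0 ?ltW//; lra.
by rewrite ler_peMl ?powR_ge0// -[leLHS](powRr0 2) ler_powR// ler1n.
Qed.

End power_integrals.

(** * Covariance of the bifractional sheet *)

Section nondeterminism.
Context {R : realType}.
Implicit Types a b u s t H K : R.

Lemma powRB a u v : 0 < a -> a `^ (u + v) = a `^ u * a `^ v.
Proof. by move=> a0; rewrite powRD// (gt_eqF a0) implybT. Qed.

Lemma powR1l u : 1 `^ u = 1 :> R. Proof. by rewrite powR1. Qed.

Lemma powR_le1 a u : 0 <= a <= 1 -> 0 <= u -> a `^ u <= 1.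
Proof.
move=> /andP[a0 a1] u0; rewrite -[leRHS](powR1l u).
by apply: ge0_ler_powR; rewrite ?nnegrE.
Qed.

Lemma powR_ge_le1 a u v : 0 < a <= 1 -> u <= v -> a `^ v <= a `^ u.
Proof.
move=> /andP[a0 a1] uv; rewrite -(subrK u v) powRB// ler_piMl ?powR_ge0//.
by apply: powR_le1; rewrite ?subr_ge0// ltW.
Qed.

Lemma powR_subadditive K a b : 0 < K <= 1 -> 0 <= a -> 0 <= b ->
  (a + b) `^ K <= a `^ K + b `^ K.
Proof.
move=> /andP[K0 K1]; rewrite le_eqVlt => /predU1P[<- _|a0].
  by rewrite add0r lerDr powR_ge0.
rewrite le_eqVlt => /predU1P[<-|b0]; first by rewrite addr0 lerDl powR_ge0.
have ab0 := addr_gt0 a0 b0.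
have split1 (x : R) : 0 < x -> x `^ K = x * x `^ (K - 1).
  by move=> x0; rewrite -[X in X * _](@powRr1 _ x) ?ltW// -powRB// addrC subrK.
rewrite !split1// mulrDl lerD// ler_pM2l// -[K - 1]opprB !powRN lef_pV2 ?posrE ?powR_gt0//;
  by apply: ge0_ler_powR; rewrite ?nnegrE ?subr_ge0 ?lerDl ?lerDr ?(ltW a0) ?(ltW b0) ?(ltW ab0).
Qed.

Variables (H K : R).
Hypotheses (H01 : 0 < H < 1) (K01 : 0 < K <= 1).

Let H0 : 0 < H. Proof. by case/andP: H01. Qed.
Let H1 : H < 1. Proof. by case/andP: H01. Qed.
Let K0 : 0 < K. Proof. by case/andP: K01. Qed.
Let K1 : K <= 1. Proof. by case/andP: K01. Qed.
Let HK0 : 0 < H * K. Proof. exact: mulr_gt0. Qed.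
Let HK1 : H * K < 1. Proof. by apply: le_lt_trans H1; rewrite ler_piMr ?(ltW H0). Qed.

Lemma bifractional_covC s t : bifractional_cov H K s t = bifractional_cov H K t s.
Proof. by rewrite /bifractional_cov [s `^ _ + _]addrC distrC. Qed.

Lemma bifractional_cov_diag s : 0 <= s -> bifractional_cov H K s s = s `^ (2 * H * K).
Proof.
move=> s0; rewrite /bifractional_cov subrr normr0 powR0 ?mulf_neq0 ?gt_eqF// subr0.
rewrite (_ : s `^ _ + _ = 2 * s `^ (2 * H)); last by ring.
by rewrite powRM ?powR_ge0// -powRrM mulKf ?gt_eqF ?powR_gt0.
Qed.

Lemma bifractional_cov_ge0 s t : 0 <= s -> 0 <= t -> 0 <= bifractional_cov H K s t.
Proof.
wlog st : s t / s <= t.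
  by move=> h s0 t0; have [/h|/ltW /h] := leP s t; last rewrite bifractional_covC; apply.
move=> s0 t0; rewrite mulr_ge0 ?invr_ge0 ?powR_ge0// subr_ge0 powRrM.
apply: ge0_ler_powR; rewrite ?nnegrE ?addr_ge0 ?powR_ge0 ?(ltW K0)//.
rewrite ger0_norm ?subr_ge0//; apply: (@le_trans _ _ (t `^ (2 * H))); last by rewrite lerDl powR_ge0.
by apply: ge0_ler_powR; rewrite ?nnegrE ?subr_ge0 ?mulr_ge0 ?(ltW H0)// gerBl.
Qed.

(** By self-similarity, the covariance at times [u t] and [t] is this function times
    [t ^ (2 H K)]. *)
Let ucov u : R := 2 `^ (- K) * ((1 + u `^ (2 * H)) `^ K - (1 - u) `^ (2 * H * K)).

Let scale_cov u t : 0 <= u <= 1 -> 0 < t ->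
  bifractional_cov H K (u * t) t = t `^ (2 * H * K) * ucov u.
Proof.
move=> /andP[u0 u1] t0; rewrite /bifractional_cov /ucov powRN.
rewrite (_ : t - u * t = (1 - u) * t); last by ring.
rewrite normrM (gtr0_norm t0) ger0_norm ?subr_ge0// !powRM ?subr_ge0 ?(ltW t0)//.
rewrite (_ : t `^ (2 * H) + _ = (1 + u `^ (2 * H)) * t `^ (2 * H)); last by ring.
by rewrite (powRM K) ?addr_ge0 ?powR_ge0// -powRrM; ring.
Qed.

(** Used for small [u]: since [0 < H K < 1], the second factor, which bounds the correlation, tends
    to zero with [u]. *)
Let cov_far u : 0 < u <= 1 -> ucov u <= u `^ (H * K) * (u `^ (H * K) + 2 * u `^ (1 - H * K)).
Proof.
move=> u01; have /andP[u0 u1] := u01.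
have e1 : (1 + u `^ (2 * H)) `^ K <= 1 + u `^ (2 * H * K).
  by rewrite [u `^ (2 * H * K)]powRrM -[X in _ <= X + _](powR1l K) powR_subadditive ?powR_ge0.
have e2 : 1 - 2 * u <= (1 - u) `^ (2 * H * K).
  have [->|un1] := eqVneq u 1; first by apply: le_trans (powR_ge0 _ _); lra.
  have v0 : 0 < 1 - u by rewrite subr_gt0 lt_neqAle un1.
  apply: (@le_trans _ _ ((1 - u) `^ 2)).
    by rewrite (powR_mulrn 2) ?ltW// expr2; nra.
  by apply: powR_ge_le1; [lra|rewrite -mulrA ler_piMr// ltW].
apply: (@le_trans _ _ (u `^ (2 * H * K) + 2 * u)).
  apply: (@le_trans _ _ ((1 + u `^ (2 * H)) `^ K - (1 - u) `^ (2 * H * K))); last lra.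
  rewrite ler_piMl ?powRN//.
    rewrite subr_ge0 powRrM; apply: ge0_ler_powR; rewrite ?nnegrE ?addr_ge0 ?powR_ge0 ?(ltW K0)//.
    apply: (@le_trans _ _ 1); last by rewrite lerDl powR_ge0.
    by apply: powR_le1; [lra|rewrite mulr_ge0 ?ltW].
  by rewrite invf_le1 ?powR_gt0// -[leLHS](powRr0 2) ler_powR ?ler1n// ltW.
rewrite mulrDr mulrCA -!powRB// le_eqVlt; apply/orP; left; apply/eqP.
rewrite (_ : H * K + H * K = 2 * H * K); last by ring.
by rewrite (_ : H * K + (1 - H * K) = 1) ?powRr1 ?(ltW u0)//; ring.
Qed.

(* Subadditivity of the power [K] in
   [1 + u^(2 H) = 2 u^H + (1 - u^H)^2], together with [1 - u^H <= 1 - u]. *)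
Let cov_near u : 0 < u <= 1 ->
  (1 - u) `^ (2 * H * K) * (1 - (1 - u) `^ (2 * K * (1 - H))) <= 2 `^ K * (u `^ (H * K) - ucov u).
Proof.
move=> u01; have /andP[u0 u1] := u01.
have e1 : (1 + u `^ (2 * H)) `^ K <= (2 * u `^ H) `^ K + ((1 - u `^ H) `^ 2) `^ K.
  have b0 : 0 <= 1 - u `^ H by rewrite subr_ge0 powR_le1 ?(ltW u0) ?u1 ?(ltW H0).
  have -> : 1 + u `^ (2 * H) = 2 * u `^ H + (1 - u `^ H) `^ 2.
    by rewrite [2 * H]mulrC powRrM !(powR_mulrn 2) ?powR_ge0//; ring.
  by apply: powR_subadditive => //; rewrite ?mulr_ge0 ?powR_ge0.
have e2 : ((1 - u `^ H) `^ 2) `^ K <= (1 - u) `^ (2 * K).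
  rewrite -powRrM; apply: ge0_ler_powR; rewrite ?nnegrE ?subr_ge0 ?u1//.
  - by rewrite mulr_ge0 ?ltW.
  - by apply: powR_le1; [rewrite (ltW u0) u1|exact: ltW].
  by rewrite lerD2l lerN2 -[leLHS](@powRr1 _ u) ?(ltW u0)// powR_ge_le1 ?u0// (ltW H1).
have e3 : (1 - u) `^ (2 * K) = (1 - u) `^ (2 * H * K) * (1 - u) `^ (2 * K * (1 - H)).
  have [->|un1] := eqVneq u 1; first by rewrite subrr !powR0 ?mul0r// ?mulf_neq0// ?subr_eq0 gt_eqF.
  by rewrite -powRB ?subr_gt0 ?lt_neqAle ?un1//; congr (_ `^ _); ring.
have tn : 2 `^ K != 0 :> R by rewrite gt_eqF ?powR_gt0.
rewrite /ucov [leRHS]mulrBr powRN mulVKf//.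
rewrite [X in _ * X - _]powRrM -powRM ?powR_ge0//.
by rewrite mulrBr mulr1 -e3; lra.
Qed.

(** [cov_far] settles [u <= u0], where the correlation is below one half; beyond [u0] the factor
    [1 - (1 - u) ^ (2 K (1 - H))] of [cov_near] is at least [1 - q > 0]. *)
Lemma bifractional_cov_le : exists2 c, 0 < c <= 1 & forall s t, 0 < s -> 0 < t ->
  bifractional_cov H K s t <=
  s `^ (H * K) * t `^ (H * K) * (1 - c * (`|s - t| / Num.max s t) `^ (2 * H * K)).
Proof.
(* With both powers at most [1 / 8], the bracket of [cov_far] is at most [3 / 8], which is below
   [1 - c] because [c <= 1 / 2]. *)
pose e := 8^-1 : R.
have e01 : 0 <= e <= 1 by rewrite /e invr_ge0 invf_le1// ler0n ler1n.
pose u0 := Num.min (e `^ (H * K)^-1) (e `^ (1 - H * K)^-1).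
have u0gt : 0 < u0 by rewrite lt_min !powR_gt0// invr_gt0.
have u0le : u0 <= 1.
  by rewrite ge_min; apply/orP; left; apply: powR_le1 => //; rewrite invr_ge0 ltW.
have u0p : u0 `^ (H * K) <= e /\ u0 `^ (1 - H * K) <= e.
  have p1 : 0 < 1 - H * K by rewrite subr_gt0.
  split.
    apply: (@le_trans _ _ ((e `^ (H * K)^-1) `^ (H * K))).
      by apply: ge0_ler_powR; rewrite ?nnegrE ?powR_ge0 ?(ltW u0gt) ?(ltW HK0)// ge_min lexx.
    by rewrite -powRrM mulVf ?gt_eqF// powRr1// invr_ge0.
  apply: (@le_trans _ _ ((e `^ (1 - H * K)^-1) `^ (1 - H * K))).
    by apply: ge0_ler_powR; rewrite ?nnegrE ?powR_ge0 ?(ltW u0gt) ?(ltW p1)// ge_min lexx orbT.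
  by rewrite -powRrM mulVf ?gt_eqF// powRr1// invr_ge0.
pose q := (1 - u0) `^ (2 * K * (1 - H)).
have p0 : 0 < 2 * K * (1 - H) by rewrite !mulr_gt0// subr_gt0.
have q1 : q < 1.
  rewrite /q -[ltRHS](powR1l (2 * K * (1 - H))); apply: gt0_ltr_powR => //;
  by rewrite ?nnegrE ?subr_ge0// ltrBlDr ltrDl.
have q0 : 0 <= q by exact: powR_ge0.
pose c := Num.min 2^-1 (2 `^ (- K) * (1 - q)).
have c0 : 0 < c by rewrite lt_min invr_gt0 ltr0n mulr_gt0 ?powR_gt0 ?subr_gt0.
have c2 : c <= 2^-1 by rewrite ge_min lexx.
exists c; first by rewrite c0; lra.
have key u : 0 < u <= 1 -> ucov u <= u `^ (H * K) * (1 - c * (1 - u) `^ (2 * H * K)).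
  move=> u01; have /andP[ug ul] := u01.
  have v1 : (1 - u) `^ (2 * H * K) <= 1.
    by apply: powR_le1; [lra|rewrite !mulr_ge0 ?ltW].
  have v0 : 0 <= (1 - u) `^ (2 * H * K) by exact: powR_ge0.
  have [uu|uu] := leP u u0.
    apply: (le_trans (cov_far u01)); rewrite ler_wpM2l ?powR_ge0//.
    have h1 : u `^ (H * K) <= e.
      by apply: le_trans u0p.1; apply: ge0_ler_powR; rewrite ?nnegrE ?(ltW HK0) ?(ltW ug) ?(ltW u0gt).
    have h2 : u `^ (1 - H * K) <= e.
      by apply: le_trans u0p.2; apply: ge0_ler_powR; rewrite ?nnegrE ?subr_ge0 ?(ltW HK1) ?(ltW ug) ?(ltW u0gt).
    by rewrite /e in h1 h2; nra.
  have := cov_near u01; set D := (1 - u) `^ (2 * H * K) in v0 v1 * => nr.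
  have qu : (1 - u) `^ (2 * K * (1 - H)) <= q.
    by apply: ge0_ler_powR; rewrite ?nnegrE ?subr_ge0 ?(ltW p0)// lerD2l lerN2 ltW.
  have w1 : u `^ (H * K) <= 1 by apply: powR_le1; [lra|exact: ltW].
  have w0 : 0 <= u `^ (H * K) by exact: powR_ge0.
  have tK : 0 < 2 `^ K :> R by exact: powR_gt0.
  have cq : c * 2 `^ K <= 1 - q.
    by rewrite -ler_pdivlMr// mulrC -powRN ge_min lexx orbT.
  have h : D * (1 - q) <= 2 `^ K * (u `^ (H * K) - ucov u).
    by apply: le_trans nr; rewrite ler_wpM2l// lerD2l lerN2.
  have h2 : D * (c * 2 `^ K) <= 2 `^ K * (u `^ (H * K) - ucov u).
    by apply: le_trans h; rewrite ler_wpM2l.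
  have h3 : D * c <= u `^ (H * K) - ucov u.
    by rewrite -(ler_pM2l tK); apply: le_trans h2; rewrite mulrC -mulrA.
  have : u `^ (H * K) * (c * D) <= D * c by rewrite mulrC [D * c]mulrC ler_piMr// mulr_ge0// ltW.
  by lra.
have main s t : 0 < s -> 0 < t -> s <= t -> bifractional_cov H K s t <=
    s `^ (H * K) * t `^ (H * K) * (1 - c * (`|s - t| / Num.max s t) `^ (2 * H * K)).
  move=> s0 t0 st; rewrite max_r//.
  pose u := s / t; have sE : s = u * t by rewrite /u divfK ?gt_eqF.
  have u01 : 0 < u <= 1 by rewrite divr_gt0//= ler_pdivrMr// mul1r.
  clearbody u; rewrite {s s0 st}sE; have /andP[/ltW u0' u1'] := u01.
  rewrite scale_cov ?u0'//.
  have -> : `|u * t - t| / t = 1 - u.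
    rewrite (_ : u * t - t = - ((1 - u) * t)); last by ring.
    by rewrite normrN normrM (gtr0_norm t0) ger0_norm ?subr_ge0// mulfK ?gt_eqF.
  rewrite powRM ?(ltW t0)// (_ : 2 * H * K = H * K + H * K); last by ring.
  rewrite [t `^ _]powRB// -(_ : 2 * H * K = H * K + H * K); last by ring.
  apply: le_trans (ler_wpM2l _ (key u u01)) _; first by rewrite mulr_ge0 ?powR_ge0.
  by rewrite le_eqVlt; apply/orP; left; apply/eqP; ring.
move=> s t s0 t0; case/orP: (le_total s t) => st; first exact: main.
by rewrite bifractional_covC [X in _ <= X * _]mulrC distrC maxC; exact: main.
Qed.

End nondeterminism.

(** * Integrable domination, uniform in the variance of the kernel *)

Section domination.
Context {R : realType} (N d : nat).
Variables (H K : 'I_d -> 'I_N -> R) (x : 'I_d -> R) (t : N.-tuple R).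
Hypotheses (H01 : forall i j, 0 < H i j < 1) (K01 : forall i j, 0 < K i j <= 1).
Hypothesis t_gt0 : forall j, 0 < tnth t j.

Definition sheet_var i (s : N.-tuple R) : R := sheet_pow (H i) (K i) 2 s.

(** The square root of the bound of [alpha_le], up to the polynomial factor in
    the order. *)
Definition kernel_bound (eps : R) (s : N.-tuple R) : R :=
  \prod_i ((Num.sqrt (sheet_var i s + eps))^-1 *
           expR (- (x i ^+ 2 / (sheet_var i s + eps)) / 4)).

Lemma HK_gt0 i j : 0 < H i j * K i j.
Proof. by have /andP[h _] := H01 i j; have /andP[k _] := K01 i j; rewrite mulr_gt0. Qed.

Lemma HK_lt1 i j : H i j * K i j < 1.
Proof.
have /andP[h h1] := H01 i j; have /andP[k k1] := K01 i j.
by apply: le_lt_trans h1; rewrite ler_piMr// ltW.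
Qed.

Lemma sheet_pow_gt0 i m s : pos_box t s -> 0 < sheet_pow (H i) (K i) m s.
Proof. by move=> ps; apply: prodr_gt0 => j _; rewrite powR_gt0//; case/andP: (ps j). Qed.

Lemma sheet_var_gt0 i s : pos_box t s -> 0 < sheet_var i s.
Proof. exact: sheet_pow_gt0. Qed.

Lemma sheet_pow_sqr i s : sheet_pow (H i) (K i) 1 s ^+ 2 = sheet_var i s.
Proof.
rewrite /sheet_var /sheet_pow -prodrXl; apply: eq_bigr => j _.
by rewrite -powR_mulrn ?powR_ge0// -powRrM mul1r mulrC mulrA.
Qed.

Lemma sheet_pow_natr i n s : sheet_pow (H i) (K i) n%:R s = sheet_pow (H i) (K i) 1 s ^+ n.
Proof.
rewrite /sheet_pow -prodrXl; apply: eq_bigr => j _.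
by rewrite -powR_mulrn ?powR_ge0// -powRrM mul1r; congr (_ `^ _); ring.
Qed.

Lemma sqrt_sheet_var i s : Num.sqrt (sheet_var i s) = sheet_pow (H i) (K i) 1 s.
Proof. by rewrite -sheet_pow_sqr sqrtr_sqr ger0_norm// prodr_ge0// => j _; exact: powR_ge0. Qed.

Lemma kernel_bound_ge0 eps s : 0 <= kernel_bound eps s.
Proof. by apply: prodr_ge0 => i _; rewrite mulr_ge0 ?invr_ge0 ?expR_ge0. Qed.

Lemma kernel_bound_le eps s : 0 < eps -> pos_box t s ->
  kernel_bound eps s <= (Num.sqrt eps)^-1 ^+ d.
Proof.
move=> e0 ps; rewrite -[d in leRHS]card_ord -prodr_const; apply: ler_prod => i _.
have v0 := sheet_var_gt0 i ps.
rewrite mulr_ge0 ?invr_ge0 ?expR_ge0//= -[leRHS]mulr1; apply: ler_pM; rewrite ?invr_ge0 ?expR_ge0//.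
  by rewrite lef_pV2 ?posrE ?sqrtr_gt0 ?addr_gt0// ler_sqrt ?addr_ge0 ?ltW// ltrDr.
by rewrite -expR0 ler_expR mulNr oppr_le0 !divr_ge0 ?sqr_ge0// ltW// addr_gt0.
Qed.

Lemma power_expR_bound m (q : R) : 0 < q -> exists2 C : R, 0 <= C & forall u, 0 <= u ->
  (1 + u) ^+ m * expR (- (q * u)) <= C.
Proof.
move=> q0; exists (m.+1`!%:R / q ^+ m.+1 * expR q).
  by rewrite mulr_ge0 ?divr_ge0 ?exprn_ge0 ?expR_ge0// ltW.
move=> u u0; have -> : - (q * u) = q - q * (1 + u) by ring.
have u1 : 1 <= 1 + u by rewrite lerDl.
have u10 : 0 <= 1 + u by exact: le_trans u1.
apply: (@le_trans _ _ ((1 + u) ^+ m.+1 * expR (q - q * (1 + u)))).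
  by rewrite ler_pM2r ?expR_gt0// ler_weXn2l.
rewrite expRD expRN mulrCA mulrC ler_pM2r ?expR_gt0// ler_pdivrMr ?expR_gt0//.
rewrite mulrAC ler_pdivlMr ?exprn_gt0// mulrC -exprMn.
have qu : 0 <= q * (1 + u) by rewrite mulr_ge0// ltW.
have := expR_ge1Dxn m qu; have f0 : 0 < m.+1`!%:R :> R by rewrite ltr0n fact_gt0.
move=> h; rewrite -ler_pdivrMl// mulrC; apply: le_trans h; rewrite lerDr ler01//.
Qed.

(** A nonzero [x i0] yields decay in the variance of index [i0] only. All the variances vanish on
    the same axes, so some power of that one is below any other up to a constant. *)
Let axis_compare i i0 : exists2 k, (0 < k)%N & exists2 c : R, 0 < c & forall s, pos_box t s ->
  c * sheet_var i0 s ^+ k <= sheet_var i s.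
Proof.
(* Large enough for [k H_i0j K_i0j >= 1 > H_ij K_ij] on every axis; dividing the coordinates by [M]
   brings them below one, where powers decrease in the exponent. *)
pose k := (\sum_j (Num.trunc (H i0 j * K i0 j)^-1).+1 + 1)%N.
have kj j : 1 <= k%:R * (H i0 j * K i0 j).
  rewrite -ler_pdivrMr ?HK_gt0// div1r.
  apply: (@le_trans _ _ (Num.trunc (H i0 j * K i0 j)^-1).+1%:R); first exact/ltW/truncnS_gt.
  by rewrite ler_nat /k (bigD1 j)//= -addnA leq_addr.
pose M := 1 + \sum_j tnth t j.
have M1 : 1 <= M by rewrite lerDl sumr_ge0// => j _; exact: ltW.
have M0 : 0 < M by apply: lt_le_trans M1.
have Mt j : tnth t j <= M.
  rewrite /M (bigD1 j)//= addrCA lerDl addr_ge0// sumr_ge0// => l _; exact: ltW.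
exists k; first by rewrite /k addn1.
exists (\prod_(j < N) (M `^ (2 * H i0 j * K i0 j * k%:R))^-1).
  by apply: prodr_gt0 => j _; rewrite invr_gt0 powR_gt0.
move=> s ps; rewrite /sheet_var /sheet_pow -prodrXl -big_split/=.
apply: ler_prod => j _; have /andP[s0 st] := ps j.
rewrite mulr_ge0 ?exprn_ge0 ?invr_ge0 ?powR_ge0//=.
rewrite -powR_mulrn ?powR_ge0// -powRrM mulrC.
have sM : 0 < tnth s j / M by rewrite divr_gt0.
have sM1 : tnth s j / M <= 1 by rewrite ler_pdivrMr// mul1r (le_trans st).
rewrite [leLHS](_ : _ = (tnth s j / M) `^ (2 * H i0 j * K i0 j * k%:R)); last first.
  rewrite powRM ?invr_ge0 ?(ltW s0) ?(ltW M0)//; congr (_ * _).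
  by rewrite -powRN -[M^-1]powR_inv1 ?(ltW M0)// -powRrM mulN1r.
apply: (@le_trans _ _ ((tnth s j / M) `^ (2 * H i j * K i j))).
  apply: powR_ge_le1; first by rewrite sM.
  rewrite -subr_ge0 (_ : _ - _ = 2 * (k%:R * (H i0 j * K i0 j) - H i j * K i j)); last by ring.
  by rewrite mulr_ge0// subr_ge0; apply: le_trans (kj j); rewrite ltW// HK_lt1.
apply: ge0_ler_powR; rewrite ?nnegrE ?(ltW s0) ?(ltW sM)//.
  by rewrite -mulrA mulr_ge0// ltW// HK_gt0.
by rewrite ler_pdivrMr// ler_peMr// ltW.
Qed.

(** Every factor is below a power of [1 + W^-1], where [W] is the variance of index [i0] increased
    by [eps], and [exp(- x_i0 ^ 2 / (4 W))] beats all such powers. *)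
Lemma kernel_bound_nonzero i0 : x i0 != 0 -> exists2 C : R, 0 <= C & forall eps s,
  0 <= eps -> pos_box t s -> kernel_bound eps s <= C.
Proof.
move=> xi0.
have hi i : exists m, exists A : R, 0 <= A /\ forall eps s, 0 <= eps -> pos_box t s ->
    (Num.sqrt (sheet_var i s + eps))^-1 <= A * (1 + (sheet_var i0 s + eps)^-1) ^+ m.
  have [k k0 [c c0 h]] := axis_compare i i0.
  exists k, (1 + (2 ^+ k / c + 2)); split; first by rewrite !addr_ge0// divr_ge0 ?exprn_ge0 ?ltW.
  move=> eps s e0 ps; have v0 := sheet_var_gt0 i ps; have w0 := sheet_var_gt0 i0 ps.
  set V := sheet_var i s + eps; set W := sheet_var i0 s + eps.
  have V0 : 0 < V by rewrite ltr_wpDr.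
  have W0 : 0 < W by rewrite ltr_wpDr.
  have u0 : 0 <= W^-1 by rewrite invr_ge0 ltW.
  have u1 : 1 <= 1 + W^-1 by rewrite lerDl.
  have p1 : 1 <= (1 + W^-1) ^+ k by rewrite exprn_ege1.
  have pu : W^-1 <= (1 + W^-1) ^+ k.
    apply: (@le_trans _ _ (1 + W^-1)); first by rewrite lerDr.
    by rewrite -[leLHS]expr1 ler_weXn2l.
  have s1 : (Num.sqrt V)^-1 <= 1 + V^-1.
    have q0 : 0 < (Num.sqrt V)^-1 by rewrite invr_gt0 sqrtr_gt0.
    have -> : V^-1 = (Num.sqrt V)^-1 ^+ 2 by rewrite exprVn sqr_sqrtr ?ltW.
    by have := sqr_ge0 ((Num.sqrt V)^-1 - 1); rewrite !expr2; nra.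
  have Vb : V^-1 <= (2 ^+ k / c + 2) * (1 + W^-1) ^+ k.
    (* If [eps] is at most the variance of index [i0], this variance is at least [W / 2] and the
       comparison applies; otherwise [eps] itself is, and [V >= eps]. *)
    have [ew|we] := leP eps (sheet_var i0 s).
      have W2 : W / 2 <= sheet_var i0 s by rewrite /W; lra.
      have : c * (W / 2) ^+ k <= V.
        apply: (@le_trans _ _ (sheet_var i s)); last by rewrite lerDl.
        apply: le_trans (h _ ps); rewrite ler_pM2l// lerXn2r ?nnegrE ?divr_ge0 ?(ltW W0) ?(ltW w0)//.
      have cW : 0 < c * (W / 2) ^+ k by rewrite mulr_gt0 ?exprn_gt0 ?divr_gt0.
      rewrite -lef_pV2 ?posrE// => Vc; apply: (le_trans Vc).
      rewrite invfM expr_div_n invfM invrK -exprVn.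
      apply: (@le_trans _ _ (2 ^+ k / c * (1 + W^-1) ^+ k)); last first.
        by rewrite ler_wpM2r ?exprn_ge0 ?(le_trans _ u1)// lerDl.
      rewrite [X in X <= _](_ : _ = (2 ^+ k / c) * W^-1 ^+ k); last by ring.
      apply: ler_wpM2l; first by rewrite ?divr_ge0 ?exprn_ge0 ?(ltW c0).
      by rewrite lerXn2r ?nnegrE ?addr_ge0// lerDr.
    apply: (@le_trans _ _ (2 * W^-1)).
      rewrite -[2]invrK -invfM lef_pV2 ?posrE ?mulr_gt0// /V /W; lra.
    by rewrite ler_pM// lerDr divr_ge0 ?exprn_ge0 ?ltW.
  by apply: (le_trans s1); rewrite mulrDl mul1r lerD.
have [m hm] := choice hi; have [A hA] := choice hm.
pose M := (\sum_i m i)%N.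
have q0 : 0 < x i0 ^+ 2 / 4 by rewrite divr_gt0// exprn_even_gt0.
have [C C0 hC] := power_expR_bound M q0.
exists ((\prod_i A i) * C); first by rewrite mulr_ge0// prodr_ge0// => i _; case: (hA i).
move=> eps s e0 ps; have w0 := sheet_var_gt0 i0 ps.
set W := sheet_var i0 s + eps; have W0 : 0 < W by rewrite ltr_wpDr.
apply: (@le_trans _ _ ((\prod_i (A i * (1 + W^-1) ^+ m i)) * expR (- (x i0 ^+ 2 / W) / 4))).
  rewrite /kernel_bound big_split/=; apply: ler_pM.
  - by apply: prodr_ge0 => i _; rewrite invr_ge0.
  - by apply: prodr_ge0 => i _; rewrite expR_ge0.
  - by apply: ler_prod => i _; rewrite invr_ge0 sqrtr_ge0/=; case: (hA i) => _; apply.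
  rewrite (bigD1 i0)//= ler_piMr ?expR_ge0//; apply: prodr_ile1 => i _.
  rewrite expR_ge0/= -expR0 ler_expR mulNr oppr_le0 !divr_ge0 ?sqr_ge0// ltW//.
  by rewrite ltr_wpDr ?sheet_var_gt0.
rewrite big_split/= -mulrA ler_wpM2l//; first by apply: prodr_ge0 => i _; case: (hA i).
rewrite prodrXr -/M; apply: le_trans (hC W^-1 _); last by rewrite invr_ge0 ltW.
by rewrite mulNr [x i0 ^+ 2 / 4 * _]mulrAC.
Qed.

Local Notation mu := (@lebesgue_measure R).

Definition box_power (a : 'I_N -> R) (s : N.-tuple R) : R :=
  \prod_j (if 0 < tnth s j <= tnth t j then tnth s j `^ (- a j) else 0).

Lemma box_powerE a s : pos_box t s -> box_power a s = \prod_j tnth s j `^ (- a j).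
Proof. by move=> ps; apply: eq_bigr => j _; rewrite ps. Qed.

Lemma box_power_out a s : ~ pos_box t s -> box_power a s = 0.
Proof.
move=> /existsNP[j /negP nj]; apply/eqP; rewrite prodf_seq_eq0.
by apply/hasP; exists j; rewrite ?mem_index_enum//= (negbTE nj).
Qed.

Lemma box_power_ge0 a s : 0 <= box_power a s.
Proof. by apply: prodr_ge0 => j _; case: ifP => // _; exact: powR_ge0. Qed.

Lemma measurable_power_cut (T b : R) :
  measurable_fun setT (fun u : R => if 0 < u <= T then u `^ (- b) else 0).
Proof.
apply: measurable_fun_ifT; [|exact: measurable_powR|exact: measurable_cst].
by apply: measurable_and; apply: measurable_fun_ltr || apply: measurable_fun_ler.
Qed.

Lemma measurable_box_power a : measurable_fun setT (box_power a).
Proof.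
apply: measurable_prod_all => j.
exact: (measurableT_comp (measurable_power_cut _ _) (@measurable_tnth _ _ N j)).
Qed.

Lemma integral_box_power a :
  (\int[lebesgue_tuple N]_s (box_power a s)%:E =
   \prod_j \int[mu]_(u in `]0%R, tnth t j]) ((u : R) `^ (- a j))%:E)%E.
Proof.
transitivity (\prod_j \int[mu]_u ((if (0 < u <= tnth t j)%R then ((u : R) `^ (- a j))%R else 0%R)%:E))%E; last first.
  apply: eq_bigr => j _; rewrite [RHS]integral_mkcond; apply: eq_integral => u _.
  rewrite patchE; case: ifPn => [h|h]; first by rewrite mem_set//= in_itv.
  by rewrite memNset//= in_itv/=; apply/negP.
rewrite -integral_tuple_prod//.
- by apply: eq_integral => s _; rewrite -prodEFin.
- by move=> j; apply/measurable_EFinP; exact: measurable_power_cut.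
- by move=> j u; rewrite lee_fin; case: ifP => // _; exact: powR_ge0.
Qed.

Lemma box_power_integrable a : (forall j, 0 <= a j < 1) ->
  (lebesgue_tuple N).-integrable setT (EFin \o box_power a).
Proof.
move=> ha; apply/integrableP; split; first by apply/measurable_EFinP; exact: measurable_box_power.
under eq_integral do rewrite /= ger0_norm ?box_power_ge0//.
rewrite integral_box_power -ge0_fin_numE.
  apply: (big_ind (fun z : \bar R => z \is a fin_num)) => // [? ? ? ?|j _]; first exact: fin_numM.
  rewrite ge0_fin_numE ?power_integral//.
  by apply: integral_ge0 => u _; rewrite lee_fin powR_ge0.
by apply: prode_ge0 => j _; apply: integral_ge0 => u _; rewrite lee_fin powR_ge0.
Qed.

Let prod_powers s : pos_box t s ->
  \prod_i (Num.sqrt (sheet_var i s))^-1 = \prod_j tnth s j `^ (- \sum_i H i j * K i j).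
Proof.
move=> ps; under eq_bigr do rewrite sqrt_sheet_var /sheet_pow.
rewrite prodfV exchange_big/= -prodfV; apply: eq_bigr => j _.
have /andP[s0 _] := ps j.
rewrite (big_morph (fun u => tnth s j `^ (- u)) (id1 := 1) (op1 := *%R)); last 2 first.
- by move=> u v; rewrite opprD powRB.
- by rewrite oppr0 powRr0.
by rewrite -prodfV; apply: eq_bigr => i _; rewrite powRN mul1r.
Qed.

Lemma power_integral_gt0 (b T : R) : 0 <= b -> 0 < T ->
  (0 < \int[mu]_(u in `]0%R, T]) ((u : R) `^ (- b))%:E)%E.
Proof.
move=> b0 T0; apply: (@lt_le_trans _ _ (\int[mu]_(u in `]0%R, T]) cst ((T `^ (- b))%:E) u)%E).
  rewrite (integral_cst mu (measurable_itv _))/= lebesgue_measure_itv/= lte_fin T0.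
  by rewrite sube0 -EFinM lte_fin mulr_gt0 ?powR_gt0.
apply: ge0_le_integral => //.
- by move=> u _; rewrite lee_fin powR_ge0.
- by apply: measurable_funTS; apply/measurable_EFinP; exact: measurable_powR.
move=> u /=; rewrite in_itv/= => /andP[u0 uT].
rewrite lee_fin !powRN lef_pV2 ?posrE ?powR_gt0//.
by apply: ge0_ler_powR; rewrite ?nnegrE ?(ltW u0) ?(ltW T0).
Qed.

Lemma kernel_bound_zero eps s : (forall i, x i = 0) -> 0 <= eps -> pos_box t s ->
  kernel_bound eps s <= \prod_j tnth s j `^ (- \sum_i H i j * K i j).
Proof.
move=> x0 e0 ps; rewrite -prod_powers//; apply: ler_prod => i _.
rewrite x0 expr0n/= mul0r oppr0 mul0r expR0 mulr1 invr_ge0 sqrtr_ge0/=.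
have v0 := sheet_var_gt0 i ps.
by rewrite lef_pV2 ?posrE ?sqrtr_gt0 ?ltr_wpDr//; apply: ler_wsqrtr; rewrite lerDl.
Qed.

(** At [x = 0] the mean is a constant times the product over the axes of the integrals of
    [u ^ (- sum_i H_ij K_ij)]; one infinite factor is enough, the others being positive. *)
Lemma finite_mean_powers : (forall i, x i = 0) -> (local_time_mean H K x t < +oo)%E ->
  forall j, \sum_i H i j * K i j < 1.
Proof.
move=> x0 mfin j; rewrite ltNge; apply/negP => aj.
pose a l := \sum_i H i l * K i l.
suff : local_time_mean H K x t = +oo%E by move=> h; rewrite h in mfin.
pose c : R := (Num.sqrt (pi *+ 2))^-1 ^+ d.
have c0 : 0 < c by rewrite exprn_gt0// invr_gt0 sqrtr_gt0 mulrn_wgt0// pi_gt0.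
rewrite /local_time_mean integral_box//; last first.
  apply/measurable_EFinP; apply: measurable_prod_all => i.
  by apply: measurable_gaussian_density2 => //; exact: measurable_sheet_pow.
rewrite (_ : integral _ _ _ = \int[lebesgue_tuple N]_s (c%:E * (box_power a s)%:E))%E; last first.
  apply: eq_integral => s _; rewrite patchE; case: ifPn => [|] ps; last first.
    by rewrite box_power_out ?mule0//; move=> h; move/negP: ps; apply; rewrite inE.
  rewrite inE in ps; rewrite box_powerE// -prod_powers// -EFinM; congr EFin.
  rewrite /c -[d in _ ^+ d]card_ord -prodr_const -big_split/=; apply: eq_bigr => i _.
  rewrite -/(sheet_var i s) gaussian_densityE ?sheet_var_gt0// x0 expr0n/= mul0r oppr0 expR0 mulr1.
  by rewrite -mulrnAr sqrtrM ?ltW ?sheet_var_gt0// invfM mulrC.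
rewrite ge0_integralZl//; last 3 first.
- by apply/measurable_EFinP; exact: measurable_box_power.
- by move=> s _; rewrite lee_fin box_power_ge0.
- by rewrite lee_fin ltW.
rewrite integral_box_power (bigD1 j)//= power_integral_infinite//.
rewrite gt0_mulye ?gt0_muley ?lte_fin//.
apply: (big_ind (fun z : \bar R => 0 < z)%E) => // [? ? ? ?|l _]; first exact: mule_gt0.
by apply: power_integral_gt0 => //; apply: sumr_ge0 => i _; exact/ltW/HK_gt0.
Qed.

(** One dominating function serves all [eps >= 0] at once, the limit value included, and is
    integrable because its exponents are below one. *)
Lemma kernel_domination :
  (exists i, x i != 0) \/ (local_time_mean H K x t < +oo)%E ->
  exists a : 'I_N -> R, (forall j, 0 <= a j < 1) /\ exists2 C : R, 0 <= C &
    forall eps s, 0 <= eps -> pos_box t s -> kernel_bound eps s <= C * box_power a s.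
Proof.
move=> cond; have [[i0 xi0]|allz] := pselect (exists i, x i != 0).
  have [C C0 h] := kernel_bound_nonzero xi0.
  exists (fun=> 0); split=> [j|]; first by rewrite lexx ltr01.
  exists C => // eps s e0 ps; rewrite box_powerE// big1 ?mulr1; first exact: h.
  by move=> j _; rewrite oppr0 powRr0.
have x0 i : x i = 0 by apply/eqP; apply: contrapT => /negP h; apply: allz; exists i.
have mfin : (local_time_mean H K x t < +oo)%E by case: cond.
exists (fun j => \sum_i H i j * K i j); split=> [j|].
  rewrite finite_mean_powers// andbT; apply: sumr_ge0 => i _; exact/ltW/HK_gt0.
exists 1 => // eps s e0 ps; rewrite mul1r box_powerE//; exact: kernel_bound_zero.
Qed.

End domination.

(** * Chaos components of the local time *)

Section tannery.
Context {R : realType}.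

Lemma ge0_cvge0P {U : Type} {F : set_system U} {FF : Filter F} (f : U -> \bar R) : (forall u, 0 <= f u)%E ->
  (forall e : R, 0 < e -> \forall u \near F, (f u <= e%:E)%E) <-> f x @[x --> F] --> 0%E.
Proof.
move=> f0; split=> [h|].
  apply/fine_cvgP; split.
    apply: filterS (h 1 ltr01) => u fu; rewrite ge0_fin_numE//.
    by apply: le_lt_trans fu (ltry _).
  apply/cvgr0Pnorm_le => e e0; apply: filterS (h e e0) => u fu /=.
  rewrite ger0_norm ?fine_ge0//.
  have ff : f u \is a fin_num by rewrite ge0_fin_numE//; exact: le_lt_trans fu (ltry _).
  by rewrite -lee_fin fineK.
move=> /fine_cvgP[ff /cvgr0Pnorm_le h] e e0.
apply: filterS2 ff (h e e0) => u fu /= fe.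
by rewrite -(fineK fu) lee_fin (le_trans (ler_norm _)).
Qed.

(** Dominated convergence for series along an arbitrary filter: those of interest are the right
    neighbourhoods of zero and the finite sets of multi-indices. *)
Lemma tannery {U : Type} {F : set_system U} {FF : Filter F} (a : U -> nat -> R) (c : nat -> R) : (forall u m, 0 <= a u m) ->
  (forall m, 0 <= c m) -> (\forall u \near F, forall m, a u m <= c m) ->
  (\sum_(0 <= m <oo) (c m)%:E < +oo)%E -> (forall m, a u m @[u --> F] --> 0) ->
  (\sum_(0 <= m <oo) (a u m)%:E)%E @[u --> F] --> 0%E.
Proof.
move=> a0 c0 ac cfin acv; apply/ge0_cvge0P.
  by move=> u; apply: nneseries_ge0 => m _ _; rewrite lee_fin.
move=> e e0; have e2 : 0 < e / 2 by rewrite divr_gt0.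
have c0E k : (0 <= (c k)%:E)%E by rewrite lee_fin.
have /(ge0_cvge0P _).2/(_ _ e2) := nneseries_tail_cvg cfin (fun k _ => c0E k).
case; first by move=> N; apply: nneseries_ge0.
move=> M _ /(_ M (leqnn M)) hM.
have : (\sum_(m < M) a u m) @[u --> F] --> 0.
  elim: M {hM} => [|M IH].
    by rewrite (_ : (fun _ => _) = cst 0); [exact: cvg_cst|apply/funext => u; rewrite big_ord0].
  rewrite -[X in _ --> X](addr0 0) (_ : (fun _ => _) = (fun u => \sum_(m < M) a u m + a u M)).
    exact: cvgD.
  by apply/funext => u; rewrite big_ord_recr.
move/cvgr0Pnorm_le/(_ _ e2) => fin.
apply: filterS2 ac fin => u au fu.
rewrite (nneseries_split 0 M); last by move=> k _; rewrite lee_fin.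
rewrite (splitr e) EFinD add0n; apply: leeD.
  by rewrite big_mkord sumEFin lee_fin (le_trans (ler_norm _)).
by apply: le_trans hM; apply: lee_nneseries => k *; rewrite lee_fin.
Qed.

End tannery.

Lemma Rintegral_sum {R : realType} {d} {U : measurableType d}
    (mu : {measure set U -> \bar R}) (I : Type) (r : seq I) (f : I -> U -> R) :
  (forall i, mu.-integrable setT (EFin \o f i)) ->
  mu.-integrable setT (EFin \o (fun s => \sum_(i <- r) f i s)) /\
  \int[mu]_s (\sum_(i <- r) f i s) = \sum_(i <- r) \int[mu]_s f i s.
Proof.
move=> fi; elim: r => [|i r [IH1 IH2]].
  rewrite big_nil (_ : (fun s : U => _) = cst 0); last by apply/funext => s; rewrite big_nil.
  by split; [exact: integrable0|rewrite /Rintegral integral0].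
rewrite (_ : (fun s : U => _) = (fun s => f i s + \sum_(j <- r) f j s)); last first.
  by apply/funext => s; rewrite big_cons.
split; first exact: (integrableD measurableT (fi i) IH1).
by rewrite RintegralD// big_cons IH2.
Qed.

Section Gint_linear.
Context {R : realType} {disp disp' : measure_display}
  {T : measurableType disp} {U : measurableType disp'}
  (P : probability T R) (mu : {sigma_finite_measure set U -> \bar R}).
Local Notation L2 := (Lfun P 2%:E).

(** The pathwise integral is additive only almost everywhere. Testing the difference against itself
    through [dotp_Gint] reduces to the additivity of real integrals. *)
Lemma Gint_comb_le (I : choiceType) (r : seq I) (G0 : U -> T -> R) (b0 : U -> R)
    (G : I -> U -> T -> R) (b : I -> U -> R) (g : U -> R) :
  measurable_fun setT (fun p : U * T => G0 p.1 p.2) -> (forall s, G0 s \in L2) ->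
  mu.-integrable setT (EFin \o b0) -> (forall s, L2nrm P (G0 s) <= b0 s) ->
  (forall i, measurable_fun setT (fun p : U * T => G i p.1 p.2)) ->
  (forall i s, G i s \in L2) -> (forall i, mu.-integrable setT (EFin \o b i)) ->
  (forall i s, L2nrm P (G i s) <= b i s) ->
  mu.-integrable setT (EFin \o g) ->
  (forall s, L2nrm P (G0 s - \sum_(i <- r) G i s) <= g s) ->
  L2nrm P (Gint mu G0 - \sum_(i <- r) Gint mu (G i)) <= \int[mu]_s g s.
Proof.
move=> m0 l0 i0 n0 mi li ii ni ig ng.
have X0 := (Gint_L2_nrm m0 l0 i0 n0).1.
have Xi i := (Gint_L2_nrm (mi i) (li i) (ii i) (ni i)).1.
set Z := (X in L2nrm P X); have hZ : Z \in L2 by apply: L2B => //; apply: L2_sum.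
have [z0|zn] := eqVneq (L2nrm P Z) 0.
  rewrite z0; apply: Rintegral_ge0 => s _; exact: le_trans (nrm_ge0 _ _) (ng s).
have zp : 0 < L2nrm P Z by rewrite lt_neqAle eq_sym zn nrm_ge0.
rewrite -(ler_pM2l zp) -expr2 nrm_sqr {1}/Z dotpBl//; last by apply: L2_sum.
rewrite dotp_suml// (dotp_Gint m0 l0 i0 n0 hZ).
under eq_bigr do rewrite (dotp_Gint (mi _) (li _) (ii _) (ni _) hZ).
have id0 := integrable_dotpG m0 l0 i0 n0 hZ.
have idi i := integrable_dotpG (mi i) (li i) (ii i) (ni i) hZ.
have [isum sumE] := Rintegral_sum r idi.
rewrite -sumE -RintegralB// -RintegralZl//.
apply: le_Rintegral => //.
- exact: (integrableB measurableT id0 isum).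
- exact: (integrableZl measurableT (L2nrm P Z) ig).
move=> s _; rewrite -dotp_suml// -dotpBl//; last by apply: L2_sum.
apply: le_trans (ler_norm _) _; apply: le_trans (nrm_CS _ hZ) _; first by apply: L2B => //; apply: L2_sum.
by rewrite mulrC ler_wpM2l ?nrm_ge0.
Qed.

End Gint_linear.

Section chaos_terms.
Context {R : realType} (N d : nat) {disp : measure_display}
  {T : measurableType disp} (P : probability T R).
Variables (H K : 'I_d -> 'I_N -> R) (B : 'I_d -> N.-tuple R -> T -> R).
Variables (x : 'I_d -> R) (t : N.-tuple R).
Hypotheses (d_gt0 : (0 < d)%N).
Hypotheses (H01 : forall i j, 0 < H i j < 1) (K01 : forall i j, 0 < K i j <= 1).
Hypothesis hB : bifractional_sheet P H K B.
Hypothesis t_gt0 : forall j, 0 < tnth t j.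
Local Notation mu := (lebesgue_tuple N).
Local Notation L2 := (Lfun P 2%:E).
Local Notation dotp := (L2inner P).
Local Notation nrm := (L2nrm P).
Local Notation var := (sheet_var H K).
Local Notation D := (pos_box t).

Lemma sheet_measurable_at i s : orthant s -> measurable_fun setT (B i s).
Proof.
move=> os; have m := sheet_measurable hB i.
rewrite (_ : B i s = (fun p => B i p.1 p.2) \o (fun w => (s, w)))//.
apply: (measurable_comp _ _ m).
- by apply: measurableX => //; exact: measurable_orthant.
- by move=> _ [w _ <-] /=; split.
exact: measurable_pair1.
Qed.

Let mB := sheet_measurable_at.
Let gaussB := sheet_gaussian hB.
Let indepB := sheet_independent hB.

Lemma pos_box_orthant s : D s -> orthant s.
Proof. by move=> h j; have /andP[/ltW] := h j. Qed.

Lemma sheet_dotp i s s' : orthant s -> orthant s' ->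
  dotp (B i s) (B i s') = bifractional_sheet_cov (H i) (K i) s s'.
Proof.
move=> os os'; have := sheet_cov hB i os os'; rewrite unlock => E.
rewrite dotpC /L2inner /Rintegral.
by have -> : (\int[P]_w (B i s' w * B i s w)%:E = (bifractional_sheet_cov (H i) (K i) s s')%:E)%E.
Qed.

Lemma sheet_dotp_diag i s : orthant s -> dotp (B i s) (B i s) = var i s.
Proof.
move=> os; rewrite sheet_dotp//; apply: eq_bigr => j _.
by rewrite bifractional_cov_diag.
Qed.

Lemma sheet_law i s : D s -> forall A, measurable A ->
  P (B i s @^-1` A) = normal_prob 0 (Num.sqrt (var i s)) A.
Proof.
move=> Ds; have os := pos_box_orthant Ds.
have [v v0 law] := gaussB i (n := 1) (fun=> 1) (fun k => os).
have BE : (fun w => \sum_(k < 1) 1 * B i s w) = B i s.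
  by apply/funext => w; rewrite big_ord1 mul1r.
rewrite BE in law.
have := gaussian_moments_sqr (gaussian_law_moments v0 (mB i os) law).
rewrite sheet_dotp_diag// => vE; move=> A mA; rewrite law// /centered_gaussian_law -vE.
by rewrite gt_eqF// (sheet_var_gt0 H K i Ds).
Qed.

(** The field is measurable on the orthant only; its extension by zero is measurable everywhere, as
    Fubini's theorem requires. *)
Definition field_patch i : N.-tuple R * T -> R :=
  (fun p => B i p.1 p.2) \_ (@orthant R N `*` [set: T]).

Lemma field_patchE i s w : orthant s -> field_patch i (s, w) = B i s w.
Proof. by move=> os; rewrite /field_patch patchE mem_set. Qed.

Lemma measurable_field_patch i : measurable_fun setT (field_patch i).
Proof.
have mO : measurable (@orthant R N `*` [set: T]).
  by apply: measurableX => //; exact: measurable_orthant.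
apply: (measurable_restrictT (fun p => B i p.1 p.2) mO).1; exact: (sheet_measurable hB).
Qed.

Definition chaos_factor (n : d.-tuple nat) (p : N.-tuple R * T) : R :=
  \prod_i heat (var i p.1) (field_patch i p) (tnth n i).

(** The deterministic part of the integrand. The value [eps = 0] is allowed and corresponds to the
    local time itself. *)
Definition chaos_weight (n : d.-tuple nat) (eps : R) (s : N.-tuple R) : R :=
  \1_D s * \prod_i hcoef (tnth n i) (var i s + eps) (x i).

Definition chaos_integrand n eps (s : N.-tuple R) (w : T) : R :=
  chaos_weight n eps s * chaos_factor n (s, w).

Lemma measurable_indicD : measurable_fun setT (\1_D : N.-tuple R -> R).
Proof. by apply: measurable_indic; exact: measurable_pos_box. Qed.

Lemma measurable_chaos_weight n eps : measurable_fun setT (chaos_weight n eps).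
Proof.
apply: measurable_funM; first exact: measurable_indicD.
apply: measurable_prod_all => i; apply: measurable_hcoef.
by apply: measurable_funD => //; exact: measurable_sheet_pow.
Qed.

Lemma measurable_chaos_integrand n eps :
  measurable_fun setT (fun p : N.-tuple R * T => chaos_integrand n eps p.1 p.2).
Proof.
rewrite (_ : (fun p => _) = (fun p : N.-tuple R * T => chaos_weight n eps p.1 * chaos_factor n p)); last first.
  by apply/funext => -[].
apply: measurable_funM.
  exact: (measurableT_comp (measurable_chaos_weight n eps) measurable_fst).
apply: measurable_prod_all => i; apply: measurable_heat2; last exact: measurable_field_patch.
exact: (measurableT_comp (measurable_sheet_pow _ _ _) measurable_fst).
Qed.

Lemma chaos_factorE n s : D s -> (fun w => chaos_factor n (s, w)) =
  (fun w => \prod_i heat (dotp (B i s) (B i s)) (B i s w) (tnth n i)).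
Proof.
move=> Ds; have os := pos_box_orthant Ds; apply/funext => w.
by apply: eq_bigr => i _; rewrite field_patchE// sheet_dotp_diag.
Qed.

Lemma chaos_integrand_out n eps s : ~ D s -> chaos_integrand n eps s = 0.
Proof. by move=> nD; apply/funext => w; rewrite /chaos_integrand /chaos_weight indicE memNset// !mul0r. Qed.

Lemma chaos_integrandE n eps s : chaos_integrand n eps s =
  chaos_weight n eps s *: (fun w => chaos_factor n (s, w)).
Proof. by []. Qed.

Lemma chaos_integrand_chaos n eps s :
  chaos P B (\sum_(i < d) tnth n i) (chaos_integrand n eps s).
Proof.
have [Ds|nD] := pselect (D s); last first.
  by rewrite chaos_integrand_out//; apply: closed_span0; exact: (chaos_gen_L2 mB gaussB indepB).
have os := pos_box_orthant Ds.
rewrite chaos_integrandE chaos_factorE//; apply: (chaosZ mB gaussB indepB).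
apply: (prod_heat_chaos mB gaussB indepB _ d_gt0).
- by move=> i; exact: (gaussian_spaceB mB gaussB indepB).
- by move=> i j ij; exact: (sheet_orthogonal mB gaussB indepB).
- by move=> i; rewrite sheet_dotp_diag// (sheet_var_gt0 H K i Ds).
Qed.

Lemma chaos_factor_L2 n s : D s -> (fun w => chaos_factor n (s, w)) \in L2.
Proof.
move=> Ds; have os := pos_box_orthant Ds; rewrite chaos_factorE//.
apply: all_moments_L2; apply: all_moments_prod => i; apply: all_moments_heat.
apply: (gaussian_space_all_moments mB gaussB indepB).
exact: (gaussian_spaceB mB gaussB indepB).
Qed.

Lemma chaos_integrand_L2 n eps s : chaos_integrand n eps s \in L2.
Proof. by have := chaos_integrand_chaos n eps s; exact: chaos_L2. Qed.

Lemma dotp_chaos_integrand n n' eps eps' s s' :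
  dotp (chaos_integrand n eps s) (chaos_integrand n' eps' s') =
  if n == n' then chaos_weight n eps s * chaos_weight n eps' s' *
    \prod_i (bifractional_sheet_cov (H i) (K i) s s' ^+ tnth n i / (tnth n i)`!%:R) else 0.
Proof.
have out e n1 u : ~ D u -> chaos_weight n1 e u = 0.
  by move=> nD; rewrite /chaos_weight indicE memNset// mul0r.
have [Ds|nD] := pselect (D s); last first.
  by rewrite chaos_integrand_out// dotp0l out// !mul0r if_same.
have [Ds'|nD] := pselect (D s'); last first.
  by rewrite (chaos_integrand_out n' eps' nD) dotpC dotp0l (out eps')// mulr0 mul0r if_same.
rewrite !chaos_integrandE dotpZl ?L2Z ?chaos_factor_L2// dotpZr ?chaos_factor_L2//.
have [os os'] := (pos_box_orthant Ds, pos_box_orthant Ds').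
rewrite !chaos_factorE// (dotp_prod_heat mB gaussB indepB)//.
case: eqP => [<-|_]; last by rewrite !mulr0.
by rewrite mulrA; congr (_ * _); apply: eq_bigr => i _; rewrite sheet_dotp.
Qed.

Definition alpha_prod n eps s : R := \prod_i alpha (tnth n i) (var i s) (var i s + eps) (x i).

Lemma alpha_prod_ge0 n eps s : 0 <= alpha_prod n eps s.
Proof.
by apply: prodr_ge0 => i _; apply: alpha_ge0; apply: prodr_ge0 => j _; exact: powR_ge0.
Qed.

Lemma bifractional_sheet_cov_diag i s : orthant s ->
  bifractional_sheet_cov (H i) (K i) s s = var i s.
Proof. by move=> os; rewrite -sheet_dotp// sheet_dotp_diag. Qed.

Lemma dotp_chaos_integrand_diag n eps s :
  dotp (chaos_integrand n eps s) (chaos_integrand n eps s) = \1_D s * alpha_prod n eps s.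
Proof.
rewrite dotp_chaos_integrand eqxx.
have [Ds|nD] := pselect (D s); last by rewrite /chaos_weight indicE memNset// !mul0r.
rewrite /chaos_weight indicE mem_set// !mul1r /alpha_prod -!big_split/=.
apply: eq_bigr => i _; rewrite bifractional_sheet_cov_diag; last exact: pos_box_orthant.
by rewrite /alpha expr2.
Qed.

(** Square root of the product of the polynomial factors in [alpha_le]. *)
Definition cramer_weight (n : d.-tuple nat) : R :=
  \prod_(i < d) Num.sqrt (expR 1 * (tnth n i).+1%:R).

Lemma cramer_weight_ge0 n : 0 <= cramer_weight n.
Proof. by apply: prodr_ge0 => i _; exact: sqrtr_ge0. Qed.

Lemma nrm_chaos_integrand n eps s : 0 <= eps ->
  nrm (chaos_integrand n eps s) <= \1_D s * (cramer_weight n * kernel_bound H K x eps s).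
Proof.
move=> e0; rewrite /L2nrm dotp_chaos_integrand_diag.
have [Ds|nD] := pselect (D s); last by rewrite indicE memNset// !mul0r sqrtr0.
rewrite indicE mem_set// !mul1r.
rewrite -[leRHS]ger0_norm ?mulr_ge0 ?cramer_weight_ge0 ?kernel_bound_ge0// -sqrtr_sqr.
apply: ler_wsqrtr; rewrite /alpha_prod /cramer_weight /kernel_bound -big_split/= -prodrXl.
apply: ler_prod => i _; have v0 := sheet_var_gt0 H K i Ds.
rewrite alpha_ge0 ?(ltW v0)//=; apply: (le_trans (alpha_le _ _ _ _)).
- by rewrite ltr_wpDr.
- by rewrite ltW//= lerDl.
rewrite exprMn sqr_sqrtr ?mulr_ge0 ?expR_ge0//; apply: ler_wpM2l.
  by rewrite mulr_ge0 ?expR_ge0.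
rewrite exprMn exprVn sqr_sqrtr ?addr_ge0 ?(ltW v0)//.
by rewrite -expRM_natl -mulr_natl; apply: ler_wpM2l; rewrite ?invr_ge0 ?addr_ge0 ?(ltW v0)// ler_expR; lra.
Qed.

End chaos_terms.

(** The case [sigma = 0] occurs on the axes; there both sides vanish for positive [n], since
    [0^-1 = 0]. *)
Lemma chaos_factor_identity {R : realType} n (sigma x b : R) : 0 <= sigma ->
  gaussian_density (sigma ^+ 2) x / sigma ^+ n * hermite n (x / sigma) *
    (n`!%:R * sigma ^+ n * hermite n (b / sigma)) =
  hcoef n (sigma ^+ 2) x * heat (sigma ^+ 2) b n.
Proof.
rewrite le_eqVlt => /predU1P[<-|s0].
  case: n => [|n]; last by rewrite /hcoef !expr0n/= ?expr0n/= !(mul0r, invr0, mulr0).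
  by rewrite /hcoef fact0 !expr0 !hermiteE !heat_n0; ring.
have sn : sigma != 0 by rewrite gt_eqF.
have hz y : heat (sigma ^+ 2) y n = sigma ^+ n * heat 1 (y / sigma) n.
  by rewrite -heatZ mulr1 [sigma * _]mulrC divfK.
have snn : sigma ^+ n != 0 by rewrite expf_neq0.
rewrite !hermiteE /hcoef !hz [(sigma ^+ 2) ^+ n]exprAC expr2.
by move: (gaussian_density _ _) (sigma ^+ n) snn (heat 1 _ _) (heat 1 _ _) => g u un h h'; field.
Qed.

Section indices.
Variable d : nat.

Definition chaos_index M : seq (d.-tuple nat) := flatten [seq compositions d m | m <- iota 0 M].

Lemma mem_chaos_index M n : (n \in chaos_index M) = (\sum_(i < d) tnth n i < M)%N.
Proof.
apply/flatten_mapP/idP => [[m]|h].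
  by rewrite mem_iota add0n /= mem_compositions => h /eqP ->.
by exists (\sum_(i < d) tnth n i)%N; rewrite ?mem_iota// mem_compositions.
Qed.

Lemma chaos_index_uniq M : uniq (chaos_index M).
Proof.
elim: M => [//|M IH]; rewrite /chaos_index -addn1 iotaD map_cat flatten_cat/= cats0 add0n.
rewrite cat_uniq IH compositions_uniq andbT /=.
apply/hasPn => n; rewrite mem_compositions => /eqP nM.
by rewrite -/(chaos_index M) mem_chaos_index nM ltnn.
Qed.

Lemma sum_chaos_index (V : nmodType) (f : d.-tuple nat -> V) M :
  \sum_(n <- chaos_index M) f n = \sum_(m < M) \sum_(n <- compositions d m) f n.
Proof.
by rewrite /chaos_index big_flatten big_map -(big_mkord xpredT (fun m => \sum_(n <- compositions d m) f n)) /index_iota subn0.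
Qed.

End indices.

Section orthogonal_residual.
Context {R : realType} {disp : measure_display} {T : measurableType disp}
  (P : probability T R).
Local Notation L2 := (Lfun P 2%:E).

(** Pythagoras, for [Y i] that are the projections of [X] on orthogonal directions: hence the same
    [c i] in both hypotheses. *)
Lemma dotp_orthogonal_residual (I : eqType) (r : seq I) (X : T -> R) (Y : I -> T -> R)
    (c : I -> R) : uniq r -> X \in L2 -> (forall i, Y i \in L2) ->
  (forall i, L2inner P X (Y i) = c i) -> (forall i j, L2inner P (Y i) (Y j) = if i == j then c i else 0) ->
  L2inner P (X - \sum_(i <- r) Y i) (X - \sum_(i <- r) Y i) = L2inner P X X - \sum_(i <- r) c i.
Proof.
move=> ur hX hY XY YY; have hS : \sum_(i <- r) Y i \in L2 by apply: L2_sum.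
have XS : L2inner P X (\sum_(i <- r) Y i) = \sum_(i <- r) c i.
  by rewrite dotp_sumr//; apply: eq_bigr.
have SS : L2inner P (\sum_(i <- r) Y i) (\sum_(i <- r) Y i) = \sum_(i <- r) c i.
  rewrite dotp_suml//; apply: eq_big_seq => i ir.
  rewrite dotp_sumr// (bigD1_seq i)//= YY eqxx big1 ?addr0// => j ji.
  by rewrite YY eq_sym (negbTE ji).
rewrite dotpBl ?L2B// !dotpBr// SS XS dotpC XS; ring.
Qed.

End orthogonal_residual.

(** * Integrands of the approximate local time *)

Section approximation.
Context {R : realType} (N d : nat) {disp : measure_display}
  {T : measurableType disp} (P : probability T R).
Variables (H K : 'I_d -> 'I_N -> R) (B : 'I_d -> N.-tuple R -> T -> R).
Variables (x : 'I_d -> R) (t : N.-tuple R).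
Hypotheses (d_gt0 : (0 < d)%N).
Hypotheses (H01 : forall i j, 0 < H i j < 1) (K01 : forall i j, 0 < K i j <= 1).
Hypothesis hB : bifractional_sheet P H K B.
Hypothesis t_gt0 : forall j, 0 < tnth t j.
Local Notation mu := (lebesgue_tuple N).
Local Notation L2 := (Lfun P 2%:E).
Local Notation dotp := (L2inner P).
Local Notation nrm := (L2nrm P).
Local Notation var := (sheet_var H K).
Local Notation D := (pos_box t).
Local Notation G := (chaos_integrand H K B x t).
Let mB := sheet_measurable_at hB.
Let gaussB := sheet_gaussian hB.
Let indepB := sheet_independent hB.

Definition chaos_term n eps : T -> R := Gint mu (G n eps).

Let sections s w i : box t s -> field_patch B i (s, w) = B i s w.
Proof. by move=> bs; apply: field_patchE => j; have /andP[] := bs j. Qed.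

Let integral_box_indic (f : N.-tuple R -> R) : measurable_fun setT f ->
  \int[mu]_(s in box t) f s = \int[mu]_s (\1_D s * f s).
Proof.
move=> mf; rewrite /Rintegral integral_box//; last exact/measurable_EFinP.
congr fine; apply: eq_integral => s _; rewrite patchE indicE.
by case: (s \in D); rewrite ?mul1r ?mul0r.
Qed.

Lemma local_time_termE n : local_time_term B H K x t n = chaos_term n 0.
Proof.
apply/funext => w; rewrite /local_time_term /chaos_term /Gint.
transitivity (\int[mu]_(s in box t) (\prod_i hcoef (tnth n i) (var i s + 0) (x i) *
    chaos_factor H K B n (s, w))).
  apply: eq_Rintegral => s; rewrite inE => bs; rewrite -big_split/=.
  apply: eq_bigr => i _; rewrite sections// addr0 /multiple_integral [sheet_pow _ _ (tnth n i)%:R s]sheet_pow_natr.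
  rewrite -/(sheet_var H K i s) -sheet_pow_sqr chaos_factor_identity//.
  by apply: prodr_ge0 => j _; exact: powR_ge0.
rewrite integral_box_indic.
  by apply: eq_Rintegral => s _; rewrite /chaos_integrand /chaos_weight mulrA.
apply: measurable_funM.
  apply: measurable_prod_all => i; apply: measurable_hcoef.
  by apply: measurable_funD => //; exact: measurable_sheet_pow.
apply: measurable_prod_all => i; apply: measurable_heat2; first exact: measurable_sheet_pow.
exact: (measurableT_comp (measurable_field_patch hB i) (measurable_pair2 w)).
Qed.

Definition kernel_integrand eps (s : N.-tuple R) (w : T) : R :=
  \1_D s * \prod_i gaussian_density eps (field_patch B i (s, w) - x i).

Let measurable_kernel_patch eps i :
  measurable_fun setT (fun p => gaussian_density eps (field_patch B i p - x i)).
Proof.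
apply: measurable_gaussian_density2; first exact: measurable_cst.
by apply: measurable_funB => //; exact: (measurable_field_patch hB).
Qed.

Lemma approx_local_timeE eps : approx_local_time B x t eps = Gint mu (kernel_integrand eps).
Proof.
apply/funext => w; rewrite /approx_local_time /Gint.
transitivity (\int[mu]_(s in box t) \prod_i gaussian_density eps (field_patch B i (s, w) - x i)).
  by apply: eq_Rintegral => s; rewrite inE => bs; apply: eq_bigr => i _; rewrite sections.
rewrite integral_box_indic//.
apply: measurable_prod_all => i.
exact: (measurableT_comp (measurable_kernel_patch eps i) (measurable_pair2 w)).
Qed.

Lemma measurable_kernel_integrand eps :
  measurable_fun setT (fun p : N.-tuple R * T => kernel_integrand eps p.1 p.2).
Proof.
rewrite (_ : (fun p => _) = (fun p : N.-tuple R * T => \1_D p.1 *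
  \prod_i gaussian_density eps (field_patch B i p - x i))); last by apply/funext => -[].
apply: measurable_funM; first exact: (measurableT_comp (@measurable_indicD _ _ t) measurable_fst).
by apply: measurable_prod_all => i; exact: measurable_kernel_patch.
Qed.

Variable eps : R.
Hypothesis eps_gt0 : 0 < eps.

Definition kernel_height : R := (Num.sqrt (eps * pi *+ 2))^-1 ^+ d.

Lemma kernel_height_ge0 : 0 <= kernel_height.
Proof. by rewrite exprn_ge0// invr_ge0. Qed.

Lemma gaussian_density_le y : gaussian_density eps y <= (Num.sqrt (eps * pi *+ 2))^-1.
Proof.
rewrite gaussian_densityE// ler_piMr ?invr_ge0// -expR0 ler_expR oppr_le0.
by rewrite divr_ge0 ?sqr_ge0// mulrn_wge0// ltW.
Qed.

Lemma kernel_integrand_bound s : kernel_integrand eps s \in L2 /\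
  nrm (kernel_integrand eps s) <= \1_D s * kernel_height.
Proof.
have -> : \1_D s * kernel_height = nrm (cst (\1_D s * kernel_height)).
  by rewrite nrm_cst ger0_norm// mulr_ge0// ?indicE// kernel_height_ge0.
apply: nrm_le; first exact: L2_cst.
  exact: (measurableT_comp (measurable_kernel_integrand eps) (measurable_pair1 s)).
move=> w /=; rewrite !ger0_norm.
- apply: ler_wpM2l; first by rewrite indicE.
  rewrite /kernel_height -[d in leRHS]card_ord -prodr_const; apply: ler_prod => i _.
  by rewrite gaussian_density_ge0 gaussian_density_le.
- by rewrite mulr_ge0 ?indicE// kernel_height_ge0.
by rewrite mulr_ge0 ?indicE// prodr_ge0// => i _; exact: gaussian_density_ge0.
Qed.

Let kernelE s : D s -> kernel_integrand eps s = (fun w => \prod_i gaussian_density eps (B i s w - x i)).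
Proof.
move=> Ds; apply/funext => w; rewrite /kernel_integrand indicE mem_set// mul1r.
by apply: eq_bigr => i _; rewrite field_patchE//; exact: pos_box_orthant Ds.
Qed.

Let expect_prod (f : 'I_d -> R -> R) s : D s -> (forall i, measurable_fun setT (f i)) ->
  (forall i, (fun w => f i (B i s w)) \in L2) ->
  expect P (fun w => \prod_i f i (B i s w)) = \prod_i expect P (fun w => f i (B i s w)).
Proof.
move=> Ds mf fi; have os := pos_box_orthant Ds.
have ind := independentB indepB (X := fun i => B i s) (fun i => field_measurableB os).
have h := integral_prod_independent (fun i => mB i os) ind mf.
by rewrite /expect (h (fun i => L2_integrable (fi i))).2.
Qed.

Let kernel_L2 i s : D s -> (fun w => gaussian_density eps (B i s w - x i)) \in L2.
Proof.
move=> Ds; apply: (@L2_bounded _ _ _ _ _ (Num.sqrt (eps * pi *+ 2))^-1).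
  exact: (measurableT_comp (measurable_gaussian_density eps (x i)) (mB i (pos_box_orthant Ds))).
by move=> w; rewrite ger0_norm ?gaussian_density_ge0// gaussian_density_le.
Qed.

Let bounded_mul (f g : T -> R) M : g \in L2 -> measurable_fun setT f ->
  (forall w, `|f w| <= M) -> (fun w => f w * g w) \in L2.
Proof.
move=> hg mf fM; apply: (nrm_le (Y := M *: g) _ _ _).1.
- exact: L2Z.
- by apply: measurable_funM => //; exact: L2_measurable hg.
move=> w; rewrite !normrM ler_wpM2r//.
by apply: (le_trans (fM w)); rewrite ler_norm.
Qed.

Lemma dotp_kernel_integrand n s :
  dotp (kernel_integrand eps s) (G n eps s) = \1_D s * alpha_prod H K x n eps s.
Proof.
have [Ds|nD] := pselect (D s); last first.
  by rewrite chaos_integrand_out// dotpC dotp0l indicE memNset// mul0r.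
have os := pos_box_orthant Ds.
rewrite indicE mem_set// mul1r chaos_integrandE kernelE//.
rewrite dotpZr ?(chaos_factor_L2 H01 K01 hB)//; last by rewrite -kernelE//; case: (kernel_integrand_bound s).
rewrite /L2inner (_ : (fun w => _) = (fun w => \prod_i (gaussian_density eps (B i s w - x i) *
    heat (var i s) (B i s w) (tnth n i)))); last first.
  by apply/funext => w; rewrite big_split/=; congr (_ * _); apply: eq_bigr => i _; rewrite field_patchE.
have := @expect_prod (fun i y => gaussian_density eps (y - x i) * heat (var i s) y (tnth n i)) s Ds.
rewrite /expect => ->.
- rewrite /chaos_weight indicE mem_set// mul1r /alpha_prod -big_split/=; apply: eq_bigr => i _.
  have v0 := sheet_var_gt0 H K i Ds.
  have := expect_kernel_heat v0 (mB i os) (sheet_law H01 K01 hB i Ds) (x i) (tnth n i) eps_gt0.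
  by rewrite /expect => ->; rewrite /alpha; ring.
- move=> i; apply: measurable_funM; first exact: measurable_gaussian_density.
  exact: measurable_heat.
move=> i; apply: (@bounded_mul _ _ (Num.sqrt (eps * pi *+ 2))^-1).
- apply: heat_L2; apply: (gaussian_space_all_moments mB gaussB indepB).
  exact: (gaussian_spaceB mB gaussB indepB).
- exact: L2_measurable (kernel_L2 i Ds).
by move=> w; rewrite ger0_norm ?gaussian_density_ge0// gaussian_density_le.
exact: (chaos_factor_L2 H01 K01 hB n Ds).
Qed.

Definition kernel_energy s : R :=
  \prod_i ((Num.sqrt (eps * pi *+ 4))^-1 * gaussian_density (var i s + eps / 2) (x i)).

Lemma dotp_kernel_integrand_diag s :
  dotp (kernel_integrand eps s) (kernel_integrand eps s) = \1_D s * kernel_energy s.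
Proof.
have [Ds|nD] := pselect (D s); last first.
  rewrite indicE memNset// mul0r (_ : kernel_integrand eps s = 0) ?dotp0l//.
  by apply/funext => w; rewrite /kernel_integrand indicE memNset// mul0r.
have os := pos_box_orthant Ds.
rewrite indicE mem_set// mul1r kernelE// /L2inner.
rewrite (_ : (fun w => _) = (fun w => \prod_i gaussian_density eps (B i s w - x i) ^+ 2)); last first.
  by apply/funext => w; rewrite -expr2 -prodrXl.
have := @expect_prod (fun i y => gaussian_density eps (y - x i) ^+ 2) s Ds.
rewrite /expect => ->.
- apply: eq_bigr => i _.
  have := expect_kernel_sqr (sheet_var_gt0 H K i Ds) (mB i os) (sheet_law H01 K01 hB i Ds) (x i) eps_gt0.
  by rewrite /expect => ->.
- by move=> i; apply: measurable_funX; exact: measurable_gaussian_density.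
move=> i; rewrite (_ : (fun w => _) = (fun w => gaussian_density eps (B i s w - x i) * gaussian_density eps (B i s w - x i))).
  apply: (@bounded_mul _ _ (Num.sqrt (eps * pi *+ 2))^-1); first exact: kernel_L2.
    exact: L2_measurable (kernel_L2 i Ds).
  by move=> w; rewrite ger0_norm ?gaussian_density_ge0// gaussian_density_le.
by apply/funext => w; rewrite expr2.
Qed.

End approximation.

Section squared_norms.
Context {R : realType} {disp : measure_display} {T : measurableType disp}
  (P : probability T R).
Local Notation L2 := (Lfun P 2%:E).

Lemma expectation_sqr_nrm (X : T -> R) : X \in L2 ->
  ('E_P[fun w => (X w ^+ 2)%R] = (L2nrm P X ^+ 2)%:E)%E.
Proof. by move=> hX; rewrite expectation_sqr// nrm_sqr. Qed.

Lemma cvg_expectation_sqr {U : Type} {F : set_system U} {FF : Filter F} (Z : U -> T -> R) :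
  (forall u, Z u \in L2) -> L2nrm P (Z u) @[u --> F] --> 0 ->
  ('E_P[fun w => (Z u w ^+ 2)%R])%E @[u --> F] --> 0%E.
Proof.
move=> hZ hn; under eq_fun do rewrite expectation_sqr_nrm//.
apply: cvg_EFin; first exact: nearW.
rewrite (_ : fine \o _ = fun u => L2nrm P (Z u) ^+ 2)//.
by rewrite -[X in _ --> X](expr0n _ 2); exact: cvg_exprn.
Qed.

End squared_norms.

Section domination.
Context {R : realType} (N d : nat) {disp : measure_display}
  {T : measurableType disp} (P : probability T R).
Variables (H K : 'I_d -> 'I_N -> R) (B : 'I_d -> N.-tuple R -> T -> R).
Variables (x : 'I_d -> R) (t : N.-tuple R).
Hypotheses (d_gt0 : (0 < d)%N).
Hypotheses (H01 : forall i j, 0 < H i j < 1) (K01 : forall i j, 0 < K i j <= 1).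
Hypothesis hB : bifractional_sheet P H K B.
Hypothesis t_gt0 : forall j, 0 < tnth t j.
Local Notation mu := (lebesgue_tuple N).
Local Notation L2 := (Lfun P 2%:E).
Local Notation dotp := (L2inner P).
Local Notation nrm := (L2nrm P).
Local Notation var := (sheet_var H K).
Local Notation D := (pos_box t).
Local Notation G := (chaos_integrand H K B x t).
Local Notation term := (chaos_term H K B x t).
Let mB := sheet_measurable_at hB.
Let gaussB := sheet_gaussian hB.
Let indepB := sheet_independent hB.

Definition component eps (m : nat) : T -> R := \sum_(n <- compositions d m) term n eps.

Section dominated.
Variables (a : 'I_N -> R) (C eps : R).
Hypotheses (a01 : forall j, 0 <= a j < 1) (C0 : 0 <= C) (eps0 : 0 <= eps).
Hypothesis dom : forall s, D s -> kernel_bound H K x eps s <= C * box_power t a s.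

Local Notation W := (fun s => C * box_power t a s).
Definition dominating_mass : R := \int[mu]_s (C * box_power t a s).

Lemma dominating_integrable c : mu.-integrable setT (EFin \o (fun s => c * W s)).
Proof.
have h := integrableZl measurableT C (box_power_integrable t_gt0 a01).
exact: (integrableZl measurableT c h).
Qed.

Lemma dominating_ge0 s : 0 <= W s. Proof. by rewrite mulr_ge0// box_power_ge0. Qed.

Lemma dominating_mass_ge0 : 0 <= dominating_mass.
Proof. by apply: Rintegral_ge0 => s _; exact: dominating_ge0. Qed.

Lemma nrm_integrand_dominated n s : nrm (G n eps s) <= cramer_weight n * W s.
Proof.
apply: (le_trans (nrm_chaos_integrand x t H01 K01 hB n s eps0)).
have [Ds|nD] := pselect (D s).
  by rewrite indicE mem_set// mul1r ler_wpM2l ?cramer_weight_ge0// dom.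
by rewrite indicE memNset// mul0r mulr_ge0 ?cramer_weight_ge0// dominating_ge0.
Qed.

Let mG n := measurable_chaos_integrand x t hB n eps.
Let G2 n s := chaos_integrand_L2 x t d_gt0 H01 K01 hB n eps s.
Let iW (n : d.-tuple nat) := dominating_integrable (cramer_weight n).

Lemma term_L2 n : term n eps \in L2.
Proof. exact: (Gint_L2_nrm (mG n) (G2 n) (iW n) (nrm_integrand_dominated n)).1. Qed.

Lemma nrm_term n : nrm (term n eps) <= cramer_weight n * dominating_mass.
Proof.
rewrite -RintegralZl//; last first.
  exact: (integrableZl measurableT C (box_power_integrable t_gt0 a01)).
exact: (Gint_L2_nrm (mG n) (G2 n) (iW n) (nrm_integrand_dominated n)).2.
Qed.

Lemma term_chaos n : chaos P B (\sum_(i < d) tnth n i) (term n eps).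
Proof.
apply: (Gint_closed_span (mG n) (G2 n) (iW n) (nrm_integrand_dominated n)).
  exact: (chaos_gen_L2 mB gaussB indepB).
by move=> s; exact: (chaos_integrand_chaos x t d_gt0 H01 K01 hB).
Qed.

Lemma component_chaos m : chaos P B m (component eps m).
Proof.
rewrite /component big_seq; apply: (chaos_sum mB gaussB indepB) => n.
by rewrite mem_compositions => /eqP <-; exact: term_chaos.
Qed.

Lemma component_L2 m : component eps m \in L2.
Proof. by apply: L2_sum => n _; exact: term_L2. Qed.

(** A bound on the number of multi-indices, times one on their weights, times the integral of the
    dominating function. *)
Definition component_bound (m : nat) : R :=
  m.+1%:R ^+ d * Num.sqrt (expR 1 * m.+1%:R) ^+ d * dominating_mass.

Lemma cramer_weight_le m n : n \in compositions d m ->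
  cramer_weight n <= Num.sqrt (expR 1 * m.+1%:R) ^+ d :> R.
Proof.
rewrite mem_compositions => /eqP nm; rewrite -[d in leRHS]card_ord -prodr_const.
apply: ler_prod => i _; rewrite sqrtr_ge0/=; apply: ler_wsqrtr.
by rewrite ler_pM2l ?expR_gt0// ler_nat ltnS -nm (bigD1 i)//= leq_addr.
Qed.

Lemma sum_nrm_terms (r : seq (d.-tuple nat)) m : uniq r -> {subset r <= compositions d m} ->
  \sum_(n <- r) nrm (term n eps) <= component_bound m.
Proof.
move=> ur rm; pose q := Num.sqrt (expR 1 * m.+1%:R) ^+ d * dominating_mass.
have q0 : 0 <= q by rewrite mulr_ge0 ?exprn_ge0// dominating_mass_ge0.
apply: (@le_trans _ _ (\sum_(n <- r) q)).
  rewrite big_seq [leRHS]big_seq; apply: ler_sum => n /rm nr.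
  apply: (le_trans (nrm_term n)); rewrite ler_wpM2r ?dominating_mass_ge0//.
  exact: cramer_weight_le.
rewrite big_const_seq count_predT iter_addr_0 -[q *+ _]mulr_natl /component_bound -mulrA.
rewrite ler_wpM2r// -natrX ler_nat; apply: leq_trans (size_compositions d m).
exact: uniq_leq_size.
Qed.

Lemma nrm_component_part (r : seq (d.-tuple nat)) m : uniq r -> {subset r <= compositions d m} ->
  nrm (\sum_(n <- r) term n eps) <= component_bound m.
Proof.
move=> ur rm; apply: le_trans (sum_nrm_terms ur rm).
by apply: nrm_sum => n _; exact: term_L2.
Qed.

Lemma nrm_component m : nrm (component eps m) <= component_bound m.
Proof. by apply: nrm_component_part => //; exact: compositions_uniq. Qed.

End dominated.

Section approximation.
Variable eps : R.
Hypothesis eps_gt0 : 0 < eps.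
Local Notation kern := (kernel_integrand B x t eps).

(** For a fixed [eps > 0] the kernel is bounded, so null exponents suffice whatever [x]; only the
    constant depends on [eps]. *)
Let zero01 (j : 'I_N) : 0 <= (0 : R) < 1. Proof. by rewrite lexx ltr01. Qed.
Let Ceps := (Num.sqrt eps)^-1 ^+ d.
Let Ceps0 : 0 <= Ceps. Proof. by rewrite exprn_ge0// invr_ge0. Qed.

Lemma indic_box_power s : \1_D s = box_power t (fun=> 0) s.
Proof.
have [Ds|nD] := pselect (D s); last by rewrite box_power_out// indicE memNset.
by rewrite box_powerE// indicE mem_set// big1// => j _; rewrite oppr0 powRr0.
Qed.

Let dom s : D s -> kernel_bound H K x eps s <= Ceps * box_power t (fun=> 0) s.
Proof.
move=> Ds; rewrite -indic_box_power indicE mem_set// mulr1.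
exact: (kernel_bound_le H K x eps_gt0 Ds).
Qed.

Let ikern : mu.-integrable setT (EFin \o (fun s => \1_D s * kernel_height d eps)).
Proof.
have h := integrableZl measurableT (kernel_height d eps) (box_power_integrable t_gt0 zero01).
rewrite (_ : EFin \o _ = (fun s => ((kernel_height d eps)%:E * (box_power t (fun=> 0%R) s)%:E)%E))//.
by apply/funext => s /=; rewrite indic_box_power mulrC.
Qed.

Let eps_ge0 : 0 <= eps. Proof. exact: ltW. Qed.

Lemma approx_term_L2 n : term n eps \in L2.
Proof. exact: (term_L2 zero01 Ceps0 eps_ge0 dom). Qed.

Lemma approx_component_chaos m : chaos P B m (component eps m).
Proof. exact: (component_chaos zero01 Ceps0 eps_ge0 dom). Qed.

(** Norm of the remainder at a fixed [s], explicit by orthogonality; its convergence to zero is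
    Parseval's identity for a product of [d] kernels. *)
Let residual M s : R :=
  \1_D s * Num.sqrt (kernel_energy H K x eps s - \sum_(n <- chaos_index d M) alpha_prod H K x n eps s).

Let nrm_residual M s : nrm (kern s - \sum_(n <- chaos_index d M) G n eps s) = residual M s.
Proof.
rewrite /L2nrm (dotp_orthogonal_residual (c := fun n => \1_D s * alpha_prod H K x n eps s)).
- rewrite (dotp_kernel_integrand_diag x t H01 K01 hB eps_gt0) -mulr_sumr -mulrBr /residual.
  by rewrite indicE; case: (s \in D); rewrite ?mul1r ?mul0r ?sqrtr0.
- exact: chaos_index_uniq.
- by case: (kernel_integrand_bound x t hB eps_gt0 s).
- by move=> n; exact: chaos_integrand_L2.
- by move=> n; exact: (dotp_kernel_integrand x t H01 K01 hB eps_gt0).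
move=> n n'; case: eqP => [<-|nn]; first exact: (dotp_chaos_integrand_diag x t H01 K01 hB).
by rewrite (dotp_chaos_integrand x t H01 K01 hB); case: eqP.
Qed.

Let residual_ge0 M s : 0 <= residual M s.
Proof. by rewrite -nrm_residual nrm_ge0. Qed.

Let residual_le M s : residual M s <= \1_D s * kernel_height d eps.
Proof.
have [_ h] := kernel_integrand_bound x t hB eps_gt0 s; apply: le_trans h.
rewrite /L2nrm (dotp_kernel_integrand_diag x t H01 K01 hB eps_gt0) /residual.
rewrite indicE; case: (s \in D); rewrite ?mul1r ?mul0r ?sqrtr0//.
by apply: ler_wsqrtr; rewrite gerBl sumr_ge0// => n _; exact: alpha_prod_ge0.
Qed.

Let measurable_residual M : measurable_fun setT (residual M).
Proof.
apply: measurable_funM; first exact: measurable_indicD.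
have mv i : measurable_fun setT (var i : N.-tuple R -> R) by exact: measurable_sheet_pow.
apply: measurable_sqrt; apply: measurable_funB.
  apply: measurable_prod_all => i; apply: measurable_funM; first exact: measurable_cst.
  by apply: measurable_gaussian_density2 => //; exact: measurable_funD.
apply: measurable_sum => n; apply: measurable_prod_all => i; rewrite /alpha.
apply: measurable_funM.
  by apply: measurable_funX; apply: measurable_hcoef; exact: measurable_funD.
by apply: measurable_funM => //; exact: measurable_funX.
Qed.

Let integrable_residual M : mu.-integrable setT (EFin \o residual M).
Proof.
apply: le_integrable ikern => //; first exact/measurable_EFinP.
move=> s _ /=; rewrite lee_fin !ger0_norm ?residual_le//.
exact: le_trans (residual_ge0 M s) (residual_le M s).
Qed.

Let residual_cvg s : residual M s @[M --> \oo] --> 0.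
Proof.
have [Ds|nD] := pselect (D s); last first.
  rewrite (_ : (fun M => _) = cst 0); first exact: cvg_cst.
  by apply/funext => M; rewrite /residual indicE memNset// mul0r.
rewrite (_ : (fun M => _) = Num.sqrt \o (fun M => kernel_energy H K x eps s - \sum_(n <- chaos_index d M) alpha_prod H K x n eps s)); last first.
  by apply/funext => M; rewrite /residual indicE mem_set// mul1r.
rewrite -[X in _ --> X](@sqrtr0 R); apply: continuous_cvg; first exact: sqrt_continuous.
rewrite -[X in _ --> X](subrr (kernel_energy H K x eps s)); apply: cvgB; first exact: cvg_cst.
have := cvg_compositions (f := fun i n => alpha n (var i s) (var i s + eps) (x i))
  (F := fun i => (Num.sqrt (eps * pi *+ 4))^-1 * gaussian_density (var i s + eps / 2) (x i)).
rewrite (_ : series (fun m => \sum_(n <- compositions d m) _) = (fun M => \sum_(n <- chaos_index d M) alpha_prod H K x n eps s)); last first.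
  by apply/funext => M; rewrite /series/= big_mkord sum_chaos_index.
apply.
- by move=> i n; apply: alpha_ge0; apply/ltW; exact: (sheet_var_gt0 H K i Ds).
- by move=> i; apply: cvg_alpha => //; exact: (sheet_var_gt0 H K i Ds).
Qed.

(** The norm of the remainder is at most the integral of its norms at fixed [s], which are dominated
    by [kernel_height] on the box and tend to zero. *)
Lemma approx_decomposition :
  chaos_decomposition P B (approx_local_time B x t eps) (component eps).
Proof.
have kb := kernel_integrand_bound x t hB eps_gt0.
have mk := measurable_kernel_integrand x t hB eps.
have X2 := (Gint_L2_nrm mk (fun s => (kb s).1) ikern (fun s => (kb s).2)).1.
rewrite (approx_local_timeE x hB t_gt0); split=> //; first exact: approx_component_chaos.
rewrite (_ : (fun n => _) = (fun M => 'E_P[fun w =>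
   ((Gint mu kern - \sum_(n <- chaos_index d M) term n eps) w ^+ 2)%R]))%E; last first.
  apply/funext => M; congr expectation; apply/funext => w; rewrite sum_chaos_index.
  by congr (_ ^+ 2); rewrite !fctE fct_sumE.
apply: (cvg_expectation_sqr (Z := fun M => Gint mu kern - \sum_(n <- chaos_index d M) term n eps)) => [M|].
  by apply: L2B => //; apply: L2_sum => n _; exact: approx_term_L2.
apply: (@squeeze_cvgr _ _ _ _ (cst 0) (fun M => \int[mu]_s residual M s)).
- apply: nearW => M; rewrite nrm_ge0/=.
  apply: (@Gint_comb_le _ _ _ _ _ P mu _ (chaos_index d M) kern _ (fun n => G n eps)
    (fun n s => cramer_weight n * (Ceps * box_power t (fun=> 0) s)) (residual M) mk _ ikern).
  + by move=> s; case: (kb s).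
  + by move=> s; case: (kb s).
  + by move=> n; exact: (measurable_chaos_integrand x t hB n eps).
  + by move=> n s; exact: (chaos_integrand_L2 x t d_gt0 H01 K01 hB n eps s).
  + by move=> n; apply: dominating_integrable.
  + by move=> n s; exact: (nrm_integrand_dominated Ceps0 eps_ge0 dom n s).
  + exact: integrable_residual.
  + by move=> s; rewrite nrm_residual.
- exact: cvg_cst.
have /= [] := @dominated_convergence _ _ _ mu _ measurableT (fun M s => (residual M s)%:E)
  (cst 0%E) (fun s => (\1_D s * kernel_height d eps)%:E).
- by move=> M; apply/measurable_EFinP.
- exact: measurable_cst.
- by apply: aeW => s _; apply: cvg_EFin; [exact: nearW|exact: residual_cvg].
- exact: ikern.
- by apply: aeW => s M _ /=; rewrite lee_fin ger0_norm ?residual_le ?residual_ge0.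
move=> _ _; rewrite integral0 => /fine_cvgP[_]; exact.
Qed.

End approximation.

End domination.

Section hcoef_continuity.
Context {R : realType}.
Variables (V : nat -> R) (l x : R).
Hypotheses (V0 : forall k, 0 < V k) (l0 : 0 < l) (Vl : V k @[k --> \oo] --> l).

Lemma cvg_heat_var n : heat (V k) x n @[k --> \oo] --> heat l x n.
Proof.
suff: heat (V k) x n @[k --> \oo] --> heat l x n /\
  heat (V k) x n.+1 @[k --> \oo] --> heat l x n.+1 by case.
elim: n => [|n [IH1 IH2]].
  split; first by under eq_fun do rewrite heat_n0; rewrite heat_n0; exact: cvg_cst.
  by under eq_fun do rewrite heat_n1; rewrite heat_n1; exact: cvg_cst.
split=> //; have hE v : heat v x n.+2 = n.+2%:R^-1 * (x * heat v x n.+1 - v * heat v x n).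
  by apply: (@mulfI _ n.+2%:R); rewrite ?pnatr_eq0// heat_rec mulVKf ?pnatr_eq0.
under eq_fun do rewrite hE; rewrite hE.
apply: cvgMl_tmp; apply: cvgB; first exact: cvgMl_tmp.
exact: cvgM.
Qed.

Lemma cvg_gaussian_density_var :
  gaussian_density (V k) x @[k --> \oo] --> gaussian_density l x.
Proof.
rewrite gaussian_densityE//; under eq_fun do rewrite gaussian_densityE//.
have pi0 := pi_gt0 R.
apply: cvgM.
  apply: cvgV; first by rewrite gt_eqF// sqrtr_gt0 mulrn_wgt0// mulr_gt0.
  apply: continuous_cvg; first exact: sqrt_continuous.
  under eq_fun do rewrite -mulrnAr; rewrite -mulrnAr; exact: cvgMr_tmp.
apply: continuous_cvg; first exact: continuous_expR.
apply: cvgN; apply: cvgMl_tmp; apply: cvgV; first by rewrite gt_eqF// mulrn_wgt0.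
by rewrite (_ : (fun k => _) = (fun k => V k + V k))// mulr2n; apply: cvgD.
Qed.

Lemma cvg_hcoef n : hcoef n (V k) x @[k --> \oo] --> hcoef n l x.
Proof.
rewrite /hcoef; apply: cvgM; last exact: cvg_heat_var.
apply: cvgM; first by apply: cvgMl_tmp; exact: cvg_gaussian_density_var.
by apply: cvgV; [rewrite expf_neq0// gt_eqF|exact: cvg_exprn].
Qed.

End hcoef_continuity.

Section inverse_squares.
Context {R : realType}.

Lemma sum_inverse_squares (c : R) : 0 <= c ->
  (\sum_(0 <= m <oo) (c / m.+1%:R ^+ 2)%:E < +oo)%E.
Proof.
move=> c0; apply: (@le_lt_trans _ _ (c * 2)%:E); last exact: ltry.
have t0 k : 0 <= c / k.+1%:R ^+ 2 by rewrite divr_ge0.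
apply: lime_le; first by apply: is_cvg_nneseries => k _ _; rewrite lee_fin.
apply: nearW => n; rewrite sumEFin lee_fin -mulr_sumr ler_wpM2l//.
(* The sharper majorant [2 - 2 / (n + 1)] is what the induction can carry. *)
rewrite big_mkord; apply: (@le_trans _ _ (2 - 2 / n.+1%:R)); last by rewrite gerBl divr_ge0.
elim: n => [|n IH]; first by rewrite big_ord0 divr1 subrr.
rewrite big_ord_recr/=; apply: (le_trans (lerD IH (lexx _))).
have n1 : 0 < n.+1%:R :> R by []; have n2 : 0 < n.+2%:R :> R by [].
have -> : n.+2%:R = n.+1%:R + 1 :> R by rewrite -natr1.
have n1' : 1 <= n.+1%:R :> R by rewrite ler1n.
move: (n.+1%:R : R) n1 n1' => u u0 u1.
have un : u != 0 by rewrite gt_eqF.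
have un1 : u + 1 != 0 by rewrite gt_eqF// addr_gt0.
rewrite -subr_ge0 (_ : _ - _ = (u - 1) / (u ^+ 2 * (u + 1))).
  by rewrite divr_ge0 ?subr_ge0// mulr_ge0 ?sqr_ge0 ?addr_ge0 ?ltW.
by field; rewrite un un1.
Qed.

End inverse_squares.

(** * Passage to the limit in the variance of the kernel *)

Section limit.
Context {R : realType} (N d : nat) {disp : measure_display}
  {T : measurableType disp} (P : probability T R).
Variables (H K : 'I_d -> 'I_N -> R) (B : 'I_d -> N.-tuple R -> T -> R).
Variables (x : 'I_d -> R) (t : N.-tuple R).
Hypotheses (d_gt0 : (0 < d)%N).
Hypotheses (H01 : forall i j, 0 < H i j < 1) (K01 : forall i j, 0 < K i j <= 1).
Hypothesis hB : bifractional_sheet P H K B.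
Hypothesis t_gt0 : forall j, 0 < tnth t j.
Local Notation mu := (lebesgue_tuple N).
Local Notation L2 := (Lfun P 2%:E).
Local Notation dotp := (L2inner P).
Local Notation nrm := (L2nrm P).
Local Notation var := (sheet_var H K).
Local Notation D := (pos_box t).
Local Notation G := (chaos_integrand H K B x t).
Local Notation weight := (chaos_weight H K x t).
Local Notation term := (chaos_term H K B x t).
Local Notation cmp := (component H K B x t).
Let mB := sheet_measurable_at hB.
Let gaussB := sheet_gaussian hB.
Let indepB := sheet_independent hB.

Lemma cvg_chaos_weight n s (u : nat -> R) : (forall k, 0 < u k) -> u k @[k --> \oo] --> 0 ->
  weight n (u k) s @[k --> \oo] --> weight n 0 s.
Proof.
move=> u0 ul; rewrite /chaos_weight.
have [Ds|nD] := pselect (D s); last first.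
  rewrite indicE memNset// mul0r (_ : (fun k => _) = cst 0); first exact: cvg_cst.
  by apply/funext => k; rewrite mul0r.
rewrite indicE mem_set//; apply: cvgMl_tmp.
have vs i := sheet_var_gt0 H K i Ds.
apply: cvg_big; first exact: mul_continuous.
move=> i _; rewrite addr0; apply: cvg_hcoef => [k||]; [by rewrite addr_gt0|exact: vs|].
by rewrite -[X in _ --> X](addr0 (var i s)); apply: cvgD => //; exact: cvg_cst.
Qed.

Section uniform.
Variables (a : 'I_N -> R) (C : R).
Hypotheses (a01 : forall j, 0 <= a j < 1) (C0 : 0 <= C).
Hypothesis dom : forall eps s, 0 <= eps -> D s ->
  kernel_bound H K x eps s <= C * box_power t a s.

Let tL2 eps n : 0 <= eps -> term n eps \in L2.
Proof. by move=> e0; apply: (term_L2 d_gt0 H01 K01 hB t_gt0 a01 C0 e0) => s Ds; exact: dom. Qed.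

Let cL2 eps m : 0 <= eps -> cmp eps m \in L2.
Proof. by move=> e0; apply: (component_L2 d_gt0 H01 K01 hB t_gt0 a01 C0 e0) => s Ds; exact: dom. Qed.

Let cbd eps m : 0 <= eps -> nrm (cmp eps m) <= component_bound d t a C m.
Proof. by move=> e0; apply: (nrm_component d_gt0 H01 K01 hB t_gt0 a01 C0 e0) => s Ds; exact: dom. Qed.

Let cchaos eps m : 0 <= eps -> chaos P B m (cmp eps m).
Proof. by move=> e0; apply: (component_chaos d_gt0 H01 K01 hB t_gt0 a01 C0 e0) => s Ds; exact: dom. Qed.

Let Gdom eps n s : 0 <= eps -> nrm (G n eps s) <= cramer_weight n * (C * box_power t a s).
Proof. by move=> e0; apply: (nrm_integrand_dominated H01 K01 hB C0 e0) => u Du; exact: dom. Qed.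

Let gap n eps s : R := nrm (G n eps s - G n 0 s).

(** Both integrands carry the same random factor, so their distance reduces to a difference of
    deterministic weights. *)
Let gapE n eps s : gap n eps s = `|weight n eps s - weight n 0 s| *
  Num.sqrt (\prod_i (var i s ^+ tnth n i / (tnth n i)`!%:R)).
Proof.
have [Ds|nD] := pselect (D s); last first.
  by rewrite /gap !chaos_integrand_out// subr0 nrm0 /chaos_weight indicE memNset// !mul0r subrr normr0 mul0r.
have os := pos_box_orthant Ds.
rewrite /gap !chaos_integrandE -scalerBl nrmZ ?(chaos_factor_L2 H01 K01 hB n Ds)//.
rewrite (chaos_factorE H01 K01 hB n Ds) /L2nrm (dotp_prod_heat mB gaussB indepB)// eqxx.
congr (_ * Num.sqrt _); apply: eq_bigr => i _.
by rewrite (sheet_dotp hB)// (bifractional_sheet_cov_diag H01 K01 hB).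
Qed.

Let measurable_gap n eps : measurable_fun setT (gap n eps).
Proof.
rewrite (_ : gap n eps = (fun s => `|weight n eps s - weight n 0 s| *
  Num.sqrt (\prod_i (var i s ^+ tnth n i / (tnth n i)`!%:R)))); last by apply/funext => s; rewrite gapE.
apply: measurable_funM.
  by apply: measurableT_comp => //; apply: measurable_funB; exact: measurable_chaos_weight.
apply: measurable_sqrt; apply: measurable_prod_all => i; apply: measurable_funM => //.
by apply: measurable_funX; exact: measurable_sheet_pow.
Qed.

Let gap_le n eps s : 0 <= eps -> gap n eps s <= 2 * cramer_weight n * (C * box_power t a s).
Proof.
move=> e0; have GL e := chaos_integrand_L2 x t d_gt0 H01 K01 hB n e s.
apply: (@le_trans _ _ (nrm (G n eps s) + nrm (G n 0 s))).
  by rewrite -(nrmN (GL 0)); apply: nrmD; rewrite ?L2N.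
by rewrite (_ : 2 * _ * _ = cramer_weight n * (C * box_power t a s) + cramer_weight n * (C * box_power t a s)) ?lerD ?Gdom//; ring.
Qed.

Let iW c : mu.-integrable setT (EFin \o (fun s => c * (C * box_power t a s))).
Proof. exact: (dominating_integrable t_gt0 C a01 c). Qed.

Let integrable_gap n eps : 0 <= eps -> mu.-integrable setT (EFin \o gap n eps).
Proof.
move=> e0; apply: le_integrable (iW (2 * cramer_weight n)) => //; first exact/measurable_EFinP.
move=> s _ /=; rewrite lee_fin ger0_norm ?nrm_ge0//.
by apply: le_trans (ler_norm _); exact: gap_le.
Qed.

Let term_gap n eps : 0 <= eps -> nrm (term n eps - term n 0) <= \int[mu]_s gap n eps s.
Proof.
move=> e0; have := @Gint_comb_le _ _ _ _ _ P mu _ [:: n] (G n eps)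
  (fun s => cramer_weight n * (C * box_power t a s)) (fun n' => G n' 0)
  (fun n s => cramer_weight n * (C * box_power t a s)) (gap n eps).
rewrite big_seq1; apply.
- exact: (measurable_chaos_integrand x t hB n eps).
- exact: (chaos_integrand_L2 x t d_gt0 H01 K01 hB n eps).
- exact: iW.
- by move=> s; exact: Gdom.
- by move=> n'; exact: (measurable_chaos_integrand x t hB n' 0).
- by move=> n' s; exact: (chaos_integrand_L2 x t d_gt0 H01 K01 hB n' 0).
- by move=> n'; exact: iW.
- by move=> n' s; exact: Gdom.
- exact: integrable_gap.
by move=> s; rewrite big_seq1.
Qed.

(** The maximum with zero makes the bounds valid for every real [eps] and changes nothing on the
    right of zero. *)
Lemma term_cvg n : nrm (term n (Num.max 0 eps) - term n 0) @[eps --> 0^'+] --> 0.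
Proof.
apply/cvg_at_rightP => u [u0 ul].
apply: (@squeeze_cvgr _ _ _ _ (cst 0) (fun k => \int[mu]_s gap n (u k) s)).
- apply: nearW => k; rewrite nrm_ge0/= max_r ?(ltW (u0 k))//.
  by apply: term_gap; exact: ltW.
- exact: cvg_cst.
have /= [] := @dominated_convergence _ _ _ mu _ measurableT (fun k s => (gap n (u k) s)%:E)
  (cst 0%E) (fun s => (2 * cramer_weight n * (C * box_power t a s))%:E).
- by move=> k; apply/measurable_EFinP.
- exact: measurable_cst.
- apply: aeW => s _; apply: cvg_EFin; first exact: nearW.
  rewrite (_ : fine \o _ = (fun k => `|weight n (u k) s - weight n 0 s| *
    Num.sqrt (\prod_i (var i s ^+ tnth n i / (tnth n i)`!%:R)))); last by apply/funext => k /=; rewrite gapE.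
  rewrite -[X in _ --> X](mul0r (Num.sqrt (\prod_i (var i s ^+ tnth n i / (tnth n i)`!%:R)))).
  apply: cvgMr_tmp; apply/norm_cvg0P; apply/subr_cvg0; exact: cvg_chaos_weight.
- exact: iW.
- by apply: aeW => s k _ /=; rewrite lee_fin ger0_norm ?nrm_ge0// gap_le// ltW.
move=> _ _; rewrite integral0 => /fine_cvgP[_]; exact.
Qed.

Lemma max0_ge0 (eps : R) : 0 <= Num.max 0 eps. Proof. by rewrite le_max lexx. Qed.

Lemma component_cvg m : nrm (cmp (Num.max 0 eps) m - cmp 0 m) @[eps --> 0^'+] --> 0.
Proof.
apply: (@squeeze_cvgr _ _ _ _ (cst 0) (fun eps => \sum_(n <- compositions d m) nrm (term n (Num.max 0 eps) - term n 0))).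
- apply: nearW => eps; rewrite nrm_ge0/= /component -sumrB.
  by apply: nrm_sum => n _; rewrite L2B ?tL2 ?max0_ge0.
- exact: cvg_cst.
elim: (compositions d m) => [|n r IH].
  by rewrite (_ : (fun _ => _) = cst 0); [exact: cvg_cst|apply/funext => e; rewrite big_nil].
rewrite -[X in _ --> X](addr0 0) (_ : (fun _ => _) = (fun eps => nrm (term n (Num.max 0 eps) - term n 0) +
  \sum_(n <- r) nrm (term n (Num.max 0 eps) - term n 0))).
  by apply: cvgD => //; exact: term_cvg.
by apply/funext => e; rewrite big_cons.
Qed.

(** The square of [component_bound] grows like the power [3 d] of the order; two more powers make
    the series summable. *)
Definition sobolev_exponent : R := - (3 * d + 2)%N%:R.

Let k0 : R := 4 * (expR 1 ^+ d * dominating_mass t a C ^+ 2).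

Let k0_ge0 : 0 <= k0. Proof. by rewrite !mulr_ge0 ?exprn_ge0 ?expR_ge0 ?dominating_mass_ge0. Qed.

(** The factor 2 leaves room for the difference of two components. *)
Lemma sobolev_weight_bound m (z : R) : 0 <= z -> z <= 2 * component_bound d t a C m ->
  (1 + m%:R) `^ sobolev_exponent * z ^+ 2 <= k0 / m.+1%:R ^+ 2.
Proof.
move=> z0 zb; have m0 : 0 < m.+1%:R :> R by [].
rewrite -(natrD _ 1 m) add1n /sobolev_exponent powRN powR_mulrn//.
rewrite mulrC ler_pdivrMr ?exprn_gt0//.
apply: (@le_trans _ _ ((2 * component_bound d t a C m) ^+ 2)).
  by rewrite lerXn2r ?nnegrE// (le_trans z0).
rewrite /component_bound !exprMn -[Num.sqrt _ ^+ d ^+ 2]exprAC sqr_sqrtr; last by rewrite mulr_ge0 ?expR_ge0.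
set M : R := m.+1%:R; have ME : M ^+ (3 * d + 2) = (M ^+ d) ^+ 2 * M ^+ d * M ^+ 2.
  by rewrite -exprM -!exprD; congr (_ ^+ _); lia.
rewrite ME exprMn /k0; have Mn : M != 0 by rewrite gt_eqF.
rewrite le_eqVlt; apply/orP; left; apply/eqP.
by move: (M ^+ d) (expR 1 ^+ d) (dominating_mass _ _ _) => u e b; field.
Qed.

End uniform.
End limit.

(** * Uniqueness and convergence of chaos components *)

Section chaos_sequences.
Context {R : realType} (N d : nat) {disp : measure_display}
  {T : measurableType disp} (P : probability T R)
  (B : 'I_d -> N.-tuple R -> T -> R).
Hypothesis mB : forall i s, orthant s -> measurable_fun setT (B i s).
Hypothesis gaussB : forall i, centered_gaussian_field P (B i).
Hypothesis indepB : independent_fields P B.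
Local Notation L2 := (Lfun P 2%:E).
Local Notation dotp := (L2inner P).
Local Notation nrm := (L2nrm P).
Local Notation chaos := (chaos P B).

Lemma decomposition_nrm X F : chaos_decomposition P B X F ->
  nrm (X - \sum_(m < M) F m) @[M --> \oo] --> 0.
Proof.
move=> [hX hF hE]; have L M : X - \sum_(m < M) F m \in L2.
  by apply: L2B => //; apply: L2_sum => m _; exact: chaos_L2 (hF m).
have {hE} : ((nrm (X - \sum_(m < M) F m) ^+ 2)%:E)%E @[M --> \oo] --> 0%E.
  rewrite (_ : (fun M => _) = (fun n => 'E_P[fun w => ((X w - \sum_(m < n) F m w) ^+ 2)%R]))%E//.
  apply/funext => M; rewrite -expectation_sqr_nrm//; congr expectation; apply/funext => w.
  by rewrite !fctE fct_sumE.
move=> /fine_cvgP[_] h.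
rewrite (_ : (fun M => _) = Num.sqrt \o (fun M => nrm (X - \sum_(m < M) F m) ^+ 2)); last first.
  by apply/funext => M /=; rewrite sqrtr_sqr ger0_norm// nrm_ge0.
rewrite -[X in _ --> X](@sqrtr0 R); apply: continuous_cvg => //; exact: sqrt_continuous.
Qed.

(** [F m - F' m] is the component of order [m] of the difference of two
    partial sums, both of which tend to [X]. *)
Lemma chaos_decomposition_unique X F F' : chaos_decomposition P B X F ->
  chaos_decomposition P B X F' -> forall m, nrm (F m - F' m) = 0.
Proof.
move=> h h' m; have [hX hF _] := h; have [_ hF' _] := h'.
have FL k : F k \in L2 by exact: chaos_L2 (hF k).
have FL' k : F' k \in L2 by exact: chaos_L2 (hF' k).
pose Z k := F k - F' k; have ZL k : Z k \in L2 by exact: L2B.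
have Zc k : chaos k (Z k) by apply: (chaosB mB gaussB indepB).
have bd M : (m < M)%N -> nrm (Z m) <= nrm (X - \sum_(k < M) F' k) + nrm (X - \sum_(k < M) F k).
  move=> mM; have S2 : X - \sum_(k < M) F k \in L2 by apply: L2B => //; apply: L2_sum.
  have S2' : X - \sum_(k < M) F' k \in L2 by apply: L2B => //; apply: L2_sum.
  have SZ : \sum_(k < M) Z k = (X - \sum_(k < M) F' k) - (X - \sum_(k < M) F k).
    by rewrite /Z sumrB opprB [RHS]addrC addrA subrK.
  have [z0|zn] := eqVneq (nrm (Z m)) 0; first by rewrite z0 addr_ge0 ?nrm_ge0.
  have zp : 0 < nrm (Z m) by rewrite lt_neqAle eq_sym zn nrm_ge0.
  rewrite -(ler_pM2l zp) -expr2 nrm_sqr.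
  have -> : dotp (Z m) (Z m) = dotp (Z m) (\sum_(k < M) Z k).
    rewrite dotp_sumr// (bigD1 (Ordinal mM))//= big1 ?addr0// => k km.
    by apply: (chaos_orthogonal mB gaussB indepB _ (Zc m) (Zc k)); rewrite eq_sym.
  have SL : \sum_(k < M) Z k \in L2 by apply: L2_sum.
  apply: le_trans (ler_norm _) _; apply: le_trans (nrm_CS (ZL m) SL) _.
  rewrite ler_wpM2l ?nrm_ge0// SZ -(nrmN S2); apply: nrmD => //; exact: L2N.
apply/eqP; rewrite eq_le nrm_ge0 andbT; apply/ler_addgt0Pl => e e0; rewrite addr0.
have e2 : 0 < e / 2 by rewrite divr_gt0.
have /cvgr0Pnorm_le/(_ _ e2)[M1 _ h1] := decomposition_nrm h.
have /cvgr0Pnorm_le/(_ _ e2)[M2 _ h2] := decomposition_nrm h'.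
pose M := maxn (maxn M1 M2) m.+1.
have mM : (m < M)%N by rewrite /M; lia.
apply: (le_trans (bd M mM)); rewrite [e]splitr; apply: lerD.
  by apply: le_trans (ler_norm _) (h2 M _); rewrite /= /M; lia.
by apply: le_trans (ler_norm _) (h1 M _); rewrite /= /M; lia.
Qed.

Lemma sobolev_sqnormE alpha (Z : nat -> T -> R) : (forall m, Z m \in L2) ->
  sobolev_sqnorm P alpha Z =
  (\sum_(0 <= m <oo) ((1 + m%:R) `^ alpha * nrm (Z m) ^+ 2)%:E)%E.
Proof. by move=> ZL; apply: eq_eseriesr => m _; rewrite expectation_sqr_nrm// EFinM. Qed.

(** A single term of a nonnegative series. Square integrability is asked only near the limit,
    because approximations are given a decomposition only for positive [eps]. *)
Lemma sobolev_component {U : Type} {F : set_system U} {FF : Filter F} alpha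
    (Z : U -> nat -> T -> R) : (\forall u \near F, forall m, Z u m \in L2) ->
  sobolev_sqnorm P alpha (Z u) @[u --> F] --> 0%E ->
  forall m (e : R), 0 < e -> \forall u \near F, nrm (Z u m) <= e.
Proof.
move=> ZL hZ m e e0; pose c : R := (1 + m%:R) `^ alpha.
have c0 : 0 < c by rewrite powR_gt0// ltr_pwDl.
have sge u : (0 <= sobolev_sqnorm P alpha (Z u))%E.
  apply: nneseries_ge0 => k _ _; rewrite mule_ge0 ?lee_fin ?powR_ge0//.
  by apply: expectation_ge0 => w; exact: sqr_ge0.
have ce : 0 < c * e ^+ 2 by rewrite mulr_gt0 ?exprn_gt0.
have near1 : \forall u \near F, (sobolev_sqnorm P alpha (Z u) <= (c * e ^+ 2)%:E)%E.
  by apply: ((ge0_cvge0P sge).2 hZ _ ce).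
apply: filterS2 ZL near1 => u uL; rewrite sobolev_sqnormE// => su.
have : ((c * nrm (Z u m) ^+ 2)%:E <= (c * e ^+ 2)%:E)%E.
  apply: le_trans su; apply: le_trans (nneseries_lim_ge m.+1 _); last first.
    by move=> k _ _; rewrite lee_fin mulr_ge0 ?powR_ge0 ?sqr_ge0.
  rewrite big_nat_recr//=; apply: lee_paddl => //; apply: sume_ge0 => k _.
  by rewrite lee_fin mulr_ge0 ?powR_ge0 ?sqr_ge0.
by rewrite lee_fin ler_pM2l// ler_pXn2r// nnegrE ?nrm_ge0// ltW.
Qed.

End chaos_sequences.

Section local_time.
Context {R : realType} (N d : nat) {disp : measure_display}
  {T : measurableType disp} (P : probability T R).
Variables (H K : 'I_d -> 'I_N -> R) (B : 'I_d -> N.-tuple R -> T -> R).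
Variables (x : 'I_d -> R) (t : N.-tuple R).
Hypotheses (d_gt0 : (0 < d)%N).
Hypotheses (H01 : forall i j, 0 < H i j < 1) (K01 : forall i j, 0 < K i j <= 1).
Hypothesis hB : bifractional_sheet P H K B.
Hypothesis t_gt0 : forall j, 0 < tnth t j.
Local Notation mu := (lebesgue_tuple N).
Local Notation L2 := (Lfun P 2%:E).
Local Notation dotp := (L2inner P).
Local Notation nrm := (L2nrm P).
Local Notation var := (sheet_var H K).
Local Notation D := (pos_box t).
Local Notation G := (chaos_integrand H K B x t).
Local Notation weight := (chaos_weight H K x t).
Local Notation term := (chaos_term H K B x t).
Local Notation cmp := (component H K B x t).
Let mB := sheet_measurable_at hB.
Let gaussB := sheet_gaussian hB.
Let indepB := sheet_independent hB.

Let n0 : d.-tuple nat := [tuple 0%N | i < d].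

Let compositions0 : perm_eq (compositions d 0) [:: n0].
Proof.
apply: uniq_perm; rewrite ?compositions_uniq// => n.
rewrite mem_compositions sum_nat_eq0 inE; apply/forallP/eqP => [h|-> i]; last by rewrite tnth_mktuple.
by apply: eq_from_tnth => i; rewrite tnth_mktuple; apply/eqP; exact: h.
Qed.

Let weight0E eps s : weight n0 eps s = \1_D s * \prod_i gaussian_density (var i s + eps) (x i).
Proof.
congr (_ * _); apply: eq_bigr => i _.
by rewrite tnth_mktuple /hcoef fact0 expr0 divr1 mul1r heat_n0 mulr1.
Qed.

Let weight0_ge0 eps s : 0 <= weight n0 eps s.
Proof. by rewrite weight0E mulr_ge0 ?indicE// prodr_ge0// => i _; exact: gaussian_density_ge0. Qed.

Let integrand0E eps s : G n0 eps s = cst (weight n0 eps s).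
Proof.
apply/funext => w; rewrite /chaos_integrand /chaos_factor big1 ?mulr1// => i _.
by rewrite tnth_mktuple heat_n0.
Qed.

Let component0E eps : cmp eps 0 = cst (\int[mu]_s weight n0 eps s).
Proof.
rewrite /component (perm_big _ compositions0) big_seq1; apply/funext => w /=.
by rewrite /chaos_term /Gint; apply: eq_Rintegral => s _; rewrite integrand0E.
Qed.

Let weight0_integrable eps : 0 < eps -> mu.-integrable setT (EFin \o weight n0 eps).
Proof.
move=> e0; pose Ce := (Num.sqrt eps)^-1 ^+ d.
have Ce0 : 0 <= Ce by rewrite exprn_ge0// invr_ge0.
have z01 (j : 'I_N) : 0 <= (0 : R) < 1 by rewrite lexx ltr01.
have dom s : D s -> kernel_bound H K x eps s <= Ce * box_power t (fun=> 0) s.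
  move=> Ds; rewrite -indic_box_power indicE mem_set// mulr1.
  exact: (kernel_bound_le H K x e0 Ds).
have ig := dominating_integrable t_gt0 Ce z01 (@cramer_weight R d n0).
apply: (le_integrable _ _ _ ig) => //.
  by apply/measurable_EFinP; exact: measurable_chaos_weight.
move=> s _ /=; rewrite lee_fin -(nrm_cst P) -integrand0E.
by apply: le_trans (ler_norm _); exact: (nrm_integrand_dominated H01 K01 hB Ce0 (ltW e0) dom).
Qed.

(** The component of order zero of an approximation is the integral of the densities of variances
    [var i s + eps]. It converges to [L 0] in norm, hence stays bounded, and Fatou's lemma concludes
    as [eps] tends to zero. The components [F] of the hypothesis are identified with the explicit
    ones by uniqueness. *)
Lemma local_time_mean_finite L : local_time P B x t L -> (local_time_mean H K x t < +oo)%E.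
Proof.
move=> [[Lc _] [alpha [F [dF sF]]]].
have LL m : L m \in L2 by exact: chaos_L2 (Lc m).
have nearL2 : \forall eps \near (0 : R)^'+, forall m, (fun w => F eps m w - L m w) \in L2.
  apply: filterS (nbhs_right_gt 0) => eps e0 m.
  by have [_ /(_ m) c _] := dF eps e0; exact: (L2B (chaos_L2 c) (LL m)).
have near1 : \forall eps \near (0 : R)^'+, nrm (fun w => F eps 0%N w - L 0%N w) <= 1.
  by apply: (sobolev_component (Z := fun eps m w => F eps m w - L m w) nearL2 sF 0 ltr01).
pose A := nrm (L 0%N) + 1.
have bd : \forall eps \near (0 : R)^'+, 0 < eps /\ \int[mu]_s weight n0 eps s <= A.
  have near2 := @nbhs_right_gt R 0.
  apply: filterS2 near1 near2 => eps h e0; split=> //.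
  have cFe := dF eps e0; have [_ /(_ 0%N) c0 _] := cFe.
  have cE := approx_decomposition x d_gt0 H01 K01 hB t_gt0 e0.
  have un := chaos_decomposition_unique mB gaussB indepB cE cFe 0.
  have [_ /(_ 0%N) c0' _] := cE.
  have FL := chaos_L2 c0; have FL' := chaos_L2 c0'.
  have : nrm (cmp eps 0) <= A.
    have -> : cmp eps 0 = (cmp eps 0 - F eps 0%N) + ((F eps 0%N - L 0%N) + L 0%N).
      by rewrite !subrK.
    have S1 := L2B FL' FL; have S2 := L2B FL (LL 0%N).
    apply: (le_trans (nrmD S1 (L2D S2 (LL 0%N)))); rewrite un add0r.
    by apply: (le_trans (nrmD S2 (LL 0%N))); rewrite /A addrC lerD2l.
  rewrite component0E nrm_cst ger0_norm//.
  by apply: Rintegral_ge0 => s _; exact: weight0_ge0.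
(* Fatou's lemma is sequential, so a sequence tending to zero is extracted from the right
   neighbourhoods. *)
have hk k : exists v : R, (0 < v /\ \int[mu]_s weight n0 v s <= A) /\ v <= harmonic k.
  have h1 : 0 < (harmonic k : R) by rewrite /harmonic invr_gt0.
  have n2 := nbhs_right_ltW h1.
  apply: (@filter_ex _ _ (at_right_proper_filter 0) (fun v => (0 < v /\ \int[mu]_s weight n0 v s <= A) /\ v <= harmonic k)).
  by apply: filterS2 bd n2 => v; split.
have [u hu] := choice hk.
have u0 k : 0 < u k by case: (hu k) => -[].
have ul : u k @[k --> \oo] --> 0.
  apply: (@squeeze_cvgr _ _ _ _ (cst 0) harmonic); last exact: cvg_harmonic.
    by apply: nearW => k /=; rewrite ltW//=; case: (hu k).
  exact: cvg_cst.
have mw eps : measurable_fun setT (fun s => (weight n0 eps s)%:E).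
  by apply/measurable_EFinP; exact: measurable_chaos_weight.
rewrite /local_time_mean integral_box//; last first.
  apply/measurable_EFinP; apply: measurable_prod_all => i.
  by apply: measurable_gaussian_density2 => //; exact: measurable_sheet_pow.
rewrite (_ : integral _ _ _ = \int[mu]_s (weight n0 0 s)%:E)%E; last first.
  apply: eq_integral => s _; rewrite patchE weight0E indicE; case: (s \in D); rewrite ?mul0r// mul1r.
  by congr EFin; apply: eq_bigr => i _; rewrite addr0.
apply: (@le_lt_trans _ _ A%:E); last exact: ltry.
have lim s : limn_einf (fun k => (weight n0 (u k) s)%:E) = (weight n0 0 s)%:E.
  by apply: (cvg_limn_einf_sup _).1; apply: cvg_EFin; [exact: nearW|exact: cvg_chaos_weight].
under eq_integral do rewrite -lim.
apply: le_trans (fatou _ _ _ _) _ => //.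
  by move=> k s _; rewrite lee_fin weight0_ge0.
apply: le_trans (limn_einf_sup _) _; rewrite limn_esup_lim; apply: lime_le; first exact: is_cvg_esups.
apply: nearW => n; apply: ge_ereal_sup => _ [k /= _ <-].
have fin : (\int[mu]_s (weight n0 (u k) s)%:E)%E \is a fin_num.
  exact: integrable_fin_num (weight0_integrable (u0 k)).
by rewrite -(fineK fin) lee_fin; case: (hu k) => -[].
Qed.

Section uniform.
Variables (a : 'I_N -> R) (C : R).
Hypotheses (a01 : forall j, 0 <= a j < 1) (C0 : 0 <= C).
Hypothesis dom : forall eps s, 0 <= eps -> D s ->
  kernel_bound H K x eps s <= C * box_power t a s.

Let tL2 eps n : 0 <= eps -> term n eps \in L2.
Proof. by move=> e0; apply: (term_L2 d_gt0 H01 K01 hB t_gt0 a01 C0 e0) => s Ds; exact: dom. Qed.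

Let cL2 eps m : 0 <= eps -> cmp eps m \in L2.
Proof. by move=> e0; apply: (component_L2 d_gt0 H01 K01 hB t_gt0 a01 C0 e0) => s Ds; exact: dom. Qed.

Let cbd eps m : 0 <= eps -> nrm (cmp eps m) <= component_bound d t a C m.
Proof. by move=> e0; apply: (nrm_component d_gt0 H01 K01 hB t_gt0 a01 C0 e0) => s Ds; exact: dom. Qed.

Let cchaos eps m : 0 <= eps -> chaos P B m (cmp eps m).
Proof. by move=> e0; apply: (component_chaos d_gt0 H01 K01 hB t_gt0 a01 C0 e0) => s Ds; exact: dom. Qed.

Local Notation k0 := (4 * (expR 1 ^+ d * dominating_mass t a C ^+ 2)).
Let k0_ge0 : 0 <= k0. Proof. by rewrite !mulr_ge0 ?exprn_ge0 ?expR_ge0 ?dominating_mass_ge0. Qed.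

Let sb := sobolev_weight_bound d_gt0 C0 (t := t) (a := a).

Let sobolev_cvg {U : Type} {F : set_system U} {FF : Filter F} (Z : U -> nat -> T -> R) :
  (forall u m, Z u m \in L2) -> (forall u m, nrm (Z u m) <= 2 * component_bound d t a C m) ->
  (forall m, nrm (Z u m) @[u --> F] --> 0) ->
  sobolev_sqnorm P (sobolev_exponent d) (Z u) @[u --> F] --> 0%E.
Proof.
move=> ZL Zb Z0; under eq_fun do rewrite sobolev_sqnormE//.
apply: (@tannery _ _ _ _ _ (fun m => k0 / m.+1%:R ^+ 2)).
- by move=> u m; rewrite mulr_ge0 ?powR_ge0 ?sqr_ge0.
- by move=> m; rewrite divr_ge0.
- by apply: nearW => u m; apply: sb => //; exact: nrm_ge0.
- exact: sum_inverse_squares.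
move=> m; rewrite -[X in _ --> X](mulr0 ((1 + m%:R) `^ sobolev_exponent d)).
by apply: cvgMl_tmp; rewrite -[X in _ --> X](expr0n _ 2); exact: cvg_exprn.
Qed.

Lemma local_time_exists : local_time P B x t (cmp 0).
Proof.
have le2 m (z : R) : z <= component_bound d t a C m -> z <= 2 * component_bound d t a C m.
  move=> h; apply: (le_trans h); rewrite ler_peMl// ?ler1n//.
  exact: le_trans (nrm_ge0 P _) (cbd m (lexx 0)).
split.
  split=> [m|]; first exact: cchaos.
  exists (sobolev_exponent d); rewrite sobolev_sqnormE; last by move=> m; exact: cL2.
  apply: le_lt_trans (sum_inverse_squares k0_ge0).
  apply: lee_nneseries => m *; first by rewrite lee_fin mulr_ge0 ?powR_ge0 ?sqr_ge0.
  by rewrite lee_fin; apply: sb; [exact: nrm_ge0|apply: le2; exact: cbd].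
exists (sobolev_exponent d), (fun eps => cmp (Num.max 0 eps)); split.
  by move=> eps e0; rewrite max_r ?ltW//; exact: approx_decomposition.
apply: (@sobolev_cvg R _ _ (fun eps m => cmp (Num.max 0 eps) m - cmp 0 m)).
- by move=> eps m; rewrite L2B ?cL2// max0_ge0.
- move=> eps m; have c0 := cL2 m (lexx 0); have ce := cL2 m (max0_ge0 eps).
  apply: (@le_trans _ _ (nrm (cmp (Num.max 0 eps) m) + nrm (cmp 0 m))).
    by rewrite -(nrmN c0); apply: nrmD; rewrite ?L2N.
  by rewrite mulr_natl mulr2n lerD ?cbd ?max0_ge0.
move=> m; exact: (component_cvg d_gt0 H01 K01 hB t_gt0 a01 C0 dom).
Qed.

(** Neither the exponent nor the sequences [F] of a given local time are known, but convergence in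
    any of the Sobolev norms controls each order, and uniqueness determines [F eps] up to null
    norm. *)
Lemma local_time_components L : local_time P B x t L -> forall m, nrm (L m - cmp 0 m) = 0.
Proof.
move=> [[Lc _] [alpha [F [dF sF]]]] m.
have LL k : L k \in L2 by exact: chaos_L2 (Lc k).
have cL := cL2 m (lexx 0).
have nearL2 : \forall eps \near (0 : R)^'+, forall k, (fun w => F eps k w - L k w) \in L2.
  apply: filterS (nbhs_right_gt 0) => eps e0 k.
  by have [_ /(_ k) c _] := dF eps e0; exact: (L2B (chaos_L2 c) (LL k)).
apply/eqP; rewrite eq_le nrm_ge0 andbT; apply/ler_addgt0Pl => e e0; rewrite addr0.
have e2 : 0 < e / 2 by rewrite divr_gt0.
have n1 : \forall eps \near (0 : R)^'+, nrm (fun w => F eps m w - L m w) <= e / 2.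
  by apply: (sobolev_component (Z := fun eps m w => F eps m w - L m w) nearL2 sF m e2).
have /cvgr0Pnorm_le/(_ _ e2) n2 := component_cvg d_gt0 H01 K01 hB t_gt0 a01 C0 dom m.
have n3 := @nbhs_right_gt R 0.
have n4 : \forall eps \near (0 : R)^'+, [/\ nrm (fun w => F eps m w - L m w) <= e / 2,
    `|nrm (cmp (Num.max 0 eps) m - cmp 0 m)| <= e / 2 & 0 < eps].
  by apply: filterS3 n1 n2 n3 => eps ? ? ?; split.
have [eps [h1 h2 eps0]] : exists eps : R, [/\ nrm (fun w => F eps m w - L m w) <= e / 2,
    `|nrm (cmp (Num.max 0 eps) m - cmp 0 m)| <= e / 2 & 0 < eps].
  by apply: (@filter_ex _ _ (at_right_proper_filter 0) _ n4).
rewrite max_r ?(ltW eps0)// ger0_norm ?nrm_ge0// in h2.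
have cFe := dF eps eps0; have [_ /(_ m) cm _] := cFe; have FL := chaos_L2 cm.
have cE := approx_decomposition x d_gt0 H01 K01 hB t_gt0 eps0.
have un := chaos_decomposition_unique mB gaussB indepB cE cFe m.
have ce := cL2 m (ltW eps0).
apply: (le_trans (nrm_triangle (LL m) FL cL)); rewrite [e]splitr; apply: lerD.
  by rewrite nrmB.
apply: (le_trans (nrm_triangle FL ce cL)); rewrite nrmB// un add0r//.
Qed.

(** At order [m] the remainder over a finite set [J] is at most twice [component_bound m] in norm,
    whatever [J], and has null norm as soon as [J] contains the multi-indices of degree [m];
    domination then gives convergence along finite sets. *)
Lemma local_time_expansion L : local_time P B x t L ->
  chaos_expansion P B L (local_time_term B H K x t).
Proof.
move=> hL; have LL k : L k \in L2 by case: hL => -[Lc _] _; exact: chaos_L2 (Lc k).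
have tE : local_time_term B H K x t = (fun n => term n 0).
  by apply/funext => n; rewrite (local_time_termE x hB t_gt0).
rewrite tE; split=> [n|].
  by apply: (term_chaos d_gt0 H01 K01 hB t_gt0 a01 C0 (lexx 0)) => s Ds; exact: dom.
exists (sobolev_exponent d).
pose part (J : {fset d.-tuple nat}) m := [seq n <- enum_fset J | (\sum_(i < d) tnth n i)%N == m].
have pu J m : uniq (part J m) by rewrite filter_uniq// fset_uniq.
have ps J m : {subset part J m <= compositions d m}.
  by move=> n; rewrite mem_filter mem_compositions => /andP[].
have pL J m : \sum_(n <- part J m) term n 0 \in L2 by apply: L2_sum => n _; exact: tL2.
have LcE J m : nrm (L m - \sum_(n <- part J m) term n 0) = nrm (cmp 0 m - \sum_(n <- part J m) term n 0).
  have h0 := local_time_components hL m.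
  have c0 := cL2 m (lexx 0).
  apply/eqP; rewrite eq_le; apply/andP; split.
    by apply: (le_trans (nrm_triangle (LL m) c0 (pL J m))); rewrite h0 add0r.
  by apply: (le_trans (nrm_triangle c0 (LL m) (pL J m))); rewrite nrmB// h0 add0r.
rewrite (_ : (fun J => _) = (fun J => sobolev_sqnorm P (sobolev_exponent d)
    (fun m => L m - \sum_(n <- part J m) term n 0))); last first.
  apply/funext => J; congr sobolev_sqnorm; apply/funext => m; apply/funext => w.
  by rewrite /part big_filter !fctE fct_sumE.
apply: (@sobolev_cvg _ _ (@summability.totally_filter _)).
- by move=> J m; rewrite L2B.
- move=> J m; rewrite LcE mulr_natl mulr2n.
  apply: (@le_trans _ _ (nrm (cmp 0 m) + nrm (\sum_(n <- part J m) term n 0))).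
    by rewrite -(nrmN (pL J m)); apply: nrmD; rewrite ?L2N ?cL2.
  apply: lerD; first exact: cbd.
  by apply: (nrm_component_part d_gt0 H01 K01 hB t_gt0 a01 C0 (lexx 0)) => // s Ds; exact: dom.
pose FF : Filter (@summability.totally (d.-tuple nat)) := @summability.totally_filter _.
move=> m; apply: cvg_near_cst.
exists [fset n in compositions d m]%fset => // J /= /fsubsetP sJ.
rewrite LcE /component (perm_big (part J m)) ?subrr ?nrm0//.
apply: uniq_perm => // [|n]; first exact: compositions_uniq.
apply/idP/idP => [nm|]; last exact: ps.
rewrite mem_filter -mem_compositions nm/=; apply: sJ; by rewrite inE.
Qed.

End uniform.

End local_time.

(** * Square integrability *)

Section mehler_pair.
Context {R : realType}.

Definition gaussian_factor (v x : R) : R := (Num.sqrt v)^-1 * expR (- (x ^+ 2 / v) / 4).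

(** Bounding absolute values leads to two diagonal sums at the same ratio, the correlation, so that
    Mehler's formula at two different points is avoided. *)
Lemma mehler_pair (v v' c x : R) : 0 < v -> 0 < v' -> 0 <= c ->
  c / (Num.sqrt v * Num.sqrt v') < 1 ->
  exists f : nat -> R, exists F : R, [/\ forall k, 0 <= f k,
    forall k, `|hcoef k v x * hcoef k v' x * (c ^+ k / k`!%:R)| <= f k,
    series f @ \oo --> F &
    F <= gaussian_factor v x * gaussian_factor v' x *
         (Num.sqrt (1 - (c / (Num.sqrt v * Num.sqrt v')) ^+ 2))^-1].
Proof.
move=> v0 v'0 c0; set r := c / _ => r1.
have s0 : 0 < Num.sqrt v by rewrite sqrtr_gt0.
have s'0 : 0 < Num.sqrt v' by rewrite sqrtr_gt0.
have r0 : 0 <= r by rewrite divr_ge0// mulr_ge0 ?ltW.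
have r01 : 0 <= r < 1 by rewrite r0.
pose E (w : R) := expR (- (x ^+ 2 / w) / 4).
(* The density is [g w * E w]: the half of the exponential in [g] is kept for [gaussian_factor], the
   half in [E] absorbs the exponential of Mehler's formula. *)
pose g (w : R) := (Num.sqrt (w * pi *+ 2))^-1 * E w.
pose y (w : R) := x / Num.sqrt w.
have g0 w : 0 <= g w by rewrite mulr_ge0 ?invr_ge0 ?expR_ge0.
have hE w k : 0 < w -> hcoef k w x = k`!%:R / Num.sqrt w ^+ k * (g w * (E w * heat 1 (y w) k)).
  move=> w0; have sw : 0 < Num.sqrt w by rewrite sqrtr_gt0.
  have swn : Num.sqrt w ^+ k != 0 by rewrite expf_neq0// gt_eqF.
  have hz : heat w x k = Num.sqrt w ^+ k * heat 1 (y w) k.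
    by rewrite -heatZ mulr1 sqr_sqrtr ?ltW// /y [_ * (x / _)]mulrC divfK// gt_eqF.
  have pE : gaussian_density w x = g w * E w.
    rewrite gaussian_densityE// /g -mulrA -expRD; congr (_ * expR _).
    by rewrite -[w *+ 2]mulr_natr; field; rewrite gt_eqF.
  have wk : w ^+ k = Num.sqrt w ^+ k * Num.sqrt w ^+ k by rewrite -exprMn -expr2 sqr_sqrtr// ltW.
  rewrite /hcoef hz pE wk.
  by move: (Num.sqrt w ^+ k) swn (g w) (E w) (heat _ _ _) (k`!%:R) => a an g1 e1 h1 n1; field.
pose f k := g v * g v' / 2 * (E v ^+ 2 * (mehler_coef (y v) k * r ^+ k) +
  E v' ^+ 2 * (mehler_coef (y v') k * r ^+ k)).
pose F := g v * g v' / 2 * (E v ^+ 2 * psum (mehler_coef (y v)) r +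
  E v' ^+ 2 * psum (mehler_coef (y v')) r).
(* [f] comes from the arithmetic-geometric mean inequality applied to the two
   Hermite factors, each weighted by the square root of its density. *)
exists f, F; split.
- move=> k; apply: mulr_ge0; first by apply: divr_ge0 => //; apply: mulr_ge0; exact: g0.
  by rewrite addr_ge0// mulr_ge0 ?sqr_ge0// mulr_ge0 ?exprn_ge0// mehler_coef_ge0.
- move=> k; rewrite !hE//.
  have rk : r ^+ k = c ^+ k / (Num.sqrt v ^+ k * Num.sqrt v' ^+ k) by rewrite expr_div_n exprMn.
  have kf : 0 < k`!%:R :> R by rewrite ltr0n fact_gt0.
  rewrite [X in `|X|](_ : _ = g v * g v' * (k`!%:R * r ^+ k) * ((E v * heat 1 (y v) k) * (E v' * heat 1 (y v') k))); last first.
    have a1 : Num.sqrt v ^+ k != 0 by rewrite expf_neq0// gt_eqF.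
    have a2 : Num.sqrt v' ^+ k != 0 by rewrite expf_neq0// gt_eqF.
    have kn : k`!%:R != 0 :> R by rewrite gt_eqF.
    rewrite rk; move: (Num.sqrt v ^+ k) (Num.sqrt v' ^+ k) (k`!%:R) a1 a2 kn (c ^+ k) (g v) (g v') (E v) (E v') (heat _ _ _) (heat _ _ _).
    by move=> a a' n an a'n nn cc g1 g2 e1 e2 h1 h2; field; rewrite an a'n nn.
  have A0 : 0 <= g v * g v' * (k`!%:R * r ^+ k).
    apply: mulr_ge0; first by apply: mulr_ge0; exact: g0.
    by apply: mulr_ge0; [exact: ltW|exact: exprn_ge0].
  rewrite normrM (ger0_norm A0).
  have amgm (p q : R) : `|p * q| <= (p ^+ 2 + q ^+ 2) / 2.
    rewrite ler_norml; have := sqr_ge0 (p + q); have := sqr_ge0 (p - q); rewrite !expr2 => ? ?.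
    by apply/andP; split; nra.
  apply: (le_trans (ler_wpM2l A0 (amgm _ _))).
  rewrite /f /mehler_coef !exprMn.
  by rewrite le_eqVlt; apply/orP; left; apply/eqP; field.
- have cv z : series (fun k => mehler_coef z k * r ^+ k) @ \oo --> psum (mehler_coef z) r.
    by apply: (subgeometric_cvg (subgeometric_mehler z)); rewrite ger0_norm.
  rewrite (_ : series f = (fun n => g v * g v' / 2 * (E v ^+ 2 * series (fun k => mehler_coef (y v) k * r ^+ k) n +
    E v' ^+ 2 * series (fun k => mehler_coef (y v') k * r ^+ k) n))); last first.
    apply/funext => n; rewrite /series/= !mulr_sumr -big_split/= mulr_sumr.
    by apply: eq_bigr => k _.
  by apply: cvgMl_tmp; apply: cvgD; apply: cvgMl_tmp; exact: cv.
have r2 : 0 < 1 - r ^+ 2 by rewrite subr_gt0 expr_lt1.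
set q := (Num.sqrt (1 - r ^+ 2))^-1; have q0 : 0 <= q by rewrite invr_ge0.
(* Since [r / (1 + r) <= 1 / 2], the square of [E w] outweighs Mehler's exponential. *)
have Eb w : 0 < w -> E w ^+ 2 * psum (mehler_coef (y w)) r <= q.
  move=> w0; rewrite psum_mehlerE// -/q mulrCA ler_piMr// /E expr2 -!expRD -[leRHS]expR0 ler_expR.
  have -> : y w ^+ 2 = x ^+ 2 / w by rewrite expr_div_n sqr_sqrtr// ltW.
  have z0 : 0 <= x ^+ 2 / w by rewrite divr_ge0 ?sqr_ge0 ?ltW.
  move: (x ^+ 2 / w) z0 => z z0.
  have r1p : 0 < 1 + r by rewrite ltr_wpDr.
  rewrite (_ : _ + _ = - (z * (1 - r) / (2 * (1 + r)))); last by field; rewrite gt_eqF.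
  by rewrite oppr_le0 divr_ge0 ?mulr_ge0 ?subr_ge0 ?(ltW r1) ?(ltW r1p).
have gb w : 0 < w -> g w <= gaussian_factor w x.
  move=> w0; rewrite /g /gaussian_factor ler_wpM2r ?expR_ge0//.
  have pi1 : 1 <= pi *+ 2 :> R by have := pi_ge2 R; rewrite mulr2n; lra.
  rewrite lef_pV2 ?posrE ?sqrtr_gt0//; last by rewrite mulrn_wgt0// mulr_gt0// pi_gt0.
  by apply: ler_wsqrtr; rewrite -mulrnAr ler_peMr// ltW.
apply: (@le_trans _ _ (g v * g v' * q)).
  rewrite /F -mulrA; apply: ler_wpM2l; first by apply: mulr_ge0; exact: g0.
  have := Eb v v0; have := Eb v' v'0; lra.
by apply: ler_wpM2r => //; apply: ler_pM; rewrite ?g0 ?gb.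
Qed.

End mehler_pair.

(** * Correlations of the sheet away from the diagonal *)

Section correlation.
Context {R : realType} (N d : nat).
Variables (H K : 'I_d -> 'I_N -> R) (t : N.-tuple R).
Hypotheses (H01 : forall i j, 0 < H i j < 1) (K01 : forall i j, 0 < K i j <= 1).
Local Notation D := (pos_box t).

Definition rel_dist (s s' : N.-tuple R) j : R :=
  `|tnth s' j - tnth s j| / Num.max (tnth s' j) (tnth s j).

Lemma rel_dist_bounds s s' j : D s -> D s' -> 0 <= rel_dist s s' j <= 1.
Proof.
move=> /(_ j)/andP[s0 _] /(_ j)/andP[s'0 _].
have m0 : 0 < Num.max (tnth s' j) (tnth s j) by rewrite lt_max s0 orbT.
rewrite divr_ge0 ?(ltW m0)//= ler_pdivrMr// mul1r ler_norml le_max.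
by case: (leP (tnth s' j) (tnth s j)) => h; apply/andP; split; try lra; apply/orP; lra.
Qed.

Lemma sheet_cov_ge0 i s s' : D s -> D s' -> 0 <= bifractional_sheet_cov (H i) (K i) s s'.
Proof.
move=> Ds Ds'; apply: prodr_ge0 => j _; have /andP[s0 _] := Ds j; have /andP[s'0 _] := Ds' j.
by apply: (bifractional_cov_ge0 (H01 i j) (K01 i j)); exact: ltW.
Qed.

(** Any coordinate [j] may provide the defect, the other factors being at most the products of their
    standard deviations. Enlarging the exponent to [2 gam j] is harmless because relative distances
    are at most one. *)
Lemma sheet_cov_bound (gam : 'I_N -> R) : (forall i j, H i j * K i j <= gam j) ->
  exists2 c : R, 0 < c & forall i j s s', D s -> D s' ->
  bifractional_sheet_cov (H i) (K i) s s' <=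
  Num.sqrt (sheet_var H K i s) * Num.sqrt (sheet_var H K i s') *
    (1 - c * rel_dist s s' j `^ (2 * gam j)).
Proof.
move=> hg.
have hc i j : exists c : R, 0 < c <= 1 /\ forall s t, 0 < s -> 0 < t ->
    bifractional_cov (H i j) (K i j) s t <= s `^ (H i j * K i j) * t `^ (H i j * K i j) *
     (1 - c * (`|s - t| / Num.max s t) `^ (2 * H i j * K i j)).
  by have [c ? ?] := bifractional_cov_le (H01 i j) (K01 i j); exists c.
have [cc hcc] : exists cc : 'I_d -> 'I_N -> R, forall i j, 0 < cc i j <= 1 /\ forall s t, 0 < s -> 0 < t ->
    bifractional_cov (H i j) (K i j) s t <= s `^ (H i j * K i j) * t `^ (H i j * K i j) *
     (1 - cc i j * (`|s - t| / Num.max s t) `^ (2 * H i j * K i j)).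
  have [cc h] := choice (fun p : 'I_d * 'I_N => hc p.1 p.2).
  by exists (fun i j => cc (i, j)) => i j; exact: (h (i, j)).
(* A product of positive numbers at most one is below each of them. *)
pose c := \prod_i \prod_j cc i j.
have c0 : 0 < c by apply: prodr_gt0 => i _; apply: prodr_gt0 => j _; case: (hcc i j) => /andP[].
have cle i j : c <= cc i j.
  have c01 k l : 0 <= cc k l <= 1 by case: (hcc k l) => /andP[/ltW -> ->].
  rewrite /c (bigD1 i)//= (bigD1 j)//= -mulrA ler_piMr//; first by case/andP: (c01 i j).
  rewrite -[leRHS]mulr1; apply: ler_pM.
  - by apply: prodr_ge0 => l _; case/andP: (c01 i l).
  - by apply: prodr_ge0 => k _; apply: prodr_ge0 => l _; case/andP: (c01 k l).
  - by apply: prodr_ile1 => l _; exact: c01.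
  apply: prodr_ile1 => k _; apply/andP; split; first by apply: prodr_ge0 => l _; case/andP: (c01 k l).
  by apply: prodr_ile1 => l _; exact: c01.
exists c => // i j s s' Ds Ds'.
rewrite !sqrt_sheet_var /sheet_pow -big_split/= /bifractional_sheet_cov.
have pos l : 0 < tnth s l /\ 0 < tnth s' l.
  by have /andP[? _] := Ds l; have /andP[? _] := Ds' l.
have each l : 0 <= bifractional_cov (H i l) (K i l) (tnth s l) (tnth s' l) <=
    tnth s l `^ (1 * H i l * K i l) * tnth s' l `^ (1 * H i l * K i l).
  have [p p'] := pos l; rewrite (bifractional_cov_ge0 (H01 i l) (K01 i l)) ?(ltW p) ?(ltW p')//= mul1r.
  have [/andP[ccp _] /(_ _ _ p p') h] := hcc i l; apply: (le_trans h).
  by rewrite ler_piMr ?mulr_ge0 ?powR_ge0// gerBl mulr_ge0 ?powR_ge0// ltW.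
rewrite (bigD1 j)//= [in leRHS](bigD1 j)//= [leRHS]mulrAC; apply: ler_pM.
- by case/andP: (each j).
- by apply: prodr_ge0 => l _; case/andP: (each l).
- have [p p'] := pos j; have [_ /(_ _ _ p p') h] := hcc i j; apply: (le_trans h).
  rewrite mul1r; apply: ler_wpM2l; first by rewrite mulr_ge0 ?powR_ge0.
  rewrite lerD2l lerN2 distrC maxC -/(rel_dist s s' j).
  have /andP[D0 D1] := rel_dist_bounds j Ds Ds'.
  apply: ler_pM; rewrite ?powR_ge0 ?cle ?(ltW c0)//.
  move: D0; rewrite le_eqVlt => /predU1P[<-|D0].
    have h1 : 0 < H i j * K i j by exact: HK_gt0.
    have n1 : 2 * gam j != 0 by rewrite mulf_neq0// gt_eqF// (lt_le_trans h1).
    have n2 : 2 * H i j * K i j != 0 by rewrite -mulrA mulf_neq0// gt_eqF.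
    by rewrite (powR0 n1) (powR0 n2).
  by apply: powR_ge_le1; rewrite ?D0// -mulrA ler_pM2l.
by apply: ler_prod => l _; exact: each.
Qed.

End correlation.

Lemma lee_prod_ord {R : realType} n (F F' : 'I_n -> \bar R) :
  (forall j, 0 <= F j <= F' j)%E -> (\prod_j F j <= \prod_j F' j)%E.
Proof.
move=> h; suff: (0 <= \prod_j F j <= \prod_j F' j)%E by case/andP.
apply: (big_ind2 (fun u v : \bar R => 0 <= u <= v)%E) => //.
- by rewrite lexx lee_fin ler01.
- by move=> u v u' v' /andP[u0 uv] /andP[u'0 uv']; rewrite mule_ge0//= lee_pmul.
Qed.

Section orthogonal_series.
Context {R : realType} {disp : measure_display} {T : measurableType disp}
  (P : probability T R).
Local Notation L2 := (Lfun P 2%:E).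
Local Notation dotp := (L2inner P).
Local Notation nrm := (L2nrm P).

(** Squared distances between partial sums are increments of a bounded nondecreasing series. *)
Lemma orthogonal_sum_cvg (Y : nat -> T -> R) (A : R) : (forall m, Y m \in L2) ->
  (forall m k, m != k -> dotp (Y m) (Y k) = 0) ->
  (forall M, dotp (\sum_(m < M) Y m) (\sum_(m < M) Y m) <= A) ->
  exists2 X, X \in L2 & nrm (\sum_(m < M) Y m - X) @[M --> \oo] --> 0.
Proof.
move=> YL orth bd; pose g m := dotp (Y m) (Y m); pose S M := \sum_(m < M) Y m.
have SL M : S M \in L2 by apply: L2_sum.
have SS n m : (n <= m)%N -> dotp (S n) (S m) = \sum_(k < n) g k.
  move=> nm; rewrite dotp_suml//; apply: eq_bigr => k _.
  have km := leq_trans (ltn_ord k) nm.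
  rewrite dotp_sumr// (bigD1 (Ordinal km))//= big1 ?addr0// => l lk.
  by apply: orth; rewrite eq_sym.
have gE n : series g n = dotp (S n) (S n) by rewrite SS// /series/= big_mkord.
have gnd : nondecreasing_seq (series g).
  apply/nondecreasing_seqP => n; rewrite /series/= big_nat_recr//= lerDl; exact: dotp_ge0.
have gcv : cvgn (series g).
  apply: nondecreasing_is_cvgn => //; exists A => _ [n _ <-]; rewrite gE; exact: bd.
have gap n m : (n <= m)%N -> nrm (S n - S m) ^+ 2 = series g m - series g n.
  move=> nm; rewrite nrm_sqr dotpBl ?L2B// !dotpBr// !gE (SS n m nm) (SS n n)// [dotp (S m) (S n)]dotpC (SS n m nm).
  by ring.
apply: (L2_complete SL) => e e0.
have e2 : 0 < e ^+ 2 by rewrite exprn_gt0.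
have /cvgrPdist_le/(_ _ e2)[n0 _ h] := gcv.
have key n m : (n0 <= n)%N -> (n <= m)%N -> nrm (S n - S m) <= e.
  move=> n0n nm; rewrite -(@ler_pXn2r _ 2)// ?nnegrE ?nrm_ge0 ?(ltW e0)// gap//.
  apply: le_trans (le_trans (ler_norm _) (h n n0n)).
  by rewrite lerD2r; exact: nondecreasing_cvgn_le.
exists n0 => n m hn hm; case/orP: (leq_total n m) => nm; first exact: key.
by rewrite nrmB//; exact: key.
Qed.

End orthogonal_series.

Section square_integrable.
Context {R : realType} (N d : nat) {disp : measure_display}
  {T : measurableType disp} (P : probability T R).
Variables (H K : 'I_d -> 'I_N -> R) (B : 'I_d -> N.-tuple R -> T -> R).
Variables (x : 'I_d -> R) (t : N.-tuple R).
Hypotheses (N_gt0 : (0 < N)%N) (d_gt0 : (0 < d)%N).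
Hypotheses (H01 : forall i j, 0 < H i j < 1) (K01 : forall i j, 0 < K i j <= 1).
Hypothesis hB : bifractional_sheet P H K B.
Hypothesis t_gt0 : forall j, 0 < tnth t j.
Local Notation mu := (lebesgue_tuple N).
Local Notation L2 := (Lfun P 2%:E).
Local Notation dotp := (L2inner P).
Local Notation nrm := (L2nrm P).
Local Notation var := (sheet_var H K).
Local Notation D := (pos_box t).
Local Notation G := (chaos_integrand H K B x t).
Local Notation term := (chaos_term H K B x t).
Local Notation cmp := (component H K B x t).
Let mB := sheet_measurable_at hB.
Let gaussB := sheet_gaussian hB.
Let indepB := sheet_independent hB.

Variable gam : 'I_N -> R.
Hypotheses (gam_gt0 : forall j, 0 < gam j) (hgam : forall i j, H i j * K i j <= gam j).
Let S : R := \sum_j (gam j)^-1.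
Hypothesis dS : d%:R < S.

Let S0 : 0 < S. Proof. by apply: le_lt_trans dS. Qed.
Let beta : R := d%:R / S.
Let beta01 : 0 <= beta < 1.
Proof. by rewrite divr_ge0 ?(ltW S0)//= ltr_pdivrMr// mul1r. Qed.

(** Weights proportional to [(gam j)^-1] turn all the exponents into [- S^-1]. *)
Let geometric_mean (m : R) (A : 'I_N -> R) : 0 < m -> (forall j, 0 < A j) ->
  (forall j, m <= A j `^ (- gam j)) -> m <= \prod_j A j `^ (- S^-1).
Proof.
move=> m0 A0 mA; pose th j := (gam j)^-1 / S.
have th0 j : 0 <= th j by rewrite divr_ge0 ?invr_ge0 ?ltW.
have th1 : \sum_j th j = 1 by rewrite -mulr_suml divff// gt_eqF.
rewrite -[leLHS](@powRr1 _ m) ?(ltW m0)// -[X in m `^ X]th1.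
rewrite (big_morph (fun u => m `^ u) (id1 := 1) (op1 := *%R)); last 2 first.
- by move=> u v; rewrite powRB.
- by rewrite powRr0.
apply: ler_prod => j _; rewrite powR_ge0/=.
have -> : A j `^ (- S^-1) = (A j `^ (- gam j)) `^ th j.
  by rewrite -powRrM; congr (_ `^ _); rewrite /th mulNr mulrA divff ?mul1r// gt_eqF.
by apply: ge0_ler_powR => //; rewrite nnegrE ?powR_ge0 ?ltW.
Qed.

(** The bound is uniform in [M]. Pairs with a common coordinate are left out: there the bound on the
    correlation says nothing for that coordinate, and the geometric mean needs all of them. *)
Lemma pair_bound : exists2 C2 : R, 0 < C2 & forall M s s', D s -> D s' ->
  (forall j, rel_dist s s' j != 0) ->
  \sum_(n <- chaos_index d M) `|dotp (G n 0 s') (G n 0 s)| <=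
  C2 * (kernel_bound H K x 0 s * kernel_bound H K x 0 s') * \prod_j rel_dist s s' j `^ (- beta).
Proof.
have [c c0 hc] := sheet_cov_bound t H01 K01 hgam.
have sc0 : 0 < Num.sqrt c by rewrite sqrtr_gt0.
exists ((Num.sqrt c)^-1 ^+ d); first by rewrite exprn_gt0// invr_gt0.
move=> M s s' Ds Ds' Dn.
have v0 i := sheet_var_gt0 H K i Ds; have v'0 i := sheet_var_gt0 H K i Ds'.
pose cov i := bifractional_sheet_cov (H i) (K i) s s'.
have cov0 i : 0 <= cov i by exact: (sheet_cov_ge0 H01 K01 i Ds Ds').
pose r i := cov i / (Num.sqrt (var i s) * Num.sqrt (var i s')).
have D0 j : 0 < rel_dist s s' j.
  by have /andP[h _] := rel_dist_bounds j Ds Ds'; rewrite lt_neqAle eq_sym Dn.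
have sp i : 0 < Num.sqrt (var i s) * Num.sqrt (var i s') by rewrite mulr_gt0 ?sqrtr_gt0.
have rb i j : r i <= 1 - c * rel_dist s s' j `^ (2 * gam j).
  by rewrite ler_pdivrMr// mulrC; exact: hc.
have r0 i : 0 <= r i by rewrite divr_ge0// ltW.
have r1 i : r i < 1.
  apply: le_lt_trans (rb i (Ordinal N_gt0)) _.
  by rewrite ltrBlDr ltrDl mulr_gt0// powR_gt0.
have hf i := mehler_pair (x i) (v0 i) (v'0 i) (cov0 i) (r1 i).
have [f hf1] := choice hf; have [F hF] := choice hf1.
(* As [1 - r ^ 2 >= 1 - r], each coordinate [j] bounds the left-hand side by [1 / sqrt c] times the
   power [- gam j] of its relative distance. *)
have qb i : (Num.sqrt (1 - r i ^+ 2))^-1 <= (Num.sqrt c)^-1 * \prod_j rel_dist s s' j `^ (- S^-1).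
  have r2 : 0 < 1 - r i ^+ 2 by rewrite subr_gt0 expr_lt1.
  rewrite mulrC ler_pdivlMr//; apply: geometric_mean => // [|j].
    by rewrite mulr_gt0// invr_gt0 sqrtr_gt0.
  rewrite mulrC ler_pdivrMr ?sqrtr_gt0// powRN mulrC ler_pdivlMr ?powR_gt0//.
  rewrite -[leLHS]ger0_norm; last by rewrite mulr_ge0 ?powR_ge0 ?ltW.
  rewrite -sqrtr_sqr; apply: ler_wsqrtr.
  have DD : (rel_dist s s' j `^ gam j) ^+ 2 = rel_dist s s' j `^ (2 * gam j).
    by rewrite -(powR_mulrn 2) ?powR_ge0// -powRrM mulrC.
  rewrite exprMn sqr_sqrtr ?(ltW c0)// DD; have := rb i j; have : r i ^+ 2 <= r i.
    by rewrite expr2 ler_piMr// ltW.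
  lra.
apply: (@le_trans _ _ (\sum_(n <- chaos_index d M) \prod_i f i (tnth n i))).
  apply: ler_sum => n _; rewrite dotpC (dotp_chaos_integrand x t H01 K01 hB) eqxx.
  rewrite /chaos_weight !indicE !mem_set// !mul1r -!big_split/= normr_prod.
  apply: ler_prod => i _; rewrite normr_ge0/= !addr0.
  by have [_ h _ _] := hF i; exact: h.
have cv := cvg_compositions (fun i => let: And4 h _ _ _ := hF i in h) (fun i => let: And4 _ _ h _ := hF i in h).
apply: (@le_trans _ _ (\prod_i F i)).
  rewrite sum_chaos_index -(cvg_lim _ cv)//.
  rewrite -[leLHS](_ : series (fun m => \sum_(n <- compositions d m) \prod_i f i (tnth n i)) M = _); last first.
    by rewrite /series/= big_mkord.
  apply: nondecreasing_cvgn_le; last by apply/cvg_ex; eexists; exact: cv.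
  apply/nondecreasing_seqP => m; rewrite /series/= big_nat_recr//= lerDl.
  by apply: sumr_ge0 => n _; apply: prodr_ge0 => i _; case: (hF i).
apply: (@le_trans _ _ (\prod_i ((gaussian_factor (var i s) (x i) * gaussian_factor (var i s') (x i)) *
   ((Num.sqrt c)^-1 * \prod_j rel_dist s s' j `^ (- S^-1))))).
  apply: ler_prod => i _; have [f0 _ fF Fle] := hF i; apply/andP; split.
    rewrite -(cvg_lim _ fF)//; apply: limr_ge; first by apply/cvg_ex; eexists; exact: fF.
    by apply: nearW => n; apply: sumr_ge0 => k _.
  apply: (le_trans Fle); apply: ler_wpM2l; last exact: qb.
  by rewrite !mulr_ge0 ?invr_ge0 ?expR_ge0.
rewrite [X in X <= _]big_split/= [X in X * _ <= _]big_split/= [X in _ * X <= _]big_split/=.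
rewrite !prodr_const card_ord.
have kE u : kernel_bound H K x 0 u = \prod_i gaussian_factor (var i u) (x i).
  by apply: eq_bigr => i _; rewrite addr0.
have pE : (\prod_(j < N) rel_dist s s' j `^ (- S^-1)) ^+ d = \prod_j rel_dist s s' j `^ (- beta).
  rewrite -prodrXl; apply: eq_bigr => j _.
  by rewrite -(powR_mulrn d) ?powR_ge0// -powRrM /beta mulNr mulrC.
have regroup (a1 a2 e p : R) : a1 * a2 * (e * p) <= e * (a1 * a2) * p.
  by rewrite le_eqVlt; apply/orP; left; apply/eqP; ring.
rewrite pE (kE s) (kE s'); exact: regroup.
Qed.

Variables (a : 'I_N -> R) (C : R).
Hypotheses (a01 : forall j, 0 <= a j < 1) (C_gt0 : 0 < C).
Hypothesis dom : forall eps s, 0 <= eps -> D s ->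
  kernel_bound H K x eps s <= C * box_power t a s.
Local Notation W := (fun s => C * box_power t a s).

Let C0 : 0 <= C. Proof. exact: ltW. Qed.
Let domE s : D s -> kernel_bound H K x 0 s <= C * box_power t a s.
Proof. exact: dom. Qed.
Let mG n := measurable_chaos_integrand x t hB n 0.
Let G2 n s := chaos_integrand_L2 x t d_gt0 H01 K01 hB n 0 s.
Let iW (n : d.-tuple nat) := dominating_integrable t_gt0 C a01 (cramer_weight n).
Let bG n s := nrm_integrand_dominated H01 K01 hB C0 (lexx 0) domE n s.
Let tL n : term n 0 \in L2.
Proof. exact: (term_L2 d_gt0 H01 K01 hB t_gt0 a01 C0 (lexx 0) domE). Qed.
Let idotp n Z : Z \in L2 -> mu.-integrable setT (EFin \o (fun s => dotp (G n 0 s) Z)).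
Proof. exact: (integrable_dotpG (mG n) (G2 n) (iW n) (bG n)). Qed.

(** Its double integral is the second moment of the sum of the terms of degree below [M]. *)
Let overlap M s s' := \sum_(n <- chaos_index d M) dotp (G n 0 s') (G n 0 s).

Let overlap_integrable M s : mu.-integrable setT (EFin \o overlap M s).
Proof. by apply: (Rintegral_sum _ _).1 => n; apply: idotp; exact: G2. Qed.

(** Factor of index [j] in the majorant of [overlap], as a function of the coordinate of [s']. *)
Let line j (v : R) (u : R) : \bar R :=
  ((if (0 < u <= tnth t j)%R then (u `^ (- a j))%R else 0%R)%:E * sing beta (`|u - v| / Num.max u v)%R)%E.

Let line_ge0 j v u : (0 <= line j v u)%E.
Proof. by rewrite mule_ge0 ?sing_ge0// lee_fin; case: ifP => // _; exact: powR_ge0. Qed.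

Let measurable_line j v : measurable_fun setT (line j v).
Proof.
apply: emeasurable_funM; first by apply/measurable_EFinP; exact: measurable_power_cut.
apply: measurable_sing; apply: measurable_funM.
  by apply: measurableT_comp => //; exact: measurable_funB.
by apply: measurable_fun_inv; exact: measurable_maxr.
Qed.

(** As in Schur's test, the majorant is integrated in one variable only: it factors over the
    coordinates, and [schur_power_bound] bounds each factor uniformly in the other variable. *)
Let overlap_le : exists2 C3 : R, 0 <= C3 & forall M s, `|\int[mu]_s' overlap M s s'| <= C3 * (C * box_power t a s).
Proof.
have [C2 C2p pb] := pair_bound; have C20 := ltW C2p.
have hs j := schur_power_bound (a01 j) beta01 (t_gt0 j).
have [cj hcj] : exists cj : 'I_N -> R, forall j, 0 <= cj j /\ forall v, 0 < v <= tnth t j ->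
    (\int[lebesgue_measure]_u line j v u <= (cj j)%:E)%E.
  have h j : exists k : R, 0 <= k /\ forall v, 0 < v <= tnth t j ->
      (\int[lebesgue_measure]_u line j v u <= k%:E)%E.
    have [k k0 hk] := hs j; exists k; split=> // v hv; apply: le_trans (hk v hv).
    rewrite [leRHS]integral_mkcond le_eqVlt; apply/orP; left; apply/eqP; apply: eq_integral => u _.
    rewrite patchE /line; case: ifPn => [hu|hu]; first by rewrite mem_set//= in_itv.
    by rewrite mul0e memNset//= in_itv/=; apply/negP.
  by have [cj h'] := choice h; exists cj.
pose C3 := C2 * C * \prod_j cj j.
have cp : 0 <= \prod_j cj j by apply: prodr_ge0 => j _; case: (hcj j).
exists C3; first by rewrite !mulr_ge0.
move=> M s; have W0 := dominating_ge0 t a C0 s.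
have [Ds|nD] := pselect (D s); last first.
  rewrite (_ : \int[mu]_s' _ = 0); first by rewrite normr0 !mulr_ge0// box_power_ge0.
  rewrite /Rintegral (eq_integral (cst 0%E)) ?integral0// => s' _.
  by rewrite /overlap big1// => n _; rewrite dotpC chaos_integrand_out// dotp0l.
pose q : R := C2 * C * (C * box_power t a s).
have q0 : 0 <= q by rewrite !mulr_ge0 ?box_power_ge0.
have io := overlap_integrable M s.
apply: (le_trans (le_normr_Rintegral measurableT io)).
have ion := integrable_norm io.
rewrite -lee_fin /Rintegral fineK; last exact: integrable_fin_num ion.
apply: (@le_trans _ _ (\int[mu]_s' (q%:E * \prod_j line j (tnth s j) (tnth s' j)))%E).
  have ml : measurable_fun setT (fun s' : N.-tuple R => (\prod_j line j (tnth s j) (tnth s' j))%E).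
    apply: emeasurable_prod_ord => j.
    exact: (measurableT_comp (measurable_line j (tnth s j)) (@measurable_tnth _ _ N j)).
  have pl s' : (0 <= \prod_j line j (tnth s j) (tnth s' j))%E by apply: prode_ge0 => j _.
  apply: ge0_le_integral => //.
  - exact: measurable_int ion.
  - exact: emeasurable_funM.
  move=> s' _; have [Ds'|nD'] := pselect (D s'); last first.
    rewrite /overlap big1 ?normr0 ?mule_ge0// => n _.
    by rewrite chaos_integrand_out// dotp0l.
  have bp : (\prod_j line j (tnth s j) (tnth s' j) =
      (box_power t a s')%:E * \prod_j sing beta (rel_dist s s' j))%E.
    by rewrite /line big_split/= /box_power -prodEFin.
  have bp0 : 0 < box_power t a s'.
    by rewrite box_powerE//; apply: prodr_gt0 => j _; rewrite powR_gt0//; case/andP: (Ds' j).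
  have bs0 : 0 < box_power t a s.
    by rewrite box_powerE//; apply: prodr_gt0 => j _; rewrite powR_gt0//; case/andP: (Ds j).
  rewrite bp.
  have [alln|] := pselect (forall j, rel_dist s s' j != 0).
    rewrite (_ : \prod_j sing beta (rel_dist s s' j) = (\prod_j rel_dist s s' j `^ (- beta))%:E)%E; last first.
      by rewrite -prodEFin; apply: eq_bigr => j _; rewrite /sing (negbTE (alln j)).
    rewrite -!EFinM lee_fin; apply: (le_trans (ler_norm_sum _ _ _)).
    apply: (le_trans (pb M s s' Ds Ds' alln)); rewrite [leRHS]mulrA.
    apply: ler_wpM2r; first by apply: prodr_ge0 => j _; exact: powR_ge0.
    rewrite (_ : q * _ = C2 * (C * box_power t a s * (C * box_power t a s'))); last by rewrite /q; ring.
    by apply: ler_wpM2l => //; apply: ler_pM; rewrite ?kernel_bound_ge0 ?domE.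
  (* When a relative distance vanishes the majorant is infinite, since all its other factors are
     positive; this uses the strict positivity of [C]. *)
  move=> /existsNP[j /negP]; rewrite negbK => /eqP Dj0.
  have qp : 0 < q by rewrite !mulr_gt0.
  have sp k : (0 < sing beta (rel_dist s s' k))%E.
    rewrite /sing; case: ifPn => // nk; rewrite lte_fin powR_gt0//.
    by have /andP[h _] := rel_dist_bounds k Ds Ds'; rewrite lt_neqAle eq_sym nk.
  rewrite (bigD1 j)//= {1}/sing Dj0 eqxx [X in (_ * (_ * X))%E]gt0_mulye; last first.
    by apply: (big_ind (fun z : \bar R => 0 < z)%E) => // ? ? ? ?; exact: mule_gt0.
  by rewrite !gt0_muley ?lte_fin// leey.
rewrite ge0_integralZl//; last 2 first.
- apply: emeasurable_prod_ord => j.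
  exact: (measurableT_comp (measurable_line j (tnth s j)) (@measurable_tnth _ _ N j)).
- by move=> s' _; apply: prode_ge0 => j _.
rewrite (@integral_tuple_prod _ _ (fun j => line j (tnth s j)) (fun j => measurable_line j (tnth s j)) (fun j => line_ge0 j (tnth s j))).
rewrite /C3 (_ : C2 * C * _ * _ = q * \prod_j cj j); last by rewrite /q; ring.
rewrite [leRHS](EFinM q); apply: lee_wpmul2l; first by rewrite lee_fin.
rewrite -prodEFin; apply: lee_prod_ord => j; apply/andP; split.
  by apply: integral_ge0 => u _; exact: line_ge0.
by case: (hcj j) => _; apply; exact: Ds.
Qed.

(** The inner product is exchanged with the integral in each argument in turn, which gives iterated
    integrals to which [overlap_le] applies directly. *)
Let energy_bound : exists A : R, forall M,
  dotp (\sum_(n <- chaos_index d M) term n 0) (\sum_(n <- chaos_index d M) term n 0) <= A.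
Proof.
have [C3 C30 ol] := overlap_le.
exists (\int[mu]_s (C3 * (C * box_power t a s))) => M.
set Z := \sum_(n <- _) _; have ZL : Z \in L2 by apply: L2_sum.
rewrite {1}/Z dotp_suml//.
under eq_bigr do rewrite (dotp_Gint (mG _) (G2 _) (iW _) (bG _) ZL).
have [i1 <-] := Rintegral_sum (chaos_index d M) (fun n => idotp n ZL).
have inner s : \sum_(n <- chaos_index d M) dotp (G n 0 s) Z = \int[mu]_s' overlap M s s'.
  rewrite (Rintegral_sum (chaos_index d M) (fun n => idotp n (G2 n s))).2.
  apply: eq_big_seq => n nM; rewrite dotp_sumr// (bigD1_seq n)//=; last exact: chaos_index_uniq.
  rewrite big1 ?addr0; last first.
    move=> n' n'n; rewrite dotpC (dotp_Gint (mG _) (G2 _) (iW _) (bG _) (G2 n s)).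
    rewrite /Rintegral (eq_integral (cst 0%E)) ?integral0// => s' _.
    by rewrite (dotp_chaos_integrand x t H01 K01 hB) (negbTE n'n).
  by rewrite dotpC (dotp_Gint (mG _) (G2 _) (iW _) (bG _) (G2 n s)).
apply: le_Rintegral => //; first exact: (dominating_integrable t_gt0 C a01 C3).
by move=> s _; rewrite inner; apply: le_trans (ler_norm _) (ol M s).
Qed.

Lemma local_time_square_integrable L : local_time P B x t L ->
  square_integrable_distribution P B L.
Proof.
move=> hL; have [[Lc _] _] := hL; have LL k : L k \in L2 by exact: chaos_L2 (Lc k).
have [A hA] := energy_bound.
have cc m : chaos P B m (cmp 0 m) by exact: (component_chaos d_gt0 H01 K01 hB t_gt0 a01 C0 (lexx 0) domE).
have cL m : cmp 0 m \in L2 by exact: chaos_L2 (cc m).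
have [X XL hX] : exists2 X, X \in L2 & nrm (\sum_(m < M) cmp 0 m - X) @[M --> \oo] --> 0.
  apply: (@orthogonal_sum_cvg _ _ _ _ _ A) => //.
    by move=> m k mk; exact: (chaos_orthogonal mB gaussB indepB mk (cc m) (cc k)).
  by move=> M; rewrite -sum_chaos_index; exact: hA.
exists X; split=> //.
have SL M : \sum_(m < M) L m \in L2 by apply: L2_sum.
have ScL M : \sum_(m < M) cmp 0 m \in L2 by apply: L2_sum.
rewrite (_ : (fun n => _) = (fun M => 'E_P[fun w => ((X - \sum_(m < M) L m) w ^+ 2)%R]))%E; last first.
  by apply/funext => M; congr expectation; apply/funext => w; rewrite !fctE fct_sumE.
apply: (cvg_expectation_sqr (Z := fun M => X - \sum_(m < M) L m)) => [M|]; first exact: L2B.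
apply: (squeeze_cvgr _ (cvg_cst 0) hX); apply: nearW => M; rewrite nrm_ge0/=.
apply: (le_trans (nrm_triangle XL (ScL M) (SL M))); rewrite nrmB// gerDl.
have -> : \sum_(m < M) cmp 0 m - \sum_(m < M) L m = \sum_(m < M) (cmp 0 m - L m) by rewrite sumrB.
have h := @nrm_sum _ _ _ P _ (index_enum 'I_M) xpredT (fun m : 'I_M => cmp 0 m - L m) (fun m _ => L2B (cL m) (LL m)).
apply: (le_trans h); rewrite big1// => m _.
rewrite nrmB//; exact: (local_time_components d_gt0 H01 K01 hB t_gt0 a01 C0 dom hL).
Qed.

End square_integrable.

Theorem proposition4p15 (R : realType) (N d : nat) (N_gt0 : (0 < N)%N)
    (d_gt0 : (0 < d)%N) (disp : measure_display) (Omega : measurableType disp)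
    (P : probability Omega R) (H K : 'I_d -> 'I_N -> R)
    (H01 : forall i j, 0 < H i j < 1) (K01 : forall i j, 0 < K i j <= 1)
    (B : 'I_d -> N.-tuple R -> Omega -> R) (hB : bifractional_sheet P H K B)
    (x : 'I_d -> R) (t : N.-tuple R) (t_gt0 : forall j, 0 < tnth t j) :
  ((exists i, x i != 0) \/ (local_time_mean H K x t < +oo)%E ->
     exists L : nat -> Omega -> R, local_time P B x t L) /\
  (forall L : nat -> Omega -> R, local_time P B x t L ->
     chaos_expansion P B L (local_time_term B H K x t) /\
     (d%:R < \sum_(j < N) ((\big[Num.max/0]_(i < d) H i j)
                           * (\big[Num.max/0]_(i < d) K i j))^-1 ->
      square_integrable_distribution P B L)).
Proof.
split=> [cond|L hL].
  have [a [a01 [C C0 dom]]] := kernel_domination H01 K01 t_gt0 cond.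
  exists (component H K B x t 0).
  exact: (local_time_exists d_gt0 H01 K01 hB t_gt0 a01 C0 dom).
(* An existing local time has a finite mean, so both halves rest on the same domination. *)
have cond : (exists i, x i != 0) \/ (local_time_mean H K x t < +oo)%E.
  right; exact: (local_time_mean_finite d_gt0 H01 K01 hB t_gt0 hL).
have [a [a01 [C C0 dom]]] := kernel_domination H01 K01 t_gt0 cond.
split; first exact: (local_time_expansion d_gt0 H01 K01 hB t_gt0 a01 C0 dom hL).
(* The initial value zero of the maxima is harmless, all entries being positive. *)
pose gam j := (\big[Num.max/0]_(i < d) H i j) * (\big[Num.max/0]_(i < d) K i j).
have hgam i j : H i j * K i j <= gam j.
  have /andP[/ltW h0 _] := H01 i j; have /andP[/ltW k0 _] := K01 i j.
  by apply: ler_pM => //; [exact: (le_bigmax 0 (H^~ j) i)|exact: (le_bigmax 0 (K^~ j) i)].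
have gam0 j : 0 < gam j.
  exact: lt_le_trans (HK_gt0 H01 K01 (Ordinal d_gt0) j) (hgam _ j).
(* The constant is enlarged because the argument for square integrability takes it strictly
   positive. *)
have C1 : 0 < C + 1 by rewrite ltr_wpDl.
have dom1 eps s : 0 <= eps -> pos_box t s ->
    kernel_bound H K x eps s <= (C + 1) * box_power t a s.
  move=> e0 Ds; apply: (le_trans (dom eps s e0 Ds)).
  by apply: ler_wpM2r; rewrite ?box_power_ge0// lerDl.
move=> dS.
exact: (local_time_square_integrable N_gt0 d_gt0 H01 K01 hB t_gt0 gam0 hgam dS a01 C1 dom1 hL).
Qed.
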